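(* Let $ab$ be an edge of an even-hole-free graph $G$, and let $(J,M)$ be optimal for $ab$. Let $Z$ be the set of vertices of $G$ adjacent to both $a$ and $b$. Then for every connected induced subgraph $F$ of $G\setminus (Z\cup V(M)\cup\{a,b\})$: (i) if not both $a,b$ have neighbours in $V(F)$, then the set of vertices in $V(M)$ with a neighbour in $V(F)$ is local; (ii) if both $a,b$ have neighbours in $V(F)$, then there exists a leaf $t$ of $J$ such that every vertex of $V(M)$ with a neighbour in $V(F)$ belongs to $M_t$.
   Context: All graphs are finite and simple. A hole is an induced cycle of length at least four; a graph is even-hole-free if it has no hole of even length. Disjoint sets $X,Y\subseteq V(G)$ are complete to each other if every vertex of $X$ is adjacent to every vertex of $Y$ (and a vertex $v$ is complete to $Y$ if $\{v\}$ is). $G\setminus X$ is the subgraph induced on $V(G)\setminus X$. Extended tree line-graphs. A leaf of a tree $T$ is a vertex of degree one, and a leaf-edge is an edge incident with a leaf. Let $T$ be a tree with at least three leaves, let $(A',B')$ be a bipartition of $T$, and suppose that for every $v\in V(T)$ there is at most one component of $T\setminus v$ containing no leaf of $T$ that belongs to $A'$, and at most one component of $T\setminus v$ containing no leaf of $T$ that belongs to $B'$. Let $A$ be the set of leaf-edges incident with a leaf in $A'$, and $B$ the set of leaf-edges incident with a leaf in $B'$. Let $H(T)$ be obtained from the line-graph $L(T)$ (with vertex set $E(T)$) by adding two new vertices $a,b$ and the edge $ab$, and making $a$ adjacent to precisely $A\cup\{b\}$ and $b$ adjacent to precisely $B\cup\{a\}$. Then $H(T)$ is an extended tree line-graph and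 $ab$ is its cross-edge. Shape. A branch-vertex of a tree is a vertex of degree different from two. A branch of $T$ is a path of $T$ whose ends are distinct branch-vertices and all of whose internal vertices have degree two in $T$. The shape of $T$ is the tree $J$ whose vertices are the branch-vertices of $T$, two being adjacent in $J$ if they are the ends of a branch of $T$. Strips. Let $A,B,C\subseteq V(G)$ with $A,B\neq\emptyset$ and $A,B$ disjoint from $C$ ($A\cap B$ may be nonempty). A rung of $(A,B,C)$ is an induced path $p_1,\dots,p_k$ ($k\ge 1$) of $G[A\cup B\cup C]$ with $p_1\in A$, $p_k\in B$, $p_2,\dots,p_{k-1}\in C$, and such that if $k>1$ then $p_1\notin B$ and $p_k\notin A$. If every vertex of $A\cup B\cup C$ is in a rung, $(A,B,C)$ is a strip. $J$-strip systems. Let $J$ be a tree with at least three vertices. A $J$-strip system $M$ in $G$ consists of a subset $M_{uv}=M_{vu}=M_e$ of $V(G)$ for each edge $e=uv$ of $J$, and a subset $M_v$ of $V(G)$ for each $v\in V(J)$, such that: the sets $M_e$ ($e\in E(J)$) are pairwise disjoint; for each $u\in V(J)$, $M_u\subseteq\bigcup(M_{uv}: v \text{ adjacent to } u \text{ in } J)$; for each $uv\in E(J)$, $(M_{uv}\cap M_u,\ M_{uv}\cap M_v,\ M_{uv}\setminus(M_u\cup M_v))$ is a strip; if $uv,wx\in E(J)$ with $u,v,w,x$ all distinct, there are no edges between $M_{uv}$ and $M_{wx}$; if $uv,uw\in E(J)$ with $v\ne w$, then $M_u\cap M_{uv}$ is complete to $M_u\cap M_{uw}$, and there are no other edges between $M_{uv}$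 and $M_{uw}$. $V(M)$ denotes $\bigcup_{e\in E(J)}M_e$. Cross-edges. Let $(\alpha,\beta)$ be a partition of the set of leaves of $J$. An edge $ab$ of $G$ is a cross-edge for $M$ with partition $(\alpha,\beta)$ if: $J$ has no vertex of degree two and at least three vertices; every $s\in V(J)$ has at most one $J$-neighbour in $\alpha$ and at most one in $\beta$; $a,b\notin V(M)$; $a$ is complete to $\bigcup_{u\in\alpha}M_u$ and has no other neighbours in $V(M)$; $b$ is complete to $\bigcup_{u\in\beta}M_u$ and has no other neighbours in $V(M)$. The partition $(\alpha,\beta)$ is determined by $J,M,ab$. Optimality. Suppose $G$ is even-hole-free and contains, as an induced subgraph, an extended tree line-graph with cross-edge $ab$. $(J,M)$ is optimal for $ab$ if $J$ is the shape of a tree $T$ such that $H(T)$ is an induced subgraph of $G$ with cross-edge $ab$, with $|E(J)|$ maximum over all such $T$, and $M$ is a $J$-strip system in $G$ with the same cross-edge $ab$, with $V(M)$ maximal (under inclusion). Local sets. For a $J$-strip system $M$ with cross-edge $ab$ and partition $(\alpha,\beta)$, a set $X\subseteq V(M)\cup\{a,b\}$ is local if: $X\subseteq M_e$ for some $e\in E(J)$; or $X\subseteq M_u$ for some $u\in V(J)$; or $X$ contains $a$ and not $b$, and $X\setminus\{a\}\subseteq M_u$ for some leaf $u\in\alpha$; or $X$ contains $b$ and not $a$, and $X\setminus\{b\}\subseteq M_u$ for some leaf $u\in\beta$. *)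

(* Defs.v *)
From HB Require Import structures.
From mathcomp Require Import all_boot.

Set Implicit Arguments.
Unset Strict Implicit.
Unset Printing Implicit Defensive.

Record sgraph := SGraph {
  svertex :> finType;
  sedge : rel svertex;
  sedge_sym : symmetric sedge;
  sedge_irr : irreflexive sedge
}.

Notation "x -- y" := (sedge x y) (at level 30).

Section Basics.
Variable G : sgraph.
Implicit Types (x y : G) (S : {set G}).

Definition degree x : nat := #|[set y | x -- y]|.

Definition leaves : {set G} := [set x | degree x == 1].

Definition edges : {set {set G}} :=
  [set e | [exists x, exists y, (x -- y) && (e == [set x; y])]].

(* The vertices, inside or outside S, with a neighbour in S. *)
Definition nbrs S : {set G} := [set x | [exists y in S, x -- y]].

Definition restr_edge S : rel G := [rel x y | [&& x \in S, y \in S & x -- y]].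

(* The null graph counts as connected here; is_tree excludes it separately. *)
Definition connected_set S : Prop :=
  forall x y, x \in S -> y \in S -> connect (restr_edge S) x y.

(* Vertex sets of the components of the subgraph induced on S. *)
Definition components S : {set {set G}} :=
  equivalence_partition (connect (restr_edge S)) S.

Definition is_tree : Prop :=
  [/\ 0 < #|G|, connected_set [set: G]
    & forall c : seq G, 2 < size c -> ~ ucycle (@sedge G) c].

Definition is_hole (c : seq G) : Prop :=
  [/\ 3 < size c, ucycle (@sedge G) c
    & forall x y, x \in c -> y \in c -> x -- y ->
        (y == next c x) || (x == next c y)].

Definition even_hole_free : Prop :=
  forall c : seq G, is_hole c -> odd (size c).

(* x :: p is the sequence of vertices of an induced path. *)
Definition induced_path x (p : seq G) : Prop :=
  uniq (x :: p) /\
  forall i j, i < size (x :: p) -> j < size (x :: p) ->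
    nth x (x :: p) i -- nth x (x :: p) j = (i.+1 == j) || (j.+1 == i).

End Basics.

Arguments leaves : clear implicits.
Arguments edges : clear implicits.
Arguments is_tree : clear implicits.
Arguments even_hole_free : clear implicits.

Definition induced_embedding (H G : sgraph) (f : H -> G) : Prop :=
  injective f /\ forall x y : H, f x -- f y = x -- y.

Section LineGraph.
Variable T : sgraph.

Definition line_vertex : finType := {e : {set T} | e \in edges T}.

Definition line_rel : rel line_vertex :=
  [rel e f | (e != f) && (val e :&: val f != set0)].

Lemma line_rel_sym : symmetric line_rel.
Proof. by move=> e f; rewrite /line_rel /= eq_sym setIC. Qed.

Lemma line_rel_irr : irreflexive line_rel.
Proof. by move=> e; rewrite /line_rel /= eqxx. Qed.

Definition line_graph : sgraph := SGraph line_rel_sym line_rel_irr.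

End LineGraph.

Section ExtendedTreeLineGraph.
Variables (T : sgraph) (A' B' : {set T}).

Definition is_bipartition : Prop :=
  [/\ [disjoint A' & B'], A' :|: B' = [set: T]
    & forall x y : T, x -- y -> (x \in A') = (y \in B')].

Definition few_components_avoiding (S : {set T}) : Prop :=
  forall v : T,
    #|[set K in components [set~ v] | [disjoint K & leaves T :&: S]]| <= 1.

Definition extended_tree : Prop :=
  [/\ is_tree T, 2 < #|leaves T|, is_bipartition,
      few_components_avoiding A' & few_components_avoiding B'].

Definition leaf_edge_at (S : {set T}) (e : line_graph T) : bool :=
  val e :&: (leaves T :&: S) != set0.

(* The two new vertices are inr true (called a) and inr false (called b). *)
Definition ext_rel : rel (line_graph T + bool)%type :=
  fun x y => match x, y with
  | inl e, inl f => e -- f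
  | inl e, inr c | inr c, inl e => leaf_edge_at (if c then A' else B') e
  | inr c, inr d => c != d
  end.

Lemma ext_rel_sym : symmetric ext_rel.
Proof. by move=> [e|c] [f|d] //=; [exact: line_rel_sym | rewrite eq_sym]. Qed.

Lemma ext_rel_irr : irreflexive ext_rel.
Proof. by move=> [e|c] /=; [exact: line_rel_irr | rewrite eqxx]. Qed.

Definition ext_line_graph : sgraph := SGraph ext_rel_sym ext_rel_irr.

Definition ext_a : ext_line_graph := inr true.
Definition ext_b : ext_line_graph := inr false.

(* Fixing which end of the cross-edge goes to a loses nothing: exchanging A'
   and B' exchanges the two ends. *)
Definition ext_induced_in (G : sgraph) (a b : G) : Prop :=
  exists f : ext_line_graph -> G,
    [/\ induced_embedding f, f ext_a = a & f ext_b = b].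

End ExtendedTreeLineGraph.

Section Shape.
Variable T : sgraph.

Definition branch_vertex (v : T) : bool := degree v != 2.

Definition is_branch (x : T) (p : seq T) (y : T) : Prop :=
  [/\ branch_vertex x, branch_vertex y, path (@sedge T) x (rcons p y),
      uniq (x :: rcons p y) & forall z, z \in p -> degree z = 2].

(* J is the shape of T up to isomorphism; f identifies V(J) with the
   branch-vertices of T. *)
Definition is_shape (J : sgraph) : Prop :=
  exists f : J -> T,
    [/\ injective f, forall v : T, branch_vertex v <-> exists u, f u = v
      & forall u v : J, u -- v <-> exists p, is_branch (f u) p (f v)].

End Shape.

Section Strips.
Variables (G : sgraph) (A B C : {set G}).

(* x :: p is the vertex sequence p_1, ..., p_k, so p_k is last x p and the
   internal vertices are behead (belast x p). *)
Definition is_rung (x : G) (p : seq G) : Prop :=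
  [/\ induced_path x p, {subset x :: p <= A :|: B :|: C},
      x \in A /\ last x p \in B,
      {subset behead (belast x p) <= C}
    & p != [::] -> x \notin B /\ last x p \notin A].

Definition is_strip : Prop :=
  [/\ A != set0 /\ B != set0, [disjoint A & C], [disjoint B & C]
    & forall v, v \in A :|: B :|: C ->
        exists x p, is_rung x p /\ v \in x :: p].

End Strips.

Section StripSystems.
Variables J G : sgraph.

(* M_uv is Me M [set u; v]; the values of Me outside edges J are irrelevant. *)
Record strip_family := StripFamily {
  Me : {set J} -> {set G};
  Mv : J -> {set G}
}.

Definition is_strip_system (M : strip_family) : Prop :=
  [/\ is_tree J /\ 2 < #|J|,
      forall e f, e \in edges J -> f \in edges J -> e != f ->
        [disjoint Me M e & Me M f],
      forall u : J, Mv M u \subset \bigcup_(v | u -- v) Me M [set u; v],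
      forall u v : J, u -- v ->
        is_strip (Me M [set u; v] :&: Mv M u) (Me M [set u; v] :&: Mv M v)
                 (Me M [set u; v] :\: (Mv M u :|: Mv M v))
    & (forall u v w x : J, u -- v -> w -- x -> uniq [:: u; v; w; x] ->
        forall y z, y \in Me M [set u; v] -> z \in Me M [set w; x] ->
          ~~ (y -- z)) /\
      (forall u v w : J, u -- v -> u -- w -> v != w ->
        forall y z, y \in Me M [set u; v] -> z \in Me M [set u; w] ->
          y -- z = (y \in Mv M u) && (z \in Mv M u))].

Definition VM (M : strip_family) : {set G} := \bigcup_(e in edges J) Me M e.

Definition cross_edge (M : strip_family) (alpha beta : {set J}) (a b : G) :
    Prop :=
  [/\ a -- b,
      alpha :|: beta = leaves J /\ [disjoint alpha & beta],
      (forall s : J, degree s != 2) /\ 2 < #|J|,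
      forall s : J, #|[set t in alpha | s -- t]| <= 1 /\
                    #|[set t in beta | s -- t]| <= 1
    & [/\ a \notin VM M, b \notin VM M,
          forall x, x \in VM M -> a -- x = (x \in \bigcup_(u in alpha) Mv M u)
        & forall x, x \in VM M -> b -- x = (x \in \bigcup_(u in beta) Mv M u)]].

Definition has_cross_edge (M : strip_family) (a b : G) : Prop :=
  exists alpha beta : {set J}, cross_edge M alpha beta a b.

Definition is_local (M : strip_family) (alpha beta : {set J}) (a b : G)
    (X : {set G}) : Prop :=
  X \subset VM M :|: [set a; b] /\
  [\/ exists2 e, e \in edges J & X \subset Me M e,
      exists u : J, X \subset Mv M u,
      [/\ a \in X, b \notin X & exists2 u, u \in alpha & X :\ a \subset Mv M u]
    | [/\ b \in X, a \notin X & exists2 u, u \in beta & X :\ b \subset Mv M u]].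

End StripSystems.

Definition is_optimal (J G : sgraph) (M : strip_family J G) (a b : G) : Prop :=
  [/\ exists (T : sgraph) (A' B' : {set T}),
        [/\ extended_tree A' B', ext_induced_in A' B' a b & is_shape T J],
      forall (T : sgraph) (A' B' : {set T}) (J' : sgraph),
        extended_tree A' B' -> ext_induced_in A' B' a b -> is_shape T J' ->
        #|edges J'| <= #|edges J|,
      is_strip_system M,
      has_cross_edge M a b
    & forall M' : strip_family J G,
        is_strip_system M' -> has_cross_edge M' a b ->
        ~~ (VM M \proper VM M')].

(* Main.v *)
Require Import Defs.
From HB Require Import structures.
From mathcomp Require Import all_boot zify.

Set Implicit Arguments.
Unset Strict Implicit.
Unset Printing Implicit Defensive.

(* A pair of vertices of V(M) is bad if no local set contains it; by a Helly property of the tree J, (i) says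
   that a connected set F unseen by b, say, sees no bad pair. A smallest counterexample is an induced path fs
   whose two ends see the two members of a bad pair. From a vertex v of J, paths through the strips of
   distinct branches at v lead to distinct leaves, hence to a or b (the arms and beams below); they close up with fs to
   holes, and the parities of these exclude everything but two outcomes. Either fs can be added to one strip,
   against the maximality of V(M); or fs is a pendant path from a, attached to a single M_u or to two
   consecutive vertices of rungs of a single strip. In the second case fs and one rung per edge of J form
   an extended tree line-graph with cross-edge ab whose tree has a shape with more edges than J.
   For (ii), the same argument on paths of F towards a or b shows that all vertices of V(M) seen by F are
   adjacent to a or b, that is, belong to M_t for leaves t. If two leaves occurred, take an induced path of F
   between them: the distances between consecutive neighbours of a, b on it have prescribed parities, and the
   conditions imposed at the two ends and on the length contradict each other. *)

(** * Induced paths and odd rings *)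

(** Even-hole-freeness enters only through [ring_odd]. With a coded as true and b as false, two
    paths with adjacent heads that leave through the letters c and d have total length of parity c
    (+) d. Each exclusion adds up a few rings whose variable lengths and letters cancel modulo two
    while the constants do not. The two letters play different roles in a proof: a vertex of J has
    at most one neighbour in alpha, so an arm can be steered to a beta leaf unless the vertex it has
    to contain lies in a strip at an alpha leaf. Hence membership in such strips ([inS]), rather
    than adjacency to a, governs many case distinctions; the mirror images come from the symmetry of
    cross-edges. When the shape grows, a tree with the right bipartition has to be produced. Depth
    parity always is a bipartition, and the hole that leads from a leaf up to the root and back
    through a or b forces the leaf to the side of its letter. *)

Section InducedPaths.
Variable G : sgraph.
Implicit Types (x y z : G) (s t : seq G).

(** Recursive boolean form of [induced_path], which lets paths be cut and glued by induction on
    lists. The empty list counts as a path. *)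
Fixpoint ipath s : bool :=
  if s is x :: s' then
    [&& ipath s', x \notin s' & all (fun y => (x -- y) == (y == head x s')) s']
  else true.

(** The condition under which concatenation gives an induced path. The defaults of [last] and [head]
    are never reached, both lists being nonempty here. *)
Definition linked s t := forall x y, x \in s -> y \in t ->
  x != y /\ x -- y = (x == last x s) && (y == head y t).

Definition apart s t := forall x y, x \in s -> y \in t -> x != y /\ x -- y = false.

(** The situation of two arms leaving the same vertex of J in different directions: their heads are
    adjacent and nothing else is. *)
Definition touch s t := forall x y, x \in s -> y \in t ->
  x != y /\ x -- y = (x == head x s) && (y == head y t).

Lemma ipath_uniq s : ipath s -> uniq s.
Proof. by elim: s => //= x s IH /and3P[/IH -> ->]. Qed.

Lemma edgeC x y : x -- y = y -- x. Proof. exact: sedge_sym. Qed.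

Lemma edgexx x : x -- x = false. Proof. exact: sedge_irr. Qed.

Lemma edge_neq x y : x -- y -> x != y.
Proof. by apply: contraTneq => ->; rewrite edgexx. Qed.

Lemma head_def x y s : s != [::] -> head x s = head y s.
Proof. by case: s. Qed.

Lemma last_def x y s : s != [::] -> last x s = last y s.
Proof. by case: s. Qed.

Lemma mem_nonnil x s : x \in s -> s != [::].
Proof. by case: s. Qed.

Lemma mem_head_def x s : s != [::] -> head x s \in s.
Proof. by case: s => //= y s; rewrite mem_head. Qed.

Lemma mem_last_def x s : s != [::] -> last x s \in s.
Proof. by case: s => //= y s; rewrite mem_last. Qed.

Lemma ipath_cons x s : ipath s -> linked [:: x] s -> ipath (x :: s).
Proof.
move=> ps L /=; rewrite ps /=; apply/andP; split.
  by apply/negP => xs; case: (L x x (mem_head _ _) xs); rewrite eqxx.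
apply/allP => y ys; case: (L x y (mem_head _ _) ys) => _ -> /=.
by rewrite eqxx (head_def x y) ?(mem_nonnil ys).
Qed.

Lemma ipath_cat s t : ipath s -> ipath t -> linked s t -> ipath (s ++ t).
Proof.
elim: s => // x s IH pxs pt L.
have [ps xs /allP hx] := and3P pxs.
case: s => [|y s] in IH pxs L ps xs hx *.
  by apply: ipath_cons.
rewrite cat_cons; apply: ipath_cons.
  apply: IH => // p q ps' qt.
  have [-> ->] := L p q (mem_behead (s := [:: x, y & s]) ps') qt.
  by [].
move=> p q; rewrite mem_cat inE => /eqP -> /orP[qs|qt].
  have := hx _ qs => /eqP -> /=; split; last by rewrite eqxx.
  by apply: contraNneq xs => ->.
have [-> ->] := L x q (mem_head _ _) qt; split=> //; rewrite eqxx.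
have -> : (x == last x [:: x, y & s]) = false.
  by apply/negP => /eqP e; rewrite {1}e /= mem_last in xs.
apply/esym/negP => /= /eqP e; subst q.
by case: (L y y _ qt); rewrite ?eqxx // !inE eqxx orbT.
Qed.

Lemma ipath_catP s t : ipath (s ++ t) -> [/\ ipath s, ipath t & linked s t].
Proof.
elim: s => [|x s IH]; first by split.
rewrite cat_cons => /and3P[/IH[ps pt L] xst /allP hx].
split=> //.
  rewrite /= ps /=; move: xst; rewrite mem_cat => /norP[-> _] /=.
  apply/allP => y ys; have := hx y; rewrite mem_cat ys => /(_ isT) /eqP ->.
  by case: (s) ys.
move=> p q; rewrite inE => /orP[/eqP -> {p}|ps'] qt; last first.
  by have [-> ->] := L p q ps' qt; split=> //; case: (s) ps'.
have := hx q; rewrite mem_cat qt orbT => /(_ isT) /eqP ->; split.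
  by apply: contraNneq xst => ->; rewrite mem_cat qt orbT.
case: s => [|y s] in IH ps L xst hx *.
  by rewrite /= eqxx (head_def x q) ?(mem_nonnil qt).
have -> : (x == last x [:: x, y & s]) = false.
  by apply/negP => /eqP e; rewrite {1}e /= -cat_cons mem_cat mem_last in xst.
apply/negP => /= /eqP e; subst q.
by case: (L y y (mem_head _ _) qt); rewrite eqxx.
Qed.

Lemma last_rev x s : last x (rev s) = head x s.
Proof. by case: s => //= y s; rewrite rev_cons last_rcons. Qed.

Lemma head_rev x s : head x (rev s) = last x s.
Proof. by rewrite -{2}(revK s) last_rev. Qed.

Lemma ipath_rev s : ipath s -> ipath (rev s).
Proof.
elim: s => // x s IH /and3P[/IH ps xs /allP hx].
rewrite rev_cons -cats1; apply: ipath_cat => // p q.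
rewrite mem_rev => pin; rewrite inE => /eqP ->; split.
  by apply: contraNneq xs => <-.
rewrite last_rev edgeC; have /eqP -> := hx _ pin.
by rewrite /= eqxx andbT (head_def x p) ?(mem_nonnil pin).
Qed.

Lemma linked_rev s t : linked s t -> linked (rev t) (rev s).
Proof.
move=> L x y; rewrite !mem_rev => xt ys; have [d e] := L y x ys xt.
by rewrite eq_sym edgeC e last_rev head_rev andbC.
Qed.

Lemma ipath_nth x0 s : ipath s -> forall i j, i < size s -> j < size s ->
  nth x0 s i -- nth x0 s j = (i.+1 == j) || (j.+1 == i).
Proof.
elim: s => // x s IH /and3P[ps xs /allP hx].
have us := ipath_uniq ps.
have hx' j : j < size s -> x -- nth x0 s j = (j == 0).
  move=> js; have /eqP -> := hx _ (mem_nth x0 js).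
  have -> : head x s = nth x0 s 0 by case: (s) js => //=.
  by rewrite nth_uniq // (leq_ltn_trans (leq0n j)).
case=> [|i] [|j] //=; rewrite ?ltnS => Hi Hj.
- by rewrite edgexx.
- by rewrite hx' // eqSS eq_sym orbF.
- by rewrite edgeC hx' // eqSS eq_sym.
- by rewrite IH.
Qed.

Lemma ipathP x0 s : uniq s ->
  (forall i j, i < size s -> j < size s ->
     nth x0 s i -- nth x0 s j = (i.+1 == j) || (j.+1 == i)) -> ipath s.
Proof.
elim: s => // x s IH /andP[xs us] H; rewrite /= xs /=; apply/andP; split.
  by apply: IH => // i j Hi Hj; rewrite (H i.+1 j.+1).
apply/allP => y ys; rewrite -(nth_index x0 ys).
have iy : index y s < size s by rewrite index_mem.
rewrite (H 0 (index y s).+1) //= orbF eqSS.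
have -> : head x s = nth x0 s 0 by rewrite nth0; apply: head_def (mem_nonnil ys).
by rewrite nth_uniq ?(leq_ltn_trans (leq0n _) iy) //; apply/eqP/eq_sym.
Qed.

Lemma induced_pathP x p : induced_path x p <-> ipath (x :: p).
Proof.
split=> [[u H]|H]; first exact: ipathP u H.
by split; [exact: ipath_uniq | move=> i j; exact: ipath_nth].
Qed.

Hypothesis ehf : even_hole_free G.

(* Chordless cycles; a triangle is odd as well, so only length two is excluded. *)
Lemma ring_odd s t : ipath s -> ipath t -> s != [::] -> t != [::] ->
  2 < size s + size t ->
  (forall x y, x \in s -> y \in t -> x != y /\
     x -- y = (x == last x s) && (y == head y t)
           || (x == head x s) && (y == last y t)) ->
  odd (size s + size t).
Proof.
move=> ps pt s0 t0 sz L.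
case: (ltnP 3 (size s + size t)) => [sz4|sz3]; last first.
  by have -> : size s + size t = 3 by apply/eqP; rewrite eqn_leq sz3 sz.
rewrite -size_cat; apply: ehf.
have us := ipath_uniq ps; have ut := ipath_uniq pt.
have dis x : x \in s -> x \notin t.
  by move=> xs; apply/negP => xt; case: (L x x xs xt); rewrite eqxx.
have uc : uniq (s ++ t).
  rewrite cat_uniq us ut andbT /=; apply/hasPn => x xt; apply/negP => xs.
  by rewrite /= (negPf (dis x xs)) in xt.
set c := s ++ t; set n := size c.
have nE : n = size s + size t by rewrite /n /c size_cat.
have [x0 _] : exists x0 : G, x0 \in s by case: (s) s0 => // x s' _; exists x; rewrite mem_head.
have s1 : 0 < size s by rewrite lt0n size_eq0.
have t1 : 0 < size t by rewrite lt0n size_eq0.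
have hs y : head y s = nth x0 s 0 by rewrite nth0; apply: head_def.
have ht y : head y t = nth x0 t 0 by rewrite nth0; apply: head_def.
have ls y : last y s = nth x0 s (size s).-1.
  by rewrite (last_def y x0) // nth_last.
have lt y : last y t = nth x0 t (size t).-1.
  by rewrite (last_def y x0) // nth_last.
have cross i j : i < size s -> j < size t ->
    nth x0 s i -- nth x0 t j =
    (i == (size s).-1) && (j == 0) || (i == 0) && (j == (size t).-1).
  move=> Hi Hj; have [_ ->] := L _ _ (mem_nth x0 Hi) (mem_nth x0 Hj).
  by rewrite hs ht ls lt !nth_uniq // prednK.
(* A chord would join indices that are not consecutive modulo [n]; the junction of the end of [t]
   with the start of [s] is the wrap-around case. *)
have adj i j : i < n -> j < n -> nth x0 c i -- nth x0 c j ->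
    (j == i.+1 %[mod n]) || (i == j.+1 %[mod n]).
  rewrite /c !nth_cat nE => Hin Hjn.
  case: (ltnP i (size s)) => Hi; case: (ltnP j (size s)) => Hj.
  - rewrite ipath_nth // => /orP[/eqP <-|/eqP <-]; by rewrite eqxx ?orbT.
  - rewrite cross ?ltn_subLR // => /orP[/andP[/eqP -> /eqP e]|/andP[/eqP -> /eqP e]].
      apply/orP; left; rewrite prednK //.
      by have -> : j = size s by apply/eqP; rewrite eqn_leq Hj -subn_eq0 e.
    apply/orP; right.
    have -> : j.+1 = size s + size t.
      by rewrite -(subnK Hj) e addnC -addnS prednK.
    by rewrite modnn mod0n.
  - rewrite edgeC cross ?ltn_subLR // => /orP[/andP[/eqP -> /eqP e]|/andP[/eqP -> /eqP e]].
      apply/orP; right; rewrite prednK //.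
      by have -> : i = size s by apply/eqP; rewrite eqn_leq Hi -subn_eq0 e.
    apply/orP; left.
    have -> : i.+1 = size s + size t.
      by rewrite -(subnK Hi) e addnC -addnS prednK.
    by rewrite modnn mod0n.
  - rewrite ipath_nth ?ltn_subLR // -!subSn //.
    rewrite -[i.+1 - _ == _](eqn_add2r (size s)).
    rewrite -[j.+1 - _ == _](eqn_add2r (size s)) !subnK ?leqW //.
    by move=> /orP[/eqP <-|/eqP <-]; rewrite eqxx ?orbT.
have nextE i : i < n -> next c (nth x0 c i) = nth x0 c (i.+1 %% n).
  move=> Hi; rewrite next_nth mem_nth // index_uniq //.
  have cE : c = nth x0 c 0 :: behead c by rewrite /c; case: (s) s0.
  have sb : size (behead c) = n.-1 by rewrite size_behead.
  rewrite {1}cE; have [lt1|ge1] := ltnP i.+1 n.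
    rewrite modn_small // nth_behead.
    by apply: set_nth_default.
  have -> : i.+1 = n by apply/eqP; rewrite eqn_leq Hi ge1.
  by rewrite modnn nth_default // sb -ltnS prednK // (leq_ltn_trans _ Hi).
split.
- by rewrite size_cat.
- apply/andP; split=> //.
  have: forall i, i < n -> nth x0 c i -- nth x0 c (i.+1 %% n).
    move=> i Hi; rewrite /c !nth_cat.
    have [lt1|ge1] := ltnP i.+1 n.
      rewrite modn_small //; have [Hs|Hs] := ltnP i (size s).
        have [Hs1|Hs1] := ltnP i.+1 (size s).
          by rewrite ipath_nth // eqxx.
        have eS : i.+1 = size s by apply/eqP; rewrite eqn_leq Hs Hs1.
        by rewrite eS subnn cross // -eS /= !eqxx.
      rewrite ltnNge (leq_trans Hs) //= ipath_nth ?ltn_subLR -?nE //.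
        by rewrite subSn // eqxx.
      by rewrite (leq_trans Hs).
    have eS : i.+1 = n by apply/eqP; rewrite eqn_leq Hi ge1.
    have -> : (i < size s) = false by lia.
    rewrite eS modnn s1 edgeC cross //; last by lia.
    have -> : i - size s = (size t).-1 by lia.
    by rewrite !eqxx orbT.
  move=> H; apply/(@cycle_from_next _ _ _ uc) => x xc.
  by rewrite -(nth_index x0 xc) nextE ?index_mem // H // index_mem.
- move=> x y xc yc; rewrite -(nth_index x0 xc) -(nth_index x0 yc).
  set i := index x c; set j := index y c.
  have Hi : i < n by rewrite index_mem. have Hj : j < n by rewrite index_mem.
  move=> /adj => /(_ Hi Hj) /orP[/eqP e|/eqP e].
    by rewrite nextE // -e modn_small // eqxx.
  by rewrite orbC nextE // -e modn_small // eqxx.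
Qed.

End InducedPaths.

(** * Touching paths, and how an outside vertex sees a path *)

Section ListPieces.
Variable G : sgraph.
Implicit Types (x y z c : G) (s t u fs : seq G).

Lemma linked_catr s t u : linked s t -> t != [::] -> apart s u -> linked s (t ++ u).
Proof.
move=> L t0 A x y xs ytu.
have -> : head y (t ++ u) = head y t by case: (t) t0.
have [yt|yt] := boolP (y \in t); first exact: L.
move: ytu; rewrite mem_cat (negPf yt) => yu.
have [-> ->] := A x y xs yu; split=> //; apply/esym/negbTE.
by rewrite negb_and; apply/orP; right; apply: contraNneq yt => ->; apply: mem_head_def.
Qed.

Lemma apartC s t : apart s t -> apart t s.
Proof. by move=> A x y xs yt; rewrite eq_sym edgeC; apply: A. Qed.

Lemma touchC s t : touch s t -> touch t s.
Proof. by move=> A x y xs yt; rewrite eq_sym edgeC andbC; apply: A. Qed.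

Lemma apart_sub s t s' t' : apart s t -> {subset s' <= s} -> {subset t' <= t} -> apart s' t'.
Proof. by move=> A ss tt x y /ss xs /tt; apply: A. Qed.

Lemma touch_prefix s s' t : touch (s ++ s') t -> s != [::] -> touch s t.
Proof.
move=> T s0 x y xs yt; have [|-> ->] := T x y _ yt; first by rewrite mem_cat xs.
by have -> : head x (s ++ s') = head x s by case: (s) s0.
Qed.

Lemma touch_suffix s s' t : uniq (s ++ s') -> touch (s ++ s') t -> s != [::] -> apart s' t.
Proof.
move=> us T s0 x y xs yt; have [|-> ->] := T x y _ yt; first by rewrite mem_cat xs orbT.
split=> //; apply/negbTE; rewrite negb_and; apply/orP; left.
apply/eqP => e; move: us; rewrite cat_uniq => /and3P[_ /hasPn /(_ x xs)] /=.
by rewrite e; case: (s) s0 => //= z s2; rewrite mem_head.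
Qed.

Lemma touch_linked s t : touch s t -> linked (rev s) t.
Proof. by move=> T x y; rewrite mem_rev last_rev => xs yt; apply: T. Qed.

Lemma ipath_touch s t : ipath s -> ipath t -> touch s t -> ipath (rev s ++ t).
Proof. by move=> ps pt T; apply: ipath_cat => //; [apply: ipath_rev | apply: touch_linked]. Qed.

Lemma first_split (S : pred G) s : has S s ->
  exists s1 x s2, [/\ s = s1 ++ x :: s2, S x & {in s1, forall z, ~~ S z}].
Proof.
elim: s => //= x s IH; have [Sx|nSx] := boolP (S x).
  by move=> _; exists (@nil G), x, s; split.
move=> /IH[s1 [y [s2 [-> Sy H]]]]; exists (x :: s1), y, s2; split=> //.
by move=> z; rewrite inE => /orP[/eqP ->|/H].
Qed.

Lemma last_split (S : pred G) s : has S s ->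
  exists s1 x s2, [/\ s = s1 ++ x :: s2, S x & {in s2, forall z, ~~ S z}].
Proof.
rewrite -(has_rev S s) => h; have [s1 [x [s2 [e Sx H]]]] := first_split h.
exists (rev s2), x, (rev s1); split=> //.
  by rewrite -[s]revK e rev_cat rev_cons cat_rcons.
by move=> z; rewrite mem_rev; apply: H.
Qed.

Definition sees fs z := has (fun f => f -- z) fs.
Definition noF fs z := z \notin fs /\ forall f, f \in fs -> f -- z = false.
Definition atH fs z := z \notin fs /\ forall f, f \in fs -> f -- z = (f == head f fs).
Definition atL fs z := z \notin fs /\ forall f, f \in fs -> f -- z = (f == last f fs).
(** Minimality of an attachment yields the one-sided forms [onlyH] and [onlyL], which also hold for
    unseen vertices; for a seen vertex they become [atH] and [atL], the exact adjacencies that a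
    ring needs. *)
Definition onlyH fs z := z \notin fs /\ forall f, f \in fs -> f -- z -> f = head f fs.
Definition onlyL fs z := z \notin fs /\ forall f, f \in fs -> f -- z -> f = last f fs.

Lemma noF_sees fs z : z \notin fs -> ~~ sees fs z -> noF fs z.
Proof. by move=> zf /hasPn H; split=> // f /H /negbTE. Qed.

Lemma seesN fs z : noF fs z -> ~~ sees fs z.
Proof. by case=> _ H; apply/hasPn => f /H ->. Qed.

Lemma noF_onlyH fs z : noF fs z -> onlyH fs z.
Proof. by case=> ? H; split=> // f /H ->. Qed.

Lemma onlyH_atH fs z : onlyH fs z -> sees fs z -> atH fs z.
Proof.
case=> zf H /hasP[f ff fz]; split=> // g gf; apply/idP/eqP; first exact: H.
by move=> ->; rewrite (head_def _ f (mem_nonnil gf)) -(H f).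
Qed.

Lemma onlyL_atL fs z : onlyL fs z -> sees fs z -> atL fs z.
Proof.
case=> zf H /hasP[f ff fz]; split=> // g gf; apply/idP/eqP; first exact: H.
by move=> ->; rewrite (last_def _ f (mem_nonnil gf)) -(H f).
Qed.

Lemma atH_rev fs z : atH fs z -> atL (rev fs) z.
Proof.
case=> zf H; split; rewrite ?mem_rev // => f; rewrite mem_rev last_rev; exact: H.
Qed.

Lemma atL_rev fs z : atL fs z -> atH (rev fs) z.
Proof.
case=> zf H; split; rewrite ?mem_rev // => f; rewrite mem_rev head_rev; exact: H.
Qed.

Lemma onlyH_rev fs z : onlyH fs z -> onlyL (rev fs) z.
Proof.
case=> zf H; split; rewrite ?mem_rev // => f; rewrite mem_rev last_rev; exact: H.
Qed.

Lemma noF_rev fs z : noF fs z -> noF (rev fs) z.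
Proof. by case=> zf H; split; rewrite ?mem_rev // => f; rewrite mem_rev; apply: H. Qed.

Lemma sees_rev fs z : sees (rev fs) z = sees fs z.
Proof. exact: has_rev. Qed.

Lemma atH1 f fs z : atH (f :: fs) z -> atH [:: f] z.
Proof.
case=> zf H; split; first by move: zf; rewrite !inE => /norP[].
by move=> g; rewrite inE => /eqP -> /=; rewrite H ?mem_head.
Qed.

Lemma noF1 f fs z : noF (f :: fs) z -> noF [:: f] z.
Proof.
case=> zf H; split; first by move: zf; rewrite !inE => /norP[].
by move=> g; rewrite inE => /eqP ->; rewrite H ?mem_head.
Qed.

(** The form in which a path closes up with a vertex c: the ring enters c from the last vertex and
    has no other edge to c. *)
Definition capped c s := forall z, z \in s -> z != c /\ c -- z = (z == last z s).
Definition free c s := forall z, z \in s -> z != c /\ c -- z = false.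

Lemma capped_suffix c s t : t != [::] -> capped c (s ++ t) -> capped c t.
Proof.
move=> t0 H z zt; have [|-> ->] := H z; first by rewrite mem_cat zt orbT.
by rewrite last_cat (last_def _ z t0).
Qed.

Lemma free_sub c s t : free c t -> {subset s <= t} -> free c s.
Proof. by move=> H st z /st/H. Qed.

Lemma free_cat c s t : free c s -> free c t -> free c (s ++ t).
Proof. by move=> Hs Ht z; rewrite mem_cat => /orP[/Hs|/Ht]. Qed.

Lemma capped_cat c s t : free c s -> capped c t -> t != [::] -> capped c (s ++ t).
Proof.
move=> Hs Ht t0 z zst; rewrite last_cat (last_def _ z t0).
have [/Ht//|zt] := boolP (z \in t).
move: zst; rewrite mem_cat (negPf zt) orbF => /Hs[-> ->]; split=> //.
by apply/esym/negbTE; apply: contraNneq zt => ->; apply: mem_last_def.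
Qed.

Lemma capped_prefix c s t : t != [::] -> uniq (s ++ t) -> capped c (s ++ t) -> free c s.
Proof.
move=> t0 u H z zs; have [|-> ->] := H z; first by rewrite mem_cat zs.
split=> //; apply/negbTE; apply/eqP => e.
move: u; rewrite cat_uniq => /and3P[_ /hasPn N _].
have /N /= := mem_last_def z t0.
by rewrite -[last z t](last_def (last z s)) // -last_cat -e zs.
Qed.

End ListPieces.

(** * Rings through a, b or the edge ab *)

Section Rings.
Variables (G : sgraph) (ehf : even_hole_free G) (a b : G).
Hypothesis ab : a -- b.
Implicit Types (x y z : G) (s t u fs E Q R K P : seq G) (c d : bool).

(** The ring consists of [fs], [y], [R], [x]; the two vertices that are not counted leave the parity
    unchanged. *)
Lemma fring fs y R x : ipath fs -> fs != [::] -> ipath (y :: rcons R x) ->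
  atL fs y -> atH fs x -> {in R, forall z, noF fs z} -> odd (size fs + size R).
Proof.
move=> pf f0 pR Hy Hx HR.
have := ring_odd ehf pf pR f0 isT; rewrite /= size_rcons !addnS /= negbK; apply.
  by case: (fs) f0.
have uR := ipath_uniq pR.
move=> f z ff; rewrite last_rcons inE mem_rcons inE.
have yx : y != x by move: uR; rewrite /= mem_rcons inE negb_or => /andP[/andP[]].
case/or3P=> [/eqP -> {z}|/eqP -> {z}|zR].
- case: Hy => yf ->//; rewrite eqxx andbT (negPf yx) andbF orbF; split=> //.
  by apply: contraNneq yf => <-.
- case: Hx => xf ->//; rewrite eqxx andbT [x == y]eq_sym (negPf yx) andbF; split=> //.
  by apply: contraNneq xf => <-.
- have [zf ->//] := HR z zR.
  have -> : (z == y) = false.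
    by apply/negbTE; apply: contraTneq uR => <- /=; rewrite mem_rcons inE zR orbT.
  have -> : (z == x) = false.
    apply/negbTE; apply: contraTneq uR => <- /=.
    by rewrite rcons_uniq zR !andbF.
  by rewrite !andbF; split=> //; apply: contraNneq zf => <-.
Qed.

(** The ring runs through [fs], out along [y :: E2], across [K] and back along [x :: E1]; [K] stands
    for the passage through one letter or through the edge ab. *)
Lemma round K fs x E1 y E2 : ipath fs -> fs != [::] -> ipath (x :: E1) ->
  ipath (y :: E2) -> ipath K -> K != [::] -> apart (y :: E2) (x :: E1) ->
  linked (y :: E2) K -> linked (x :: E1) (rev K) -> atH fs x -> atL fs y ->
  {in E1, forall z, noF fs z} -> {in E2, forall z, noF fs z} ->
  {in K, forall z, noF fs z} ->
  odd (size fs + size E1 + size E2 + size K).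
Proof.
move=> pf f0 p1 p2 pK K0 A L2 L1 Hx Hy H1 H2 HK.
have L1' : linked K (rev (x :: E1)) by have := linked_rev L1; rewrite revK.
have r0 : rev (x :: E1) != [::] by rewrite rev_cons; case: (rev E1).
have -> : size fs + size E1 + size E2 + size K = size fs + size (E2 ++ K ++ rev E1).
  by rewrite !size_cat size_rev; lia.
apply: (fring pf f0 _ Hy Hx).
  have -> : y :: rcons (E2 ++ K ++ rev E1) x = (y :: E2) ++ K ++ rev (x :: E1).
    by rewrite rev_cons /= -!cats1 -!catA.
  apply: ipath_cat => //.
    by apply: ipath_cat => //; apply: ipath_rev.
  apply: linked_catr => //; apply: apart_sub A _ _ => // z.
  by rewrite mem_rev.
move=> z; rewrite !mem_cat mem_rev => /or3P[/H2|/HK|/H1] //.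
Qed.

(** Here [K] is the single vertex c, so three vertices of the ring (x, y and c) are not counted. *)
Lemma round1 (c : G) fs x E1 y E2 : ipath fs -> fs != [::] -> ipath (x :: E1) ->
  ipath (y :: E2) -> apart (y :: E2) (x :: E1) ->
  capped c (x :: E1) -> capped c (y :: E2) -> atH fs x -> atL fs y ->
  {in E1, forall z, noF fs z} -> {in E2, forall z, noF fs z} -> noF fs c ->
  ~~ odd (size fs + size E1 + size E2).
Proof.
move=> pf f0 p1 p2 A C1 C2 Hx Hy H1 H2 Hc.
have := round (K := [:: c]) pf f0 p1 p2 isT isT A _ _ Hx Hy H1 H2.
rewrite addn1 /=; apply.
- move=> z d zE; rewrite inE => /eqP ->; have [-> e] := C2 z zE.
  by rewrite edgeC e /= eqxx andbT.
- move=> z d zE; rewrite inE => /eqP ->; have [-> e] := C1 z zE.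
  by rewrite edgeC e /= eqxx andbT.
- by move=> z; rewrite inE => /eqP ->.
Qed.

(** The code true for a and false for b turns parities of rings into sums of codes. *)
Definition letter c1 := if c1 then a else b.
Definition full c1 E := capped (letter c1) E /\ free (letter (~~ c1)) E.

Lemma letter_adj c1 : letter c1 -- letter (~~ c1).
Proof. by case: c1 => /=; rewrite // edgeC. Qed.

(** Equal letters close the ring through one vertex, different letters through the edge ab; in both
    cases the parity is the sum of the codes. *)
Lemma roundc c1 c2 fs x E1 y E2 : ipath fs -> fs != [::] -> ipath (x :: E1) ->
  ipath (y :: E2) -> apart (y :: E2) (x :: E1) ->
  full c1 (x :: E1) -> full c2 (y :: E2) -> atH fs x -> atL fs y ->
  {in E1, forall z, noF fs z} -> {in E2, forall z, noF fs z} ->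
  noF fs a -> noF fs b ->
  odd (size fs + size E1 + size E2) = c1 (+) c2.
Proof.
move=> pf f0 p1 p2 A [C1 F1] [C2 F2] Hx Hy H1 H2 Ha Hb.
have Hl c : noF fs (letter c) by case: c.
have [e|ne] := boolP (c1 == c2).
  move/eqP: e => e; subst c2; rewrite addbb; apply/negbTE.
  exact: (round1 pf f0 p1 p2 A C1 C2 Hx Hy H1 H2 (Hl _)).
have e2 : c2 = ~~ c1 by case: (c1) (c2) ne => [] [].
subst c2; have -> : c1 (+) ~~ c1 = true by case: (c1).
have K0 : ipath [:: letter (~~ c1); letter c1].
  rewrite /= andbT eqxx edgeC letter_adj /= inE andbT.
  by rewrite eq_sym; apply: edge_neq (letter_adj c1).
have ll : (letter c1 == letter (~~ c1)) = false by apply/negbTE/edge_neq/letter_adj.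
have := round pf f0 p1 p2 K0 isT A _ _ Hx Hy H1 H2.
rewrite addnS addn1 /= negbK; apply.
- move=> z d zE; rewrite !inE => /orP[]/eqP ->.
    by have [-> e] := C2 z zE; rewrite edgeC e /= eqxx andbT.
  by rewrite negbK in F2; have [-> e] := F2 z zE; rewrite edgeC e /= ll andbF.
- move=> z d zE; rewrite !inE => /orP[]/eqP ->.
    by have [-> e] := C1 z zE; rewrite edgeC e /= eqxx andbT.
  by have [-> e] := F1 z zE; rewrite edgeC e /= [letter (~~ c1) == _]eq_sym ll andbF.
- by move=> z; rewrite !inE => /orP[]/eqP ->.
Qed.

(** This ring avoids a and b: it goes from x back to one head, over to the adjacent head and out to
    y. *)
Lemma direct fs q1 x q2 y : ipath fs -> fs != [::] -> ipath (rcons q1 x) ->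
  ipath (rcons q2 y) -> touch (rcons q1 x) (rcons q2 y) -> atH fs x -> atL fs y ->
  {in q1, forall z, noF fs z} -> {in q2, forall z, noF fs z} ->
  odd (size fs + size q1 + size q2).
Proof.
move=> pf f0 p1 p2 T Hx Hy H1 H2.
have -> : size fs + size q1 + size q2 = size fs + size (rev q2 ++ q1).
  by rewrite size_cat size_rev; lia.
apply: (fring pf f0 _ Hy Hx).
  have -> : y :: rcons (rev q2 ++ q1) x = rev (rcons q2 y) ++ rcons q1 x.
    by rewrite rev_rcons rcons_cat.
  by apply: ipath_touch => //; apply: touchC.
by move=> z; rewrite mem_cat mem_rev => /orP[/H2|/H1].
Qed.

(** The two paths meet at their heads and again through one letter or through the edge ab, so the
    letters determine the parity of the total length. *)
Lemma closed_arms c1 c2 s t : ipath s -> ipath t -> s != [::] -> t != [::] ->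
  touch s t -> full c1 s -> full c2 t -> odd (size s + size t) = c1 (+) c2.
Proof.
move=> ps pt s0 t0 T [C1 F1] [C2 F2].
set K := if c1 == c2 then [:: letter c1] else [:: letter c2; letter c1].
have szK : odd (size K) = ~~ (c1 (+) c2) by rewrite /K; case: (c1) (c2) => [] [].
have K1 : 0 < size K by rewrite /K; case: ifP.
have pK : ipath K.
  rewrite /K; case: eqVneq => // ne.
  have -> : c2 = ~~ c1 by case: (c1) (c2) ne => [] [].
  by rewrite /= eqxx edgeC letter_adj /= inE eq_sym (edge_neq (letter_adj c1)).
have := ring_odd ehf pK (ipath_touch ps pt T).
rewrite size_cat size_rev => /(_ _ _ _ _) H.
have: odd (size K + (size s + size t)).
  apply: H; rewrite -?size_eq0 ?size_cat ?size_rev -?lt0n //.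
  - by case: (s) s0.
  - by case: (s) s0 => //= ? ? _; case: (t) t0 => //= ? ? _; lia.
  move=> k z kK; rewrite mem_cat mem_rev.
  have -> : head z (rev s ++ t) = last z s.
    by rewrite -head_rev; case: (rev s) (size_rev s) => //=; case: (s) s0.
  rewrite last_cat (last_def _ z t0).
  have Fs : forall w, w \in s -> last w s = last z s by move=> w _; apply: last_def.
  have dis w : w \in s -> w \in t -> False by move=> ws wt; case: (T w w ws wt); rewrite eqxx.
  have lt_ := mem_last_def z t0; have ls_ := mem_last_def z s0.
  move=> zst; have zC : (z \in s -> (z == last z t) = false) /\ (z \in t -> (z == last z s) = false).
    by split=> zin; apply/negbTE/eqP => e; [apply: (dis z zin) | apply: (dis z _ zin)]; rewrite [z]e.
  move: kK; rewrite /K; case: eqVneq => [e|ne].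
    rewrite inE => /eqP ->; rewrite /= eqxx /=.
    case/orP: zst => zin.
      have [d ->] := C1 z zin; rewrite eq_sym d; split=> //.
      by rewrite (zC.1 zin) orbF.
    have [d e2] := C2 z zin; rewrite e eq_sym d e2; split=> //.
    by rewrite (zC.2 zin).
  have e2 : c2 = ~~ c1 by case: (c1) (c2) ne => [] [].
  have ll : (letter c1 == letter c2) = false by apply/negbTE; rewrite e2 edge_neq // letter_adj.
  have F1' : free (letter c2) s by rewrite e2.
  have F2' : free (letter c1) t by move: F2; rewrite e2 negbK.
  have ll' : (letter c2 == letter c1) = false by rewrite eq_sym.
  rewrite !inE /= => /orP[]/eqP ->; rewrite /= ?eqxx ?ll ?ll' /=; case/orP: zst => zin.
  - by have [d ->] := F1' _ zin; rewrite eq_sym d (zC.1 zin).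
  - by have [d ->] := C2 _ zin; rewrite eq_sym d.
  - by have [d ->] := C1 _ zin; rewrite eq_sym d orbF.
  - by have [d ->] := F2' _ zin; rewrite eq_sym d (zC.2 zin).
by rewrite oddD szK; case: (c1) (c2) (odd _) => [] [] [].
Qed.

End Rings.

(** * Configurations of paths leaving through a or b *)

Section Legs.
Variables (G : sgraph) (ehf : even_hole_free G) (a b : G).
Hypothesis ab : a -- b.
Implicit Types (x y z : G) (s t fs E Q P : seq G) (c d e : bool).

Notation full := (full a b).
Notation letter := (letter a b).

Definition leg c Q := [/\ ipath Q, Q != [::] & full c Q].

Lemma full_suffix c s t : t != [::] -> full c (s ++ t) -> full c t.
Proof.
move=> t0 [C F]; split; first exact: capped_suffix t0 C.
by apply: free_sub F _ => z; rewrite mem_cat orbC => ->.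
Qed.

Lemma full_prefix c d s t : t != [::] -> uniq (s ++ t) -> full c (s ++ t) -> free (letter d) s.
Proof.
move=> t0 u [C F].
have Fc := capped_prefix t0 u C.
have Fn : free (letter (~~ c)) s by apply: free_sub F _ => z; rewrite mem_cat => ->.
by case: c d Fc Fn {C F} => [] [].
Qed.

Lemma full_cat c s t : free a s -> free b s -> full c t -> t != [::] -> full c (s ++ t).
Proof.
move=> Fa Fb [C F] t0; split; first by apply: capped_cat => //; case: c {C F}.
by apply: free_cat => //; case: c {C F}.
Qed.

(** From x back to the head of its own leg and out along another leg. If x ends its leg then x is
    itself adjacent to the letter c, and only the adjacencies to a different letter d remain under
    control. *)
Lemma detour c d q x r Q : leg c (q ++ x :: r) -> leg d Q -> touch (q ++ x :: r) Q ->
  [/\ ipath (x :: rev q ++ Q), ipath (q ++ [:: x]),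
      r != [::] -> full d (x :: rev q ++ Q) &
      r = [::] -> c != d -> capped (letter d) (x :: rev q ++ Q)].
Proof.
move=> [p1 q0 F1] [p2 Q0 F2] T.
have E : x :: rev q ++ Q = rev (q ++ [:: x]) ++ Q by rewrite rev_cat /=.
have q1 : q ++ [:: x] != [::] by case: (q).
have E1 : q ++ x :: r = (q ++ [:: x]) ++ r by rewrite -catA.
rewrite E1 in p1 F1 T; have [px pr L] := ipath_catP p1.
have up := ipath_uniq p1.
split=> //.
- by rewrite E; apply: ipath_touch => //; apply: touch_prefix T q1.
- move=> r0; rewrite E; apply: full_cat => //.
    by move=> z; rewrite mem_rev; apply: (full_prefix true r0 up F1).
  by move=> z; rewrite mem_rev; apply: (full_prefix false r0 up F1).
- move=> r0 cd; rewrite E; apply: capped_cat => //; last by case: F2.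
  move=> z; rewrite mem_rev => zq; have [_ F] := F1.
  have -> : d = ~~ c by case: (c) (d) cd => [] [].
  by apply: F; rewrite mem_cat zq.
Qed.

Lemma size_split x s t : size (s ++ x :: t) = (size s + size t).+1.
Proof. by rewrite size_cat /= addnS. Qed.

Lemma leg_out c q x r : leg c (q ++ x :: r) -> [/\ ipath (x :: r), full c (x :: r) & leg c (x :: r)].
Proof.
case=> p _ F; have [_ pr _] := ipath_catP p.
by have Fr := full_suffix (t := x :: r) isT F.
Qed.

Lemma touch_out c q x r Q : leg c (q ++ x :: r) -> touch (q ++ x :: r) Q -> q != [::] ->
  apart (x :: r) Q.
Proof. by case=> /ipath_uniq u _ _ T q0; apply: touch_suffix T q0. Qed.

Lemma touch_out2 c d q x r q' x' r' : leg c (q ++ x :: r) -> leg d (q' ++ x' :: r') ->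
  touch (q ++ x :: r) (q' ++ x' :: r') -> (q != [::]) || (q' != [::]) ->
  apart (x :: r) (x' :: r').
Proof.
move=> L L' T /orP[q0|q0].
  apply: apart_sub (touch_out L T q0) _ _ => // z; by rewrite [in X in _ -> X]mem_cat orbC => ->.
apply: apartC; apply: apart_sub (touch_out L' (touchC T) q0) _ _ => // z.
by rewrite [in X in _ -> X]mem_cat orbC => ->.
Qed.

Lemma closed_legs c d Q Q' : leg c Q -> leg d Q' -> touch Q Q' ->
  odd (size Q + size Q') = c (+) d.
Proof.
by move=> [p1 q1 F1] [p2 q2 F2] T; apply: (closed_arms ehf ab p1 p2 q1 q2 T F1 F2).
Qed.

Lemma in_split q x r : x \in q ++ x :: r.
Proof. by rewrite mem_cat mem_head orbT. Qed.

Definition loose fs := [/\ ipath fs, fs != [::], noF fs a & noF fs b].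

Lemma loose_rev fs : loose fs -> loose (rev fs).
Proof.
case=> pf f0 fa fb; split; [exact: ipath_rev | | exact: noF_rev | exact: noF_rev].
by move: f0; rewrite -!size_eq0 size_rev.
Qed.

(** As [roundc], but the side of x takes the detour through [Q3]. The last hypothesis allows x to
    end its leg when its letter differs from both others, for then the ring closes through the
    common letter of legs 2 and 3. *)
Lemma round_via fs c1 c2 c3 p1 x s1 q2 y r2 Q3 : loose fs ->
  leg c1 (p1 ++ x :: s1) -> leg c2 (q2 ++ y :: r2) -> leg c3 Q3 ->
  touch (p1 ++ x :: s1) (q2 ++ y :: r2) -> touch (p1 ++ x :: s1) Q3 ->
  touch Q3 (q2 ++ y :: r2) -> q2 != [::] ->
  atH fs x -> {in p1, forall z, noF fs z} -> {in Q3, forall z, noF fs z} ->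
  atL fs y -> {in r2, forall z, noF fs z} ->
  s1 != [::] \/ c1 != c2 /\ c1 != c3 ->
  odd (size fs + size p1 + size Q3 + size r2) = c3 (+) c2.
Proof.
move=> [pf f0 fa fb] L1 L2 L3 T12 T13 T32 q0 Hx H1 H3 Hy H2 V.
have [py Fy _] := leg_out L2.
have A1 := touch_out L2 (touchC T12) q0; have A3 := touch_out L2 (touchC T32) q0.
have [pd _ D1 D2] := detour L1 L3 T13.
have A4 : apart (y :: r2) (x :: rev p1 ++ Q3).
  move=> p q pin; rewrite inE mem_cat mem_rev => /or3P[/eqP ->|qp|]; last exact: A3.
    by apply: A1 => //; apply: in_split.
  by apply: A1 => //; rewrite mem_cat qp.
have HD : {in rev p1 ++ Q3, forall z, noF fs z}.
  by move=> z; rewrite mem_cat mem_rev => /orP[/H1|/H3].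
have E : size fs + size p1 + size Q3 + size r2 = size fs + size (rev p1 ++ Q3) + size r2.
  by rewrite size_cat size_rev addnA.
rewrite E; case: (eqVneq s1 [::]) V => [s10|s10 _].
  case=> // -[c12 c13]; have c32 : c3 = c2 by case: (c1) (c2) (c3) c12 c13 => [] [] [].
  rewrite c32 addbb; apply/negbTE.
  apply: (round1 ehf ab pf f0 pd py A4 (D2 s10 c13) _ Hx Hy HD H2 _).
    by rewrite c32; case: Fy.
  by case: (c3).
exact: (roundc ehf ab pf f0 pd py A4 (D1 s10) Fy Hx Hy HD H2 fa fb).
Qed.

Lemma last_seen fs Q : uniq Q -> (exists2 z, z \in Q & (z != head z Q) && sees fs z) ->
  exists q y r, [/\ Q = q ++ y :: r, q != [::], sees fs y & {in r, forall z, ~~ sees fs z}].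
Proof.
move=> u2 [z zQ /andP[zh zs]].
have hS : has (sees fs) Q by apply/hasP; exists z.
have [q [y [r [e ys yr]]]] := last_split hS; exists q, y, r; split=> //.
apply: contraNneq zh => q0; move: zQ; rewrite e q0 /= inE => /orP[//|/yr].
by rewrite zs.
Qed.

(** Three rings: [fs] with legs 1 and 2, [fs] with legs 3 and 2, and legs 1 and 3 alone. In their
    sum every length and every letter occurs twice; only the head x, which is counted in the third
    ring, is left over. *)
Lemma tripod_head fs x Q1 Q2 Q3 c1 c2 c3 : loose fs ->
  leg c1 (x :: Q1) -> leg c2 Q2 -> leg c3 Q3 ->
  touch (x :: Q1) Q2 -> touch (x :: Q1) Q3 -> touch Q3 Q2 ->
  atH fs x -> {in Q1, forall z, noF fs z} -> {in Q3, forall z, noF fs z} ->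
  {in Q2, forall z, z != head z Q2 -> onlyL fs z} ->
  (exists2 z, z \in Q2 & (z != head z Q2) && sees fs z) ->
  Q1 != [::] \/ c1 != c2 /\ c1 != c3 -> False.
Proof.
move=> lf L1 L2 L3 T12 T13 T32 Hx H1 H3 O2 S2 V; have [pf f0 fa fb] := lf.
have u2 : uniq Q2 by case: L2 => /ipath_uniq.
have [q2 [y [r2 [e2 q0 ys yr]]]] := last_seen u2 S2.
have Oy w : w \in y :: r2 -> w != head w Q2.
  move=> wy; have -> : head w Q2 = head w q2 by rewrite e2; case: (q2) q0.
  apply/eqP => e; move: u2.
  rewrite e2 cat_uniq => /and3P[_ /hasPn /(_ w wy) /=].
  by rewrite {1}e mem_head_def.
have Hy : atL fs y.
  by apply: onlyL_atL => //; apply: O2; rewrite ?e2 ?in_split // -e2 Oy ?mem_head.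
have Hr : {in r2, forall z, noF fs z}.
  move=> w wr; apply: noF_sees; last exact: yr.
  have [] // : onlyL fs w.
  by apply: O2; rewrite ?Oy ?inE ?wr ?orbT // e2 mem_cat inE wr !orbT.
subst Q2; have [py Fy _] := leg_out L2; have [p1 _ F1] := L1.
have A1 := touch_out L2 (touchC T12) q0.
have R1 := roundc ehf ab pf f0 p1 py A1 F1 Fy Hx Hy H1 Hr fa fb.
have H0 : {in [::], forall z, noF fs z} by [].
have R2 := round_via (p1 := [::]) lf L1 L2 L3 T12 T13 T32 q0 Hx H0 H3 Hy Hr V.
have C := closed_legs L1 L3 T13.
by move: R1 R2 C; clear => /=; lia.
Qed.

Lemma last_split_nil Q p x s : uniq Q -> Q = p ++ x :: s -> (x \in Q -> x = last x Q) -> s = [::].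
Proof.
move=> u e; rewrite e in_split last_cat /= => /(_ isT) xl.
case: s => // y s in e xl *; move: u; rewrite e cat_uniq => /and3P[_ _] /=.
by rewrite {1}xl /= mem_last.
Qed.

(** Let x1, x2 be the first and last seen vertices of leg 1, and y1, y2 those of leg 2. The outer
    ring through x2 and y2, the inner ring through x1 and y1 and the two mixed rings through leg 3
    contain every stretch and every letter twice, and the parity one of the inner ring, which uses
    no letter, remains. In the second alternative each leg is seen at its last vertex only, and the
    ring of legs 1 and 2 takes the place of the mixed rings. *)
Lemma tripod_body fs Q1 Q2 Q3 c1 c2 c3 : loose fs ->
  leg c1 Q1 -> leg c2 Q2 -> leg c3 Q3 ->
  touch Q1 Q2 -> touch Q1 Q3 -> touch Q3 Q2 ->
  {in Q1, forall z, onlyH fs z} -> {in Q2, forall z, onlyL fs z} ->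
  {in Q3, forall z, noF fs z} ->
  (exists2 z, z \in Q1 & (z != head z Q1) && sees fs z) ->
  (exists2 z, z \in Q2 & (z != head z Q2) && sees fs z) ->
  [\/ ((exists2 z, z \in Q1 & (z != last z Q1) && sees fs z) \/ c1 != c2 /\ c1 != c3) /\
      ((exists2 z, z \in Q2 & (z != last z Q2) && sees fs z) \/ c2 != c1 /\ c2 != c3)
    | (forall z, z \in Q1 -> sees fs z -> z = last z Q1) /\
      (forall z, z \in Q2 -> sees fs z -> z = last z Q2)] -> False.
Proof.
move=> lf L1 L2 L3 T12 T13 T32 O1 O2 H3 S1 S2 V; have [pf f0 fa fb] := lf.
have u1 : uniq Q1 by case: L1 => /ipath_uniq.
have u2 : uniq Q2 by case: L2 => /ipath_uniq.
have h1 : has (sees fs) Q1 by case: S1 => z zQ /andP[_ zs]; apply/hasP; exists z.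
have h2 : has (sees fs) Q2 by case: S2 => z zQ /andP[_ zs]; apply/hasP; exists z.
have [q1 [x2 [r1 [e1 q10 x2s r1N]]]] := last_seen u1 S1.
have [q2 [y2 [r2 [e2 q20 y2s r2N]]]] := last_seen u2 S2.
have [p1 [x1 [s1 [d1 x1s p1N]]]] := first_split h1.
have [p2 [y1 [s2 [d2 y1s p2N]]]] := first_split h2.
have N1 s : {subset s <= Q1} -> {in s, forall z, ~~ sees fs z} -> {in s, forall z, noF fs z}.
  by move=> sQ sN z zs; apply: noF_sees (sN z zs); case: (O1 z (sQ z zs)).
have N2 s : {subset s <= Q2} -> {in s, forall z, ~~ sees fs z} -> {in s, forall z, noF fs z}.
  by move=> sQ sN z zs; apply: noF_sees (sN z zs); case: (O2 z (sQ z zs)).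
have Hr1 := N1 r1 _ r1N; have {}Hr1 : {in r1, forall z, noF fs z}.
  by apply: Hr1 => z; rewrite e1 mem_cat inE => ->; rewrite !orbT.
have Hr2 := N2 r2 _ r2N; have {}Hr2 : {in r2, forall z, noF fs z}.
  by apply: Hr2 => z; rewrite e2 mem_cat inE => ->; rewrite !orbT.
have Hp1 := N1 p1 _ p1N; have {}Hp1 : {in p1, forall z, noF fs z}.
  by apply: Hp1 => z; rewrite d1 mem_cat => ->.
have Hp2 := N2 p2 _ p2N; have {}Hp2 : {in p2, forall z, noF fs z}.
  by apply: Hp2 => z; rewrite d2 mem_cat => ->.
have Hx1 : atH fs x1 by apply: onlyH_atH => //; apply: O1; rewrite d1 in_split.
have Hx2 : atH fs x2 by apply: onlyH_atH => //; apply: O1; rewrite e1 in_split.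
have Hy1 : atL fs y1 by apply: onlyL_atL => //; apply: O2; rewrite d2 in_split.
have Hy2 : atL fs y2 by apply: onlyL_atL => //; apply: O2; rewrite e2 in_split.
have C12 := closed_legs L1 L2 T12; have C13 := closed_legs L1 L3 T13.
have C32 := closed_legs L3 L2 T32.
have z1 : size Q1 = (size p1 + size s1).+1 by rewrite d1 size_split.
have z2 : size Q2 = (size p2 + size s2).+1 by rewrite d2 size_split.
have w1 : size Q1 = (size q1 + size r1).+1 by rewrite e1 size_split.
have w2 : size Q2 = (size q2 + size r2).+1 by rewrite e2 size_split.
have Roo : odd (size fs + size r1 + size r2) = c1 (+) c2.
  rewrite e1 in L1 T12; rewrite e2 in L2 T12.
  have [py Fy _] := leg_out L2; have [px Fx _] := leg_out L1.
  have A : apart (y2 :: r2) (x2 :: r1).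
    by apply: touch_out2 L2 L1 (touchC T12) _; rewrite q10 orbT.
  by have := roundc ehf ab pf f0 px py A Fx Fy Hx2 Hy2 Hr1 Hr2 fa fb.
have Rii : odd (size fs + size p1 + size p2).
  have [q1' q2'] : rcons p1 x1 != [::] /\ rcons p2 y1 != [::] by case: (p1); case: (p2).
  have T : touch (rcons p1 x1) (rcons p2 y1).
    apply: (@touch_prefix _ _ s1 _ _ q1'); rewrite cat_rcons -d1.
    apply/touchC; apply: (@touch_prefix _ _ s2 _ _ q2'); rewrite cat_rcons -d2.
    exact: touchC.
  have [P1 P2] : ipath (rcons p1 x1) /\ ipath (rcons p2 y1).
    case: L1 L2 => P1 _ _ [P2 _ _]; rewrite d1 -cat_rcons in P1; rewrite d2 -cat_rcons in P2.
    by case: (ipath_catP P1) (ipath_catP P2) => ? _ _ [].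
  by have := direct ehf ab pf f0 P1 P2 T Hx1 Hy1 Hp1 Hp2.
case: V => [[V1 V2]|[V1 V2]]; last first.
  have s10 := last_split_nil u1 d1 (fun h => V1 x1 h x1s).
  have s20 := last_split_nil u2 d2 (fun h => V2 y1 h y1s).
  have r10 := last_split_nil u1 e1 (fun h => V1 x2 h x2s).
  have r20 := last_split_nil u2 e2 (fun h => V2 y2 h y2s).
  move: Roo Rii C12; rewrite z1 z2 s10 ?s20 ?r10 ?r20 ?d1 ?d2 ?e1 ?e2 ?in_split //=.
  by clear; case: (_ (+) _); lia.
have W1 : s1 != [::] \/ c1 != c2 /\ c1 != c3.
  case: V1 => [[z zQ /andP[zl zs]]|]; [left | by right].
  apply: contraNneq zl => s10; move: zQ; rewrite d1 s10 mem_cat last_cat inE /=.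
  by case/orP=> [/p1N|//]; rewrite zs.
have W2 : s2 != [::] \/ c2 != c1 /\ c2 != c3.
  case: V2 => [[z zQ /andP[zl zs]]|]; [left | by right].
  apply: contraNneq zl => s20; move: zQ; rewrite d2 s20 mem_cat last_cat inE /=.
  by case/orP=> [/p2N|//]; rewrite zs.
have Ra : odd (size fs + size p1 + size Q3 + size r2) = c3 (+) c2.
  rewrite d1 in L1 T12 T13; rewrite e2 in L2 T12 T32.
  by have := round_via lf L1 L2 L3 T12 T13 T32 q20 Hx1 Hp1 H3 Hy2 Hr2 W1.
have Rb : odd (size (rev fs) + size p2 + size Q3 + size r1) = c3 (+) c1.
  have T21 := touchC T12; have T23 := touchC T32; have T31 := touchC T13.
  rewrite e1 in L1 T21 T31; rewrite d2 in L2 T21 T23.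
  have N s : {in s, forall z, noF fs z} -> {in s, forall z, noF (rev fs) z}.
    by move=> H z /H; apply: noF_rev.
  have := round_via (loose_rev lf) L2 L1 L3 T21 T23 T31 q10 (atL_rev Hy1) (N _ Hp2) (N _ H3).
  by move=> /(_ (atH_rev Hx2) (N _ Hr1) W2).
move: Roo Rii Ra Rb; rewrite size_rev !oddD.
move: (odd (size fs)) (odd (size r1)) (odd (size r2)) (odd (size p1)) (odd (size p2)) (odd (size Q3)).
by case: (c1); case: (c2); case: (c3); do 6!case.
Qed.

End Legs.

Section Pendant.
Variables (G : sgraph) (ehf : even_hole_free G) (a b : G).
Hypothesis ab : a -- b.
Implicit Types (x y z f : G) (s t fs E Q P : seq G) (c d e : bool).

Notation full := (full a b).
Notation letter := (letter a b).
Notation leg := (leg a b).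
Notation loose := (loose a b).

(** A vertex that sees all three legs gives one ring for each pair of legs; in the sum all else
    occurs twice, but f occurs three times. Since two legs are seen off their heads, the outer parts
    of any two legs are apart. *)
Lemma tripod_single f Q1 Q2 Q3 c1 c2 c3 : loose [:: f] ->
  leg c1 Q1 -> leg c2 Q2 -> leg c3 Q3 ->
  touch Q1 Q2 -> touch Q1 Q3 -> touch Q3 Q2 ->
  f \notin Q1 -> f \notin Q2 -> f \notin Q3 ->
  (exists2 z, z \in Q1 & (z != head z Q1) && sees [:: f] z) ->
  (exists2 z, z \in Q2 & (z != head z Q2) && sees [:: f] z) ->
  has (sees [:: f]) Q3 -> False.
Proof.
move=> [pf f0 fa fb] L1 L2 L3 T12 T13 T32 n1 n2 n3 S1 S2 h3.
have u1 : uniq Q1 by case: L1 => /ipath_uniq.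
have u2 : uniq Q2 by case: L2 => /ipath_uniq.
have [q1 [x1 [r1 [e1 q10 x1s r1N]]]] := last_seen u1 S1.
have [q2 [x2 [r2 [e2 q20 x2s r2N]]]] := last_seen u2 S2.
have [q3 [x3 [r3 [e3 x3s r3N]]]] := last_split h3.
have N Q q x r : Q = q ++ x :: r -> f \notin Q -> {in r, forall z, ~~ sees [:: f] z} ->
    sees [:: f] x -> [/\ {in r, forall z, noF [:: f] z}, atH [:: f] x & atL [:: f] x].
  move=> e nQ rN xs; have W z : z \in Q -> z \notin [:: f].
    by rewrite inE => zQ; apply: contraNneq nQ => <-.
  have xQ : x \in Q by rewrite e in_split.
  split.
  - move=> z zr; apply: noF_sees (rN z zr); apply: W.
    by rewrite e mem_cat inE zr !orbT.
  - by apply: onlyH_atH => //; split; [exact: W | move=> g; rewrite inE => /eqP].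
  - by apply: onlyL_atL => //; split; [exact: W | move=> g; rewrite inE => /eqP].
have [N1 H1 K1] := N _ _ _ _ e1 n1 r1N x1s.
have [N2 H2 K2] := N _ _ _ _ e2 n2 r2N x2s.
have [N3 H3 K3] := N _ _ _ _ e3 n3 r3N x3s.
have C12 := closed_legs ehf ab L1 L2 T12; have C13 := closed_legs ehf ab L1 L3 T13.
have C32 := closed_legs ehf ab L3 L2 T32.
subst Q1 Q2 Q3.
have [p1 F1 _] := leg_out L1; have [p2 F2 _] := leg_out L2; have [p3 F3 _] := leg_out L3.
have A12 : apart (x2 :: r2) (x1 :: r1) by apply: touch_out2 L2 L1 (touchC T12) _; rewrite q20.
have A13 : apart (x3 :: r3) (x1 :: r1) by apply: touch_out2 L3 L1 (touchC T13) _; rewrite q10 orbT.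
have A32 : apart (x2 :: r2) (x3 :: r3) by apply: touch_out2 L2 L3 (touchC T32) _; rewrite q20.
have R12 := roundc ehf ab pf f0 p1 p2 A12 F1 F2 H1 K2 N1 N2 fa fb.
have R13 := roundc ehf ab pf f0 p1 p3 A13 F1 F3 H1 K3 N1 N3 fa fb.
have R32 := roundc ehf ab pf f0 p3 p2 A32 F3 F2 H3 K2 N3 N2 fa fb.
move: R12 R13 R32; rewrite /= !oddD /=.
move: (odd (size r1)) (odd (size r2)) (odd (size r3)).
by case: (c1); case: (c2); case: (c3); do 3!case.
Qed.

(** * Paths hanging from a *)

Definition pend fs := [/\ ipath fs, fs != [::], capped a fs & free b fs].

Lemma pend_a fs : pend fs -> atL fs a.
Proof.
case=> _ _ C _; split; first by apply/negP => /C; rewrite eqxx => -[].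
by move=> f /C[_]; rewrite edgeC.
Qed.

Lemma pend_b fs : pend fs -> noF fs b.
Proof.
case=> _ _ _ C; split; first by apply/negP => /C; rewrite eqxx => -[].
by move=> f /C[_]; rewrite edgeC.
Qed.

Lemma exit_a fs x E : pend fs -> ipath (x :: E) -> capped a (x :: E) ->
  atH fs x -> {in E, forall z, noF fs z} -> odd (size fs + size E).
Proof.
move=> Pf pE C Hx HE; have [pf f0 _ _] := Pf.
rewrite -(size_rev E); apply: (fring ehf pf f0 _ (pend_a Pf) Hx); last first.
  by move=> z; rewrite mem_rev => /HE.
rewrite -rev_cons; apply: ipath_cons; first exact: ipath_rev.
move=> z w; rewrite inE => /eqP ->; rewrite mem_rev head_rev => wE.
by have [d ->] := C w wE; rewrite eq_sym d /= eqxx.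
Qed.

Lemma exit_b fs x E : pend fs -> ipath (x :: E) -> capped b (x :: E) -> free a (x :: E) ->
  atH fs x -> {in E, forall z, noF fs z} -> ~~ odd (size fs + size E).
Proof.
move=> Pf pE C Fa Hx HE; have [pf f0 _ _] := Pf.
have: odd (size fs + size (b :: rev E)); last by rewrite /= size_rev addnS.
apply: (fring ehf pf f0 _ (pend_a Pf) Hx); last first.
  by move=> z; rewrite inE mem_rev => /orP[/eqP -> |/HE //]; apply: pend_b.
rewrite rcons_cons -rev_cons; apply: ipath_cons.
  apply: ipath_cons; first exact: ipath_rev.
  move=> z w; rewrite inE => /eqP ->; rewrite mem_rev head_rev => wE.
  by have [d ->] := C w wE; rewrite eq_sym d /= eqxx.
move=> z w; rewrite inE => /eqP ->; rewrite inE mem_rev => /orP[/eqP -> | wE] /=.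
  by rewrite ab !eqxx; split=> //; apply: edge_neq.
have [d ->] := Fa w wE; rewrite eq_sym d eqxx /=; split=> //.
by apply/esym/negbTE; case: (C w wE).
Qed.

(** An exit along E to a closes the ring at a; an exit to b uses the edge ab as well, which changes
    the parity. *)
Lemma exit_full fs c x E : pend fs -> ipath (x :: E) -> full c (x :: E) ->
  atH fs x -> {in E, forall z, noF fs z} -> odd (size fs + size E) = c.
Proof.
move=> Pf pE [C F] Hx HE; case: c C F => /= C F; first exact: exit_a C Hx HE.
by apply/negbTE; apply: exit_b C F Hx HE.
Qed.

Lemma pend1 f fs : pend (f :: fs) -> noF [:: f] b.
Proof. by move=> /pend_b; apply: noF1. Qed.

(* A theta between the first vertex of fs and b. *)
Lemma pendant_theta fs x E1 y E2 : pend fs -> ipath (x :: E1) -> ipath (y :: E2) ->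
  apart (y :: E2) (x :: E1) -> full false (x :: E1) -> full false (y :: E2) ->
  atH fs x -> atH fs y -> {in E1, forall z, noF fs z} -> {in E2, forall z, noF fs z} -> False.
Proof.
move=> Pf p1 p2 A F1 F2 Hx Hy N1 N2.
have R1 := exit_full Pf p1 F1 Hx N1; have R2 := exit_full Pf p2 F2 Hy N2.
case: fs => [|f fs] in Pf Hx Hy N1 N2 R1 R2 *; first by case: Pf.
(* The two rings above contain all of [fs] and a; for this one the first vertex of [fs] suffices, as
   it sees both x and y. *)
have R := round1 ehf ab (fs := [:: f]) (c := b) isT isT p1 p2 A (proj1 F1) (proj1 F2) (atH1 Hx) (atH1 Hy).
have {}R : ~~ odd (size [:: f] + size E1 + size E2).
  by apply: R; [move=> z /N1 /noF1 | move=> z /N2 /noF1 | apply: pend1 Pf].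
by move: R1 R2 R; clear => /=; lia.
Qed.

Lemma touch_split q x r q' x' r' : touch (q ++ x :: r) (q' ++ x' :: r') ->
  touch (rcons q x) (rcons q' x').
Proof.
have n (p : seq G) v : rcons p v != [::] by case: p.
rewrite -2!cat_rcons => T; apply: touch_prefix _ (n q x).
apply: touchC; apply: touch_prefix _ (n q' x'); exact: touchC T.
Qed.

Lemma leg_prefix c q x r : leg c (q ++ x :: r) -> ipath (rcons q x).
Proof. by case; rewrite -cat_rcons => /ipath_catP[]. Qed.

(** Three rings: [fs] between legs 1 and 2; [fs] closed through a and b by the detour from x to leg
    3; legs 1 and 3 alone. Their lengths cancel and their constants do not. *)
Lemma pendant_prism fs c2 q1 z p2 x r2 Q3 : pend fs ->
  leg true (q1 ++ [:: z]) -> leg c2 (p2 ++ x :: r2) -> leg false Q3 ->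
  touch (q1 ++ [:: z]) (p2 ++ x :: r2) -> touch (q1 ++ [:: z]) Q3 ->
  touch (p2 ++ x :: r2) Q3 -> r2 != [::] ->
  {in q1, forall w, noF fs w} -> atL fs z -> {in p2, forall w, noF fs w} -> atH fs x ->
  {in Q3, forall w, noF fs w} -> False.
Proof.
move=> Pf L1 L2 L3 T12 T13 T23 r0 N1 Hz N2 Hx N3; have [pf f0 _ _] := Pf.
have [pd _ D _] := detour L2 L3 T23.
have R1 := direct ehf ab pf f0 (leg_prefix L2) (leg_prefix L1) (touch_split (touchC T12)) Hx Hz N2 N1.
have R2 := exit_full Pf pd (D r0) Hx.
have {}R2 : odd (size fs + size (rev p2 ++ Q3)) = false.
  by apply: R2 => w; rewrite mem_cat mem_rev => /orP[/N2|/N3].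
have C := closed_legs ehf ab L1 L3 T13.
by move: R1 R2 C; clear; rewrite !size_cat size_rev /=; lia.
Qed.

(** The first vertex of [fs] sees both x and the head y, so it alone closes a ring with the part of
    leg 1 up to x. This is compared with the exits to b along leg 2 and along the detour from x to
    leg 3, and with the ring of legs 2 and 3. *)
Lemma pendant_star fs p1 x r1 y Q2 Q3 : pend fs ->
  leg true (p1 ++ x :: r1) -> leg false (y :: Q2) -> leg false Q3 ->
  touch (p1 ++ x :: r1) (y :: Q2) -> touch (p1 ++ x :: r1) Q3 -> touch (y :: Q2) Q3 ->
  r1 != [::] -> {in p1, forall w, noF fs w} -> atH fs x -> atH fs y ->
  {in Q2, forall w, noF fs w} -> {in Q3, forall w, noF fs w} -> False.
Proof.
move=> Pf L1 L2 L3 T12 T13 T23 r0 N1 Hx Hy N2 N3.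
have [pd _ D _] := detour L1 L3 T13.
have R1 := exit_full Pf pd (D r0) Hx.
have {}R1 : odd (size fs + size (rev p1 ++ Q3)) = false.
  by apply: R1 => w; rewrite mem_cat mem_rev => /orP[/N1|/N3].
have [p2 _ F2] := L2; have R2 := exit_full Pf p2 F2 Hy N2.
have C := closed_legs ehf ab L2 L3 T23.
case: fs => [|f fs] in Pf N1 Hx Hy N2 N3 R1 R2 *; first by case: Pf.
have R3 := direct ehf ab (fs := [:: f]) (q2 := [::]) isT isT (leg_prefix L1) isT
  (touch_split (q' := [::]) T12) (atH1 Hx) (atH1 Hy).
have {}R3 : odd (size [:: f] + size p1 + 0).
  by apply: R3 => // w /N1 /noF1.
by move: R1 R2 C R3; clear; rewrite !size_cat size_rev /=; lia.
Qed.

(** The ring is [fs] with a, b and x. *)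
Lemma end_even fs x : pend fs -> capped b [:: x] -> free a [:: x] -> atH fs x -> ~~ odd (size fs).
Proof. by move=> Pf C F Hx; have := exit_b (E := [::]) Pf isT C F Hx; rewrite addn0; apply. Qed.

Lemma capped_rev_legs c d Q1 Q2 : leg c Q1 -> leg d Q2 -> c != d ->
  capped (letter d) (rev Q1 ++ Q2).
Proof.
move=> [_ _ [_ F]] [_ q2 [C _]] cd; apply: capped_cat => //.
by move=> z; rewrite mem_rev => /F; have -> : ~~ c = d by case: (c) (d) cd => [] [].
Qed.

(** Dropping at least the first vertex of the joined path removes its only contact with the letter
    of the first leg. *)
Lemma leg_path_suffix c d Q1 Q2 q y r : leg c Q1 -> leg d Q2 -> touch Q1 Q2 ->
  rev Q1 ++ Q2 = q ++ y :: r -> q != [::] -> full d (y :: r).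
Proof.
move=> L1 L2 T e q0; have [p1 n1 F1] := L1; have [p2 n2 F2] := L2.
have lastE w : last w Q2 = last w (y :: r).
  have := congr1 (last w) e; rewrite !last_cat.
  by rewrite (last_def _ w n2) /= => ->.
have uP := ipath_uniq (ipath_touch p1 p2 T).
have sub : {subset y :: r <= rev Q1 ++ Q2} by move=> w; rewrite e [in X in _ -> X]mem_cat orbC => ->.
have key w : w \in y :: r -> w \in Q1 -> free a [:: w] /\ free b [:: w].
  move=> wr w1.
  have nl : w != last w Q1.
    apply/eqP => wl; move: uP; rewrite e cat_uniq => /and3P[_ /hasPn /(_ w wr) /= + _].
    apply/negP; rewrite negbK.
    have hq : head w (rev Q1 ++ Q2) = head w q by rewrite e; case: (q) q0.
    have : head w (rev Q1 ++ Q2) = last w Q1.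
      by rewrite -head_rev; case: (rev Q1) (mem_rev Q1 w) => //; rewrite w1.
    by rewrite hq -wl => <-; apply: mem_head_def.
  case: F1 => C1 F1'; case: (C1 w w1) (F1' w w1) => d1 e1 [d2 e2].
  rewrite (negPf nl) in e1.
  by case: (c) d1 e1 d2 e2 => /= d1 e1 d2 e2; split=> z; rewrite inE => /eqP ->.
split.
- move=> w wr; rewrite -lastE; have := sub w wr; rewrite mem_cat mem_rev => /orP[w1|w2].
    have [Fa Fb] := key w wr w1.
    have nw : (w == last w Q2) = false.
      apply/negbTE/eqP => wl.
      by case: (T w (last w Q2) w1 (mem_last_def w n2)); rewrite -wl eqxx.
    rewrite nw; case: (d) => /=; [exact: Fa (mem_head _ _) | exact: Fb (mem_head _ _)].
  by case: F2 => C2 _; apply: C2.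
- move=> w wr; have := sub w wr; rewrite mem_cat mem_rev => /orP[w1|w2].
    have [Fa Fb] := key w wr w1.
    case: (d) => /=; [exact: Fb (mem_head _ _) | exact: Fa (mem_head _ _)].
  by case: F2 => _; apply.
Qed.

Lemma rev_legs Q1 Q2 : rev (rev Q1 ++ Q2) = rev Q2 ++ Q1.
Proof. by rewrite rev_cat revK. Qed.

(** The immediate exit from x to b makes the length of [fs] even; the exit along the whole path to a
    makes it odd. *)
Lemma single_head fs Q1 Q2 x s : pend fs -> leg false Q1 -> leg true Q2 -> touch Q1 Q2 ->
  rev Q1 ++ Q2 = x :: s -> atH fs x -> {in s, forall z, noF fs z} -> False.
Proof.
move=> Pf L1 L2 T e Hx Hs; have [p1 n1 F1] := L1; have [p2 n2 F2] := L2.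
have C := closed_legs ehf ab L1 L2 T.
have s0 : s != [::].
  have : size (rev Q1 ++ Q2) = (size s).+1 by rewrite e.
  by rewrite size_cat size_rev; case: (Q1) n1 => // ? ? _; case: (Q2) n2 => //= ? ? _; case: (s) => //; rewrite addnS.
have Fx : full false [:: x].
  have e' : rev Q2 ++ Q1 = rev s ++ [:: x] by rewrite -rev_legs e rev_cons cats1.
  apply: leg_path_suffix L2 L1 (touchC T) e' _.
  by rewrite -size_eq0 size_rev size_eq0.
have R1 := exit_full (E := [::]) Pf isT Fx Hx.
have Cx : capped a (x :: s) by rewrite -e; apply: (capped_rev_legs L1 L2).
have pP : ipath (x :: s) by rewrite -e; apply: ipath_touch.
have R2 := exit_a Pf pP Cx Hx Hs.
have : size Q1 + size Q2 = (size s).+1 by rewrite -(size_rev Q1) -size_cat e.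
rewrite addn0 in R1; have {}R1 : odd (size fs) = false by apply: R1.
by move: C R2 R1; clear => /=; lia.
Qed.

End Pendant.

Section PendantPath.
Variables (G : sgraph) (ehf : even_hole_free G) (a b : G).
Hypothesis ab : a -- b.
Implicit Types (x y z f : G) (s t fs E Q P : seq G) (c d e : bool).

Notation leg := (leg a b).
Notation loose := (loose a b).
Notation pend := (pend a b).

Lemma ipath_apart p x m y r : ipath (p ++ x :: m ++ y :: r) -> m != [::] ->
  apart (y :: r) (x :: rev p).
Proof.
move=> pP m0; rewrite -cat_rcons in pP; have u := ipath_uniq pP.
have [_ _ L] := ipath_catP pP.
apply: apartC => z w; rewrite inE mem_rev -[(z == x) || _]/(z \in x :: p) -(mem_rcons p x).
move=> zp wr; have [|-> ->] := L z w zp; first by rewrite mem_cat wr orbT.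
split=> //; apply/negbTE; rewrite negb_and; apply/orP; right.
have -> : head w (m ++ y :: r) = head w m by case: (m) m0.
move: u; rewrite cat_uniq cat_uniq => /and3P[_ _ /and3P[_ /hasPn /(_ w wr) /= wm _]].
by apply: contraNneq wm => ->; apply: mem_head_def.
Qed.

Lemma cat_eq_lt s t p x m q y r : p ++ x :: m = q ++ y :: r -> size p < size q ->
  exists m', q = p ++ x :: m' /\ m = m' ++ y :: r.
Proof.
elim: p q => [|z p IH] [|w q] //=.
  by case=> -> -> _; exists q.
by case=> -> /IH H /H[m' [-> ->]]; exists m'.
Qed.

(** The exits from the first seen vertex x and the last seen vertex y fix the parities of the two
    outer parts. Hence a single seen vertex is an end of the path, and [single_head] gives the
    conditions on the letters. If x and y are distinct and not consecutive, the first vertex of [fs]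
    alone closes a ring of wrong parity through the outer parts, provided that both parts leave to b
    or that this vertex is not adjacent to a. The last outcome is what escapes. *)
Lemma pendant_path fs c d Q1 Q2 : pend fs -> leg c Q1 -> leg d Q2 -> touch Q1 Q2 ->
  {in rev Q1 ++ Q2, forall z, onlyH fs z} -> has (sees fs) (rev Q1 ++ Q2) ->
  [\/ exists p x y r, rev Q1 ++ Q2 = p ++ [:: x, y & r] /\
        {in rev Q1 ++ Q2, forall z, sees fs z = (z == x) || (z == y)},
      c || ~~ d /\ {in rev Q1 ++ Q2, forall z, sees fs z = (z == head z (rev Q1 ++ Q2))},
      d || ~~ c /\ {in rev Q1 ++ Q2, forall z, sees fs z = (z == last z (rev Q1 ++ Q2))}
    | [/\ c || d, size fs = 1 &
        exists x y, [/\ x \in rev Q1 ++ Q2, y \in rev Q1 ++ Q2, x != y, sees fs x & sees fs y]]].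
Proof.
move=> Pf L1 L2 T O h; have [pf f0 Cf Ff] := Pf.
have C := closed_legs ehf ab L1 L2 T.
have pP : ipath (rev Q1 ++ Q2) by case: L1 L2 => ? _ _ [? _ _]; apply: ipath_touch.
have uP := ipath_uniq pP.
have szP : size (rev Q1 ++ Q2) = size Q1 + size Q2 by rewrite size_cat size_rev.
have [p [x [s [e1 xs pN]]]] := first_split h.
have [q [y [r [e2 ys rN]]]] := last_split h.
have N t : {subset t <= rev Q1 ++ Q2} -> {in t, forall z, ~~ sees fs z} ->
    {in t, forall z, noF fs z}.
  by move=> tP tN z zt; apply: noF_sees (tN z zt); case: (O z (tP z zt)).
have xP : x \in rev Q1 ++ Q2 by rewrite e1 in_split.
have yP : y \in rev Q1 ++ Q2 by rewrite e2 in_split.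
have Hx : atH fs x by apply: onlyH_atH => //; apply: O.
have Hy : atH fs y by apply: onlyH_atH => //; apply: O.
have Hp : {in p, forall z, noF fs z} by apply: N => // z zp; rewrite e1 mem_cat zp.
have Hr : {in r, forall z, noF fs z}.
  by apply: N => // z zr; rewrite e2 mem_cat inE zr !orbT.
have eR : rev Q2 ++ Q1 = rev s ++ x :: rev p by rewrite -rev_legs e1 rev_cat rev_cons cat_rcons.
have HpR : {in rev p, forall z, noF fs z} by move=> z; rewrite mem_rev; apply: Hp.
have [s0|s0] := eqVneq s [::].
  apply: Or43; split; last first.
    move=> z zP; rewrite e1 s0 last_cat /=.
    move: zP; rewrite e1 s0 mem_cat inE => /orP[zp|/eqP ->]; last by rewrite xs eqxx.
    rewrite (negbTE (pN z zp)); apply/esym/negbTE; apply: contraNneq (pN z zp) => ->.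
    by rewrite xs.
  apply: contraT; rewrite negb_or negbK => /andP[/negbTE d0 c1]; exfalso.
  rewrite d0 in L2; rewrite c1 in L1; rewrite s0 in eR.
  exact: (single_head ehf ab Pf L2 L1 (touchC T) eR Hx HpR).
have [q0|q0] := eqVneq q [::].
  apply: Or42; split; last first.
    move=> z zP; rewrite e2 q0 /=.
    move: zP; rewrite e2 q0 inE => /orP[/eqP ->|zr]; first by rewrite ys eqxx.
    rewrite (negbTE (rN z zr)); apply/esym/negbTE; apply: contraNneq (rN z zr) => ->.
    by rewrite ys.
  apply: contraT; rewrite negb_or negbK => /andP[/negbTE c0 d1]; exfalso.
  rewrite d1 in L2; rewrite c0 in L1; rewrite q0 in e2.
  exact: (single_head ehf ab Pf L1 L2 T e2 Hy Hr).
have pE1 : ipath (x :: rev p).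
  have := ipath_rev pP; rewrite e1 rev_cat rev_cons cat_rcons.
  by case/ipath_catP.
have pE2 : ipath (y :: r) by move: pP; rewrite e2 => /ipath_catP[].
have s0' : rev s != [::] by rewrite -size_eq0 size_rev size_eq0.
have F1 := leg_path_suffix L2 L1 (touchC T) eR s0'.
have F2 := leg_path_suffix L1 L2 T e2 q0.
have R1 := exit_full ehf ab Pf pE1 F1 Hx HpR; rewrite size_rev in R1.
have R2 := exit_full ehf ab Pf pE2 F2 Hy Hr.
have Z1 : size Q1 + size Q2 = (size p + size s).+1 by rewrite -szP e1 size_split.
have Z2 : size Q1 + size Q2 = (size q + size r).+1 by rewrite -szP e2 size_split.
(* Equality would mean one seen vertex inside the path; the exits on its two sides then give the
   whole path the wrong parity. *)
have lt : size p < size q.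
  rewrite ltnNge leq_eqVlt; apply/negP => /orP[/eqP e|lt].
    move: R1 R2 C; rewrite Z1 /= -e; move: Z2; rewrite Z1 -e; clear.
    by case=> /addnI ->; case: c; case: d => /=; lia.
  have [m' [e3 e4]] := cat_eq_lt [::] [::] (etrans (esym e2) e1) lt.
  by move: (rN x); rewrite e4 in_split xs => /(_ isT).
have [m' [e3 e4]] := cat_eq_lt [::] [::] (etrans (esym e1) e2) lt.
have [m0|m0] := eqVneq m' [::].
  apply: Or41; exists p, x, y, r; rewrite {1}e1 e4 m0; split=> // z zP.
  move: zP; rewrite e1 e4 m0 mem_cat !inE => /or4P[zp|/eqP ->|/eqP ->|zr].
  - rewrite (negbTE (pN z zp)); apply/esym/negbTE; rewrite negb_or.
    by apply/andP; split; apply: contraNneq (pN z zp) => ->; rewrite ?xs ?ys.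
  - by rewrite xs eqxx.
  - by rewrite ys eqxx orbT.
  - rewrite (negbTE (rN z zr)); apply/esym/negbTE; rewrite negb_or.
    by apply/andP; split; apply: contraNneq (rN z zr) => ->; rewrite ?xs ?ys.
have pm : ipath (p ++ x :: m' ++ y :: r) by rewrite -e4 -e1.
have A := ipath_apart pm m0.
have xy : x != y.
  have := ipath_uniq pm; rewrite cat_uniq => /and3P[_ _] /= /andP[+ _].
  by rewrite mem_cat inE => /norP[_ /norP[]].
have [/andP[cd /eqP sz]|H] := boolP ((c || d) && (size fs == 1)).
  by apply: Or44; split=> //; exists x, y; split.
(* From here on rings use only the first vertex f of [fs], which sees both x and y. *)
exfalso; case: fs => [|f fs] in Pf O h xs pN ys rN pf f0 Cf Ff N Hx Hy Hp Hr HpR R1 R2 H *; first by [].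
have fb : noF [:: f] b := pend1 Pf.
have H1 : {in rev p, forall z, noF [:: f] z} by move=> z /HpR /noF1.
have H2 : {in r, forall z, noF [:: f] z} by move=> z /Hr /noF1.
have pf1 : ipath [:: f] by [].
move: H; rewrite negb_and negb_or => /orP[/andP[/negbTE c0 /negbTE d0]|k1].
  rewrite c0 in F1 R1; rewrite d0 in F2 R2; case: F1 F2 => [C1 _] [C2 _].
  have := round1 ehf ab pf1 isT pE1 pE2 A C1 C2 (atH1 Hx) (atH1 Hy) H1 H2 fb.
  by move: R1 R2; rewrite size_rev; clear => /=; lia.
have fa : noF [:: f] a.
  have [fl e] := Cf f (mem_head _ _); split; first by rewrite inE eq_sym.
  move=> g; rewrite inE => /eqP ->; rewrite edgeC e.
  case: fs pf k1 {e fl Pf O h xs pN ys rN f0 Cf Ff N Hx Hy Hp Hr HpR R1 R2} => // g' fs pf _.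
  apply/negbTE; apply: contraTneq (ipath_uniq pf) => /= ->.
  by rewrite mem_last.
have := roundc ehf ab pf1 isT pE1 pE2 A F1 F2 (atH1 Hx) (atH1 Hy) H1 H2 fa fb.
move: R1 R2; rewrite size_rev; clear => /=; rewrite !oddD /=.
by case: c; case: d; do 3!case: (odd _).
Qed.

(** Legs 1 and 3 start at one vertex of J, legs 5 and 4 at another. Both ends of [fs] are led to b
    by detours. Since the ring avoids a, the vertices x and y may be last vertices of legs labelled
    a. *)
Lemma double_round fs q1 x r1 Q3 q5 y r5 Q4 c d : ipath fs -> fs != [::] -> noF fs b ->
  leg c (q1 ++ x :: r1) -> leg false Q3 -> leg d (q5 ++ y :: r5) -> leg false Q4 ->
  touch (q1 ++ x :: r1) Q3 -> touch (q5 ++ y :: r5) Q4 ->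
  apart (q1 ++ x :: r1) (q5 ++ y :: r5) -> apart (q1 ++ x :: r1) Q4 ->
  apart Q3 (q5 ++ y :: r5) -> apart Q3 Q4 ->
  (r1 != [::] \/ c) -> (r5 != [::] \/ d) ->
  atH fs x -> atL fs y -> {in q1, forall z, noF fs z} -> {in q5, forall z, noF fs z} ->
  {in Q3, forall z, noF fs z} -> {in Q4, forall z, noF fs z} ->
  ~~ odd (size fs + size q1 + size Q3 + size q5 + size Q4).
Proof.
move=> pf f0 fb L1 L3 L5 L4 T13 T54 A15 A14 A35 A34 V1 V5 Hx Hy N1 N5 N3 N4.
have [p1 _ D1 D1'] := detour L1 L3 T13; have [p5 _ D5 D5'] := detour L5 L4 T54.
have C1 : capped b (x :: rev q1 ++ Q3).
  have [r0|r0] := eqVneq r1 [::]; last by case: (D1 r0).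
  by apply: D1' => //; case: V1 => [|->] //; rewrite r0.
have C5 : capped b (y :: rev q5 ++ Q4).
  have [r0|r0] := eqVneq r5 [::]; last by case: (D5 r0).
  by apply: D5' => //; case: V5 => [|->] //; rewrite r0.
have A : apart (y :: rev q5 ++ Q4) (x :: rev q1 ++ Q3).
  apply: apartC => z w; rewrite inE mem_cat mem_rev => zi; rewrite inE mem_cat mem_rev => wi.
  case: (boolP (z \in Q3)) zi => [z3 _|z3 zi].
    case: (boolP (w \in Q4)) wi => [w4 _|w4 wi]; first exact: A34.
    by apply: A35 => //; rewrite mem_cat inE; case/or3P: wi => [->|->|//]; rewrite ?orbT.
  have z1 : z \in q1 ++ x :: r1.
    by rewrite mem_cat inE; case/or3P: zi => [->|->|//]; rewrite ?orbT.
  case: (boolP (w \in Q4)) wi => [w4 _|w4 wi]; first exact: A14.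
  by apply: A15 => //; rewrite mem_cat inE; case/or3P: wi => [->|->|//]; rewrite ?orbT.
have N13 : {in rev q1 ++ Q3, forall z, noF fs z}.
  by move=> z; rewrite mem_cat mem_rev => /orP[/N1|/N3].
have N54 : {in rev q5 ++ Q4, forall z, noF fs z}.
  by move=> z; rewrite mem_cat mem_rev => /orP[/N5|/N4].
have := round1 ehf ab pf f0 p1 p5 A C1 C5 Hx Hy N13 N54 fb.
by rewrite !size_cat !size_rev !addnA.
Qed.

(** The ring that goes from x straight to a differs from the one in [double_round] by legs 1 and 3,
    whose total parity is known. *)
Lemma double_loose fs q1 x Q3 q5 y r5 Q4 : loose fs ->
  leg true (q1 ++ [:: x]) -> leg false Q3 -> leg true (q5 ++ y :: r5) -> leg false Q4 ->
  touch (q1 ++ [:: x]) Q3 -> touch (q5 ++ y :: r5) Q4 ->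
  apart (q1 ++ [:: x]) (q5 ++ y :: r5) -> apart (q1 ++ [:: x]) Q4 ->
  apart Q3 (q5 ++ y :: r5) -> apart Q3 Q4 -> r5 != [::] ->
  atH fs x -> atL fs y -> {in q1, forall z, noF fs z} -> {in q5, forall z, noF fs z} ->
  {in Q3, forall z, noF fs z} -> {in Q4, forall z, noF fs z} -> False.
Proof.
move=> lf L1 L3 L5 L4 T13 T54 A15 A14 A35 A34 r0 Hx Hy N1 N5 N3 N4; have [pf f0 fa fb] := lf.
have R1 := double_round pf f0 fb L1 L3 L5 L4 T13 T54 A15 A14 A35 A34 (or_intror isT)
  (or_introl r0) Hx Hy N1 N5 N3 N4.
have [p5 _ D5 _] := detour L5 L4 T54.
have [px Fx _] := leg_out L1.
have A : apart (y :: rev q5 ++ Q4) [:: x].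
  apply: apartC => z w; rewrite inE => /eqP ->; have xi := in_split q1 x [::].
  rewrite inE mem_cat mem_rev => /or3P[/eqP ->|wi|wi].
  - by apply: A15; rewrite ?in_split.
  - by apply: A15 => //; rewrite mem_cat wi.
  - exact: A14.
have N54 : {in rev q5 ++ Q4, forall z, noF fs z}.
  by move=> z; rewrite mem_cat mem_rev => /orP[/N5|/N4].
have R2 := roundc ehf ab pf f0 px p5 A Fx (D5 r0) Hx Hy _ N54 fa fb.
have {}R2 : odd (size fs + size (Nil G) + size (rev q5 ++ Q4)) = true (+) false by apply: R2.
have C := closed_legs ehf ab L1 L3 T13.
by move: R1 R2 C; clear; rewrite !size_cat size_rev /=; lia.
Qed.

(** Legs 2 and 5 reach the same vertex y from the two vertices of J. The ring of [fs] with legs 1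
    and 2 makes [fs] odd, while [double_round] makes it even. *)
Lemma double_pendant fs q1 x q2 y Q3 q5 Q4 : ipath fs -> fs != [::] -> noF fs b ->
  leg true (q1 ++ [:: x]) -> leg true (q2 ++ [:: y]) -> leg false Q3 ->
  leg true (q5 ++ [:: y]) -> leg false Q4 ->
  touch (q1 ++ [:: x]) (q2 ++ [:: y]) ->
  touch (q1 ++ [:: x]) Q3 -> touch (q5 ++ [:: y]) Q4 ->
  apart (q1 ++ [:: x]) (q5 ++ [:: y]) -> apart (q1 ++ [:: x]) Q4 ->
  apart Q3 (q5 ++ [:: y]) -> apart Q3 Q4 ->
  atH fs x -> atL fs y -> {in q1, forall z, noF fs z} -> {in q2, forall z, noF fs z} ->
  {in q5, forall z, noF fs z} ->
  {in Q3, forall z, noF fs z} -> {in Q4, forall z, noF fs z} -> False.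
Proof.
move=> pf f0 fb L1 L2 L3 L5 L4 T12 T13 T54 A15 A14 A35 A34 Hx Hy N1 N2 N5 N3 N4.
have R1 := double_round pf f0 fb L1 L3 L5 L4 T13 T54 A15 A14 A35 A34 (or_intror isT)
  (or_intror isT) Hx Hy N1 N5 N3 N4.
have R2 := direct ehf ab pf f0 (leg_prefix L1) (leg_prefix L2) (touch_split T12) Hx Hy N1 N2.
have C13 := closed_legs ehf ab L1 L3 T13; have C12 := closed_legs ehf ab L1 L2 T12.
have C54 := closed_legs ehf ab L5 L4 T54.
by move: R1 R2 C13 C12 C54; clear; rewrite !size_cat /=; lia.
Qed.

End PendantPath.

(** * Directions, rungs and arms of a strip system *)

Lemma set2_eq (T : finType) (r s r' s' : T) : [set r; s] = [set r'; s'] ->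
  r = r' /\ s = s' \/ r = s' /\ s = r'.
Proof.
move=> e; have h1 : r \in [set r'; s'] by rewrite -e set21.
have h2 : s \in [set r'; s'] by rewrite -e set22.
have h3 : r' \in [set r; s] by rewrite e set21.
have h4 : s' \in [set r; s] by rewrite e set22.
by case/set2P: h1 => h1; case/set2P: h2 => h2; case/set2P: h3 => h3;
  case/set2P: h4 => h4; subst; auto.
Qed.

Section TreeSides.
Variable J : sgraph.
Hypothesis treeJ : is_tree J.
Implicit Types (p q r s t u v w : J).

(** For an edge pq, the component of J minus p that contains q. *)
Definition side p q : {set J} := [set r | connect (restr_edge [set~ p]) q r].

Lemma restr_edge_sym (S : {set J}) : symmetric (restr_edge S).
Proof. by move=> x y; rewrite /restr_edge /= edgeC andbCA. Qed.

Lemma side_refl p q : q \in side p q.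
Proof. by rewrite inE connect0. Qed.

Lemma side_notin p q : p -- q -> p \notin side p q.
Proof.
move=> pq; rewrite inE; apply/negP => /connectP[c]; elim/last_ind: c => [|c z _] /=.
  by move=> _ e; move: pq; rewrite e edgexx.
rewrite rcons_path last_rcons => /andP[_ /and3P[_ z1 _]] e.
by move: z1; rewrite -e !inE eqxx.
Qed.

Lemma side_neq p q r : p -- q -> r \in side p q -> r != p.
Proof. by move=> pq; apply: contraTneq => ->; apply: side_notin. Qed.

Lemma side_step p q r s : p -- q -> r \in side p q -> r -- s -> s != p -> s \in side p q.
Proof.
move=> pq rs e sp; have rp := side_neq pq rs; move: rs; rewrite !inE => /connect_trans; apply.
by apply: connect1; rewrite /restr_edge /= !inE rp sp.
Qed.

Lemma restr_path (S : {set J}) x c : path (restr_edge S) x c -> path (@sedge J) x c.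
Proof. by apply: sub_path => y z /and3P[]. Qed.

(** A path from q to q' avoiding p would close to a cycle through p. *)
Lemma side_disj p q q' r : p -- q -> p -- q' -> r \in side p q -> r \in side p q' -> q = q'.
Proof.
move=> pq pq'; rewrite !inE => c1.
rewrite (sym_connect_sym (restr_edge_sym _)) => /(connect_trans c1) {c1}/connectP[c pc e].
subst q'; case/shortenP: pc pq' => c' pc' uc' _ pq'; case: c' => // z c' in pc' uc' pq' *; exfalso.
have pn : p \notin q :: z :: c'.
  apply/negP => pin; have: p \in side p q.
    move: pin; rewrite inE => /orP[/eqP e|]; first by move: pq; rewrite -e edgexx.
    move=> pin; rewrite inE; case/splitPr: pin pc' => c1 c2; rewrite cat_path /=.
    case/and3P=> h1 h2 _; apply: connect_trans (connect1 h2); apply/connectP; by exists c1.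
  by apply/negP; apply: side_notin.
have [_ _ /(_ (p :: q :: z :: c') isT)] := treeJ; apply; apply/andP; split; last by rewrite /= pn.
by rewrite /cycle rcons_path [path _ p _]/= pq -[_ && path _ z c']/(path _ q (z :: c')) (restr_path pc') edgeC.
Qed.

Lemma side_path p q c : p -- q -> path (@sedge J) q c -> p \notin q :: c -> {subset q :: c <= side p q}.
Proof.
move=> pq; elim/last_ind: c => [|c z IH] /=.
  by move=> _ _ r; rewrite inE => /eqP ->; apply: side_refl.
rewrite rcons_path -rcons_cons mem_rcons inE negb_or => /andP[h1 h2] /andP[pz pn] r.
rewrite mem_rcons inE => /orP[/eqP ->|]; last exact: IH.
by apply: side_step h2 _ => //; [apply: IH => //; apply: mem_last | rewrite eq_sym].
Qed.

Lemma side_cover p r : r != p -> exists2 q, p -- q & r \in side p q.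
Proof.
move=> rp; have [_ /(_ p r (in_setT _) (in_setT _)) /connectP[c pc e] _] := treeJ.
subst r; case/shortenP: pc rp => c' /restr_path pc' uc' _; case: c' pc' uc' => [|q c'].
  by rewrite eqxx.
move=> /= /andP[pq pc'] /andP[pn _] _; exists q => //.
by apply: (side_path pq pc' pn); apply: mem_last.
Qed.

Lemma side_sub p q q' : p -- q -> p -- q' -> q != q' -> {subset side p q' <= side q p}.
Proof.
move=> pq pq' qq' r; rewrite [in X in X -> _]inE => /connectP[c pc ->].
have pn : p \notin q' :: c.
  apply/negP => pin; have: p \in side p q'.
    move: pin; rewrite inE => /orP[/eqP e|]; first by move: pq'; rewrite -e edgexx.
    move=> pin; rewrite inE; case/splitPr: pin pc => c1 c2; rewrite cat_path /=.
    case/and3P=> h1 h2 _; apply: connect_trans (connect1 h2); apply/connectP; by exists c1.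
  by apply/negP; apply: side_notin.
have sub := side_path pq' (restr_path pc) pn.
have qp : q -- p by rewrite edgeC.
have /(side_path qp) H : path (@sedge J) p (q' :: c) by rewrite /= pq' (restr_path pc).
apply: H; last by rewrite inE mem_last orbT.
rewrite inE negb_or eq_sym (edge_neq pq) /=; apply/negP => /sub qs.
by move: qq'; rewrite (side_disj pq pq' (side_refl _ _) qs) eqxx.
Qed.

Lemma side_split p q r : p -- q -> (r \in side p q) || (r \in side q p).
Proof.
move=> pq; have [->|rp] := eqVneq r p; first by rewrite side_refl orbT.
have [q' pq' rq] := side_cover rp; have [->|qq'] := eqVneq q q'; first by rewrite rq.
by rewrite (side_sub pq pq' qq' rq) orbT.
Qed.

Lemma side_excl p q r : p -- q -> r \in side p q -> r \notin side q p.
Proof.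
move=> pq rp; apply/negP => rq; have qp : q -- p by rewrite edgeC.
move: rq; rewrite inE => /connectP[c pc e]; subst r.
case/shortenP: pc rp => c' pc' uc' _; case: c' pc' uc' => [|q' c'].
  by move=> _ _; apply/negP; apply: side_notin.
move=> /= /andP[/and3P[_ nq pq'] pc'] /andP[pn _] h.
have := side_path pq' (restr_path pc') pn (mem_last _ _).
by move/(side_disj pq pq' h) => e; move: nq; rewrite -e !inE eqxx.
Qed.

Lemma side_proper p q r : p -- q -> q -- r -> r != p -> side q r \proper side p q.
Proof.
move=> pq qr rp; have qp : q -- p by rewrite edgeC.
apply/properP; split; first by apply/subsetP => u; apply: side_sub => //; rewrite eq_sym.
by exists q; [apply: side_refl | apply: side_notin].
Qed.

(** The vertices s and s' face each other along [sg] and [sg']. As s lies in the component at [sg'],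
    the component at w' avoids s and can be walked through inside [side s sg]. *)
Lemma side_far s sg s' w' sg' : s -- sg -> s' \in side s sg -> s' -- sg' -> s \in side s' sg' ->
  s' -- w' -> w' != sg' -> {subset side s' w' <= side s sg}.
Proof.
move=> e1 h1 e2 h2 e3 ne r; rewrite [in X in X -> _]inE => /connectP[c pc ->].
have pn : s \notin side s' w'.
  apply/negP => h; by move: ne; rewrite (side_disj e2 e3 h2 h) eqxx.
have cs : {subset w' :: c <= side s' w'}.
  apply: side_path (restr_path pc) _ => //; apply/negP => pin.
  have: s' \in side s' w'.
    move: pin; rewrite inE => /orP[/eqP e|]; first by move: e3; rewrite -e edgexx.
    move=> pin; rewrite inE; case/splitPr: pin pc => c1 c2; rewrite cat_path /=.
    case/and3P=> g1 g2 _; apply: connect_trans (connect1 g2); apply/connectP; by exists c1.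
  by apply/negP; apply: side_notin.
have w's : w' \in side s sg.
  by apply: side_step h1 e3 _ => //; apply: contraNneq pn => <-; apply: side_refl.
elim/last_ind: c pc cs => [|c z IH] //=.
rewrite rcons_path last_rcons => /andP[h3 /and3P[_ _ h4]] cs.
apply: side_step h4 _ => //.
  by apply: IH => // u uc; apply: cs; rewrite -rcons_cons mem_rcons inE uc orbT.
by apply: contraNneq pn => <-; apply: cs; rewrite -rcons_cons mem_rcons inE eqxx.
Qed.

End TreeSides.

Section Strips.
Variables (J G : sgraph) (M : strip_family J G).
Hypothesis SM : is_strip_system M.
Implicit Types (p q r s t u v w : J) (x y z : G) (Q R : seq G).

Notation Mv := (Mv M).
Notation Mvv u v := (Me M [set u; v]).

Let treeJ : is_tree J. Proof. by case: SM => -[]. Qed.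

Lemma edge_in u v : u -- v -> [set u; v] \in edges J.
Proof. by move=> e; rewrite inE; apply/existsP; exists u; apply/existsP; exists v; rewrite e eqxx. Qed.

Lemma edgesP (e : {set J}) : reflect (exists u v, u -- v /\ e = [set u; v]) (e \in edges J).
Proof.
rewrite inE; apply: (iffP existsP) => [[u /existsP[v /andP[uv /eqP ->]]]|[u [v [uv ->]]]].
  by exists u, v.
by exists u; apply/existsP; exists v; rewrite uv eqxx.
Qed.

Lemma MvvC u v : Mvv u v = Mvv v u. Proof. by rewrite setUC. Qed.

Lemma VMP x : reflect (exists u v, u -- v /\ x \in Mvv u v) (x \in VM M).
Proof.
apply: (iffP bigcupP) => [[e /edgesP[u [v [uv ->]]] xe]|[u [v [uv xe]]]]; first by exists u, v.
by exists [set u; v] => //; apply: edge_in.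
Qed.

Lemma strip_eq u v u' v' x : u -- v -> u' -- v' -> x \in Mvv u v -> x \in Mvv u' v' ->
  u = u' /\ v = v' \/ u = v' /\ v = u'.
Proof.
move=> e e' h h'; apply: set2_eq; apply/eqP; apply: contraT => ne.
case: SM => _ /(_ _ _ (edge_in e) (edge_in e') ne) /pred0P /(_ x) /=.
by rewrite h h'.
Qed.

Lemma Mv_strip u x : x \in Mv u -> exists2 v, u -- v & x \in Mvv u v.
Proof.
move=> xu; case: SM => _ _ /(_ u) /subsetP /(_ x xu) /bigcupP[v uv xv] _ _.
by exists v.
Qed.

Lemma Mv_VM u x : x \in Mv u -> x \in VM M.
Proof. by case/Mv_strip => v uv xv; apply/VMP; exists u, v. Qed.

Lemma Mv_ends u v w x : u -- v -> x \in Mvv u v -> x \in Mv w -> w = u \/ w = v.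
Proof.
move=> uv xe /Mv_strip[w' ww' xw]; case: (strip_eq ww' uv xw xe) => -[-> _]; auto.
Qed.

(** All strips on the q side of p, the strip pq included: the end s of each edge lies in the
    component of q, while r may be p. *)
Definition dir p q : {set G} :=
  [set x | [exists r, exists s, [&& r -- s, s \in side p q & x \in Mvv r s]]].

Lemma dirP p q x : reflect (exists r s, [/\ r -- s, s \in side p q & x \in Mvv r s]) (x \in dir p q).
Proof.
rewrite inE; apply: (iffP existsP) => [[r /existsP[s /and3P[? ? ?]]]|[r [s [? ? ?]]]].
  by exists r, s.
by exists r; apply/existsP; exists s; apply/and3P.
Qed.

Lemma dir_edge p q r s x : p -- q -> r -- s -> x \in Mvv r s -> x \in dir p q ->
  r = p /\ s = q \/ s = p /\ r = q \/ r \in side p q /\ s \in side p q.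
Proof.
move=> pq rs xe /dirP[r' [s' [rs' sd xe']]].
have H : forall r s, r -- s -> s \in side p q -> r = p /\ s = q \/ r \in side p q /\ s \in side p q.
  move=> r1 s1 e1 h1; have [e|ne] := eqVneq r1 p.
    left; split=> //; subst r1; exact: (side_disj treeJ e1 pq (side_refl _ _) h1).
  by right; split=> //; apply: side_step h1 _ ne => //; rewrite edgeC.
have h := H _ _ rs' sd.
by case: (strip_eq rs rs' xe xe') => -[e1 e2]; rewrite e1 e2; case: h => -[h1 h2]; auto.
Qed.

Lemma strip_dir p q x : p -- q -> x \in Mvv p q -> x \in dir p q.
Proof. by move=> pq xe; apply/dirP; exists p, q; split=> //; apply: side_refl. Qed.

Lemma VM_dir p x : x \in VM M -> exists2 q, p -- q & x \in dir p q.
Proof.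
case/VMP => r [s [rs xe]]; have [e|ne] := eqVneq r p.
  by subst r; exists s => //; apply: strip_dir.
have [q pq h] := side_cover treeJ ne; exists q => //.
by apply/dirP; exists s, r; rewrite edgeC MvvC.
Qed.

Lemma dir_VM p q x : x \in dir p q -> x \in VM M.
Proof. by case/dirP => r [s [? _ ?]]; apply/VMP; exists r, s. Qed.

Lemma dir_inj p q q' x : p -- q -> p -- q' -> x \in dir p q -> x \in dir p q' -> q = q'.
Proof.
move=> pq pq' /dirP[r [s [rs h xe]]] h'.
have sp := side_neq pq h; case: (dir_edge pq' rs xe h') => [[e1 e2]|[[e _]|[_ h2]]].
- by subst r s; apply: (side_disj treeJ pq pq' h (side_refl _ _)).
- by rewrite e eqxx in sp.
- exact: (side_disj treeJ pq pq' h h2).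
Qed.

Lemma dir_head p q x : p -- q -> x \in dir p q -> x \in Mv p -> x \in Mvv p q.
Proof.
move=> pq h /Mv_strip[v pv xv].
by rewrite (dir_inj pq pv h (strip_dir pv xv)).
Qed.

Lemma dir_deep_head p q r s x : p -- q -> r -- s -> r \in side p q -> s \in side p q ->
  x \in Mvv r s -> x \notin Mv p.
Proof.
move=> pq rs hr hs xe; apply/negP => xp.
by case: (Mv_ends rs xe xp) => e; move: (side_neq pq hr) (side_neq pq hs); rewrite e eqxx.
Qed.

(** Strips without a common end have no edges between them, and the only strips of the two
    directions that share an end are pq and pq', which share p. *)
Lemma dir_adj p q q' x y : p -- q -> p -- q' -> q != q' -> x \in dir p q -> y \in dir p q' ->
  x != y /\ x -- y = (x \in Mv p) && (y \in Mv p).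
Proof.
move=> pq pq' ne hx hy; split.
  by apply: contraNneq ne => e; rewrite (dir_inj pq pq' hx) // e.
have [_ _ _ _ [far near]] := SM.
have K q1 q2 x1 y1 : p -- q1 -> p -- q2 -> q1 != q2 -> x1 \in dir p q1 -> y1 \in dir p q2 ->
    x1 \notin Mvv p q1 -> x1 -- y1 = false /\ x1 \notin Mv p.
  move=> e1 e2 n12 h1 h2 nx; have [r [s [rs h xe]]] := dirP _ _ _ h1.
  have [r' [s' [rs' h' ye]]] := dirP _ _ _ h2.
  case: (dir_edge e1 rs xe h1) => [[a1 a2]|[[a1 a2]|[hr _]]].
  - by subst; rewrite xe in nx.
  - by subst; rewrite MvvC xe in nx.
  split; last exact: dir_deep_head hr h xe.
  have D u : u \in side p q1 -> u \in side p q2 -> False.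
    by move=> u1 u2; rewrite (side_disj treeJ e1 e2 u1 u2) eqxx in n12.
  apply/negbTE; apply: (far r s r' s' rs rs') xe ye.
  rewrite /= !inE !negb_or (edge_neq rs) (edge_neq rs') andbT /=.
  have ns' u : u \in side p q1 -> u != s' by move=> u1; apply/eqP => e; apply: (D u u1); rewrite e.
  have nr' u : u \in side p q1 -> u != r'.
    move=> u1; have [e|n] := eqVneq r' p; first by rewrite e; apply: side_neq u1.
    apply/eqP => e; apply: (D u u1); rewrite e.
    by apply: side_step h' _ n => //; rewrite edgeC.
  by rewrite !ns' ?nr'.
have [xe|nx] := boolP (x \in Mvv p q); last first.
  by have [-> /negbTE ->] := K _ _ _ _ pq pq' ne hx hy nx.
have [ye|ny] := boolP (y \in Mvv p q').
  exact: (near p q q' pq pq' ne x y xe ye).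
have ne' : q' != q by rewrite eq_sym.
by rewrite edgeC; have [-> /negbTE ->] := K _ _ _ _ pq' pq ne' hy hx ny; rewrite andbF.
Qed.

Lemma dir_sub p q r : p -- q -> q -- r -> r != p -> {subset dir q r <= dir p q}.
Proof.
move=> pq qr rp x /dirP[u [v [uv h xe]]]; apply/dirP; exists u, v; split=> //.
by have /properP[/subsetP + _] := side_proper treeJ pq qr rp; apply.
Qed.

Lemma dir_split p q x : p -- q -> x \in dir p q ->
  x \in Mvv p q \/ exists r, [/\ q -- r, r != p & x \in dir q r].
Proof.
move=> pq hx; have [r qr xr] := VM_dir q (dir_VM hx).
have [e|ne] := eqVneq r p; last by right; exists r.
left; have [u [v [uv h xe]]] := dirP _ _ _ hx; subst r.
case: (dir_edge pq uv xe hx) => [[? ?]|[[? ?]|[hu hv]]]; subst; rewrite // 1?MvvC //.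
case: (dir_edge qr uv xe xr) => [[? ?]|[[? ?]|[hu' _]]]; subst; rewrite // 1?MvvC //.
by have := side_excl treeJ pq hu; rewrite hu'.
Qed.

Lemma strip_not_deep p q r x : p -- q -> q -- r -> r != p -> x \in Mvv p q -> x \notin dir q r.
Proof.
move=> pq qr rp xe; apply/negP => h; have qp : q -- p by rewrite edgeC.
move/negP: rp; apply; rewrite (dir_inj qr qp h) //.
by apply: strip_dir; rewrite // MvvC.
Qed.

Lemma dir_far s sg s' w' sg' : s -- sg -> s' \in side s sg -> s' -- sg' -> s \in side s' sg' ->
  s' -- w' -> w' != sg' -> {subset dir s' w' <= dir s sg} /\ {in dir s' w', forall x, x \notin Mv s}.
Proof.
move=> e1 h1 e2 h2 e3 ne; have sub := side_far treeJ e1 h1 e2 h2 e3 ne.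
split=> x /dirP[u [v [uv h xe]]]; first by apply/dirP; exists u, v; split=> //; apply: sub.
apply/negP => xs; case: (Mv_ends uv xe xs) => e; subst; last first.
  by have := side_notin e1; rewrite sub.
have hx : x \in dir s' w' by apply/dirP; exists u, v.
case: (dir_edge e3 uv xe hx) => [[e _]|[[e _]|[hu _]]].
- by move: h1; rewrite -e (negbTE (side_notin e1)).
- by move: h; rewrite e (negbTE (side_notin e3)).
- by have := side_notin e1; rewrite sub.
Qed.

Lemma leaf_nbr t : t \in leaves J -> exists2 s, t -- s & forall s', t -- s' -> s' = s.
Proof.
rewrite inE => /cards1P[s e]; exists s.
  by have := set11 s; rewrite -e inE.
by move=> s' h; apply/set1P; rewrite -e inE.
Qed.

Lemma leaf_uniq t s s' : t \in leaves J -> t -- s -> t -- s' -> s = s'.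
Proof. by case/leaf_nbr => r _ H /H -> /H ->. Qed.

Lemma nonleaf_other p q : p -- q -> q \notin leaves J -> exists2 r, q -- r & r != p.
Proof.
move=> pq nl; have pN : p \in [set r | q -- r] by rewrite inE edgeC.
have : 0 < #|[set r | q -- r] :\ p|.
  by move: nl; rewrite inE /degree (cardsD1 p) pN; case: #|_|.
by case/card_gt0P => r; rewrite !inE => /andP[rp qr]; exists r.
Qed.

(** Two adjacent leaves would be all of J, which has at least three vertices. *)
Lemma leaf_leafF t t' : t \in leaves J -> t' \in leaves J -> t -- t' -> False.
Proof.
move=> lt lt' e; have : 2 < #|J| by case: SM => -[].
have : [set: J] \subset [set t; t'].
  apply/subsetP => r _; rewrite !inE; apply: contraT; rewrite negb_or => /andP[n1 n2].
  have [q tq h] := side_cover treeJ n1; have e' := leaf_uniq lt tq e; subst q.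
  have [q' tq' h'] := side_cover treeJ n2.
  have e'' : t = q' by apply: (leaf_uniq lt' _ tq'); rewrite edgeC.
  by have := side_excl treeJ e h; rewrite e'' h'.
move/subset_leq_card; rewrite cardsT cards2; by case: eqP => _; lia.
Qed.

(** A form of [is_rung] that is symmetric under reversal. A rung of one vertex, in both end sets, is
    covered. *)
Definition rung u v R := [/\ ipath R, R != [::], {subset R <= Mvv u v},
  {in R, forall z, (z \in Mv u) = (z == head z R)} &
  {in R, forall z, (z \in Mv v) = (z == last z R)}].

Lemma rung_rev u v R : rung u v R -> rung v u (rev R).
Proof.
case=> pR R0 sR hu hv; split.
- exact: ipath_rev.
- by rewrite -size_eq0 size_rev size_eq0.
- by move=> z; rewrite mem_rev MvvC; apply: sR.
- by move=> z; rewrite mem_rev head_rev; apply: hv.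
- by move=> z; rewrite mem_rev last_rev; apply: hu.
Qed.

Lemma rung_of u v x (p : seq G) : u -- v ->
  is_rung (Mvv u v :&: Mv u) (Mvv u v :&: Mv v) (Mvv u v :\: (Mv u :|: Mv v)) x p ->
  rung u v (x :: p).
Proof.
move=> uv [/induced_pathP ip sub [/setIP[_ xu] /setIP[_ lv]] sC ends].
have S : {subset x :: p <= Mvv u v}.
  by move=> z /sub; rewrite !inE => /orP[/orP[]|] /andP[].
have E z : z \in x :: p -> [\/ z = x, z = last x p | z \notin Mv u /\ z \notin Mv v].
  case: p sC {ip sub lv ends S} => [|y p] sC; first by rewrite inE => /eqP ->; apply: Or31.
  rewrite lastI mem_rcons inE => /orP[/eqP ->|]; first by apply: Or32.
  rewrite [belast _ _]/= inE => /orP[/eqP ->|zc]; first by apply: Or31.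
  by apply: Or33; have := sC z zc; rewrite !inE negb_or => /andP[/andP[]].
have N : p != [::] -> x \notin Mv v /\ last x p \notin Mv u.
  move=> p0; have [+ +] := ends p0; rewrite !inE !negb_and.
  by rewrite (S x (mem_head _ _)) (S _ (mem_last _ _)).
split=> // z zQ /=.
  apply/idP/eqP => [zu|-> //]; case: (E z zQ) => [//|e|[/negP[]]//].
  case: (eqVneq p [::]) => [p0|p0]; first by rewrite e p0.
  by have [_] := N p0; rewrite -e zu.
apply/idP/eqP => [zv|-> //]; case: (E z zQ) => [e|//|[_ /negP[]]//].
case: (eqVneq p [::]) => [p0|p0]; first by rewrite e p0.
by have [] := N p0; rewrite -e zv.
Qed.

Lemma rung_through u v x : u -- v -> x \in Mvv u v -> exists2 R, rung u v R & x \in R.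
Proof.
move=> uv xe; have [_ _ _ /(_ u v uv) [_ _ _ H] _] := SM.
have [|z [p [Hr xp]]] := H x; last by exists (z :: p) => //; apply: rung_of.
by rewrite !inE xe /=; case: (x \in Mv u); case: (x \in Mv v).
Qed.

Lemma head_exists u v : u -- v -> exists x, x \in Mvv u v /\ x \in Mv u.
Proof.
by move=> uv; have [_ _ _ /(_ u v uv) [[/set0Pn[x /setIP[? ?]] _] _ _ _] _] := SM; exists x.
Qed.

Lemma rung_head u v x : u -- v -> x \in Mvv u v -> x \in Mv u ->
  exists s : seq G, rung u v (x :: s).
Proof.
move=> uv xe xu; have [R HR xR] := rung_through uv xe.
have [_ _ _ hu _] := HR; move: (hu x xR); rewrite xu.
by case: R HR xR {hu} => // y s HR _ /esym/eqP /= ->; exists s.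
Qed.

Lemma rung_exists u v : u -- v -> exists R, rung u v R.
Proof. by move=> uv; have [x [xe xu]] := head_exists uv; have [s] := rung_head uv xe xu; exists (x :: s). Qed.

(** A concatenation of rungs from p to the leaf t. The restriction [t' != p] keeps this meaningful
    when p is a leaf itself. By the last clause the leaf t can be read off from any vertex of the
    arm that lies in a strip at a leaf. *)
Definition arm p q t Q := [/\ ipath Q, Q != [::], {subset Q <= dir p q},
  {in Q, forall z, (z \in Mv p) = (z == head z Q)} &
  [/\ t \in leaves J, t \in side p q, {in Q, forall z t', t' \in leaves J -> t' != p ->
        (z \in Mv t') = (z == last z Q) && (t' == t)} &
     {in Q, forall z s t', t' \in leaves J -> t' != p -> s -- t' -> z \in Mvv s t' -> t' = t}]].

Lemma arm_rung p q R : p -- q -> q \in leaves J -> rung p q R -> arm p q q R.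
Proof.
move=> pq lq [pR R0 sR hp hq]; split=> //.
  by move=> z /sR; apply: strip_dir.
split=> //; first exact: side_refl; last first.
  move=> z /sR zpq s t' _ t'p st' zst; case: (strip_eq st' pq zst zpq) => -[_ //].
  by move=> e; rewrite e eqxx in t'p.
move=> z zR t' lt' t'p; have [->|ne] := eqVneq t' q; first by rewrite andbT hq.
rewrite andbF; apply/negP => /(Mv_ends pq (sR z zR))[] e; first by rewrite e eqxx in t'p.
by rewrite e eqxx in ne.
Qed.

(** Seen from q, the strip pq and the arm lie in different directions, so they are joined through
    M_q only. *)
Lemma arm_cat p q r t R Q : p -- q -> q \notin leaves J -> q -- r -> r != p ->
  rung p q R -> arm q r t Q -> arm p q t (R ++ Q).
Proof.
move=> pq nq qr rp [pR R0 sR hp hq] [pQ Q0 sQ hQ [lt ts HQ HQ']].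
have qp : q -- p by rewrite edgeC.
have RD z : z \in R -> z \in dir q p.
  by move=> zR; apply: strip_dir => //; rewrite MvvC; apply: sR.
have adj x y : x \in R -> y \in Q -> x != y /\ x -- y = (x \in Mv q) && (y \in Mv q).
  by move=> xR yQ; apply: (dir_adj qp qr) (RD x xR) (sQ y yQ); rewrite eq_sym.
split.
- apply: ipath_cat => // x y xR yQ; have [-> ->] := adj x y xR yQ.
  by rewrite hq // hQ.
- by case: (R) R0.
- move=> z; rewrite mem_cat => /orP[/sR|/sQ]; first exact: strip_dir.
  exact: dir_sub.
- have hd z : head z (R ++ Q) = head z R by case: (R) R0.
  move=> z; rewrite mem_cat hd => /orP[zR|zQ]; first exact: hp.
  have -> : (z == head z R) = false.
    by apply/negbTE; case: (adj _ z (mem_head_def z R0) zQ); rewrite eq_sym.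
  apply/negP => zp; have zpq := dir_head pq (dir_sub pq qr rp (sQ z zQ)) zp.
  by have /negP[] := strip_not_deep pq qr rp zpq; apply: sQ.
have tq : t \in side p q.
  by have /properP[/subsetP + _] := side_proper treeJ pq qr rp; apply.
split=> // z; rewrite mem_cat => /orP[zR|zQ]; last first.
- move=> s t' lt' _; apply: HQ' => //; by apply: contraNneq nq => <-.
- move=> s t' lt' t'p st' zst; case: (strip_eq st' pq zst (sR z zR)) => -[_ e]; subst t'.
    by rewrite lt' in nq.
  by rewrite eqxx in t'p.
- move=> t' lt' t'p; rewrite last_cat (last_def _ z Q0) HQ //.
  by apply: contraNneq nq => <-.
move=> t' lt' t'p; rewrite last_cat (last_def _ z Q0).
have -> : (z == last z Q) = false.
  by apply/negbTE; case: (adj z _ zR (mem_last_def z Q0)).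
apply/negP => /(Mv_ends pq (sR z zR))[] e; first by rewrite e eqxx in t'p.
by rewrite -e lt' in nq.
Qed.

Lemma arm_apart s sg s' w w' : s -- sg -> s -- w -> w != sg ->
  {subset dir s' w' <= dir s sg} /\ {in dir s' w', forall x, x \notin Mv s} ->
  forall x y, x \in dir s w -> y \in dir s' w' -> x != y /\ x -- y = false.
Proof.
move=> e1 e2 ne [sub nh] x y hx hy; have [-> ->] := dir_adj e2 e1 ne hx (sub y hy).
by rewrite (negbTE (nh y hy)) andbF.
Qed.

End Strips.

(** * Arms and the letters at their ends *)

Section Cross.
Variables (J G : sgraph) (M : strip_family J G) (alpha beta : {set J}) (a b : G).
Hypothesis SM : is_strip_system M.
Hypothesis XM : cross_edge M alpha beta a b.
Implicit Types (p q r s t u v w : J) (x y z : G) (Q R : seq G).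

Notation Mv := (Mv M).
Notation Mvv u v := (Me M [set u; v]).
Notation dir := (dir M).
Notation arm := (arm M).

Let treeJ : is_tree J. Proof. by case: SM => -[]. Qed.

Lemma leafE t : (t \in leaves J) = (t \in alpha) || (t \in beta).
Proof. by case: XM => _ [<- _] _ _ _; rewrite inE. Qed.

Lemma alpha_leaf t : t \in alpha -> t \in leaves J. Proof. by rewrite leafE => ->. Qed.
Lemma beta_leaf t : t \in beta -> t \in leaves J. Proof. by rewrite leafE orbC => ->. Qed.

Lemma alpha_betaF t : t \in alpha -> t \in beta -> False.
Proof. by case: XM => _ [_ /pred0P /(_ t) /=] + _ _ _ h1 h2; rewrite h1 h2. Qed.

Lemma beta_not_alpha t : t \in leaves J -> t \notin alpha -> t \in beta.
Proof. by rewrite leafE => /orP[->|]. Qed.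

Lemma alpha_uniq s t t' : s -- t -> s -- t' -> t \in alpha -> t' \in alpha -> t = t'.
Proof.
case: XM => _ _ _ /(_ s) [/card_le1P H _] _ h h' ht ht'.
by have := H t; rewrite inE ht h => /(_ isT t'); rewrite !inE ht' h' => /esym/eqP.
Qed.

Lemma beta_uniq s t t' : s -- t -> s -- t' -> t \in beta -> t' \in beta -> t = t'.
Proof.
case: XM => _ _ _ /(_ s) [_ /card_le1P H] _ h h' ht ht'.
by have := H t; rewrite inE ht h => /(_ isT t'); rewrite !inE ht' h' => /esym/eqP.
Qed.

(** J has no vertex of degree two, so a vertex that is not a leaf has at least three neighbours. *)
Lemma third_dir v w1 w2 : v \notin leaves J -> exists w3, [/\ v -- w3, w3 != w1 & w3 != w2].
Proof.
move=> nv; have [_ _ [/(_ v) d2 J3] _ _] := XM.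
have d0 : 0 < degree v.
  have [r rv] : exists r, r != v.
    have : 0 < #|[set~ v]| by rewrite cardsC1; case: #|J| J3 => // -[].
    by case/card_gt0P => r; rewrite !inE; exists r.
  have [q vq _] := side_cover treeJ rv; apply/card_gt0P; exists q; by rewrite inE.
have : 0 < #|[set y | v -- y] :\ w1 :\ w2|.
  have := cardsD1 w1 [set y | v -- y]; have := cardsD1 w2 ([set y | v -- y] :\ w1).
  have n1 : degree v != 1 by move: nv; rewrite inE.
  move: n1 d2 d0; rewrite /degree {nv}.
  move: #|_ :\ w1 :\ w2| #|_ :\ w1| #|_| => k1 k2 k3.
  by clear; do 2 case: (_ \in _); lia.
by case/card_gt0P => w3; rewrite !inE => /and3P[? ? ?]; exists w3.
Qed.

Lemma aVM x : x \in VM M -> (x != a) /\ a -- x = [exists t in alpha, x \in Mv t].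
Proof.
case: XM => _ _ _ _ [na _ H _] xV; split; first by apply: contraNneq na => <-.
rewrite H //; apply/bigcupP/existsP => [[t ta xt]|[t /andP[ta xt]]]; exists t => //.
by rewrite ta.
Qed.

Lemma bVM x : x \in VM M -> (x != b) /\ b -- x = [exists t in beta, x \in Mv t].
Proof.
case: XM => _ _ _ _ [_ nb _ H] xV; split; first by apply: contraNneq nb => <-.
rewrite H //; apply/bigcupP/existsP => [[t ta xt]|[t /andP[ta xt]]]; exists t => //.
by rewrite ta.
Qed.

Lemma arm_leg p q t Q : p \notin leaves J -> arm p q t Q -> leg a b (t \in alpha) Q.
Proof.
move=> np [pQ Q0 sQ _ [lt ts H _]].
have E (A : {set J}) z : {subset A <= leaves J} -> z \in Q ->
    [exists t' in A, z \in Mv t'] = (z == last z Q) && (t \in A).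
  move=> AL zQ; apply/existsP/andP => [[t' /andP[t'A zt']]|[/eqP zl tA]].
    move: zt'; rewrite (H z zQ) ?AL //; last by apply: contraNneq np => <-; apply: AL.
    by case/andP=> -> /eqP <-.
  exists t; rewrite tA (H z zQ) // -?zl ?eqxx //.
  by apply: contraNneq np => <-.
have V z : z \in Q -> z \in VM M by move/sQ; apply: dir_VM.
have ba : (t \in beta) = ~~ (t \in alpha).
  apply/idP/idP => h; last exact: beta_not_alpha.
  by apply/negP => /alpha_betaF; apply.
have Ha z : z \in Q -> z != a /\ a -- z = (z == last z Q) && (t \in alpha).
  by move=> zQ; have [-> ->] := aVM (V z zQ); rewrite (E _ _ alpha_leaf zQ).
have Hb z : z \in Q -> z != b /\ b -- z = (z == last z Q) && ~~ (t \in alpha).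
  by move=> zQ; have [-> ->] := bVM (V z zQ); rewrite (E _ _ beta_leaf zQ) ba.
by split=> //; split=> z zQ; have [d1 e1] := Ha z zQ; have [d2 e2] := Hb z zQ;
  move: e1 e2; case: (t \in alpha) => /=; rewrite ?andbT ?andbF.
Qed.

(** Induction on the size of the side. At each vertex q that is passed, the continuation can be
    chosen outside alpha, since q has at most one neighbour there; a leaf of alpha is reached only
    if the strip of x itself ends in it. *)
Lemma arm_through p q x : p -- q -> x \in dir p q -> exists t Q,
  [/\ arm p q t Q, x \in Q &
      t \in beta \/ t \in alpha /\ exists s, s -- t /\ x \in Mvv s t].
Proof.
move: {2}#|_|.+1 (ltnSn #|side p q|) => n; elim: n p q x => // n IH p q x szn pq hx.
have IH' r y : q -- r -> r != p -> y \in dir q r -> exists t Q,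
    [/\ arm q r t Q, y \in Q & t \in beta \/ t \in alpha /\ exists s, s -- t /\ y \in Mvv s t].
  move=> qr rp hy; apply: IH => //; have := proper_card (side_proper treeJ pq qr rp).
  by move: szn; rewrite ltnS => h h'; apply: leq_trans h' h.
case: (dir_split SM pq hx) => [xe|[r [qr rp xr]]]; last first.
  have nq : q \notin leaves J.
    by apply/negP => lq; rewrite (leaf_uniq lq qr (_ : q -- p)) ?eqxx // edgeC in rp.
  have [t [Q [AQ xQ H]]] := IH' r x qr rp xr; have [R HR] := rung_exists SM pq.
  by exists t, (R ++ Q); split; [exact: (arm_cat SM pq nq qr rp HR AQ) | rewrite mem_cat xQ orbT |].
have [R HR xR] := rung_through SM pq xe.
have [lq|nq] := boolP (q \in leaves J).
  exists q, R; split=> //; first exact: (arm_rung SM).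
  by move: lq; rewrite leafE => /orP[qa|qb]; [right; split=> //; exists p | left].
have [r [qr rp rok]] : exists r, [/\ q -- r, r != p & r \notin alpha].
  have [r qr rp] := nonleaf_other pq nq.
  have [ra|ra] := boolP (r \in alpha); last by exists r.
  have [r' [qr' r'p r'r]] := third_dir p r nq; exists r'; split=> //.
  by apply: contraNN r'r => r'a; apply/eqP; apply: (alpha_uniq qr' qr).
have [y [ye yq]] := head_exists SM qr.
have [t [Q [AQ yQ H]]] := IH' r y qr rp (strip_dir qr ye).
exists t, (R ++ Q); split; [exact: (arm_cat SM pq nq qr rp HR AQ) | by rewrite mem_cat xR |].
(* The vertex y lies in the strip qr, and neither q nor r is a leaf of alpha, so the arm through y
   ends in beta. *)
left; case: H => // -[ta [s [st yst]]]; exfalso.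
case: (strip_eq SM st qr yst ye) => -[e1 e2]; subst; first by rewrite ta in rok.
by rewrite alpha_leaf in nq.
Qed.

End Cross.

(** * Enlarging a strip *)

(** A path that meets U in its head only and V in its last vertex only satisfies all clauses of a
    rung, also when these two vertices coincide. *)
Lemma strip_of_rungs (G : sgraph) (E U V : {set G}) : E != set0 ->
  {in E, forall z, exists R, [/\ ipath R, {subset R <= E}, z \in R,
     {in R, forall y, (y \in U) = (y == head y R)} &
     {in R, forall y, (y \in V) = (y == last y R)}]} ->
  is_strip (E :&: U) (E :&: V) (E :\: (U :|: V)).
Proof.
move=> /set0Pn[z0 z0E] H; split.
- have [R [_ sR zR hU hV]] := H z0 z0E; have R0 := mem_nonnil zR; split; apply/set0Pn.
    exists (head z0 R); rewrite inE sR ?mem_head_def //= hU ?mem_head_def //.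
    by rewrite (head_def _ z0 R0).
  exists (last z0 R); rewrite inE sR ?mem_last_def //= hV ?mem_last_def //.
  by rewrite (last_def _ z0 R0).
- by apply/pred0P => x /=; rewrite !inE; case: (x \in U); rewrite /= ?andbF.
- by apply/pred0P => x /=; rewrite !inE; case: (x \in V); rewrite /= ?orbT ?andbF.
move=> v hv; have vE : v \in E by move: hv; rewrite !inE => /orP[/orP[]|] /andP[].
have [R [pR sR vR hU hV]] := H v vE.
case: R pR sR vR hU hV => // x p pR sR vR hU hV; exists x, p; split=> //.
have up := ipath_uniq pR; split.
- exact/induced_pathP.
- move=> z zR; rewrite !inE (sR z zR) /=.
  by case: (z \in U); case: (z \in V).
- by rewrite !inE sR ?mem_head // sR ?mem_last // hU ?mem_head // hV ?mem_last //= !eqxx.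
- case: p up pR sR vR hU hV => //= y p up _ sR _ hU hV z zb.
  have zb' : z \in belast x (y :: p) by rewrite /= inE zb orbT.
  have zR : z \in [:: x, y & p] by apply: mem_belast.
  rewrite !inE sR // hU // hV //= andbT negb_or; apply/andP; split.
    have zp : z \in y :: p by apply: mem_belast.
    by apply: contraTneq up => <-; rewrite zp.
  have : uniq (rcons (belast x (y :: p)) (last x (y :: p))) by rewrite -lastI.
  rewrite rcons_uniq => /andP[nl _]; apply/eqP => e; move: nl.
  by rewrite -[last x (y :: p)]/(last y p) -e zb'.
- move=> p0; rewrite !inE !negb_and hU ?mem_last // hV ?mem_head //=.
  have ne : x != last x p.
    case: p p0 up {pR sR vR hU hV} => //= y p _ /andP[xn _].
    by apply: contraNneq xn => {1}->; apply: mem_last.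
  by rewrite ne [last x p == x]eq_sym ne !orbT.
Qed.

Section Enlarge.
Variables (J G : sgraph) (M : strip_family J G) (alpha beta : {set J}) (a b : G).
Hypothesis SM : is_strip_system M.
Hypothesis XM : cross_edge M alpha beta a b.
Hypothesis maxM : forall M' : strip_family J G,
  is_strip_system M' -> has_cross_edge M' a b -> ~~ (VM M \proper VM M').
Implicit Types (p q r s t u v w : J) (x y z f : G) (Q R : seq G).

Notation Mv := (Mv M).
Notation Mvv u v := (Me M [set u; v]).

Variables (u v : J) (F Fu Fv : {set G}).
Hypotheses (uv : u -- v) (F0 : F != set0) (FuF : Fu \subset F) (FvF : Fv \subset F).
Hypotheses (FM : [disjoint F & VM M]) (Fa : a \notin F) (Fb : b \notin F).
Hypothesis adjM : forall f z, f \in F -> z \in VM M -> z \notin Mvv u v ->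
  f -- z = (z \in Mv u) && (f \in Fu) || (z \in Mv v) && (f \in Fv).
Hypothesis adja : forall f, f \in F ->
  a -- f = (u \in alpha) && (f \in Fu) || (v \in alpha) && (f \in Fv).
Hypothesis adjb : forall f, f \in F ->
  b -- f = (u \in beta) && (f \in Fu) || (v \in beta) && (f \in Fv).
Hypothesis rungF : {in F, forall f, exists R,
  [/\ ipath R, {subset R <= Mvv u v :|: F}, f \in R,
     {in R, forall y, (y \in Mv u :|: Fu) = (y == head y R)} &
     {in R, forall y, (y \in Mv v :|: Fv) = (y == last y R)}]}.

(* F joins the strip uv; Fu and Fv are its vertices added to M_u and M_v. *)
Let M' := StripFamily
  (fun e => if e == [set u; v] then Me M e :|: F else Me M e)
  (fun w => if w == u then Mv u :|: Fu else if w == v then Mv v :|: Fv else Mv w).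

Let FVM f : f \in F -> f \notin VM M.
Proof. by move=> fF; apply/negP => fV; have /pred0P /(_ f) := FM; rewrite /= fF fV. Qed.

Let uvN : (u == v) = false. Proof. exact/negbTE/edge_neq. Qed.

Let MeE r s x : (x \in Me M' [set r; s]) = (x \in Mvv r s) || ([set r; s] == [set u; v]) && (x \in F).
Proof. by rewrite /=; case: ifP; rewrite ?inE // orbF. Qed.

Let MvE w x : (x \in Defs.Mv M' w) = (x \in Mv w) || (w == u) && (x \in Fu) || (w == v) && (x \in Fv).
Proof.
rewrite /=; case: (eqVneq w u) => [->|_]; first by rewrite inE uvN /= orbF.
by case: (eqVneq w v) => [->|_]; rewrite ?inE /= ?orbF.
Qed.

Let MvE_old w x : x \in VM M -> (x \in Defs.Mv M' w) = (x \in Mv w).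
Proof.
move=> xV; rewrite MvE.
have -> : x \in Fu = false by apply/negP => /(subsetP FuF) /FVM; rewrite xV.
have -> : x \in Fv = false by apply/negP => /(subsetP FvF) /FVM; rewrite xV.
by rewrite !andbF !orbF.
Qed.

Let MvE_new w x : x \in F -> (x \in Defs.Mv M' w) = (w == u) && (x \in Fu) || (w == v) && (x \in Fv).
Proof.
by move=> xF; rewrite MvE; have -> : x \in Mv w = false by apply/negP => /(Mv_VM SM); rewrite (negbTE (FVM xF)).
Qed.

Let old r s x : r -- s -> x \in Mvv r s -> x \in VM M.
Proof. by move=> rs xe; apply/(VMP M _); exists r, s. Qed.

Let strips r s : r -- s -> is_strip (Me M' [set r; s] :&: Defs.Mv M' r)
  (Me M' [set r; s] :&: Defs.Mv M' s) (Me M' [set r; s] :\: (Defs.Mv M' r :|: Defs.Mv M' s)).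
Proof.
move=> rs; have [x [xe _]] := head_exists SM rs.
apply: strip_of_rungs; first by apply/set0Pn; exists x; rewrite MeE xe.
move=> z; rewrite MeE => /orP[zo|/andP[/eqP e zF]].
  have [R [pR R0 sR hr hs] zR] := rung_through SM rs zo; exists R; split=> //.
  - by move=> y /sR yo; rewrite MeE yo.
  - by move=> y yR; rewrite MvE_old ?hr // (old rs (sR y yR)).
  - by move=> y yR; rewrite MvE_old ?hs // (old rs (sR y yR)).
have [R [pR sR zR hu hv]] := rungF zF.
have E w : w = u -> Defs.Mv M' w = Mv u :|: Fu by move=> -> /=; rewrite eqxx.
have E' w : w = v -> Defs.Mv M' w = Mv v :|: Fv by move=> -> /=; rewrite eq_sym uvN eqxx.
have SR : {subset R <= Me M' [set r; s]} by move=> y /sR; rewrite MeE e eqxx inE.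
case: (set2_eq e) => -[e1 e2].
  by exists R; rewrite (E _ e1) (E' _ e2).
exists (rev R); rewrite (E' _ e1) (E _ e2); split.
- exact: ipath_rev.
- by move=> y; rewrite mem_rev; apply: SR.
- by rewrite mem_rev.
- by move=> y; rewrite mem_rev head_rev; apply: hv.
- by move=> y; rewrite mem_rev last_rev; apply: hu.
Qed.

Let FuE f : f \in Fu -> f \in F. Proof. exact: (subsetP FuF). Qed.
Let FvE f : f \in Fv -> f \in F. Proof. exact: (subsetP FvF). Qed.

Let newold f r s z : f \in F -> r -- s -> [set r; s] != [set u; v] -> z \in Mvv r s ->
  f -- z = (z \in Mv u) && (f \in Fu) || (z \in Mv v) && (f \in Fv).
Proof.
move=> fF rs ne zo; apply: adjM => //; first exact: old zo.
apply/negP => zuv; have := strip_eq SM rs uv zo zuv; move/eqP: ne.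
by move=> ne [] [e1 e2]; apply: ne; rewrite e1 e2 // setUC.
Qed.

Let far y z w (x : J) r s : r -- s -> w -- x -> uniq [:: r; s; w; x] ->
  y \in Me M' [set r; s] -> z \in Mvv w x -> y -- z = false.
Proof.
move=> rs wx un; have [_ _ _ _ [H _]] := SM; rewrite MeE => /orP[yo|/andP[/eqP e yF]] zo.
  exact: negbTE (H r s w x rs wx un y z yo zo).
move: un; rewrite /= !inE !negb_or !andbT => /and3P[/and3P[_ n1 n2] /andP[n3 n4] n5].
have nw : [set w; x] != [set u; v].
  rewrite -e; apply/eqP => /set2_eq[] [e1 _]; by rewrite e1 eqxx in n1 n3.
rewrite (newold yF wx nw zo).
have N c : c \in [set r; s] -> z \in Mv c = false.
  move=> cin; apply/negP => /(Mv_ends SM wx zo)[] ce; move: cin; rewrite ce !inE.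
    by rewrite [w == r]eq_sym [w == s]eq_sym (negbTE n1) (negbTE n3).
  by rewrite [x == r]eq_sym [x == s]eq_sym (negbTE n2) (negbTE n4).
by rewrite !N // e !inE eqxx ?orbT.
Qed.

Let near y z r s w : r -- s -> r -- w -> s != w -> y \in Me M' [set r; s] -> z \in Mvv r w ->
  y -- z = (y \in Defs.Mv M' r) && (z \in Defs.Mv M' r).
Proof.
move=> rs rw sw ye zo; have zV := old rw zo; rewrite [X in _ && X]MvE_old //.
have [_ _ _ _ [_ H]] := SM; move: ye; rewrite MeE => /orP[yo|/andP[/eqP e yF]].
  by rewrite (H r s w rs rw sw y z yo zo) MvE_old // (old rs yo).
have nw : [set r; w] != [set u; v].
  rewrite -e; apply/eqP => /set2_eq[] [e1 e2]; first by rewrite e2 eqxx in sw.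
  by have := edge_neq rs; rewrite -e1 eqxx.
rewrite (newold yF rw nw zo) MvE_new //.
have N c : c != r -> c \in [set r; s] -> z \in Mv c = false.
  move=> cr; rewrite !inE (negbTE cr) /= => /eqP cs; apply/negP => /(Mv_ends SM rw zo)[] ce.
    by rewrite ce eqxx in cr.
  by rewrite -cs ce eqxx in sw.
have uin : u \in [set r; s] by rewrite e set21. have vin : v \in [set r; s] by rewrite e set22.
case: (eqVneq r u) => [er|ru]; last first.
  rewrite (N u) //=; last by rewrite eq_sym.
  case: (eqVneq r v) => [->|rv]; first by rewrite andbC.
  by rewrite (N v) // eq_sym.
have nv : z \in Mv v = false by apply: N => //; rewrite er eq_sym uvN.
by rewrite er uvN nv /= !orbF andbC.
Qed.

(** The extended family keeps J, the cross-edge and its partition, so it contradicts the maximality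
    of V(M). *)
Lemma no_enlargement : False.
Proof.
have [[tJ J3] dis sub st [Hfar Hnear]] := SM.
have disF (e f : {set J}) x : e \in edges J -> f \in edges J -> e != f -> x \in Me M' e -> x \in Me M' f -> False.
  move=> ee ef ne; have O (e' : {set J}) : e' \in edges J -> x \in Me M' e' -> x \in Me M e' \/ e' = [set u; v] /\ x \in F.
    move=> _ /=; case: ifP => [/eqP h|_]; last by left.
    by rewrite inE => /orP[]; [left | right].
  have V (e' : {set J}) : e' \in edges J -> x \in Me M e' -> x \in VM M.
    by move=> h hx; apply/bigcupP; exists e'.
  move=> /(O _ ee)[h1|[e1 x1]] /(O _ ef)[h2|[e2 x2]].
  - by have /pred0P /(_ x) := dis e f ee ef ne; rewrite /= h1 h2.
  - by have := FVM x2; rewrite (V _ ee h1).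
  - by have := FVM x1; rewrite (V _ ef h2).
  - by rewrite e1 e2 eqxx in ne.
have SM' : is_strip_system M'.
  split=> //.
  - move=> e f ee ef ne; apply/pred0P => x /=; apply/negP => /andP[]; exact: disF ee ef ne.
  - move=> w; apply/subsetP => x; rewrite MvE => h; apply/bigcupP.
    case/orP: h => [/orP[xw|/andP[/eqP -> xF]]|/andP[/eqP -> xF]].
    + by have [s ws xs] := Mv_strip SM xw; exists s => //; rewrite MeE xs.
    + by exists v => //; rewrite MeE eqxx FuE ?orbT.
    + by exists u; rewrite 1?edgeC // MeE setUC eqxx FvE ?orbT.
  split.
  - move=> r s w x rs wx un y z ye ze; apply/negP => yz.
    have := ze; rewrite MeE => /orP[zo|/andP[/eqP ez zF]].
      by rewrite (far rs wx un ye zo) in yz.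
    have un' : uniq [:: w; x; r; s].
      by move: un; rewrite -[_ :: _]/([:: r; s] ++ [:: w; x]) uniq_catC.
    have := ye; rewrite MeE => /orP[yo|/andP[/eqP ey yF]].
      by rewrite edgeC (far wx rs un' ze yo) in yz.
    move: un; rewrite /= !inE !negb_or => /and3P[/and3P[_ n1 n2] _ _].
    by have /set2_eq[] : [set r; s] = [set w; x]; rewrite ?ey ?ez // => -[e1 _]; rewrite e1 eqxx in n1 n2.
  - move=> r s w rs rw sw y z ye ze.
    have := ze; rewrite MeE => /orP[zo|/andP[/eqP ez zF]]; first exact: near rs rw sw ye zo.
    have := ye; rewrite MeE => /orP[yo|/andP[/eqP ey yF]].
      by rewrite edgeC (near rw rs _ ze yo) 1?andbC // eq_sym.
    exfalso; have /set2_eq[] : [set r; s] = [set r; w] by rewrite ey ez.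
      by case=> _ e; rewrite e eqxx in sw.
    by case=> _ e; have := edge_neq rs; rewrite e eqxx.
have VE x : (x \in VM M') = (x \in VM M) || (x \in F).
  apply/(VMP M' _)/orP => [[r [s [rs]]]|[/(VMP M _)[r [s [rs xe]]]|xF]].
  - rewrite MeE => /orP[/(old rs)|/andP[_]]; by [left | right].
  - by exists r, s; rewrite MeE xe.
  - by exists u, v; rewrite MeE eqxx xF orbT.
have [ab lv dg few [na nb Ha Hb]] := XM.
have H A x : x \in VM M -> (x \in \bigcup_(t in A) Defs.Mv M' t) = (x \in \bigcup_(t in A) Mv t).
  move=> xV; apply/bigcupP/bigcupP => -[t tA xt]; exists t => //.
    by rewrite -MvE_old.
  by rewrite MvE_old.
have H' (A : {set J}) x : x \in F -> (x \in \bigcup_(t in A) Defs.Mv M' t) =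
    (u \in A) && (x \in Fu) || (v \in A) && (x \in Fv).
  move=> xF; apply/bigcupP/orP => [[t tA]|].
    by rewrite MvE_new // => /orP[]/andP[/eqP e xf]; subst t; rewrite tA xf; auto.
  case=> /andP[h xf]; [exists u | exists v] => //; rewrite MvE_new // eqxx xf ?orbT //.
have X' : cross_edge M' alpha beta a b.
  split=> //; split.
  - by rewrite VE negb_or na.
  - by rewrite VE negb_or nb.
  - by move=> x; rewrite VE => /orP[xV|xF]; [rewrite H // Ha | rewrite H' // adja].
  - by move=> x; rewrite VE => /orP[xV|xF]; [rewrite H // Hb | rewrite H' // adjb].
have := maxM SM' (ex_intro _ alpha (ex_intro _ beta X')).
move/negP; apply; apply/properP; split.
  by apply/subsetP => x xV; rewrite VE xV.
have [f fF] := set0Pn _ F0; exists f; first by rewrite VE fF orbT.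
exact: FVM.
Qed.

End Enlarge.

Lemma cross_edge_sym (J G : sgraph) (M : strip_family J G) alpha beta a b :
  cross_edge M alpha beta a b -> cross_edge M beta alpha b a.
Proof.
case=> ab [l d] dg few [na nb Ha Hb]; split.
- by rewrite edgeC.
- by rewrite setUC disjoint_sym.
- by [].
- by move=> s; case: (few s).
- by split.
Qed.

(** * Nonlocal pairs, minimal attachments and beams *)

Section Bad.
Variables (J G : sgraph) (M : strip_family J G).

(* {x, y} is not contained in a local set. *)
Definition bad (x y : G) := exists v w1 w2 : J,
  [/\ v -- w1, v -- w2 & w1 != w2] /\
  [/\ x \in dir M v w1, y \in dir M v w2 & ~~ ((x \in Mv M v) && (y \in Mv M v))].

Lemma bad_sym x y : bad x y -> bad y x.
Proof.
case=> v [w1 [w2 [[e1 e2 ne] [h1 h2 h3]]]]; exists v, w2, w1; rewrite eq_sym andbC; by split.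
Qed.

Lemma badI v w1 w2 x y : v -- w1 -> v -- w2 -> w1 != w2 -> x \in dir M v w1 ->
  y \in dir M v w2 -> x \notin Mv M v \/ y \notin Mv M v -> bad x y.
Proof.
move=> e1 e2 ne h1 h2 h; exists v, w1, w2; split=> //; split=> //.
by rewrite negb_and; apply/orP.
Qed.

(** For A the set alpha this is the obstruction to leading an arm through x to a beta leaf, see
    [beta_beam]. *)
Definition inS (A : {set J}) x := exists s t : J, [/\ t \in A, s -- t & x \in Me M [set s; t]].

(* A minimal attachment: the two members of a nonlocal pair are seen by opposite ends only. *)
Definition attached (a b : G) fs := [/\ ipath fs, fs != [::],
  forall f, f \in fs -> [/\ f \notin VM M, f != a & f != b] &
  forall p q f f', p \in VM M -> q \in VM M -> bad p q -> f \in fs -> f' \in fs ->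
    f -- p -> f' -- q ->
    f = head f fs /\ f' = last f' fs \/ f = last f fs /\ f' = head f' fs].

Lemma attached_rev a b fs : attached a b fs -> attached a b (rev fs).
Proof.
case=> pf f0 out mn; split; first exact: ipath_rev.
- by rewrite -size_eq0 size_rev size_eq0.
- by move=> f; rewrite mem_rev; apply: out.
- move=> p q f f'; rewrite !mem_rev => pV qV bd ff ff' e1 e2.
  by rewrite !head_rev !last_rev or_comm; apply: mn e1 e2.
Qed.

Lemma attached_swap a b fs : attached a b fs -> attached b a fs.
Proof. by case=> pf f0 out mn; split=> // f /out[]. Qed.

End Bad.

Section Beams.
Variables (J G : sgraph) (M : strip_family J G) (alpha beta : {set J}) (a b : G).
Hypothesis SM : is_strip_system M.
Hypothesis XM : cross_edge M alpha beta a b.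
Implicit Types (p q r s t u v w : J) (x y z f : G) (Q R : seq G) (c d : bool).

Notation Mv := (Mv M).
Notation Mvv u v := (Me M [set u; v]).
Notation dir := (dir M).
Notation arm := (arm M).
Notation inS := (inS M).

Let treeJ : is_tree J. Proof. by case: SM => -[]. Qed.

(** An arm of which only the direction and the letter are remembered. *)
Definition beam v w c Q := exists2 t, arm v w t Q & c = (t \in alpha).

Lemma two_nonleaf v w1 w2 : v -- w1 -> v -- w2 -> w1 != w2 -> v \notin leaves J.
Proof. by move=> e1 e2 ne; apply/negP => lv; rewrite (leaf_uniq lv e1 e2) eqxx in ne. Qed.

Lemma nbr_nonleaf s t : t \in leaves J -> s -- t -> s \notin leaves J.
Proof. by move=> lt st; apply/negP => ls; apply: (leaf_leafF SM ls lt st). Qed.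

Lemma beam_leg v w c Q : v \notin leaves J -> beam v w c Q -> leg a b c Q.
Proof. by move=> nv [t A ->]; apply: (arm_leg XM nv A). Qed.

Lemma beam_dir v w c Q z : beam v w c Q -> z \in Q -> z \in dir v w.
Proof. by case=> t [_ _ H _ _] _ /H. Qed.

Lemma beam_VM v w c Q z : beam v w c Q -> z \in Q -> z \in VM M.
Proof. by move=> B zQ; apply: dir_VM (beam_dir B zQ). Qed.

Lemma beam_head v w c Q z : beam v w c Q -> z \in Q -> (z \in Mv v) = (z == head z Q).
Proof. by case=> t [_ _ _ H _] _ /H. Qed.

Lemma beam_nonnil v w c Q : beam v w c Q -> Q != [::].
Proof. by case=> t []. Qed.

Lemma beam_uniq v w c Q : beam v w c Q -> uniq Q.
Proof. by case=> t [/ipath_uniq]. Qed.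

Lemma beam_hd v w c Q z : beam v w c Q -> z \in Q -> z \in Mv v -> exists Q', Q = z :: Q'.
Proof.
move=> B zQ zv; have := beam_head B zQ; rewrite zv.
by case: (Q) zQ => // y Q' _ /esym/eqP /= ->; exists Q'.
Qed.

Lemma beam_touch v w w' c c' Q Q' : v -- w -> v -- w' -> w != w' ->
  beam v w c Q -> beam v w' c' Q' -> touch Q Q'.
Proof.
move=> e1 e2 ne B B' x y xQ yQ; have [-> ->] := dir_adj SM e1 e2 ne (beam_dir B xQ) (beam_dir B' yQ).
by rewrite (beam_head B) // (beam_head B').
Qed.

Lemma beam_strip v w c Q z s t : v \notin leaves J -> beam v w c Q -> z \in Q ->
  t \in leaves J -> s -- t -> z \in Mvv s t -> (t \in alpha) = c.
Proof.
move=> nv [t0 [_ _ _ _ [_ _ _ H]] ->] zQ lt st zst.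
by rewrite (H z zQ s t lt _ st zst) //; apply: contraNneq nv => <-.
Qed.

Lemma beam_inS v w c Q z : v \notin leaves J -> beam v w c Q -> z \in Q ->
  (inS alpha z -> c) /\ (inS beta z -> ~~ c).
Proof.
move=> nv B zQ; split=> -[s [t [tA st zst]]].
  by rewrite -(beam_strip nv B zQ (alpha_leaf XM tA) st zst).
rewrite -(beam_strip nv B zQ (beta_leaf XM tA) st zst).
by apply/negP => /(alpha_betaF XM).
Qed.

Lemma beam_a v w c Q z : v \notin leaves J -> beam v w c Q -> z \in Q ->
  a -- z = (z == last z Q) && c.
Proof.
move=> nv B zQ; have [_ _ [C F]] := beam_leg nv B.
by case: c B C F => B C F /=; rewrite ?andbT ?andbF; [case: (C z zQ) | case: (F z zQ)].
Qed.

Lemma beam_b v w c Q z : v \notin leaves J -> beam v w c Q -> z \in Q ->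
  b -- z = (z == last z Q) && ~~ c.
Proof.
move=> nv B zQ; have [_ _ [C F]] := beam_leg nv B.
by case: c B C F => B C F /=; rewrite ?andbT ?andbF; [case: (F z zQ) | case: (C z zQ)].
Qed.

Lemma beams v w x : v -- w -> x \in dir v w ->
  exists c Q, [/\ beam v w c Q, x \in Q & c -> inS alpha x].
Proof.
move=> vw hx; have [t [Q [A xQ H]]] := arm_through SM XM vw hx.
exists (t \in alpha), Q; split=> //; first by exists t.
move=> ta; case: H => [tb|[_ [s [st xst]]]]; last by exists s, t.
by case: (alpha_betaF XM ta tb).
Qed.

Lemma beta_beam v w x : v \notin leaves J -> v -- w -> x \in dir v w -> ~ inS alpha x ->
  exists Q, beam v w false Q /\ x \in Q.
Proof.
move=> nv vw hx nS; have [c [Q [B xQ H]]] := beams vw hx.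
by case: c B H => [_ /(_ isT)|B _]; [move=> /nS | exists Q].
Qed.

Lemma aE x : x \in VM M -> reflect (exists s t, [/\ t \in alpha, s -- t, x \in Mvv s t & x \in Mv t]) (a -- x).
Proof.
move=> xV; have [_ ->] := aVM XM xV.
apply: (iffP existsP) => [[t /andP[ta xt]]|[s [t [ta _ _ xt]]]]; last by exists t; rewrite ta.
by have [s ts xs] := Mv_strip SM xt; exists s, t; rewrite edgeC MvvC.
Qed.

Lemma bE x : x \in VM M -> reflect (exists s t, [/\ t \in beta, s -- t, x \in Mvv s t & x \in Mv t]) (b -- x).
Proof.
move=> xV; have [_ ->] := bVM XM xV.
apply: (iffP existsP) => [[t /andP[ta xt]]|[s [t [ta _ _ xt]]]]; last by exists t; rewrite ta.
by have [s ts xs] := Mv_strip SM xt; exists s, t; rewrite edgeC MvvC.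
Qed.

Lemma leaf_strip_uniq s t s' t' x : t \in leaves J -> t' \in leaves J -> s -- t -> s' -- t' ->
  x \in Mvv s t -> x \in Mvv s' t' -> s = s' /\ t = t'.
Proof.
move=> lt lt' e e' h h'; case: (strip_eq SM e e' h h') => // -[e1 e2]; subst.
by case: (leaf_leafF SM lt' lt e).
Qed.

Lemma inS_excl x : inS alpha x -> inS beta x -> False.
Proof.
move=> [s [t [ta st h]]] [s' [t' [tb st' h']]].
have [_ e] := leaf_strip_uniq (alpha_leaf XM ta) (beta_leaf XM tb) st st' h h'.
by subst; apply: (alpha_betaF XM ta tb).
Qed.

Lemma a_inS x : x \in VM M -> a -- x -> inS alpha x.
Proof. by move=> xV /(aE xV)[s [t [ta st h _]]]; exists s, t. Qed.

Lemma b_inS x : x \in VM M -> b -- x -> inS beta x.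
Proof. by move=> xV /(bE xV)[s [t [ta st h _]]]; exists s, t. Qed.

Lemma ab_excl x : x \in VM M -> a -- x -> b -- x = false.
Proof. by move=> xV h; apply/negP => h'; apply: (inS_excl (a_inS xV h) (b_inS xV h')). Qed.

Lemma facing s s' : s != s' -> exists g g', [/\ s -- g, s' \in side s g, s' -- g' & s \in side s' g'].
Proof.
move=> ne; have [g sg h] : exists2 g, s -- g & s' \in side s g.
  by apply: side_cover => //; rewrite eq_sym.
by have [g' sg' h'] := side_cover treeJ ne; exists g, g'.
Qed.

Lemma beam_apart s g s' g' w w' c c' Q Q' : s -- g -> s' \in side s g -> s' -- g' ->
  s \in side s' g' -> s -- w -> w != g -> s' -- w' -> w' != g' ->
  beam s w c Q -> beam s' w' c' Q' -> apart Q Q'.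
Proof.
move=> e1 h1 e2 h2 e3 n3 e4 n4 B B' x y xQ yQ.
apply: (arm_apart SM e1 e3 n3 (dir_far SM e1 h1 e2 h2 e4 n4)).
  exact: beam_dir B xQ.
exact: beam_dir B' yQ.
Qed.

(** A vertex has at most one neighbour in alpha, so once w1 or w2 is in alpha any third neighbour is
    outside. *)
Lemma third_beta v w1 w2 : v \notin leaves J -> (w1 \in alpha) || (w2 \in alpha) ->
  v -- w1 -> v -- w2 -> exists w3, [/\ v -- w3, w3 != w1, w3 != w2 & w3 \notin alpha].
Proof.
move=> nv h e1 e2; have [w3 [e3 n1 n2]] := third_dir SM XM w1 w2 nv.
exists w3; split=> //; apply/negP => h3.
case/orP: h => h; first by rewrite (alpha_uniq XM e3 e1 h3 h) eqxx in n1.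
by rewrite (alpha_uniq XM e3 e2 h3 h) eqxx in n2.
Qed.

Lemma head_noS v w x : v \notin leaves J -> v -- w -> w \notin alpha -> x \in Mvv v w ->
  x \in Mv v -> ~ inS alpha x.
Proof.
move=> nv vw nw xe _ [s [t [ta st h]]]; case: (strip_eq SM vw st xe h) => -[e1 e2]; subst.
  by rewrite ta in nw.
by rewrite (alpha_leaf XM ta) in nv.
Qed.

Lemma dir_beam v w : v \notin leaves J -> v -- w -> w \notin alpha ->
  exists Q, beam v w false Q.
Proof.
move=> nv vw nw; have [x [xe xv]] := head_exists SM vw.
have [Q [B _]] := beta_beam nv vw (strip_dir vw xe) (head_noS nv vw nw xe xv).
by exists Q.
Qed.

Lemma head_beam v w x : v \notin leaves J -> v -- w -> w \notin alpha -> x \in Mvv v w -> x \in Mv v ->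
  exists Q, beam v w false (x :: Q).
Proof.
move=> nv vw nw xe xv.
have [Q [B xQ]] := beta_beam nv vw (strip_dir vw xe) (head_noS nv vw nw xe xv).
by have [Q' e] := beam_hd B xQ xv; exists Q'; rewrite -e.
Qed.

End Beams.

(** This is [arm_through] for the exchanged cross-edge ba, so that beams keep the same meaning of
    the code. *)
Lemma alpha_beam (J G : sgraph) (M : strip_family J G) alpha beta a b v w x :
  is_strip_system M -> cross_edge M alpha beta a b ->
  v \notin leaves J -> v -- w -> x \in dir M v w -> ~ inS M beta x ->
  exists Q, beam M alpha v w true Q /\ x \in Q.
Proof.
move=> SM XM nv vw hx nS; have [t [Q [A xQ H]]] := arm_through SM (cross_edge_sym XM) vw hx.
exists Q; split=> //; exists t => //; case: H => [-> //|[tb [s [st h]]]].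
by case: nS; exists s, t.
Qed.

Lemma alpha_head_beam (J G : sgraph) (M : strip_family J G) alpha beta a b v w x :
  is_strip_system M -> cross_edge M alpha beta a b ->
  v \notin leaves J -> v -- w -> w \notin beta -> x \in Me M [set v; w] -> x \in Mv M v ->
  exists Q, beam M alpha v w true (x :: Q).
Proof.
move=> SM XM nv vw nw xe xv.
have [Q [B xQ]] := alpha_beam SM XM nv vw (strip_dir vw xe) (head_noS SM (cross_edge_sym XM) nv vw nw xe xv).
by have [Q' e] := beam_hd B xQ xv; exists Q'; rewrite -e.
Qed.

(** * Attachments seen by neither a nor b *)

Section Attach.
Variables (J G : sgraph) (ehf : even_hole_free G) (M : strip_family J G).
Variables (alpha beta : {set J}) (a b : G).
Hypothesis SM : is_strip_system M.
Hypothesis XM : cross_edge M alpha beta a b.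
Implicit Types (p q r s t u v w g : J) (x y z f : G) (Q R fs : seq G) (c d : bool).

Notation Mv := (Mv M).
Notation dir := (dir M).
Notation bad := (bad M).
Notation beam := (beam M alpha).
Notation attached := (attached M a b).

Let ab : a -- b. Proof. by case: XM. Qed.

Definition seenH fs x := has (fun f => (f == head f fs) && (f -- x)) fs.
Definition seenL fs x := has (fun f => (f == last f fs) && (f -- x)) fs.

Lemma seenH_rev fs x : seenH (rev fs) x = seenL fs x.
Proof. by rewrite /seenH has_rev; apply: eq_has => f; rewrite head_rev. Qed.

Lemma seenL_rev fs x : seenL (rev fs) x = seenH fs x.
Proof. by rewrite /seenL has_rev; apply: eq_has => f; rewrite last_rev. Qed.

Lemma seenH_sees fs x : seenH fs x -> sees fs x.
Proof. by case/hasP => f ff /andP[_ fx]; apply/hasP; exists f. Qed.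

Lemma seenL_sees fs x : seenL fs x -> sees fs x.
Proof. by case/hasP => f ff /andP[_ fx]; apply/hasP; exists f. Qed.

Lemma onlyH_seenH fs x : onlyH fs x -> sees fs x -> seenH fs x.
Proof. by case=> _ H /hasP[f ff fx]; apply/hasP; exists f; rewrite // fx andbT; apply/eqP; apply: H. Qed.

Lemma onlyL_seenL fs x : onlyL fs x -> sees fs x -> seenL fs x.
Proof. by case=> _ H /hasP[f ff fx]; apply/hasP; exists f; rewrite // fx andbT; apply/eqP; apply: H. Qed.

Lemma att_out fs z : attached fs -> z \in VM M -> z \notin fs.
Proof. by case=> _ _ H _ zV; apply/negP => /H[]; rewrite zV. Qed.

(** The members of a bad pair are seen from opposite ends only, so a partner seen by the last vertex
    confines p to the head. *)
Lemma bad_onlyH fs (p q : G) : attached fs -> p \in VM M -> q \in VM M -> bad p q -> seenL fs q -> onlyH fs p.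
Proof.
move=> Af pV qV bd /hasP[l lf /andP[/eqP le lq]]; split; first exact: att_out Af pV.
move=> f ff fp; have [_ _ _ mn] := Af.
case: (mn p q f l pV qV bd ff lf fp lq) => -[e1 e2] //.
rewrite e1 (last_def _ l (mem_nonnil ff)) -le e2; exact: head_def (mem_nonnil ff).
Qed.

Lemma bad_onlyL fs (p q : G) : attached fs -> p \in VM M -> q \in VM M -> bad p q -> seenH fs q -> onlyL fs p.
Proof.
move=> Af pV qV bd hq; rewrite -[fs]revK; apply: onlyH_rev.
by apply: (bad_onlyH (attached_rev Af) pV qV bd); rewrite seenL_rev.
Qed.

Lemma bad_seen fs (p q : G) : attached fs -> p \in VM M -> q \in VM M -> bad p q -> sees fs p -> sees fs q ->
  seenH fs p /\ seenL fs q \/ seenL fs p /\ seenH fs q.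
Proof.
move=> [_ _ _ mn] pV qV bd /hasP[f ff fp] /hasP[f' ff' fq].
case: (mn p q f f' pV qV bd ff ff' fp fq) => -[e1 e2]; [left | right];
by split; apply/hasP; [exists f | exists f']; rewrite // ?fp ?fq -?e1 -?e2 eqxx.
Qed.

Lemma singleton fs (p : G) : attached fs -> onlyH fs p -> onlyL fs p -> sees fs p ->
  exists2 f, fs = [:: f] & f -- p.
Proof.
move=> [pf _ _ _] [_ H] [_ L] /hasP[f ff fp]; exists f => //.
have e1 := H f ff fp; have e2 := L f ff fp.
have := ipath_uniq pf; case: fs ff {pf H L} e1 e2 => //= g fs _ -> e /andP[gn _].
by case: fs e gn => //= h fs -> ; rewrite mem_last.
Qed.

Lemma beam_onlyH fs v w w' c Q y : attached fs -> v -- w -> v -- w' -> w != w' -> beam v w c Q ->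
  y \in dir v w' -> y \notin Mv v -> seenL fs y -> {in Q, forall z, onlyH fs z}.
Proof.
move=> Af e1 e2 ne B hy ny sy z zQ.
apply: (bad_onlyH Af (beam_VM B zQ) (dir_VM hy) _ sy).
by apply: (badI e1 e2 ne (beam_dir B zQ) hy); right.
Qed.

Lemma beam_onlyL fs v w w' c Q x : attached fs -> v -- w -> v -- w' -> w != w' -> beam v w c Q ->
  x \in dir v w' -> x \notin Mv v -> seenH fs x -> {in Q, forall z, onlyL fs z}.
Proof.
move=> Af e1 e2 ne B hx nx sx z zQ.
apply: (bad_onlyL Af (beam_VM B zQ) (dir_VM hx) _ sx).
by apply: (badI e1 e2 ne (beam_dir B zQ) hx); right.
Qed.

Lemma beam_nohead v w c Q z : beam v w c Q -> z \in Q -> z \notin Mv v -> z != head z Q.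
Proof. by move=> B zQ; rewrite (beam_head B zQ). Qed.

Lemma beam_nolast v w c Q z : v \notin leaves J -> beam v w c Q -> z \in Q ->
  ~~ (a -- z) -> ~~ (b -- z) -> z != last z Q.
Proof.
move=> nv B zQ; rewrite (beam_a XM nv B zQ) (beam_b XM nv B zQ).
by case: eqP => // _; case: (c).
Qed.

Lemma any_beam v w x : v \notin leaves J -> v -- w -> x \in dir v w -> exists c Q, beam v w c Q /\ x \in Q.
Proof. by move=> nv vw hx; have [c [Q [B xQ _]]] := beams SM XM vw hx; exists c, Q. Qed.

Lemma dir_any v w : v -- w -> exists c Q, beam v w c Q.
Proof.
move=> vw; have [x [xe _]] := head_exists SM vw.
by have [c [Q [B _ _]]] := beams SM XM vw (strip_dir vw xe); exists c, Q.
Qed.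

Lemma no_square (x y z w : G) : x -- y -> y -- z -> z -- w -> w -- x -> x != z -> y != w ->
  x -- z = false -> y -- w = false -> False.
Proof.
move=> xy yz zw wx nxz nyw xz yw.
suff: odd (size [:: x; y] + size [:: z; w]) by [].
have nx := edge_neq xy; have nz := edge_neq zw; have nyz := edge_neq yz.
have nwx := edge_neq wx.
apply: (ring_odd ehf) => //; first by rewrite /= xy eqxx inE nx.
  by rewrite /= zw eqxx inE nz.
move=> u v; rewrite !inE /= => /orP[]/eqP -> /orP[]/eqP -> /=.
- by rewrite nxz xz (negbTE nx) [z == w](negbTE nz) andbF.
- by rewrite eq_sym nwx edgeC wx !eqxx orbT.
- by rewrite nyz yz !eqxx.
- by rewrite nyw yw [w == z]eq_sym (negbTE nz) [y == x]eq_sym (negbTE nx) andbF.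
Qed.

(** The hole of length four would be a, x, p, b. *)
Lemma no_four_cycle x (p : G) : x \in VM M -> p \in VM M -> x -- p -> a -- x -> b -- p -> False.
Proof.
move=> xV pV xp ax bp.
have nbx : b -- x = false := ab_excl SM XM xV ax.
have nap : a -- p = false by apply/negP => ap; rewrite (ab_excl SM XM pV ap) in bp.
have [da _] := aVM XM pV; have [db _] := bVM XM xV.
have pb : p -- b by rewrite edgeC.
have ba : b -- a by rewrite edgeC.
by apply: (no_square xp pb ba ax db da); rewrite edgeC.
Qed.

Lemma heads_adj s w w' x (p : G) : s -- w -> s -- w' -> w != w' -> x \in dir s w -> p \in dir s w' ->
  x \in Mv s -> p \in Mv s -> x -- p.
Proof. by move=> e1 e2 ne hx hp xs ps; have [_ ->] := dir_adj SM e1 e2 ne hx hp; rewrite xs ps. Qed.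

Section Unseen.
Variable fs : seq G.
Hypothesis Af : attached fs.
Hypothesis fa : forall f, f \in fs -> f -- a = false.
Hypothesis fb : forall f, f \in fs -> f -- b = false.

Lemma att_loose : loose a b fs.
Proof.
have [pf f0 out _] := Af; split=> //; split=> //; apply/negP => /out[_].
  by rewrite eqxx.
by move=> _; rewrite eqxx.
Qed.

(** The vertex q forms bad pairs with both x and y, so it is seen only by the head and only by the
    last vertex: [fs] is a single vertex, which then sees three legs. *)
Lemma third_seen s t g w3 x y (q : G) : s -- t -> s -- g -> s -- w3 -> t != g -> w3 != t -> w3 != g ->
  x \in dir s t -> y \in dir s g -> q \in dir s w3 -> seenH fs x -> seenL fs y -> sees fs q ->
  y \notin Mv s -> ~~ ((x \in Mv s) && (q \in Mv s)) -> False.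
Proof.
move=> e1 e2 e3 n12 n31 n32 hx hy hq sx sy sq ny nxq.
have ns := two_nonleaf e1 e2 n12.
have qV := dir_VM hq.
have oH : onlyH fs q by apply: (bad_onlyH Af qV (dir_VM hy) (badI e3 e2 n32 hq hy (or_intror ny)) sy).
have oL : onlyL fs q.
  apply: (bad_onlyL Af qV (dir_VM hx) _ sx); apply: (badI e3 e1 n31 hq hx).
  by move: nxq; rewrite negb_and => /orP[]; [right | left].
have [f ef fq] := singleton Af oH oL sq.
have [c1 [Q1 [B1 x1]]] := any_beam ns e1 hx; have [c2 [Q2 [B2 y2]]] := any_beam ns e2 hy.
have [c3 [Q3 [B3 q3]]] := any_beam ns e3 hq.
have L1 := beam_leg XM ns B1; have L2 := beam_leg XM ns B2; have L3 := beam_leg XM ns B3.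
have lf := att_loose; rewrite ef in lf.
have fx : sees [:: f] x by rewrite -ef; apply: seenH_sees.
have fy : sees [:: f] y by rewrite -ef; apply: seenL_sees.
have fq' : sees [:: f] q by rewrite -ef.
have N v0 w0 c Q : beam v0 w0 c Q -> f \notin Q.
  by move=> B; apply/negP => /(beam_VM B) fV; have := att_out Af fV; rewrite ef mem_head.
have sx' : has (sees [:: f]) Q1 by apply/hasP; exists x.
have sq' : has (sees [:: f]) Q3 by apply/hasP; exists q.
have yh : exists2 z, z \in Q2 & (z != head z Q2) && sees [:: f] z.
  by exists y => //; rewrite fy (beam_nohead B2).
have T12 := beam_touch SM e1 e2 n12 B1 B2.
have T13 := beam_touch SM e1 e3 _ B1 B3; rewrite eq_sym in T13; have {}T13 := T13 n31.
have T32 := beam_touch SM e3 e2 n32 B3 B2.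
move: nxq; rewrite negb_and => /orP[nx|nq].
  apply: (tripod_single ehf ab lf L1 L2 L3 T12 T13 T32 (N _ _ _ _ B1) (N _ _ _ _ B2) (N _ _ _ _ B3) _ yh sq').
  by exists x => //; rewrite fx (beam_nohead B1).
apply: (tripod_single ehf ab lf L3 L2 L1 T32 (touchC T13) T12 (N _ _ _ _ B3) (N _ _ _ _ B2) (N _ _ _ _ B1) _ yh sx').
by exists q => //; rewrite fq' (beam_nohead B3).
Qed.

(** The configuration of [tripod_body] at s; the third beam is unseen by [third_seen]. *)
Lemma body s t g w3 x y c1 c2 c3 Q1 Q2 Q3 : s -- t -> s -- g -> s -- w3 -> t != g -> w3 != t -> w3 != g ->
  beam s t c1 Q1 -> beam s g c2 Q2 -> beam s w3 c3 Q3 -> x \in Q1 -> y \in Q2 ->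
  seenH fs x -> seenL fs y -> x \notin Mv s -> y \notin Mv s ->
  [\/ ((exists2 z, z \in Q1 & (z != last z Q1) && sees fs z) \/ c1 != c2 /\ c1 != c3) /\
      ((exists2 z, z \in Q2 & (z != last z Q2) && sees fs z) \/ c2 != c1 /\ c2 != c3)
    | (forall z, z \in Q1 -> sees fs z -> z = last z Q1) /\
      (forall z, z \in Q2 -> sees fs z -> z = last z Q2)] -> False.
Proof.
move=> e1 e2 e3 n12 n31 n32 B1 B2 B3 x1 y2 sx sy nx ny V.
have ns := two_nonleaf e1 e2 n12.
have hx := beam_dir B1 x1; have hy := beam_dir B2 y2.
have T13 := beam_touch SM e1 e3 _ B1 B3; rewrite eq_sym in T13; have {}T13 := T13 n31.
apply: (tripod_body ehf ab att_loose (beam_leg XM ns B1) (beam_leg XM ns B2) (beam_leg XM ns B3)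
  (beam_touch SM e1 e2 n12 B1 B2) T13 (beam_touch SM e3 e2 n32 B3 B2) _ _ _ _ _ V).
- exact: beam_onlyH Af e1 e2 n12 B1 hy ny sy.
- by apply: beam_onlyL Af e2 e1 _ B2 hx nx sx; rewrite eq_sym.
- move=> z z3; apply: noF_sees; first exact: att_out Af (beam_VM B3 z3).
  apply/negP => sz; apply: (third_seen e1 e2 e3 n12 n31 n32 hx hy (beam_dir B3 z3) sx sy sz ny).
  by rewrite (negbTE nx).
- by exists x => //; rewrite (seenH_sees sx) (beam_nohead B1).
- by exists y => //; rewrite (seenL_sees sy) (beam_nohead B2).
Qed.

Lemma headed s t g w3 x y c1 c2 c3 Q1 Q2 Q3 : s -- t -> s -- g -> s -- w3 -> t != g -> w3 != t -> w3 != g ->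
  beam s t c1 (x :: Q1) -> beam s g c2 Q2 -> beam s w3 c3 Q3 -> y \in Q2 ->
  seenH fs x -> seenL fs y -> y \notin Mv s ->
  {in Q1, forall z, ~~ sees fs z} -> {in Q3, forall z, ~~ sees fs z} ->
  Q1 != [::] \/ c1 != c2 /\ c1 != c3 -> False.
Proof.
move=> e1 e2 e3 n12 n31 n32 B1 B2 B3 y2 sx sy ny u1 u3 V.
have ns := two_nonleaf e1 e2 n12; have hy := beam_dir B2 y2.
have hx := beam_dir B1 (mem_head _ _).
have T13 := beam_touch SM e1 e3 _ B1 B3; rewrite eq_sym in T13; have {}T13 := T13 n31.
have O1 := beam_onlyH Af e1 e2 n12 B1 hy ny sy.
apply: (tripod_head ehf ab att_loose (beam_leg XM ns B1) (beam_leg XM ns B2) (beam_leg XM ns B3)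
  (beam_touch SM e1 e2 n12 B1 B2) T13 (beam_touch SM e3 e2 n32 B3 B2) _ _ _ _ _ V).
- by apply: onlyH_atH (seenH_sees sx); apply: O1; rewrite mem_head.
- move=> z z1; apply: noF_sees (u1 z z1); apply: att_out Af (beam_VM B1 _).
  by rewrite inE z1 orbT.
- by move=> z z3; apply: noF_sees (u3 z z3); apply: att_out Af (beam_VM B3 z3).
- move=> z z2 zh; apply: (bad_onlyL Af (beam_VM B2 z2) (dir_VM hx) _ sx).
  rewrite eq_sym in n12; apply: (badI e2 e1 n12 (beam_dir B2 z2) hx); left.
  by rewrite (beam_head B2 z2).
- by exists y => //; rewrite (seenL_sees sy) (beam_nohead B2).
Qed.

End Unseen.

End Attach.

Definition detached (J G : sgraph) (M : strip_family J G) (a b : G) fs :=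
  [/\ attached M a b fs, forall f, f \in fs -> f -- a = false
    & forall f, f \in fs -> f -- b = false].

Lemma detached_rev (J G : sgraph) (M : strip_family J G) (a b : G) fs :
  detached M a b fs -> detached M a b (rev fs).
Proof.
case=> A fa fb; split; first exact: attached_rev.
  by move=> f; rewrite mem_rev => /fa.
by move=> f; rewrite mem_rev => /fb.
Qed.

Lemma detached_swap (J G : sgraph) (M : strip_family J G) (a b : G) fs :
  detached M a b fs -> detached M b a fs.
Proof. by case=> A fa fb; split=> //; exact: attached_swap. Qed.

(** * Nonlocal pairs with both members off M_v *)

Section Detached.
Variables (J G : sgraph) (ehf : even_hole_free G) (M : strip_family J G).
Variables (alpha beta : {set J}) (a b : G).
Hypothesis SM : is_strip_system M.
Hypothesis XM : cross_edge M alpha beta a b.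
Variable fs : seq G.
Hypothesis D : detached M a b fs.
Implicit Types (p q r s t u v w g : J) (x y z f : G) (Q R : seq G) (c d : bool).

Notation Mv := (Mv M).
Notation Mvv u v := (Me M [set u; v]).
Notation dir := (dir M).
Notation inS := (inS M).
Notation beam := (beam M alpha).

Let ab : a -- b. Proof. by case: XM. Qed.
Let Af : attached M a b fs. Proof. by case: D. Qed.
Let fa : forall f, f \in fs -> f -- a = false. Proof. by case: D. Qed.
Let fb : forall f, f \in fs -> f -- b = false. Proof. by case: D. Qed.

Lemma leaf_dir s t z : t \in leaves J -> s -- t -> z \in dir s t -> z \in Mvv s t.
Proof.
move=> lt st /(dir_split SM st)[//|[r [tr rs _]]].
by rewrite (leaf_uniq lt tr (_ : t -- s)) ?eqxx // edgeC in rs.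
Qed.

(** Being adjacent to neither letter, x and y do not end their beams, which is the first alternative
    of [body]. *)
Lemma pair_interior v w1 w2 x y : v -- w1 -> v -- w2 -> w1 != w2 -> x \in dir v w1 -> y \in dir v w2 ->
  x \notin Mv v -> y \notin Mv v -> seenH fs x -> seenL fs y ->
  ~~ (a -- x) -> ~~ (b -- x) -> ~~ (a -- y) -> ~~ (b -- y) -> False.
Proof.
move=> e1 e2 ne hx hy nx ny sx sy ax bx ay by'.
have nv := two_nonleaf e1 e2 ne.
have [w3 [e3 n31 n32]] := third_dir SM XM w1 w2 nv.
have [c1 [Q1 [B1 x1]]] := any_beam SM XM nv e1 hx.
have [c2 [Q2 [B2 y2]]] := any_beam SM XM nv e2 hy.
have [c3 [Q3 B3]] := dir_any SM XM e3.
apply: (body ehf SM XM Af fa fb e1 e2 e3 ne n31 n32 B1 B2 B3 x1 y2 sx sy nx ny).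
left; split; left; [exists x | exists y] => //.
  by rewrite (beam_nolast XM nv B1) ?seenH_sees.
by rewrite (beam_nolast XM nv B2) ?seenL_sees.
Qed.

(* The condition [forall w3 q] says that directions other than t, g at s are unseen off the alpha strips. *)
Lemma end_against s t g x (p : G) : t \in alpha -> s -- t -> s -- g -> g != t ->
  x \in Mvv s t -> a -- x -> seenH fs x ->
  p \in dir s g -> p \notin Mv s -> seenL fs p -> ~ inS alpha p ->
  ~~ (b -- p) \/ (forall z, z \in Mvv s t -> sees fs z -> a -- z) ->
  (forall w3 (q : G), s -- w3 -> w3 != t -> w3 != g -> q \in dir s w3 -> ~ inS alpha q -> ~~ sees fs q) -> False.
Proof.
move=> ta st sg gt xe ax sx hp np sp nSp O T.
have ns := nbr_nonleaf SM (alpha_leaf XM ta) st.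
have [w3 [e3 n31 n32 n3a]] := third_beta SM XM ns (introT orP (or_introl _ ta)) st sg.
have [Q3 B3] := dir_beam SM XM ns e3 n3a.
have u3 : {in Q3, forall z, ~~ sees fs z}.
  move=> z z3; apply: (T w3) => //; first exact: beam_dir B3 z3.
  by move=> h; have [/(_ h)] := beam_inS XM ns B3 z3.
have [Q2 [B2 p2]] := beta_beam SM XM ns sg hp nSp.
have hx := strip_dir st xe.
have [c1 [Q1 [B1 x1]]] := any_beam SM XM ns st hx.
have ct : c1 = true by rewrite -(beam_strip ns B1 x1 (alpha_leaf XM ta) st xe).
subst c1; rewrite eq_sym in gt.
have xl : x == last x Q1 by have := beam_a XM ns B1 x1; rewrite ax andbT => <-.
(* A neighbour of a in M_s forms a beam by itself, of length one. *)
case xs : (x \in Mv s).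
  have [Q' e] := beam_hd B1 x1 xs; subst Q1.
  have {}e : Q' = [::].
    have := beam_uniq B1; case: Q' xl {B1 x1} => //= z Q'; case: eqP => // -> _.
    by rewrite mem_last.
  subst Q'; apply: (headed ehf SM XM Af fa fb st sg e3 gt n31 n32 B1 B2 B3 p2 sx sp np _ u3) => //.
  by right.
apply: (body ehf SM XM Af fa fb st sg e3 gt n31 n32 B1 B2 B3 x1 p2 sx sp _ np); rewrite ?xs //.
(* If the beam of p is seen at its last vertex only, this vertex is p, a neighbour of b. By O leg 1
   is then seen at its last vertex only as well, which is the second alternative of [body]. *)
case h : (has (fun z => (z != last z Q2) && sees fs z) Q2).
  by left; split; [right | left; apply/hasP].
case: O => [nb|O].
  case/hasP: h; exists p => //; rewrite (seenL_sees sp) andbT.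
  by move: nb; rewrite (beam_b XM ns B2 p2) andbT.
right; split=> z zQ sz.
  apply/eqP; have := beam_a XM ns B1 zQ; rewrite andbT => <-; apply: O => //.
  exact: leaf_dir (alpha_leaf XM ta) st (beam_dir B1 zQ).
by apply/eqP/negPn/negP => n; move/hasP: h; case; exists z; rewrite ?n.
Qed.

Lemma leaf_side t s r : t \in leaves J -> s -- t -> r \in side s t -> r = t.
Proof.
move=> lt st; rewrite inE => /connectP[[|u p] /= pp ->] //.
case/andP: pp => /and3P[_]; rewrite !inE => us tu _.
by rewrite (leaf_uniq lt tu (_ : t -- s)) ?eqxx // edgeC in us.
Qed.

(** Two strips at leaves of alpha that face each other. The first seen vertex on the beam of y does
    not end it, since y is seen and not adjacent to a; so its detour leaves to b without contact to
    a, and [double_loose] applies. *)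
Lemma double_end_beams s t g s' t' g' w3 w4 x y Q3 Q4 : t \in alpha -> t' \in alpha -> s -- t -> s' -- t' ->
  s -- g -> s' \in side s g -> s' -- g' -> s \in side s' g' ->
  x \in Mvv s t -> y \in Mvv s' t' -> a -- x -> ~~ (a -- y) -> seenH fs x -> seenL fs y ->
  (forall z, z \in Mvv s t -> sees fs z -> a -- z) ->
  s -- w3 -> w3 != t -> w3 != g ->
  beam s w3 false Q3 -> {in Q3, forall z, ~~ sees fs z} ->
  s' -- w4 -> w4 != t' -> w4 != g' ->
  beam s' w4 false Q4 -> {in Q4, forall z, ~~ sees fs z} -> False.
Proof.
move=> ta ta' st st' sg h1 sg' h2 xe ye ax nay sx sy O e3 n31 n32 B3 U3 e4 n41 n42 B4 U4.
have lt := alpha_leaf XM ta; have lt' := alpha_leaf XM ta'.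
have ns := nbr_nonleaf SM lt st; have ns' := nbr_nonleaf SM lt' st'.
have tg : t != g.
  apply/eqP => e; subst g; have e := leaf_side lt st h1; subst s'.
  by rewrite lt in ns'.
have tg' : t' != g'.
  apply/eqP => e; subst g'; have e := leaf_side lt' st' h2; subst s.
  by rewrite lt' in ns.
have [F1 F2] := dir_far SM sg h1 sg' h2 st' tg'.
have hx := strip_dir st xe; have hy := strip_dir st' ye.
have oL z : z \in dir s' t' -> onlyL fs z.
  move=> hz; apply: (bad_onlyL Af (dir_VM hz) (dir_VM hx) _ sx); apply: bad_sym.
  by apply: (badI st sg tg hx (F1 _ hz)); right; apply: F2.
have oH : onlyH fs x.
  apply: (bad_onlyH Af (dir_VM hx) (dir_VM hy) _ sy).
  by apply: (badI st sg tg hx (F1 _ hy)); right; apply: F2.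
have unseen v w Q : beam v w false Q -> {in Q, forall z, ~~ sees fs z} -> {in Q, forall z, noF fs z}.
  by move=> B U z zQ; apply: noF_sees (U z zQ); apply: att_out Af (beam_VM B zQ).
have [c1 [Q1 [B1 x1]]] := any_beam SM XM ns st hx.
have [c5 [Q5 [B5 y5]]] := any_beam SM XM ns' st' hy.
have c1E : c1 = true by rewrite -(beam_strip ns B1 x1 lt st xe).
have c5E : c5 = true by rewrite -(beam_strip ns' B5 y5 lt' st' ye).
subst c1 c5.
have xl : x = last x Q1 by apply/eqP; have := beam_a XM ns B1 x1; rewrite ax andbT => <-.
have yl : y != last y Q5 by move: nay; rewrite (beam_a XM ns' B5 y5) andbT.
have S5 : has (sees fs) Q5 by apply/hasP; exists y; rewrite ?seenL_sees.
have [q5 [z [r5 [e5 sz u5]]]] := first_split S5.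
have r5n : r5 != [::].
  apply: contraNneq yl => r50; move: y5 u5; rewrite e5 r50 mem_cat inE => /orP[h /(_ y h)|/eqP-> _].
    by rewrite seenL_sees.
  by rewrite last_cat.
have [q1 e1] : exists q1 : seq G, Q1 = q1 ++ [:: x].
  case: (lastP Q1) (x1) xl => // q1 z'; rewrite last_rcons => _ ->.
  by exists q1; rewrite cats1.
have n34 : {in q1, forall z, noF fs z}.
  move=> z' zq; have zQ : z' \in Q1 by rewrite e1 mem_cat zq.
  apply: noF_sees; first exact: att_out Af (beam_VM B1 zQ).
  apply/negP => /(O z' (leaf_dir lt st (beam_dir B1 zQ))); rewrite (beam_a XM ns B1 zQ) andbT.
  rewrite e1 last_cat /= => /eqP e; move: (beam_uniq B1).
  by rewrite e1 cat_uniq /= orbF -e zq andbF.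
have n5 : {in q5, forall z, noF fs z}.
  move=> z' zq; have zQ : z' \in Q5 by rewrite e5 mem_cat zq.
  by apply: noF_sees (u5 _ zq); apply: att_out Af (beam_VM B5 zQ).
have z5 : z \in Q5 by rewrite e5 in_split.
rewrite eq_sym in n31; rewrite eq_sym in n41.
have T13 := beam_touch SM st e3 n31 B1 B3; have T54 := beam_touch SM st' e4 n41 B5 B4.
have A15 := beam_apart SM sg h1 sg' h2 st tg st' tg' B1 B5.
have A14 := beam_apart SM sg h1 sg' h2 st tg e4 n42 B1 B4.
have A35 := beam_apart SM sg h1 sg' h2 e3 n32 st' tg' B3 B5.
have A34 := beam_apart SM sg h1 sg' h2 e3 n32 e4 n42 B3 B4.
have L1 := beam_leg XM ns B1; have L5 := beam_leg XM ns' B5.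
move: L1 L5 T13 T54 A15 A14 A35; rewrite e1 e5 => L1 L5 T13 T54 A15 A14 A35.
apply: (double_loose ehf ab (att_loose Af fa fb) L1 (beam_leg XM ns B3) L5 (beam_leg XM ns' B4) T13 T54 A15 A14 A35 A34 r5n _ _ n34 n5 (unseen _ _ _ B3 U3) (unseen _ _ _ B4 U4)).
- exact: onlyH_atH oH (seenH_sees sx).
- exact: onlyL_atL (oL _ (beam_dir B5 z5)) sz.
Qed.

Lemma beam_unseen v w Q : v \notin leaves J -> {in dir v w, forall z, ~ inS alpha z -> ~~ sees fs z} ->
    beam v w false Q -> {in Q, forall z, ~~ sees fs z}.
Proof.
move=> nv U B z zQ; apply: U (beam_dir B zQ) _ => h.
by have [/(_ h)] := beam_inS XM nv B zQ.
Qed.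

Lemma double_end s t g s' t' g' w3 w4 x y : t \in alpha -> t' \in alpha -> s -- t -> s' -- t' ->
  s -- g -> s' \in side s g -> s' -- g' -> s \in side s' g' ->
  x \in Mvv s t -> y \in Mvv s' t' -> a -- x -> ~~ (a -- y) -> seenH fs x -> seenL fs y ->
  (forall z, z \in Mvv s t -> sees fs z -> a -- z) ->
  s -- w3 -> w3 != t -> w3 != g -> w3 \notin alpha ->
  {in dir s w3, forall z, ~ inS alpha z -> ~~ sees fs z} ->
  s' -- w4 -> w4 != t' -> w4 != g' -> w4 \notin alpha ->
  {in dir s' w4, forall z, ~ inS alpha z -> ~~ sees fs z} -> False.
Proof.
move=> ta ta' st st' sg h1 sg' h2 xe ye ax nay sx sy O e3 n31 n32 n3a U3 e4 n41 n42 n4a U4.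
have ns := nbr_nonleaf SM (alpha_leaf XM ta) st; have ns' := nbr_nonleaf SM (alpha_leaf XM ta') st'.
have [Q3 B3] := dir_beam SM XM ns e3 n3a; have [Q4 B4] := dir_beam SM XM ns' e4 n4a.
exact: (double_end_beams ta ta' st st' sg h1 sg' h2 xe ye ax nay sx sy O e3 n31 n32 B3
  (beam_unseen ns U3 B3) e4 n41 n42 B4 (beam_unseen ns' U4 B4)).
Qed.

End Detached.

Lemma inSP (J G : sgraph) (M : strip_family J G) (A : {set J}) (x : G) :
  reflect (inS M A x) [exists s, exists t, [&& t \in A, s -- t & x \in Me M [set s; t]]].
Proof.
apply: (iffP existsP) => [[s /existsP[t /and3P[]]]|[s [t [tA st xe]]]]; first by exists s, t.
by exists s; apply/existsP; exists t; rewrite tA st.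
Qed.

Section Interior.
Variables (J G : sgraph) (ehf : even_hole_free G) (M : strip_family J G).
Variables (alpha beta : {set J}) (a b : G).
Hypothesis SM : is_strip_system M.
Hypothesis XM : cross_edge M alpha beta a b.
Variable fs : seq G.
Hypothesis D : detached M a b fs.
Implicit Types (p q r s t u v w g : J) (x y z f : G) (Q R : seq G) (c d : bool).

Notation Mv := (Mv M).
Notation Mvv u v := (Me M [set u; v]).
Notation dir := (dir M).
Notation inS := (inS M).

Let Af : attached M a b fs. Proof. by case: D. Qed.
Let fa : forall f, f \in fs -> f -- a = false. Proof. by case: D. Qed.
Let fb : forall f, f \in fs -> f -- b = false. Proof. by case: D. Qed.
Let treeJ : is_tree J. Proof. by case: SM => -[]. Qed.

(** The end s of the leaf strip of x becomes the new base point: seen from there, y is still in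
    another direction and off the star. *)
Lemma toward v w1 w2 s t x y : v -- w1 -> v -- w2 -> w1 != w2 -> s -- t -> t \in leaves J ->
  x \in Mvv s t -> x \in dir v w1 -> y \in dir v w2 -> y \notin Mv v ->
  exists g, [/\ s -- g, t != g, y \in dir s g, y \notin Mv s &
   (s = v /\ t = w1 /\ g = w2) \/
   [/\ s != v, v \in side s g, s \in side v w1 &
    forall w3, s -- w3 -> w3 != g -> forall z, z \in dir s w3 -> z \in dir v w1 /\ z \notin Mv v]].
Proof.
move=> e1 e2 ne st lt xe hx hy ny; have nv := two_nonleaf e1 e2 ne.
case: (dir_edge SM e1 st xe hx) => [[? ?]|[[? _]|[hs ht]]]; first 1 last.
- by subst t; rewrite lt in nv.
- have sv : s != v := side_neq e1 hs.
  have [g [g' [sg h1 vg' h2]]] := facing SM sv.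
  have ? := side_disj treeJ e1 vg' hs h2; subst g'.
  have ne' : w2 != w1 by rewrite eq_sym.
  have [F1 F2] := dir_far SM sg h1 e1 h2 e2 ne'.
  have tg : t != g.
    by apply: contraNneq nv => e; subst g; rewrite (leaf_side lt st h1).
  exists g; split=> //; [exact: F1 | exact: F2 | right; split=> // w3 e3 n3 z hz].
  by have [F3 F4] := dir_far SM e1 hs sg h1 e3 n3; split; [apply: F3 | apply: F4].
by subst; exists w2; split=> //; left.
Qed.

(** By [pair_interior], the seen vertices on the side of x off M_v are neighbours of a or b. If y is
    in no strip at an alpha leaf, then [end_against] applies at s; otherwise two strips at alpha
    leaves face each other and [double_end] applies. *)
Lemma end_interior v w1 w2 x y : v -- w1 -> v -- w2 -> w1 != w2 -> x \in dir v w1 -> y \in dir v w2 ->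
  x \notin Mv v -> y \notin Mv v -> seenH fs x -> seenL fs y ->
  a -- x -> ~~ (a -- y) -> ~~ (b -- y) -> False.
Proof.
move=> e1 e2 ne hx hy nx ny sx sy ax nay nby.
have nv := two_nonleaf e1 e2 ne.
have [s [t [ta st xe xt]]] := aE SM XM (dir_VM hx) ax.
have lt := alpha_leaf XM ta; have ns := nbr_nonleaf SM lt st.
have E z : z \in dir v w1 -> z \notin Mv v -> sees fs z -> (a -- z) || (b -- z).
  move=> hz nz sz; apply/negPn/negP; rewrite negb_or => /andP[naz nbz].
  have oH : onlyH fs z.
    by apply: (bad_onlyH Af (dir_VM hz) (dir_VM hy) _ sy); apply: (badI e1 e2 ne hz hy); left.
  exact: (pair_interior ehf SM XM D e1 e2 ne hz hy nz ny (onlyH_seenH oH sz) sy naz nbz nay nby).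
have [g [sg tg hg ng C]] := toward e1 e2 ne st lt xe hx hy ny.
have hxs := strip_dir st xe.
have T w3 (z : G) : s -- w3 -> w3 != t -> w3 != g -> z \in dir s w3 -> ~ inS alpha z -> ~~ sees fs z.
  move=> e3 n31 n32 hz nz; apply/negP => sz.
  have ts := third_seen ehf SM XM Af fa fb st sg e3 tg n31 n32 hxs hg hz sx sy sz ng.
  case: C => [[? _]|[sv _ _ C]]; first by subst s; apply: ts; rewrite (negbTE nx).
  (* If x and z are both in M_s, then z, being off M_v and in no alpha strip, is a neighbour of b,
     and a, x, z, b is a square. *)
  case: (boolP ((x \in Mv s) && (z \in Mv s))) => [/andP[xs zs]|//].
  have [hz' nz'] := C w3 e3 n32 z hz.
  case/orP: (E z hz' nz' sz) => h; first exact: nz (a_inS SM XM (dir_VM hz) h).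
  rewrite eq_sym in n31.
  by have := no_four_cycle ehf SM XM (dir_VM hx) (dir_VM hz) (heads_adj SM st e3 n31 hxs hz xs zs) ax h.
have [w3 [e3 n31 n32 n3a]] := third_beta SM XM ns (introT orP (or_introl _ ta)) st sg.
have [[s' [t' [ta' st' ye]]]|yS] := inSP M alpha y; last first.
  by apply: (end_against ehf SM XM D ta st sg _ xe ax sx hg ng sy yS _ T); [rewrite eq_sym | left].
have lt' := alpha_leaf XM ta'.
(* For s different from v this is E. For s = v a seen z in M_v that is not a neighbour of a is not
   covered by E; it begins a beam that [body] or [headed] excludes. *)
have O z : z \in Mvv s t -> sees fs z -> a -- z.
  move=> ze sz; have hz := strip_dir st ze.
  have nb : b -- z = false.
    apply/negP => /(b_inS SM XM (dir_VM hz)) zb; apply: (inS_excl SM XM _ zb).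
    by exists s, t.
  case: C => [[? [? ?]]|[sv _ _ C]]; last first.
    by have [hz' nz'] := C t st tg z hz; have := E z hz' nz' sz; rewrite nb orbF.
  subst s t g; apply/negPn/negP => naz.
  case: (boolP (z \in Mv v)) => zv; last by have := E z hz zv sz; rewrite nb orbF (negbTE naz).
  have oH z' : z' \in dir v w1 -> onlyH fs z'.
    move=> hz'; apply: (bad_onlyH Af (dir_VM hz') (dir_VM hy) _ sy).
    by apply: (badI e1 e2 ne hz' hy); right.
  have [c1 [Q1 [B1 z1]]] := any_beam SM XM nv e1 hz.
  have [Q' e] := beam_hd B1 z1 zv; subst Q1.
  have zl : z != last z (z :: Q') by apply: (beam_nolast XM nv B1 z1); rewrite ?nb.
  have [c2 [Q2 [B2 y2]]] := any_beam SM XM nv e2 hy.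
  have [Q3 B3] := dir_beam SM XM nv e3 n3a.
  case h: (has (sees fs) Q').
    case/hasP: h => z' zQ sz'.
    have zQ' : z' \in z :: Q' by rewrite inE zQ orbT.
    have hz' := beam_dir B1 zQ'.
    have nz' : z' \notin Mv v.
      rewrite (beam_head B1 zQ') /=; apply/eqP => e; have := beam_uniq B1.
      by rewrite /= -e zQ.
    apply: (body ehf SM XM Af fa fb e1 e2 e3 ne n31 n32 B1 B2 B3 zQ' y2 (onlyH_seenH (oH _ hz') sz') sy nz' ny).
    left; split; left; first by exists z => //; rewrite zl.
    by exists y => //; rewrite (beam_nolast XM nv B2) ?seenL_sees.
  apply: (headed ehf SM XM Af fa fb e1 e2 e3 ne n31 n32 B1 B2 B3 y2 (onlyH_seenH (oH _ hz) sz) sy ny).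
  - by move=> z' zQ; apply/negP => sz'; move/hasP: h; case; exists z'.
  - move=> z' z3; apply: (T w3) => //; first exact: beam_dir B3 z3.
    by move=> hh; have [/(_ hh)] := beam_inS XM nv B3 z3.
  - by left; apply: contraNneq zl => ->.
have ss' : s != s'.
  apply: contraNneq tg => e; subst s'; rewrite -(alpha_uniq XM st st' ta ta') in ye.
  by rewrite (dir_inj SM st sg (strip_dir st ye) hg).
have [g0 [g' [sg0 h1 sg' h2]]] := facing SM ss'.
have ns' := nbr_nonleaf SM lt' st'.
have tg' : t' != g'.
  by apply: contraNneq ns => e; subst g'; rewrite (leaf_side lt' st' h2).
have [F1 F2] := dir_far SM sg0 h1 sg' h2 st' tg'.
have ? := dir_inj SM sg0 sg (F1 _ (strip_dir st' ye)) hg; subst g0.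
have [w4 [e4 n41 n42 n4a]] := third_beta SM XM ns' (introT orP (or_introl _ ta')) st' sg'.
apply: (double_end ehf SM XM D ta ta' st st' sg h1 sg' h2 xe ye ax nay sx sy O e3 n31 n32 n3a _ e4 n41 n42 n4a).
  by move=> z hz; apply: (T w3).
(* A vertex z seen in the third direction at s' would take the place of y in [end_against]. *)
move=> z hz nSz; apply/negP => sz.
have [F3 F4] := dir_far SM sg h1 sg' h2 e4 n42.
have hz' := F3 _ hz; have nz' := F4 _ hz.
have oL : onlyL fs z.
  apply: (bad_onlyL Af (dir_VM hz) (dir_VM hx) _ sx); apply: bad_sym.
  by apply: (badI st sg tg hxs hz'); right.
apply: (end_against ehf SM XM D ta st sg _ xe ax sx hz' nz' (onlyL_seenL oL sz) nSz _ T).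
  by rewrite eq_sym.
by right.
Qed.

End Interior.

Lemma ends_interior (J G : sgraph) (M : strip_family J G) (alpha beta : {set J}) (a b : G) fs
    (v w1 w2 : J) (x y : G) :
  even_hole_free G -> is_strip_system M -> cross_edge M alpha beta a b -> detached M a b fs ->
  v -- w1 -> v -- w2 -> w1 != w2 -> x \in dir M v w1 -> y \in dir M v w2 ->
  x \notin Mv M v -> y \notin Mv M v -> seenH fs x -> seenL fs y ->
  (a -- x) || (b -- x) -> (a -- y) || (b -- y).
Proof.
move=> ehf SM XM D e1 e2 ne hx hy nx ny sx sy h; apply/negPn/negP; rewrite negb_or => /andP[na nb].
case/orP: h => h; first exact: (end_interior ehf SM XM D e1 e2 ne hx hy nx ny sx sy h na nb).
exact: (end_interior ehf SM (cross_edge_sym XM) (detached_swap D) e1 e2 ne hx hy nx ny sx sy h nb na).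
Qed.

Section Ends.
Variables (J G : sgraph) (ehf : even_hole_free G) (M : strip_family J G).
Variables (alpha beta : {set J}) (a b : G).
Hypothesis SM : is_strip_system M.
Hypothesis XM : cross_edge M alpha beta a b.
Variable fs : seq G.
Hypothesis D : detached M a b fs.
Implicit Types (p q r s t u v w g : J) (x y z f : G) (Q R : seq G) (c d : bool).

Notation Mv := (Mv M).
Notation dir := (dir M).
Notation inS := (inS M).

Let Af : attached M a b fs. Proof. by case: D. Qed.
Let fa : forall f, f \in fs -> f -- a = false. Proof. by case: D. Qed.
Let fb : forall f, f \in fs -> f -- b = false. Proof. by case: D. Qed.

(** Here h is a seen vertex of M_v that is adjacent to neither letter. If the strip of y is at v,
    the beams at v decide. Otherwise the pair y, h is considered from the end s of the strip of y,
    with [fs] reversed: [end_interior] excludes it if y is off M_s, and [end_against] or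
    [double_end] if y is in M_s. *)
Lemma ends_head v w1 w2 x y h : v -- w1 -> v -- w2 -> w1 != w2 -> x \in dir v w1 -> y \in dir v w2 ->
  x \notin Mv v -> y \notin Mv v -> seenH fs x -> seenL fs y -> a -- y ->
  (forall z, z \in dir v w1 -> z \notin Mv v -> sees fs z -> (a -- z) || (b -- z)) ->
  (forall z, z \in dir v w2 -> z \notin Mv v -> sees fs z -> (a -- z) || (b -- z)) ->
  h \in dir v w1 -> h \in Mv v -> sees fs h -> ~~ (a -- h) -> ~~ (b -- h) -> False.
Proof.
move=> e1 e2 ne hx hy nx ny sx sy ay E1 E2 hh hv sh nah nbh.
have nv := two_nonleaf e1 e2 ne.
have [s [t [ta st ye yt]]] := aE SM XM (dir_VM hy) ay.
have lt := alpha_leaf XM ta; have ns := nbr_nonleaf SM lt st.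
have ne' : w2 != w1 by rewrite eq_sym.
have oH z : z \in dir v w1 -> onlyH fs z.
  move=> hz; apply: (bad_onlyH Af (dir_VM hz) (dir_VM hy) _ sy).
  by apply: (badI e1 e2 ne hz hy); right.
have sH z : z \in dir v w1 -> sees fs z -> seenH fs z by move=> hz; apply: onlyH_seenH; apply: oH.
have he := dir_head SM e1 hh hv.
have third w3 z : v -- w3 -> w3 != w1 -> w3 != w2 -> z \in dir v w3 -> ~~ sees fs z.
  move=> e3 n31 n32 hz; apply/negP => sz.
  apply: (third_seen ehf SM XM Af fa fb e1 e2 e3 ne n31 n32 hx hy hz sx sy sz ny).
  by rewrite (negbTE nx).
have [g [sg tg hg ng C]] := toward SM e2 e1 ne' st lt ye hy hx nx.
case: C => [[? [? ?]]|[sv h1 h2 C]].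
  subst s t g.
  have n1a : w1 \notin alpha.
    by apply: contraNN ne => h1a; rewrite (alpha_uniq XM e1 e2 h1a ta).
  have [Q1 B1] := head_beam SM XM nv e1 n1a he hv.
  have [w3 [e3 n32 n31 n3a]] := third_beta SM XM nv (introT orP (or_introl _ ta)) e2 e1.
  have [Q3 B3] := dir_beam SM XM nv e3 n3a.
  have [c2 [Q2 [B2 y2]]] := any_beam SM XM nv e2 hy.
  have c2E : c2 = true by rewrite -(beam_strip nv B2 y2 lt st ye).
  subst c2.
  have hl : h != last h (h :: Q1) by apply: (beam_nolast XM nv B1); rewrite ?mem_head.
  case k: (has (sees fs) Q1).
    case/hasP: k => z zQ sz; have zQ' : z \in h :: Q1 by rewrite inE zQ orbT.
    have hz := beam_dir B1 zQ'.
    have nz : z \notin Mv v.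
      rewrite (beam_head B1 zQ') /=; apply/eqP => e; have := beam_uniq B1.
      by rewrite /= -e zQ.
    apply: (body ehf SM XM Af fa fb e1 e2 e3 ne n31 n32 B1 B2 B3 zQ' y2 (sH _ hz sz) sy nz ny).
    by left; split; [left; exists h; rewrite ?mem_head ?hl | right].
  apply: (headed ehf SM XM Af fa fb e1 e2 e3 ne n31 n32 B1 B2 B3 y2 (sH _ hh sh) sy ny).
  - by move=> z zQ; apply/negP => sz; move/hasP: k; case; exists z.
  - by move=> z z3; apply: (third w3) => //; apply: beam_dir B3 z3.
  - by left; apply: contraNneq hl => ->.
have Dr := detached_rev D.
have [Ar far fbr] := Dr.
have [F1 F2] := dir_far SM sg h1 e2 h2 e1 ne.
have hhs := F1 _ hh; have hns := F2 _ hh.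
have hys := strip_dir st ye.
have syr : seenH (rev fs) y by rewrite seenH_rev.
have shr : seenL (rev fs) h by rewrite seenL_rev sH.
case: (boolP (y \in Mv s)) => ys; last first.
  exact: (end_interior ehf SM XM Dr st sg tg hys hhs ys hns syr shr ay nah nbh).
have T w3 z : s -- w3 -> w3 != t -> w3 != g -> z \in dir s w3 -> ~ inS alpha z -> ~~ sees fs z.
  move=> e3 n31 n32 hz nz; apply/negP => sz.
  have ts := third_seen ehf SM XM Ar far fbr st sg e3 tg n31 n32 hys hhs hz syr shr _ hns.
  rewrite sees_rev in ts.
  case: (boolP ((y \in Mv s) && (z \in Mv s))) => [/andP[_ zs]|k]; last exact: (ts sz k).
  have [hz' nz'] := C w3 e3 n32 z hz.
  case/orP: (E2 z hz' nz' sz) => k; first exact: nz (a_inS SM XM (dir_VM hz) k).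
  rewrite eq_sym in n31.
  by have := no_four_cycle ehf SM XM (dir_VM hy) (dir_VM hz) (heads_adj SM st e3 n31 hys hz ys zs) ay k.
have Tr w3 z : s -- w3 -> w3 != t -> w3 != g -> z \in dir s w3 -> ~ inS alpha z -> ~~ sees (rev fs) z.
  by move=> e3 n31 n32 hz nz; rewrite sees_rev; apply: (T w3).
case: (boolP (w1 \in alpha)) => [a1|n1a]; last first.
  have nS := head_noS SM XM nv e1 n1a he hv.
  apply: (end_against ehf SM XM Dr ta st sg _ ye ay syr hhs hns shr nS _ Tr); first by rewrite eq_sym.
  by left.
have [w3 [e3 n31 n32 n3a]] := third_beta SM XM ns (introT orP (or_introl _ ta)) st sg.
have [w4 [e4 n41 n42 n4a]] := third_beta SM XM nv (introT orP (or_introl _ a1)) e1 e2.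
apply: (double_end ehf SM XM Dr ta a1 st e1 sg h1 e2 h2 ye he ay nah syr shr _ e3 n31 n32 n3a _ e4 n41 n42 n4a).
- move=> z ze; rewrite sees_rev => sz; have hz := strip_dir st ze.
  have [hz' nz'] := C t st tg z hz; case/orP: (E2 z hz' nz' sz) => // bz.
  by case: (inS_excl SM XM _ (b_inS SM XM (dir_VM hz) bz)); exists s, t.
- by move=> z hz; apply: (Tr w3).
- by move=> z hz _; rewrite sees_rev; apply: (third w4).
Qed.

End Ends.

Lemma ends_heads (J G : sgraph) (M : strip_family J G) (alpha beta : {set J}) (a b : G) fs
    (v w1 w2 : J) (x y : G) c Q :
  even_hole_free G -> is_strip_system M -> cross_edge M alpha beta a b -> detached M a b fs ->
  v -- w1 -> v -- w2 -> w1 != w2 -> x \in dir M v w1 -> y \in dir M v w2 ->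
  x \notin Mv M v -> y \notin Mv M v -> seenH fs x -> seenL fs y -> (a -- y) || (b -- y) ->
  (forall z, z \in dir M v w1 -> z \notin Mv M v -> sees fs z -> (a -- z) || (b -- z)) ->
  (forall z, z \in dir M v w2 -> z \notin Mv M v -> sees fs z -> (a -- z) || (b -- z)) ->
  beam M alpha v w1 c Q -> has (fun z => (z != last z Q) && sees fs z) Q -> False.
Proof.
move=> ehf SM XM D e1 e2 ne hx hy nx ny sx sy ey E1 E2 B /hasP[h hQ /andP[hl sh]].
have nv := two_nonleaf e1 e2 ne.
have na : ~~ (a -- h) by rewrite (beam_a XM nv B hQ) (negbTE hl).
have nb : ~~ (b -- h) by rewrite (beam_b XM nv B hQ) (negbTE hl).
have hh := beam_dir B hQ.
have hv : h \in Mv M v.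
  by apply/negPn/negP => k; have := E1 h hh k sh; rewrite (negbTE na) (negbTE nb).
case/orP: ey => ey.
  exact: (ends_head ehf SM XM D e1 e2 ne hx hy nx ny sx sy ey E1 E2 hh hv sh na nb).
apply: (ends_head ehf SM (cross_edge_sym XM) (detached_swap D) e1 e2 ne hx hy nx ny sx sy ey _ _ hh hv sh nb na).
  by move=> z k1 k2 k3; rewrite orbC; apply: E1.
by move=> z k1 k2 k3; rewrite orbC; apply: E2.
Qed.

(** Either both or none of x, y are neighbours of a or b. If both are, so are all seen vertices off
    M_v, and a beam seen before its last vertex is seen at its head. Then [ends_heads] excludes that
    exactly one of the two beams is of this kind, and the other two cases are the two alternatives
    of [body]. *)
Lemma interior_pair (J G : sgraph) (M : strip_family J G) (alpha beta : {set J}) (a b : G) fs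
    (v w1 w2 : J) (x y : G) :
  even_hole_free G -> is_strip_system M -> cross_edge M alpha beta a b -> detached M a b fs ->
  v -- w1 -> v -- w2 -> w1 != w2 -> x \in dir M v w1 -> y \in dir M v w2 ->
  x \notin Mv M v -> y \notin Mv M v -> seenH fs x -> seenL fs y -> False.
Proof.
move=> ehf SM XM D e1 e2 ne hx hy nx ny sx sy.
have nv := two_nonleaf e1 e2 ne.
have Dr := detached_rev D.
have ne' : w2 != w1 by rewrite eq_sym.
have syr : seenH (rev fs) y by rewrite seenH_rev.
have sxr : seenL (rev fs) x by rewrite seenL_rev.
have [Af fa fb] := D.
have oH z : z \in dir M v w1 -> sees fs z -> seenH fs z.
  move=> hz; apply: onlyH_seenH; apply: (bad_onlyH Af (dir_VM hz) (dir_VM hy) _ sy).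
  by apply: (badI e1 e2 ne hz hy); right.
have oL z : z \in dir M v w2 -> sees fs z -> seenL fs z.
  move=> hz; apply: onlyL_seenL; apply: (bad_onlyL Af (dir_VM hz) (dir_VM hx) _ sx).
  by apply: (badI e2 e1 ne' hz hx); right.
case ex : ((a -- x) || (b -- x)); last first.
  case ey : ((a -- y) || (b -- y)).
    by have := ends_interior ehf SM XM Dr e2 e1 ne' hy hx ny nx syr sxr ey; rewrite ex.
  move/negbT: ex; move/negbT: ey; rewrite !negb_or => /andP[ay bY] /andP[ax bx].
  exact: (pair_interior ehf SM XM D e1 e2 ne hx hy nx ny sx sy ax bx ay bY).
have ey := ends_interior ehf SM XM D e1 e2 ne hx hy nx ny sx sy ex.
have E1 z : z \in dir M v w1 -> z \notin Mv M v -> sees fs z -> (a -- z) || (b -- z).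
  move=> hz nz sz; apply: (ends_interior ehf SM XM Dr e2 e1 ne' hy hz ny nz syr _ ey).
  by rewrite seenL_rev oH.
have E2 z : z \in dir M v w2 -> z \notin Mv M v -> sees fs z -> (a -- z) || (b -- z).
  by move=> hz nz sz; apply: (ends_interior ehf SM XM D e1 e2 ne hx hz nx nz sx (oL _ hz sz) ex).
have [w3 [e3 n31 n32]] := third_dir SM XM w1 w2 nv.
have [c1 [Q1 [B1 x1]]] := any_beam SM XM nv e1 hx.
have [c2 [Q2 [B2 y2]]] := any_beam SM XM nv e2 hy.
have [c3 [Q3 B3]] := dir_any SM XM e3.
have V := body ehf SM XM Af fa fb e1 e2 e3 ne n31 n32 B1 B2 B3 x1 y2 sx sy nx ny.
have L Q : has (fun z => (z != last z Q) && sees fs z) Q = false ->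
    forall z, z \in Q -> sees fs z -> z = last z Q.
  by move=> /hasP k z zQ sz; apply/eqP/negPn/negP => n; case: k; exists z; rewrite ?n.
case n1: (has (fun z => (z != last z Q1) && sees fs z) Q1); case n2: (has (fun z => (z != last z Q2) && sees fs z) Q2).
- by apply: V; left; split; left; apply/hasP.
- exact: (ends_heads ehf SM XM D e1 e2 ne hx hy nx ny sx sy ey E1 E2 B1 n1).
- have E1' z : z \in dir M v w1 -> z \notin Mv M v -> sees (rev fs) z -> (a -- z) || (b -- z).
    by rewrite sees_rev; apply: E1.
  have E2' z : z \in dir M v w2 -> z \notin Mv M v -> sees (rev fs) z -> (a -- z) || (b -- z).
    by rewrite sees_rev; apply: E2.
  apply: (ends_heads ehf SM XM Dr e2 e1 ne' hy hx ny nx syr sxr ex E2' E1' B2).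
  by apply: sub_has n2 => z; rewrite sees_rev.
- by apply: V; right; split; apply: L.
Qed.

(** * Nonlocal pairs with one member in M_v *)

Section Heads.
Variables (J G : sgraph) (ehf : even_hole_free G) (M : strip_family J G).
Variables (alpha beta : {set J}) (a b : G).
Hypothesis SM : is_strip_system M.
Hypothesis XM : cross_edge M alpha beta a b.
Variable fs : seq G.
Hypothesis D : detached M a b fs.
Implicit Types (p q r s t u v w g : J) (x y z f : G) (Q R : seq G) (c d : bool).

Notation Mv := (Mv M).
Notation Mvv u v := (Me M [set u; v]).
Notation dir := (dir M).
Notation inS := (inS M).
Notation beam := (beam M alpha).

Let ab : a -- b. Proof. by case: XM. Qed.
Let Af : attached M a b fs. Proof. by case: D. Qed.
Let fa : forall f, f \in fs -> f -- a = false. Proof. by case: D. Qed.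
Let fb : forall f, f \in fs -> f -- b = false. Proof. by case: D. Qed.

Lemma seen_heads v w2 w y (p : G) : v -- w2 -> v -- w -> w != w2 -> y \in dir v w2 -> y \notin Mv v ->
  seenL fs y -> p \in dir v w -> sees fs p -> [/\ onlyH fs p, seenH fs p & p \in Mv v].
Proof.
move=> e2 e ne hy ny sy hp sp.
have oH : onlyH fs p.
  by apply: (bad_onlyH Af (dir_VM hp) (dir_VM hy) _ sy); apply: (badI e e2 ne hp hy); right.
split=> //; first exact: onlyH_seenH.
apply/negPn/negP => np.
exact: (interior_pair ehf SM XM D e e2 ne hp hy np ny (onlyH_seenH oH sp) sy).
Qed.

(** By [seen_heads] the beams of x and z are unseen beyond their heads, so [headed] applies as soon
    as x is not its whole beam. *)
Lemma head_end v w1 w2 w3 x y z : v -- w1 -> v -- w2 -> v -- w3 -> w1 != w2 -> w3 != w2 -> w1 != w3 ->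
  y \in dir v w2 -> y \notin Mv v -> seenL fs y -> x \in dir v w1 -> sees fs x ->
  z \in dir v w3 -> z \in Mv v -> ~~ sees fs z -> (a -- x) || (b -- x).
Proof.
move=> e1 e2 e3 n12 n32 n13 hy ny sy hx sx hz zv uz; apply/negPn/negP; rewrite negb_or => /andP[na nb].
have nv := two_nonleaf e1 e2 n12.
have [_ sHx xv] := seen_heads e2 e1 n12 hy ny sy hx sx.
have [c1 [Q1 [B1 x1]]] := any_beam SM XM nv e1 hx.
have [Q1' ?] := beam_hd B1 x1 xv; subst Q1.
have [c2 [Q2 [B2 y2]]] := any_beam SM XM nv e2 hy.
have [c3 [Q3 [B3 z3]]] := any_beam SM XM nv e3 hz.
have [Q3' ?] := beam_hd B3 z3 zv; subst Q3.
have tl w' c (p : G) Q : v -- w' -> w' != w2 -> beam v w' c (p :: Q) -> {in Q, forall z, ~~ sees fs z}.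
  move=> e n B z' zQ; apply/negP => sz; have zQ' : z' \in p :: Q by rewrite inE zQ orbT.
  have [_ _] := seen_heads e2 e n hy ny sy (beam_dir B zQ') sz.
  rewrite (beam_head B zQ') /= => /eqP k; have := beam_uniq B.
  by rewrite /= -k zQ.
rewrite eq_sym in n13.
apply: (headed ehf SM XM Af fa fb e1 e2 e3 n12 n13 n32 B1 B2 B3 y2 sHx sy ny (tl _ _ _ _ e1 n12 B1)).
  by move=> z' /predU1P[->|] //; apply: (tl _ _ _ _ e3 n32 B3).
left; have := beam_nolast XM nv B1 x1 na nb; apply: contraNneq => ->.
by [].
Qed.

Lemma single_beam v s t x c Q : t \in alpha -> s -- t -> v = s -> beam v t c Q -> x \in Q -> x \in Mv s ->
  x \in Mvv s t -> a -- x -> beam s t true [:: x].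
Proof.
move=> ta st -> B xQ xs xe ax; have ns := nbr_nonleaf SM (alpha_leaf XM ta) st.
have cE : c = true by rewrite -(beam_strip ns B xQ (alpha_leaf XM ta) st xe).
subst c; have [Q' e] := beam_hd B xQ xs; subst Q.
have := beam_a XM ns B xQ; rewrite ax andbT /= => /esym/eqP xl.
suff Q0 : Q' = [::] by rewrite Q0 in B.
have := beam_uniq B; case: Q' xl {B xQ} => //= z Q' ->.
by rewrite mem_last.
Qed.

Lemma end_beam s t x : t \in alpha -> s -- t -> x \in Mvv s t -> x \in Mv s -> a -- x -> beam s t true [:: x].
Proof.
move=> ta st xe xs ax; have ns := nbr_nonleaf SM (alpha_leaf XM ta) st.
have [c [Q [B xQ]]] := any_beam SM XM ns st (strip_dir st xe).
exact: (single_beam ta st erefl B xQ xs xe ax).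
Qed.

Lemma size_beam_pair v w w' c c' Q Q' : v \notin leaves J -> v -- w -> v -- w' -> w != w' ->
  beam v w c Q -> beam v w' c' Q' -> odd (size Q + size Q') = c (+) c'.
Proof.
move=> nv e e' ne B B'.
exact: (closed_legs ehf ab (beam_leg XM nv B) (beam_leg XM nv B') (beam_touch SM e e' ne B B')).
Qed.

(** Every seen vertex of direction w2 off M_v turns out to be a neighbour of a in M_s, for a strip
    st at an alpha leaf with s different from v. So x and y are beams of length one at v and at s,
    which makes the length of [fs] even. The beam of y from v contradicts this through its head h,
    whether h is seen or not. *)
Lemma heads_seen_end v w1 w2 w3 x y z : v -- w1 -> v -- w2 -> v -- w3 -> w1 != w2 -> w3 != w2 -> w1 != w3 ->
  y \in dir v w2 -> y \notin Mv v -> seenL fs y -> x \in dir v w1 -> sees fs x -> a -- x ->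
  z \in dir v w3 -> z \in Mv v -> ~~ sees fs z -> False.
Proof.
move=> e1 e2 e3 n12 n32 n13 hy ny sy hx sx ax hz zv uz.
have nv := two_nonleaf e1 e2 n12.
have [oHx sHx xv] := seen_heads e2 e1 n12 hy ny sy hx sx.
have xe := dir_head SM e1 hx xv.
have [s [t [ta st xe' _]]] := aE SM XM (dir_VM hx) ax.
have lt := alpha_leaf XM ta.
have [? ?] : s = v /\ t = w1.
  case: (strip_eq SM st e1 xe' xe) => -[? ?]; subst; first by [].
  by rewrite lt in nv.
subst s t; clear xe' st lt.
have n21 : w2 != w1 by rewrite eq_sym.
have n31 : w3 != w1 by rewrite eq_sym.
have n3a : w3 \notin alpha.
  by apply: contraNN n13 => h3; rewrite (alpha_uniq XM e1 e3 ta h3).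
have [Q3 B3] := head_beam SM XM nv e3 n3a (dir_head SM e3 hz zv) zv.
have u3 : {in z :: Q3, forall z, ~~ sees fs z}.
  move=> z' zQ; apply/negP => sz.
  have [_ _] := seen_heads e2 e3 n32 hy ny sy (beam_dir B3 zQ) sz.
  by rewrite (beam_head B3 zQ) /= => /eqP k; rewrite k (negbTE uz) in sz.
have B1 := end_beam ta e1 xe xv ax.
have oL y' : y' \in dir v w2 -> y' \notin Mv v -> onlyL fs y'.
  move=> hy' ny'; apply: (bad_onlyL Af (dir_VM hy') (dir_VM hx) _ sHx).
  by apply: (badI e2 e1 n21 hy' hx); left.
have inA y' : y' \in dir v w2 -> y' \notin Mv v -> sees fs y' -> inS alpha y'.
  move=> hy' ny' sy'; have [//|nS] := inSP M alpha y'.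
  have [Q2 [B2 y2]] := beta_beam SM XM nv e2 hy' nS.
  case: (headed ehf SM XM Af fa fb e1 e2 e3 n12 n31 n32 B1 B2 B3 y2 sHx (onlyL_seenL (oL _ hy' ny') sy') ny' _ u3) => //.
  by right.
have far y' : y' \in dir v w2 -> y' \notin Mv v -> sees fs y' -> exists s t g,
    [/\ t \in alpha, s -- t & y' \in Mvv s t] /\
    [/\ s \in side v w2, s -- g & v \in side s g] /\ [/\ t != g, y' \in Mv s & s != v].
  move=> hy' ny' sy'; have [s [t [ta' st ye]]] := inA y' hy' ny' sy'.
  have lt' := alpha_leaf XM ta'; have ns := nbr_nonleaf SM lt' st.
  have sv : v != s.
    apply: contraNneq n12 => e; subst s; rewrite (alpha_uniq XM e1 st ta ta').
    by rewrite (dir_inj SM st e2 (strip_dir st ye) hy').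
  have [g0 [g [vg0 h1 sg h2]]] := facing SM sv.
  have tg : t != g.
    by apply: contraNneq nv => e; subst g; rewrite (leaf_side lt' st h2).
  have [F1 F2] := dir_far SM vg0 h1 sg h2 st tg.
  have ? := dir_inj SM vg0 e2 (F1 _ (strip_dir st ye)) hy'; subst g0.
  exists s, t, g; split=> //; split=> //; rewrite tg [s == v]eq_sym sv; split=> //.
  apply/negPn/negP => nys.
  have [F3 F4] := dir_far SM sg h2 e2 h1 e1 n12.
  rewrite eq_sym in tg.
  apply: (interior_pair ehf SM XM D sg st tg (F3 _ hx) (strip_dir st ye) (F4 _ hx) nys sHx).
  exact: onlyL_seenL (oL _ hy' ny') sy'.
have fourth s t g : s \in side v w2 -> s -- g -> v \in side s g -> t \in alpha -> s -- t -> t != g ->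
    exists w4 Q4, [/\ s -- w4, w4 != t, w4 != g, beam s w4 false Q4 & {in Q4, forall z, ~~ sees fs z}].
  move=> h1 sg h2 ta' st tg; have ns := two_nonleaf st sg tg.
  have [w4 [e4 n41 n42 n4a]] := third_beta SM XM ns (introT orP (or_introl _ ta')) st sg.
  have [Q4 B4] := dir_beam SM XM ns e4 n4a.
  exists w4, Q4; split=> // z' zQ; apply/negP => sz.
  have [F1 F2] := dir_far SM e2 h1 sg h2 e4 n42.
  have hz' := beam_dir B4 zQ.
  have h := inA z' (F1 _ hz') (F2 _ hz') sz.
  by have [/(_ h)] := beam_inS XM ns B4 zQ.
have E1 z' : z' \in Mvv v w1 -> sees fs z' -> a -- z'.
  move=> ze sz; have hz' := strip_dir e1 ze.
  have := head_end e1 e2 e3 n12 n32 n13 hy ny sy hz' sz hz zv uz.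
  case/orP => // bz; case: (inS_excl SM XM _ (b_inS SM XM (dir_VM hz') bz)).
  by exists v, w1.
have E2 y' : y' \in dir v w2 -> y' \notin Mv v -> sees fs y' -> a -- y'.
  move=> hy' ny' sy'; apply/negPn/negP => na.
  have [s [t [g [[ta' st ye] [[h1 sg h2] [tg ys sv]]]]]] := far y' hy' ny' sy'.
  have [w4 [Q4 [e4 n41 n42 B4 u4]]] := fourth s t g h1 sg h2 ta' st tg.
  exact: (double_end_beams ehf SM XM D ta ta' e1 st e2 h1 sg h2 xe ye ax na sHx
    (onlyL_seenL (oL _ hy' ny') sy') E1 e3 n31 n32 B3 u3 e4 n41 n42 B4 u4).
have [s [t [g [[ta' st ye] [[h1 sg h2] [tg ys sv]]]]]] := far y hy ny (seenL_sees sy).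
have ay := E2 y hy ny (seenL_sees sy).
have [w4 [Q4 [e4 n41 n42 B4 u4]]] := fourth s t g h1 sg h2 ta' st tg.
have ns := two_nonleaf st sg tg.
have B5 := end_beam ta' st ye ys ay.
have n14 : t != w4 by rewrite eq_sym.
have pz := size_beam_pair nv e1 e3 n13 B1 B3.
have p4 := size_beam_pair ns st e4 n14 B5 B4.
have [lp l0 nfa nfb] := att_loose Af fa fb.
have nF Q c v' w' : beam v' w' c Q -> {in Q, forall z, ~~ sees fs z} -> {in Q, forall z, noF fs z}.
  by move=> B u z' zQ; apply: noF_sees (u _ zQ); apply: att_out Af (beam_VM B zQ).
have n0 : {in [::], forall z, noF fs z} by [].
have hx1 := onlyH_atH oHx sx; have hyL := onlyL_atL (oL _ hy ny) (seenL_sees sy).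
(* By pz and p4 the beams [z :: Q3] and [Q4] have even length, so this ring makes [fs] even. *)
have kE := @double_round _ ehf a b ab fs [::] x [::] _ [::] y [::] _ true true lp l0 nfb
  (beam_leg XM nv B1) (beam_leg XM nv B3) (beam_leg XM ns B5) (beam_leg XM ns B4)
  (beam_touch SM e1 e3 n13 B1 B3) (beam_touch SM st e4 n14 B5 B4)
  (beam_apart SM e2 h1 sg h2 e1 n12 st tg B1 B5) (beam_apart SM e2 h1 sg h2 e1 n12 e4 n42 B1 B4)
  (beam_apart SM e2 h1 sg h2 e3 n32 st tg B3 B5) (beam_apart SM e2 h1 sg h2 e3 n32 e4 n42 B3 B4)
  (or_intror isT) (or_intror isT) hx1 hyL n0 n0 (nF _ _ _ _ B3 u3) (nF _ _ _ _ B4 u4).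
have [c2 [Q2 [B2 y2]]] := any_beam SM XM nv e2 hy.
have c2E : c2 = true by rewrite -(beam_strip nv B2 y2 (alpha_leaf XM ta') st ye).
subst c2; have p2 := size_beam_pair nv e1 e2 n12 B1 B2.
have yl : y = last y Q2 by apply/eqP; have := beam_a XM nv B2 y2; rewrite ay andbT => <-.
have [h [Q2' e]] : exists (h : G) Q', Q2 = h :: Q' by case: (Q2) y2 => // h Q' _; exists h, Q'.
subst Q2; have hQ := mem_head h Q2'.
have hv : h \in Mv v by rewrite (beam_head B2 hQ) /=.
have yh : y != h by apply: contraNneq ny => ->.
have sQ z' : z' \in h :: Q2' -> sees fs z' -> (z' == h) || (z' == y).
  move=> zQ sz; case: (boolP (z' \in Mv v)) => zv'; first by move: zv'; rewrite (beam_head B2 zQ) /= => ->.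
  have := E2 z' (beam_dir B2 zQ) zv' sz; rewrite (beam_a XM nv B2 zQ) andbT => /eqP ->.
  by rewrite yl /= eqxx orbT.
have hhd := beam_dir B2 hQ.
have T12 := beam_touch SM e1 e2 n12 B1 B2.
have [L2 _ [C2 F2]] := beam_leg XM nv B2.
have [r Er] : exists r : seq G, h :: Q2' = rcons r y.
  by rewrite lastI; exists (belast h Q2'); rewrite yl.
(* If h is unseen, the ring through x and the beam of y up to y makes [fs] odd. *)
case sh : (sees fs h); last first.
  have nr : {in r, forall z, noF fs z}.
    move=> z' zr; have zQ : z' \in h :: Q2' by rewrite Er mem_rcons inE zr orbT.
    apply: noF_sees; first exact: att_out Af (beam_VM B2 zQ).
    apply/negP => sz; case/orP: (sQ z' zQ sz) => /eqP k; subst z'; first by rewrite sh in sz.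
    by have := beam_uniq B2; rewrite Er rcons_uniq zr.
  rewrite Er in T12 L2.
  have := @direct _ ehf _ _ ab fs [::] x r y lp l0 isT L2 T12 hx1 hyL n0 nr.
  by move: kE pz p4 p2; rewrite Er /= size_rcons; clear => /=; lia.
(* The beam of y has odd length and h differs from y, so its two ends are not adjacent. *)
have hy2 : h -- y = false.
  have := ipath_nth h L2 (i := 0) (j := size Q2') isT (ltnSn _).
  rewrite nth_last /= -[last h Q2']/(last h (h :: Q2')) -(last_def y) // -yl => ->.
  by rewrite orbF; move: p2 => /=; clear; case: (size Q2') => [|[|n]].
have oHh : onlyH fs h.
  apply: (bad_onlyH Af (dir_VM hhd) (dir_VM hy) _ sy).
  have he := dir_head SM e2 hhd hv.
  case: (dir_split SM e2 hy) => [ye2|[r' [wr rv hyr]]].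
    case: (strip_eq SM st e2 ye ye2) => -[? ?]; subst; first by rewrite eqxx in sv.
    by rewrite (alpha_leaf XM ta') in nv.
  have e2' : w2 -- v by rewrite edgeC.
  rewrite eq_sym in rv.
  apply: (badI e2' wr rv _ hyr); first by apply: strip_dir; rewrite // MvvC.
  apply/orP; rewrite -negb_and; apply/negP => /andP[hw yw].
  have hw' : h \in dir w2 v by apply: strip_dir; rewrite // MvvC.
  by have := heads_adj SM e2' wr rv hw' hyr hw yw; rewrite hy2.
have hl : h != last h (h :: Q2') by rewrite (last_def _ y) // -yl eq_sym.
have n23 : w2 != w3 by rewrite eq_sym.
have A : apart [:: y] (h :: z :: Q3).
  move=> y' z'; rewrite inE => /eqP -> /predU1P[->|zQ]; first by rewrite edgeC hy2.
  have [k1 k2] := beam_touch SM e2 e3 n23 B2 B3 y2 zQ.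
  by rewrite k1 k2 /= (negbTE yh).
have [ps _ [C3 F3]] := beam_leg XM nv B3.
have h3 : ipath (h :: z :: Q3).
  apply: ipath_cons => // h' z'; rewrite inE => /eqP -> zQ.
  have [k1 k2] := beam_touch SM e2 e3 n23 B2 B3 hQ zQ.
  by rewrite k1 k2 /= !eqxx.
have ha : free a [:: h].
  move=> h'; rewrite inE => /eqP ->; have [k _] := aVM XM (beam_VM B2 hQ).
  by rewrite k (beam_a XM nv B2 hQ) (negbTE hl).
have hb : free b [:: h].
  move=> h'; rewrite inE => /eqP ->; have [k _] := bVM XM (beam_VM B2 hQ).
  by rewrite k (beam_b XM nv B2 hQ) (negbTE hl).
have f3 : full a b false (h :: z :: Q3).
  split; first by apply: (@capped_cat _ _ [:: h]).
  by apply: (@free_cat _ _ [:: h]).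
have f5 : full a b true [:: y] by have [_ _] := beam_leg XM ns B5.
have := @roundc _ ehf a b ab false true fs h _ y [::] lp l0 h3 isT A f3 f5
  (onlyH_atH oHh sh) hyL (nF _ _ _ _ B3 u3) n0 nfa nfb.
by move: kE pz p4 p2; clear => /=; lia.
Qed.

End Heads.

Section EnlargePath.
Variables (J G : sgraph) (M : strip_family J G) (alpha beta : {set J}) (a b : G).
Hypothesis SM : is_strip_system M.
Hypothesis XM : cross_edge M alpha beta a b.
Hypothesis maxM : forall M' : strip_family J G,
  is_strip_system M' -> has_cross_edge M' a b -> ~~ (VM M \proper VM M').
Variables (u v : J) (fs : seq G).
Hypotheses (uv : u -- v) (pf : ipath fs) (f0 : fs != [::]).
Hypothesis out : forall f, f \in fs -> [/\ f \notin VM M, f != a & f != b].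

Notation Mv := (Mv M).
Notation Mvv u v := (Me M [set u; v]).

Let F := [set f in fs].
Let Fh := [set f in fs | f == head f fs].
Let Fl := [set f in fs | f == last f fs].

Let F0 : F != set0.
Proof.
by case: (fs) @F f0 => // f s F' _; apply/set0Pn; exists f; rewrite inE mem_head.
Qed.

Let FhF : Fh \subset F. Proof. by apply/subsetP => f; rewrite !inE => /andP[]. Qed.
Let FlF : Fl \subset F. Proof. by apply/subsetP => f; rewrite !inE => /andP[]. Qed.
Let FM : [disjoint F & VM M].
Proof. by apply/pred0P => f; apply/negP; rewrite /= inE => /andP[/out[/negP]]. Qed.
Let Fa : a \notin F. Proof. by rewrite inE; apply/negP => /out[_]; rewrite eqxx. Qed.
Let Fb : b \notin F. Proof. by rewrite inE; apply/negP => /out[_ _]; rewrite eqxx. Qed.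

Let fsM w f : f \in fs -> f \in Mv w = false.
Proof. by move=> /out[/negP n _ _]; apply/negP => /(Mv_VM SM). Qed.

Lemma enlarge_path :
  (forall f z, f \in fs -> z \in VM M -> z \notin Mvv u v ->
     f -- z = (z \in Mv u) && (f == head f fs) || (z \in Mv v) && (f == last f fs)) ->
  (forall f, f \in fs -> a -- f = (u \in alpha) && (f == head f fs) || (v \in alpha) && (f == last f fs)) ->
  (forall f, f \in fs -> b -- f = (u \in beta) && (f == head f fs) || (v \in beta) && (f == last f fs)) ->
  False.
Proof.
move=> H Ha Hb; apply: (no_enlargement SM XM maxM uv F0 FhF FlF FM Fa Fb).
- by move=> f z; rewrite !inE => ff zV zn; rewrite ff H.
- by move=> f; rewrite !inE => ff; rewrite ff Ha.
- by move=> f; rewrite !inE => ff; rewrite ff Hb.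
- move=> f; rewrite inE => ff; exists fs; split=> //.
  + by move=> g gf; rewrite !inE gf orbT.
  + by move=> g gf; rewrite !inE gf fsM.
  + by move=> g gf; rewrite !inE gf fsM.
Qed.

(** The new rungs follow [fs] from its head and then the tail of an old rung from the last vertex
    that [fs] sees; so only M_u gains a vertex. *)
Lemma enlarge_pendant y :
  (forall f z, f \in fs -> z \in VM M -> z \notin Mvv u v -> f -- z = (z \in Mv u) && (f == head f fs)) ->
  (forall f, f \in fs -> a -- f = (u \in alpha) && (f == head f fs)) ->
  (forall f, f \in fs -> b -- f = (u \in beta) && (f == head f fs)) ->
  (forall z, z \in Mvv u v -> z \notin Mv u -> onlyL fs z) ->
  y \in Mvv u v -> y \notin Mv u -> sees fs y -> False.
Proof.
move=> H Ha Hb L ye ny sy.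
apply: (no_enlargement SM XM maxM uv F0 FhF (sub0set F) FM Fa Fb).
- by move=> f z; rewrite !inE => ff zV zn; rewrite ff H // andbF orbF.
- by move=> f; rewrite !inE => ff; rewrite ff Ha // andbF orbF.
- by move=> f; rewrite !inE => ff; rewrite ff Hb // andbF orbF.
move=> f; rewrite inE => ff.
have [R [pR R0 sR Ru Rv] yR] := rung_through SM uv ye.
have uR := ipath_uniq pR.
have Q : exists2 z, z \in R & (z != head z R) && sees fs z by exists y; rewrite // sy -Ru // ny.
have [q [z [r [e q0 sz ur]]]] := last_seen uR Q.
have zR : z \in R by rewrite e in_split.
have nu w : w \in z :: r -> w \notin Mv u.
  move=> wr; have wR : w \in R by rewrite e mem_cat wr orbT.
  rewrite Ru //; apply/eqP => k.
  have /and3P[_ /hasPn nq _] : [&& uniq q, ~~ has (mem q) (z :: r) & uniq (z :: r)] by rewrite -cat_uniq -e.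
  move/negP: (nq w wr); apply; rewrite /=.
  suff: head w R \in q by rewrite -k.
  by rewrite e; case: (q) q0 => //= ? ? _; rewrite mem_head.
have oz : onlyL fs z by apply: L; [apply: sR | apply: nu; rewrite mem_head].
have az := onlyL_atL oz sz.
have outR w : w \in R -> w \notin fs.
  move=> /sR wE; apply/negP => /out[/negP n _ _]; apply: n; apply/VMP => //.
  by exists u, v.
have p : ipath (fs ++ z :: r).
  apply: ipath_cat => //; first by move: pR; rewrite e => /ipath_catP[].
  move=> g w gf; rewrite inE => /orP[/eqP ->|wr].
    by case: az => n h; rewrite h // eqxx andbT; split=> //; apply: contraNneq n => <-.
  have wR : w \in R by rewrite e mem_cat inE wr !orbT.
  have nw := outR w wR.
  have -> : (w == head w (z :: r)) = false.
    apply/eqP => /= k; move: uR; rewrite e cat_uniq => /and3P[_ _] /=; rewrite -k.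
    by rewrite wr.
  rewrite andbF; split; first by apply: contraNneq nw => <-.
  apply/negP => gw; move/negP: (ur w wr); apply; apply/hasP; exists g => //.
have hd g : head g (fs ++ z :: r) = head g fs by case: (fs) f0.
have lt g : last g (fs ++ z :: r) = last z r by rewrite last_cat.
exists (fs ++ z :: r); split=> //.
- move=> g; rewrite mem_cat !inE => /orP[->|wr]; first by rewrite orbT.
  by rewrite sR // e mem_cat inE wr orbT.
- by rewrite mem_cat ff.
- move=> g; rewrite mem_cat !inE hd => /orP[gf|gr]; first by rewrite gf fsM.
  have gR : g \in R by rewrite e mem_cat inE gr orbT.
  have ng := outR g gR; rewrite (negbTE (nu g _)) ?inE // (negbTE ng) /=.
  symmetry; apply/eqP => k; case/negP: ng; rewrite k; exact: mem_head_def.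
- move=> g; rewrite mem_cat !inE orbF lt => /orP[gf|gr].
    rewrite fsM //; symmetry; apply/eqP => k.
    have gR : g \in R by rewrite e mem_cat k mem_last orbT.
    by have := outR g gR; rewrite gf.
  have gR : g \in R by rewrite e mem_cat inE gr orbT.
  by rewrite Rv // e last_cat /=.
Qed.

End EnlargePath.

(** Outside the direction of y the set M_v is seen completely or not at all, which is the condition
    for a new rung ending in M_v. *)
Lemma heads_seen (J G : sgraph) (M : strip_family J G) (alpha beta : {set J}) (a b : G) fs
    (v w1 w2 w3 : J) (x y z : G) :
  even_hole_free G -> is_strip_system M -> cross_edge M alpha beta a b -> detached M a b fs ->
  v -- w1 -> v -- w2 -> v -- w3 -> w1 != w2 -> w3 != w2 ->
  y \in dir M v w2 -> y \notin Mv M v -> seenL fs y -> x \in dir M v w1 -> sees fs x ->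
  z \in dir M v w3 -> z \in Mv M v -> sees fs z.
Proof.
move=> ehf SM XM D e1 e2 e3 n12 n32 hy ny sy hx sx hz zv; apply/negPn/negP => uz.
have key w w' x' z' : v -- w -> v -- w' -> w != w2 -> w' != w2 -> w != w' -> x' \in dir M v w ->
    sees fs x' -> z' \in dir M v w' -> z' \in Mv M v -> ~~ sees fs z' -> False.
  move=> e e' n n' ne hx' sx' hz' zv' uz'.
  case/orP: (head_end ehf SM XM D e e2 e' n n' ne hy ny sy hx' sx' hz' zv' uz') => k.
    exact: (heads_seen_end ehf SM XM D e e2 e' n n' ne hy ny sy hx' sx' k hz' zv' uz').
  exact: (heads_seen_end ehf SM (cross_edge_sym XM) (detached_swap D) e e2 e' n n' ne hy ny sy hx' sx' k hz' zv' uz').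
(* Two heads in the same direction are compared through a head z' in a third one. *)
case: (eqVneq w1 w3) => [e|ne]; last exact: (key w1 w3 x z).
subst w3; have nv := two_nonleaf e1 e2 n12.
have [w [ew nw1 nw2]] := third_dir SM XM w1 w2 nv.
have [z' [ze zv']] := head_exists SM ew.
case k: (sees fs z').
  exact: (key w w1 z' z ew e1 nw2 n12 nw1 (strip_dir ew ze) k hz zv uz).
rewrite eq_sym in nw1.
exact: (key w1 w x z' e1 ew n12 nw2 nw1 hx sx (strip_dir ew ze) zv' (negbT k)).
Qed.

Section NoDetached.
Variables (J G : sgraph) (ehf : even_hole_free G) (M : strip_family J G).
Variables (alpha beta : {set J}) (a b : G).
Hypothesis SM : is_strip_system M.
Hypothesis XM : cross_edge M alpha beta a b.
Hypothesis maxM : forall M' : strip_family J G,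
  is_strip_system M' -> has_cross_edge M' a b -> ~~ (VM M \proper VM M').
Implicit Types (p q r s t u v w g : J) (x y z f : G) (Q R : seq G) (c d : bool).

Notation Mv := (Mv M).
Notation dir := (dir M).
Notation bad := (bad M).

(** Outside direction w2 the head of [fs] sees exactly M_v. If nothing beyond w2 is seen, then [fs]
    followed by tails of rungs enlarges the strip v w2. Otherwise the same argument at w2, with [fs]
    reversed, shows that its last vertex sees exactly M_w2 beyond this strip, and [fs] is a new rung
    of it. *)
Lemma no_half_interior fs v w1 w2 x y : detached M a b fs -> v -- w1 -> v -- w2 -> w1 != w2 ->
  x \in dir v w1 -> y \in dir v w2 -> x \in Mv v -> y \notin Mv v -> seenH fs x -> seenL fs y -> False.
Proof.
move=> D e1 e2 ne hx hy xv ny sx sy.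
have nv := two_nonleaf e1 e2 ne; have n21 : w2 != w1 by rewrite eq_sym.
have [Af fa fb] := D; have [pf f0 out _] := Af.
have va : v \in alpha = false by apply: contraNF nv; apply: (alpha_leaf XM).
have vb : v \in beta = false by apply: contraNF nv; apply: (beta_leaf XM).
have faE f : f \in fs -> a -- f = false by rewrite edgeC; apply: fa.
have fbE f : f \in fs -> b -- f = false by rewrite edgeC; apply: fb.
have w2v : w2 -- v by rewrite edgeC.
have sees_in f z : f \in fs -> f -- z -> sees fs z by move=> ff fz; apply/hasP; exists f.
have off w z f : v -- w -> w != w2 -> z \in dir v w -> f \in fs -> f -- z = (z \in Mv v) && (f == head f fs).
  move=> e n hz ff; case: (boolP (z \in Mv v)) => zv /=; last first.
    apply/negP => fz; have [_ _ k] := seen_heads ehf SM XM D e2 e n hy ny sy hz (sees_in _ _ ff fz).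
    by rewrite k in zv.
  have sz := heads_seen ehf SM XM D e1 e2 e ne n hy ny sy hx (seenH_sees sx) hz zv.
  have [oH _ _] := seen_heads ehf SM XM D e2 e n hy ny sy hz sz.
  by have [_ ->] := onlyH_atH oH sz.
have deepv r z : w2 -- r -> r != v -> z \in dir w2 r -> z \notin Mv v.
  move=> wr rv hz; apply/negP => zv.
  have := dir_head SM e2 (dir_sub SM e2 wr rv hz) zv.
  by move=> /(strip_not_deep SM e2 wr rv); rewrite hz.
have oL z : z \in dir v w2 -> z \notin Mv v -> onlyL fs z.
  move=> hz nz; apply: (bad_onlyL Af (dir_VM hz) (dir_VM hx) _ sx).
  by apply: (badI e2 e1 n21 hz hx); left.
case deep: [exists r, [&& w2 -- r, r != v & [exists q in dir w2 r, sees fs q]]]; last first.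
  have shallow r z : w2 -- r -> r != v -> z \in dir w2 r -> ~~ sees fs z.
    move=> wr rv hz; apply/negP => sz; case/negP: (negbT deep); apply/existsP; exists r.
    by rewrite wr rv; apply/exists_inP; exists z.
  apply: (enlarge_pendant SM XM maxM e2 pf f0 out (y := y)) => //.
  - move=> f z ff zV zn; have [w e hz] := VM_dir SM v zV.
    case: (eqVneq w w2) => [?|n]; last exact: off e n hz ff.
    subst w; case: (dir_split SM e2 hz) => [k|[r [wr rv hzr]]]; first by rewrite k in zn.
    rewrite (negbTE (deepv r z wr rv hzr)) /=; apply/negP => fz.
    by move/negP: (shallow r z wr rv hzr); apply; apply: sees_in fz.
  - by move=> f ff; rewrite va faE.
  - by move=> f ff; rewrite vb fbE.
  - by move=> z ze nz; apply: oL => //; apply: strip_dir.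
  - case: (dir_split SM e2 hy) => // -[r [wr rv hyr]].
    by have := shallow r y wr rv hyr; rewrite seenL_sees.
  - exact: seenL_sees.
case/existsP: deep => r /and3P[wr rv /exists_inP[q hq sq]].
have nw2 := two_nonleaf wr w2v rv; rewrite eq_sym in rv.
have wa : w2 \in alpha = false by apply: contraNF nw2; apply: (alpha_leaf XM).
have wb : w2 \in beta = false by apply: contraNF nw2; apply: (beta_leaf XM).
have hx2 : x \in dir w2 v by apply: dir_sub hx => //; rewrite eq_sym.
have nx2 : x \notin Mv w2.
  apply/negP => xw; have xe := dir_head SM w2v hx2 xw; rewrite MvvC in xe.
  by rewrite (dir_inj SM e1 e2 hx (strip_dir e2 xe)) eqxx in ne.
have hq2 : q \in dir v w2 by apply: dir_sub hq => //; rewrite eq_sym.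
have nq : q \notin Mv v by apply: (deepv r) => //; rewrite eq_sym.
have sqL := onlyL_seenL (oL _ hq2 nq) sq.
have qw : q \in Mv w2.
  apply/negPn/negP => nqw.
  exact: (interior_pair ehf SM XM D w2v wr rv hx2 hq nx2 nqw sx sqL).
have Dr := detached_rev D; have sxr : seenL (rev fs) x by rewrite seenL_rev.
have sqr : sees (rev fs) q by rewrite sees_rev.
rewrite eq_sym in rv.
apply: (enlarge_path SM XM maxM e2 pf f0 out).
- move=> f z ff zV zn; have [w e hz] := VM_dir SM v zV.
  case: (eqVneq w w2) => [?|n].
    subst w; case: (dir_split SM e2 hz) => [k|[r' [wr' rv' hzr]]]; first by rewrite k in zn.
    rewrite (negbTE (deepv r' z wr' rv' hzr)) /=.
    case: (boolP (z \in Mv w2)) => zw /=; last first.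
      apply/negP => fz; have szr : sees (rev fs) z by rewrite sees_rev; apply: sees_in fz.
      have [_ _ k] := seen_heads ehf SM XM Dr w2v wr' rv' hx2 nx2 sxr hzr szr.
      by rewrite k in zw.
    have szr := heads_seen ehf SM XM Dr wr w2v wr' rv rv' hx2 nx2 sxr hq sqr hzr zw.
    have [oH _ _] := seen_heads ehf SM XM Dr w2v wr' rv' hx2 nx2 sxr hzr szr.
    have [_ h] := onlyH_atH oH szr; have {}h := h f; rewrite mem_rev head_rev in h.
    exact: h.
  rewrite (off w z f e n hz ff).
  have -> : z \in Mv w2 = false; last by rewrite /= orbF.
  apply/negP => zw; have hz2 : z \in dir w2 v by apply: dir_sub hz.
  have ze := dir_head SM w2v hz2 zw; rewrite MvvC in ze.
  by rewrite (dir_inj SM e e2 hz (strip_dir e2 ze)) eqxx in n.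
- by move=> f ff; rewrite va wa faE.
- by move=> f ff; rewrite vb wb fbE.
Qed.

Lemma no_detached fs x y : detached M a b fs -> x \in VM M -> y \in VM M -> bad x y ->
  sees fs x -> sees fs y -> False.
Proof.
have key fs' x' y' : detached M a b fs' -> bad x' y' -> seenH fs' x' -> seenL fs' y' -> False.
  move=> D [v [w1 [w2 [[e1 e2 ne] [hx hy]]]]] nxy sx sy.
  case: (boolP (x' \in Mv v)) => xv; case: (boolP (y' \in Mv v)) => yv.
  - by rewrite xv yv in nxy.
  - exact: (no_half_interior D e1 e2 ne hx hy xv yv sx sy).
  - rewrite eq_sym in ne.
    by apply: (no_half_interior (detached_rev D) e2 e1 ne hy hx yv xv); rewrite ?seenH_rev ?seenL_rev.
  - exact: (interior_pair ehf SM XM D e1 e2 ne hx hy xv yv sx sy).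
move=> D xV yV bd sx sy; have [Af _ _] := D.
case: (bad_seen Af xV yV bd sx sy) => -[k1 k2]; first exact: (key fs x y).
by apply: (key (rev fs) x y) => //; rewrite ?seenH_rev ?seenL_rev; first exact: detached_rev.
Qed.

End NoDetached.

(** * Attachments seen by a only *)

(** What minimality gives when a sees the path and some seen vertex is not a neighbour of a: one end
    is at a, the other one sees all such vertices. *)
Definition hung (J G : sgraph) (M : strip_family J G) (a b : G) fs :=
  [/\ attached M a b fs, pend a b fs & forall x, x \in VM M -> ~~ (a -- x) -> onlyH fs x].

Section Hung.
Variables (J G : sgraph) (ehf : even_hole_free G) (M : strip_family J G).
Variables (alpha beta : {set J}) (a b : G).
Hypothesis SM : is_strip_system M.
Hypothesis XM : cross_edge M alpha beta a b.
Variable fs : seq G.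
Hypothesis D : hung M a b fs.
Implicit Types (p q r s t u v w g : J) (x y z f : G) (Q R : seq G) (c d : bool).

Notation Mv := (Mv M).
Notation Mvv u v := (Me M [set u; v]).
Notation dir := (dir M).
Notation inS := (inS M).
Notation beam := (beam M alpha).

Let ab : a -- b. Proof. by case: XM. Qed.
Let Af : attached M a b fs. Proof. by case: D. Qed.
Let P : pend a b fs. Proof. by case: D. Qed.
Let oH : forall x, x \in VM M -> ~~ (a -- x) -> onlyH fs x. Proof. by case: D. Qed.

Lemma hung_noF x : x \in VM M -> ~~ sees fs x -> noF fs x.
Proof. by move=> xV; apply: noF_sees; apply: att_out Af xV. Qed.

Lemma hung_atH x : x \in VM M -> ~~ (a -- x) -> sees fs x -> atH fs x.
Proof. by move=> xV na; apply: onlyH_atH; apply: oH. Qed.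

Lemma beta_beam_noa v w Q x : v \notin leaves J -> beam v w false Q -> x \in Q -> ~~ (a -- x).
Proof. by move=> nv B xQ; rewrite (beam_a XM nv B xQ) andbF. Qed.

(** The two beams leave to b from vertices seen by the head of [fs]; with the exit through a they
    form a theta. *)
Lemma two_exits v w w' Q Q' : v -- w -> v -- w' -> w != w' -> beam v w false Q -> beam v w' false Q' ->
  (exists2 z, z \in Q & (z != head z Q) && sees fs z) -> has (sees fs) Q' -> False.
Proof.
move=> e e' ne B B' E E'; have nv := two_nonleaf e e' ne.
have [q [y [r [eQ q0 sy ur]]]] := last_seen (beam_uniq B) E.
have [q' [y' [r' [eQ' sy' ur']]]] := last_split E'.
have L := beam_leg XM nv B; have L' := beam_leg XM nv B'.
have T := beam_touch SM e e' ne B B'.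
have yQ : y \in Q by rewrite eQ in_split.
have yQ' : y' \in Q' by rewrite eQ' in_split.
have n0 : {in r, forall z, noF fs z}.
  by move=> z zr; apply: hung_noF (ur z zr); apply: (beam_VM B); rewrite eQ mem_cat inE zr !orbT.
have n0' : {in r', forall z, noF fs z}.
  by move=> z zr; apply: hung_noF (ur' z zr); apply: (beam_VM B'); rewrite eQ' mem_cat inE zr !orbT.
have h := hung_atH (beam_VM B yQ) (beta_beam_noa nv B yQ) sy.
have h' := hung_atH (beam_VM B' yQ') (beta_beam_noa nv B' yQ') sy'.
move: L L' T; rewrite eQ eQ' => L L' T.
have [p1 p2 _] := leg_out L; have [p1' p2' _] := leg_out L'.
have A := touch_out2 L L' T; rewrite q0 /= in A; have {}A := A isT.
exact: (pendant_theta ehf ab P p1' p1 A p2' p2 h' h n0' n0).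
Qed.

Lemma no_two_exits v w w' x y : v -- w -> v -- w' -> w != w' -> x \in dir v w -> y \in dir v w' ->
  x \notin Mv v -> sees fs x -> sees fs y -> ~ inS alpha x -> ~ inS alpha y -> False.
Proof.
move=> e e' ne hx hy nx sx sy nSx nSy; have nv := two_nonleaf e e' ne.
have [Q [B xQ]] := beta_beam SM XM nv e hx nSx.
have [Q' [B' yQ]] := beta_beam SM XM nv e' hy nSy.
apply: (two_exits e e' ne B B'); last by apply/hasP; exists y.
by exists x; rewrite // sx (beam_nohead B).
Qed.

(** A seen vertex inside a strip at an alpha leaf, not adjacent to a, has a way out to b too: back
    to s along its beam and out along [Q3]. *)
Lemma strip_exit s t w3 x Q3 : t \in alpha -> s -- t -> s -- w3 -> w3 != t -> beam s w3 false Q3 ->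
  {in Q3, forall z, ~~ sees fs z} -> x \in Mvv s t -> ~~ (a -- x) -> sees fs x ->
  exists Q1 (q : seq G) y (r E : seq G), [/\ beam s t true Q1, Q1 = q ++ y :: r, r != [::] & E = rev q ++ Q3] /\
    [/\ ipath (y :: E), full a b false (y :: E), atH fs y, {in q, forall z, noF fs z} &
     {in E, forall z, noF fs z}].
Proof.
move=> ta st e3 n3 B3 u3 xe na sx.
have lt := alpha_leaf XM ta; have ns := nbr_nonleaf SM lt st.
have [c1 [Q1 [B1 x1]]] := any_beam SM XM ns st (strip_dir st xe).
have ct : c1 = true by rewrite -(beam_strip ns B1 x1 lt st xe).
subst c1.
have xl : x != last x Q1 by move: na; rewrite (beam_a XM ns B1 x1) andbT.
have S1 : has (sees fs) Q1 by apply/hasP; exists x.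
have [q [y [r [e1 sy uq]]]] := first_split S1.
have rn : r != [::].
  apply: contraNneq xl => r0; move: x1 uq; rewrite e1 r0 mem_cat inE => /orP[h /(_ x h)|/eqP-> _].
    by rewrite sx.
  by rewrite last_cat.
have y1 : y \in Q1 by rewrite e1 in_split.
have yl : y != last y Q1.
  rewrite e1 last_cat /=; case: (r) rn (beam_uniq B1) e1 => // z r' _ u e1 /=.
  apply/eqP => k; move: u; rewrite e1 cat_uniq => /and3P[_ _] /= /andP[].
  by rewrite {1}k mem_last.
have nay : ~~ (a -- y) by rewrite (beam_a XM ns B1 y1) (negbTE yl).
have nq : {in q, forall z, noF fs z}.
  by move=> z zq; apply: hung_noF (uq z zq); apply: (beam_VM B1); rewrite e1 mem_cat zq.
rewrite eq_sym in n3.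
have T := beam_touch SM st e3 n3 B1 B3; have L1 := beam_leg XM ns B1.
rewrite e1 in T L1; have [d1 d2 d3 _] := detour L1 (beam_leg XM ns B3) T.
exists Q1, q, y, r, (rev q ++ Q3); split=> //; split=> //.
- exact: d3.
- exact: hung_atH (beam_VM B1 y1) nay sy.
- move=> z; rewrite mem_cat mem_rev => /orP[/nq //|z3].
  exact: hung_noF (beam_VM B3 z3) (u3 z z3).
Qed.

(** Two ways out of this kind, from strips facing each other, again form a theta. *)
Lemma strip_exits s t s' t' w3 w4 x y Q3 Q4 : t \in alpha -> t' \in alpha -> s -- t -> s' -- t' -> s != s' ->
  (forall g, s -- g -> s' \in side s g -> w3 != g) -> (forall g, s' -- g -> s \in side s' g -> w4 != g) ->
  s -- w3 -> w3 != t -> beam s w3 false Q3 -> {in Q3, forall z, ~~ sees fs z} ->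
  s' -- w4 -> w4 != t' -> beam s' w4 false Q4 -> {in Q4, forall z, ~~ sees fs z} ->
  x \in Mvv s t -> y \in Mvv s' t' -> ~~ (a -- x) -> ~~ (a -- y) -> sees fs x -> sees fs y -> False.
Proof.
move=> ta ta' st st' ss' F3 F4 e3 n3 B3 u3 e4 n4 B4 u4 xe ye nx ny sx sy.
have [Q1 [q [x' [r [E [[B1 e1 r0 eE] [p1 f1 h1 _ m1]]]]]]] := strip_exit ta st e3 n3 B3 u3 xe nx sx.
have [Q2 [q' [y' [r' [E' [[B2 e2 r0' eE'] [p2 f2 h2 _ m2]]]]]]] := strip_exit ta' st' e4 n4 B4 u4 ye ny sy.
have [g [g' [sg k1 sg' k2]]] := facing SM ss'.
have ns := nbr_nonleaf SM (alpha_leaf XM ta) st; have ns' := nbr_nonleaf SM (alpha_leaf XM ta') st'.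
have tg : t != g.
  by apply: contraNneq ns' => e; subst g; rewrite (leaf_side (alpha_leaf XM ta) st k1) (alpha_leaf XM ta).
have tg' : t' != g'.
  by apply: contraNneq ns => e; subst g'; rewrite (leaf_side (alpha_leaf XM ta') st' k2) (alpha_leaf XM ta').
have A : apart (y' :: E') (x' :: E).
  have A12 := beam_apart SM sg k1 sg' k2 st tg st' tg' B1 B2.
  have A14 := beam_apart SM sg k1 sg' k2 st tg e4 (F4 _ sg' k2) B1 B4.
  have A32 := beam_apart SM sg k1 sg' k2 e3 (F3 _ sg k1) st' tg' B3 B2.
  have A34 := beam_apart SM sg k1 sg' k2 e3 (F3 _ sg k1) e4 (F4 _ sg' k2) B3 B4.
  have i1 z : z \in x' :: E -> (z \in Q1) || (z \in Q3).
    by rewrite eE e1 !(inE, mem_cat, mem_rev) => /or3P[->|->|->]; rewrite ?orbT.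
  have i2 z : z \in y' :: E' -> (z \in Q2) || (z \in Q4).
    by rewrite eE' e2 !(inE, mem_cat, mem_rev) => /or3P[->|->|->]; rewrite ?orbT.
  apply: apartC => z z' /i1/orP[k|k] /i2/orP[k'|k']; [exact: A12|exact: A14|exact: A32|exact: A34].
exact: (pendant_theta ehf ab P p1 p2 A f1 f2 h1 h2 m1 m2).
Qed.

(* The prism with triangle at v and legs to t, into the direction g, and in the third direction w4. *)
Lemma strip_prism v t g w4 x z Q4 : t \in alpha -> v -- t -> v -- g -> g != t ->
  z \in Mvv v t -> atL fs z -> a -- z -> (forall z', z' \in Mvv v t -> sees fs z' -> a -- z') ->
  x \in dir v g -> sees fs x -> ~~ (a -- x) -> ~~ (b -- x) ->
  v -- w4 -> w4 != t -> w4 != g -> beam v w4 false Q4 -> {in Q4, forall z, ~~ sees fs z} -> False.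
Proof.
move=> ta vt vg gt ze zL az E hx sx na nb e4 n4 n4' B4 u4.
have lt := alpha_leaf XM ta; have nv := nbr_nonleaf SM lt vt.
have [c1 [Q1 [B1 z1]]] := any_beam SM XM nv vt (strip_dir vt ze).
have ct : c1 = true by rewrite -(beam_strip nv B1 z1 lt vt ze).
subst c1.
have zl : z = last z Q1 by apply/eqP; have := beam_a XM nv B1 z1; rewrite az andbT => <-.
have [q1 e1] : exists q : seq G, Q1 = q ++ [:: z].
  case: (lastP Q1) (z1) zl => // q z'; rewrite last_rcons => _ ->.
  by exists q; rewrite cats1.
have n1 : {in q1, forall z, noF fs z}.
  move=> w wq; have wQ : w \in Q1 by rewrite e1 mem_cat wq.
  apply: hung_noF (beam_VM B1 wQ) _.
  apply/negP => /(E w (leaf_dir SM lt vt (beam_dir B1 wQ))); rewrite (beam_a XM nv B1 wQ) andbT.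
  rewrite e1 last_cat /= => /eqP e; move: (beam_uniq B1).
  by rewrite e1 cat_uniq /= orbF -e wq andbF.
have [c2 [Q2 [B2 x2]]] := any_beam SM XM nv vg hx.
have xl := beam_nolast XM nv B2 x2 na nb.
have S2 : has (sees fs) Q2 by apply/hasP; exists x.
have [p2 [y [r2 [e2 sy u2]]]] := first_split S2.
have rn : r2 != [::].
  apply: contraNneq xl => r0; move: x2 u2; rewrite e2 r0 mem_cat inE => /orP[h /(_ x h)|/eqP-> _].
    by rewrite sx.
  by rewrite last_cat.
have y2 : y \in Q2 by rewrite e2 in_split.
have yl : y != last y Q2.
  rewrite e2 last_cat /=; case: (r2) rn (beam_uniq B2) e2 => // w r' _ u e2 /=.
  apply/eqP => k; move: u; rewrite e2 cat_uniq => /and3P[_ _] /= /andP[].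
  by rewrite {1}k mem_last.
have nay : ~~ (a -- y) by rewrite (beam_a XM nv B2 y2) (negbTE yl).
have n2 : {in p2, forall z, noF fs z}.
  by move=> w wq; apply: hung_noF (u2 w wq); apply: (beam_VM B2); rewrite e2 mem_cat wq.
have yH := hung_atH (beam_VM B2 y2) nay sy.
have L1 := beam_leg XM nv B1; have L2 := beam_leg XM nv B2; have L4 := beam_leg XM nv B4.
rewrite eq_sym in gt; rewrite eq_sym in n4; rewrite eq_sym in n4'.
have T12 := beam_touch SM vt vg gt B1 B2; have T14 := beam_touch SM vt e4 n4 B1 B4.
have T24 := beam_touch SM vg e4 n4' B2 B4.
rewrite e1 in L1 T12 T14; rewrite e2 in L2 T12 T24.
apply: (pendant_prism ehf ab P L1 L2 L4 T12 T14 T24 rn n1 zL n2 yH).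
by move=> w wQ; apply: hung_noF (beam_VM B4 wQ) (u4 w wQ).
Qed.

End Hung.

(** * Vertices seen inside strips at alpha leaves *)

Section HungStrip.
Variables (J G : sgraph) (ehf : even_hole_free G) (M : strip_family J G).
Variables (alpha beta : {set J}) (a b : G).
Hypothesis SM : is_strip_system M.
Hypothesis XM : cross_edge M alpha beta a b.
Variable fs : seq G.
Hypothesis D : hung M a b fs.
Implicit Types (p q r s t u v w g : J) (x y z f : G) (Q R : seq G) (c d : bool).

Notation Mv := (Mv M).
Notation Mvv u v := (Me M [set u; v]).
Notation dir := (dir M).
Notation inS := (inS M).
Notation beam := (beam M alpha).

Let ab : a -- b. Proof. by case: XM. Qed.
Let Af : attached M a b fs. Proof. by case: D. Qed.
Let P : pend a b fs. Proof. by case: D. Qed.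
Let pf : ipath fs. Proof. by case: P. Qed.
Let f0 : fs != [::]. Proof. by case: P. Qed.
Let oH : forall x, x \in VM M -> ~~ (a -- x) -> onlyH fs x. Proof. by case: D. Qed.

Lemma strips_facing s t s' t' : t \in alpha -> t' \in alpha -> s -- t -> s' -- t' -> t != t' ->
  exists g g', [/\ s -- g, s' \in side s g, s' -- g' & s \in side s' g'] /\
    [/\ s != s', t != g, t' != g', {subset dir s' t' <= dir s g} & {in dir s' t', forall x, x \notin Mv s}].
Proof.
move=> ta ta' st st' tt'.
have lt := alpha_leaf XM ta; have lt' := alpha_leaf XM ta'.
have ns := nbr_nonleaf SM lt st; have ns' := nbr_nonleaf SM lt' st'.
have ss' : s != s'.
  by apply: contraNneq tt' => e; subst s'; rewrite (alpha_uniq XM st st' ta ta').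
have [g [g' [sg h1 sg' h2]]] := facing SM ss'.
have tg : t != g.
  by apply: contraNneq ns' => e; subst g; rewrite (leaf_side lt st h1).
have tg' : t' != g'.
  by apply: contraNneq ns => e; subst g'; rewrite (leaf_side lt' st' h2).
have [F1 F2] := dir_far SM sg h1 sg' h2 st' tg'.
by exists g, g'; split.
Qed.

Lemma end_not_head s t w x : t \in alpha -> s -- t -> s -- w -> w != t -> x \in dir s w -> x \in Mv s ->
  [/\ ~ inS alpha x, x \notin Mvv s t & ~~ (a -- x)].
Proof.
move=> ta st sw wt hx xs; have ns := nbr_nonleaf SM (alpha_leaf XM ta) st.
have xe := dir_head SM sw hx xs.
have nw : w \notin alpha by apply: contraNN wt => wa; rewrite (alpha_uniq XM sw st wa ta).
have nS := head_noS SM XM ns sw nw xe xs.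
split=> //; first by apply/negP => k; apply: nS; exists s, t.
by apply/negP => k; apply: nS; apply: (a_inS SM XM (dir_VM hx) k).
Qed.

Lemma dir_of s t x : t \in alpha -> s -- t -> x \in VM M -> x \notin Mvv s t ->
  exists g, [/\ s -- g, g != t & x \in dir s g].
Proof.
move=> ta st xV nx; have [g sg hx] := VM_dir SM s xV; exists g; split=> //.
by apply: contraNneq nx => e; subst g; apply: (leaf_dir SM (alpha_leaf XM ta) st hx).
Qed.

(** The last vertex of [fs] is adjacent to a and so belongs to M_t, the head belongs to M_s: [fs]
    becomes a rung of the strip st. *)
Lemma hung_close s t :
  (forall M' : strip_family J G, is_strip_system M' -> has_cross_edge M' a b -> ~~ (VM M \proper VM M')) ->
  t \in alpha -> s -- t ->
  (forall x, x \in VM M -> x \notin Mvv s t -> sees fs x -> x \in Mv s) ->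
  (forall x, x \in Mv s -> x \notin Mvv s t -> sees fs x) -> False.
Proof.
move=> maxM ta st H1 H2; have lt := alpha_leaf XM ta; have ns := nbr_nonleaf SM lt st.
have [_ _ out _] := Af; have [_ _ Ca Cb] := P.
have sa : s \in alpha = false by apply: contraNF ns; apply: (alpha_leaf XM).
have sb : s \in beta = false by apply: contraNF ns; apply: (beta_leaf XM).
have tb : t \in beta = false by apply/negP => tb; exact: (alpha_betaF XM ta tb).
apply: (enlarge_path SM XM maxM st pf f0 out).
- move=> f z ff zV zn.
  have -> : z \in Mv t = false.
    apply/negP => zt; have [s' ts' ze] := Mv_strip SM zt.
    have st' : t -- s by rewrite edgeC.
    by rewrite (leaf_uniq lt ts' st') MvvC (negbTE zn) in ze.
  rewrite orbF; case: (boolP (z \in Mv s)) => zs /=; last first.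
    apply/negP => fz; case/negP: zs; apply: H1 => //; apply/hasP; by exists f.
  have [g [sg gt hz]] := dir_of ta st zV zn.
  have [_ _ na] := end_not_head ta st sg gt hz zs.
  by have [_ ->] := hung_atH D zV na (H2 z zs zn).
- by move=> f ff; rewrite sa ta; have [_ ->] := Ca f ff.
- by move=> f ff; rewrite sb tb /=; have [_ ->] := Cb f ff.
Qed.

(** A vertex of M_s in the strip sw lies in M_s', for s' different from s, only if s' = w; but s has
    two neighbours besides t. *)
Lemma two_heads s t s' : t \in alpha -> s -- t -> s' != s ->
  (forall x, x \in Mv s -> x \notin Mvv s t -> sees fs x) ->
  (forall x, x \in VM M -> ~ inS alpha x -> sees fs x -> x \in Mv s') -> False.
Proof.
move=> ta st ne H2 H; have ns := nbr_nonleaf SM (alpha_leaf XM ta) st.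
have key w : s -- w -> w != t -> s' = w.
  move=> sw wt; have [x [xe xs]] := head_exists SM sw.
  have [nS nx _] := end_not_head ta st sw wt (strip_dir sw xe) xs.
  have xV := Mv_VM SM xs.
  case: (Mv_ends SM sw xe (H x xV nS (H2 x xs nx))) => // e.
  by rewrite e eqxx in ne.
have [w [sw wt _]] := third_dir SM XM t t ns.
have [w' [sw' wt' ww']] := third_dir SM XM t w ns.
by rewrite -(key w sw wt) (key w' sw' wt') eqxx in ww'.
Qed.

(** One exit leads from z back to s and out along a third beam, the other along the beam of x. If
    the third beam is seen, it and the beam of x are two exits already. *)
Lemma exit_inside s t g z x : t \in alpha -> s -- t -> z \in Mvv s t -> sees fs z -> ~~ (a -- z) ->
  s -- g -> g != t -> x \in dir s g -> x \notin Mv s -> sees fs x -> ~ inS alpha x -> False.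
Proof.
move=> ta st ze sz na sg gt hx nx sx nS; have ns := nbr_nonleaf SM (alpha_leaf XM ta) st.
have [w3 [e3 n31 n32 n3a]] := third_beta SM XM ns (introT orP (or_introl _ ta)) st sg.
have [Q3 B3] := dir_beam SM XM ns e3 n3a.
have [Q2 [B2 x2]] := beta_beam SM XM ns sg hx nS.
have E2 : exists2 z, z \in Q2 & (z != head z Q2) && sees fs z.
  by exists x; rewrite // sx (beam_nohead B2).
have n23 : g != w3 by rewrite eq_sym.
case u3: (has (sees fs) Q3).
  by apply: (two_exits ehf SM XM D sg e3 n23 B2 B3) E2 u3.
have {}u3 : {in Q3, forall z, ~~ sees fs z}.
  by move=> z' zQ; apply/negP => k; move/hasP: u3; case; exists z'.
have [Q1 [q [y [r [E [[B1 e1 r0 eE] [p1 f1 h1 _ m1]]]]]]] := strip_exit SM XM D ta st e3 n31 B3 u3 ze na sz.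
have [q2 [y2 [r2 [e2 q0 sy2 u2]]]] := last_seen (beam_uniq B2) E2.
have L2 := beam_leg XM ns B2; rewrite e2 in L2; have [p2 f2 _] := leg_out L2.
have yQ : y2 \in Q2 by rewrite e2 in_split.
have h2 := hung_atH D (beam_VM B2 yQ) (beta_beam_noa XM ns B2 yQ) sy2.
have n2 : {in r2, forall z, noF fs z}.
  by move=> w wr; apply: (hung_noF D) (u2 w wr); apply: (beam_VM B2); rewrite e2 mem_cat inE wr !orbT.
rewrite eq_sym in gt.
have T21 := touchC (beam_touch SM st sg gt B1 B2).
have T23 := beam_touch SM sg e3 n23 B2 B3; rewrite e2 in T21 T23.
have A1 := touch_out L2 T21 q0; have A3 := touch_out L2 T23 q0.
apply: (pendant_theta ehf ab P p1 p2 _ f1 f2 h1 h2 m1 n2).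
move=> w w' wr; rewrite eE inE mem_cat mem_rev => /or3P[k|k|k]; [apply: A1|apply: A1|apply: A3] => //.
  by rewrite (eqP k) e1 in_split.
by rewrite e1 mem_cat k.
Qed.

(** A seen head and an unseen head in different directions at s, together with the seen z inside the
    strip, form the configuration of [pendant_star]. *)
Lemma star_heads s t g w z x (p : G) : t \in alpha -> s -- t -> z \in Mvv s t -> sees fs z -> ~~ (a -- z) ->
  (forall x', x' \in VM M -> ~ inS alpha x' -> sees fs x' -> x' \in Mv s) ->
  s -- g -> g != t -> x \in dir s g -> x \in Mv s -> sees fs x ->
  s -- w -> w != t -> w != g -> p \in dir s w -> p \in Mv s -> sees fs p.
Proof.
move=> ta st ze sz na H sg gt hx xs sx sw wt wg hp ps; apply/negPn/negP => up.
have ns := nbr_nonleaf SM (alpha_leaf XM ta) st.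
have [nSx _ nax] := end_not_head ta st sg gt hx xs; have [nSp _ nap] := end_not_head ta st sw wt hp ps.
have [Q2 [B2 x2]] := beta_beam SM XM ns sg hx nSx.
have [Q2' ?] := beam_hd B2 x2 xs; subst Q2.
have [Q3 [B3 p3]] := beta_beam SM XM ns sw hp nSp.
have [Q3' ?] := beam_hd B3 p3 ps; subst Q3.
have tl w' (q : G) Q : beam s w' false (q :: Q) -> {in Q, forall z, ~~ sees fs z}.
  move=> B z' zQ; apply/negP => sz'; have zQ' : z' \in q :: Q by rewrite inE zQ orbT.
  have nS' : ~ inS alpha z' by move=> h; have [/(_ h)] := beam_inS XM ns B zQ'.
  have := H z' (beam_VM B zQ') nS' sz'; rewrite (beam_head B zQ') /= => /eqP k.
  by have := beam_uniq B; rewrite /= -k zQ.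
have u3 : {in p :: Q3', forall z, ~~ sees fs z}.
  by move=> z' /predU1P[->|] //; apply: tl B3 _.
have [Q1 [q [y [r [E [[B1 e1 r0 eE] [p1 f1 h1 n1 m1]]]]]]] := strip_exit SM XM D ta st sw wt B3 u3 ze na sz.
have nF Q : {subset Q <= VM M} -> {in Q, forall z, ~~ sees fs z} -> {in Q, forall z, noF fs z}.
  by move=> sV u z' zQ; apply: (hung_noF D) (u z' zQ); apply: sV.
rewrite eq_sym in gt; rewrite eq_sym in wt; rewrite eq_sym in wg.
have L1 := beam_leg XM ns B1; have T12 := beam_touch SM st sg gt B1 B2; have T13 := beam_touch SM st sw wt B1 B3.
rewrite e1 in L1 T12 T13.
apply: (pendant_star ehf ab P L1 (beam_leg XM ns B2) (beam_leg XM ns B3) T12 T13 (beam_touch SM sg sw wg B2 B3) r0 n1 h1).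
- exact: (hung_atH D (dir_VM hx) nax sx).
- apply: nF; last exact: tl B2.
  by move=> z' zQ; apply: (beam_VM B2); rewrite inE zQ orbT.
- by apply: nF u3 => z' zQ; apply: (beam_VM B3).
Qed.

Section Interior.
Hypothesis maxM : forall M' : strip_family J G,
  is_strip_system M' -> has_cross_edge M' a b -> ~~ (VM M \proper VM M').

(** The aim is [hung_close]: by [exit_inside] what is seen outside the alpha strips is in M_s, and
    by [star_heads] all of M_s outside the strip is seen. A seen vertex y in a second alpha strip
    remains to be excluded. *)
Lemma hung_strip_interior s t x z : t \in alpha -> s -- t -> z \in Mvv s t -> sees fs z -> ~~ (a -- z) ->
  x \in VM M -> ~ inS alpha x -> sees fs x -> False.
Proof.
move=> ta st ze sz na xV nSx sx; have lt := alpha_leaf XM ta; have ns := nbr_nonleaf SM lt st.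
have inside s' t' z' : t' \in alpha -> s' -- t' -> z' \in Mvv s' t' -> sees fs z' -> ~~ (a -- z') ->
    forall x', x' \in VM M -> ~ inS alpha x' -> sees fs x' -> x' \in Mv s'.
  move=> ta' st' ze' sz' na' x' xV' nS' sx'; apply/negPn/negP => nx'.
  have nxe : x' \notin Mvv s' t' by apply/negP => k; apply: nS'; exists s', t'.
  have [g [sg gt hx']] := dir_of ta' st' xV' nxe.
  exact: (exit_inside ta' st' ze' sz' na' sg gt hx' nx' sx' nS').
have H := inside s t z ta st ze sz na.
have xs := H x xV nSx sx.
have nxe : x \notin Mvv s t by apply/negP => k; apply: nSx; exists s, t.
have [g [sg gt hx]] := dir_of ta st xV nxe.
have H2 (p : G) : p \in Mv s -> p \notin Mvv s t -> sees fs p.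
  move=> ps npe; have [w [sw wt hp]] := dir_of ta st (Mv_VM SM ps) npe.
  have key g' x' w' (p' : G) := @star_heads s t g' w' z x' p' ta st ze sz na H.
  case: (eqVneq w g) => [e|ne]; last exact: (key g x w p).
  subst w; have [w' [sw' wt' wg']] := third_dir SM XM t g ns.
  have [p' [pe' ps']] := head_exists SM sw'.
  have sp' := key g x w' p' sg gt hx xs sx sw' wt' wg' (strip_dir sw' pe') ps'.
  by rewrite eq_sym in wg'; apply: (key w' p' g p sw' wt' (strip_dir sw' pe') ps' sp' sg gt wg' hp ps).
apply: (hung_close maxM ta st) => // y yV nye sy.
have [[s' [t' [ta' st' ye]]]|nSy] := inSP M alpha y; last exact: H.
have tt' : t != t'.
  apply: contraNneq nye => e; subst t'; have st1 : t -- s by rewrite edgeC.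
  have st1' : t -- s' by rewrite edgeC.
  by rewrite (leaf_uniq lt st1 st1').
have [g0 [g' [[sg0 h1 sg' h2] [ss' tg0 tg' F1 F2]]]] := strips_facing ta ta' st st' tt'.
(* A seen non-neighbour of a in the second strip would confine the seen vertices outside the alpha
   strips to M_s' as well, against [two_heads]. *)
case E: [exists z' in Mvv s' t', sees fs z' && ~~ (a -- z')].
  case/exists_inP: E => z' ze' /andP[sz' na']; exfalso.
  have H' := inside s' t' z' ta' st' ze' sz' na'.
  by rewrite eq_sym in ss'; apply: (two_heads ta st ss' H2 H').
have E' z' : z' \in Mvv s' t' -> sees fs z' -> a -- z'.
  by move=> ze' sz'; apply: contraFT E => na'; apply/exists_inP; exists z'; rewrite ?sz'.
have ns' := nbr_nonleaf SM (alpha_leaf XM ta') st'.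
have [w4 [e4 n41 n42 n4a]] := third_beta SM XM ns' (introT orP (or_introl _ ta')) st' sg'.
have [Q4 B4] := dir_beam SM XM ns' e4 n4a.
have [F3 F4] := dir_far SM sg0 h1 sg' h2 e4 n42.
have [F5 F6] := dir_far SM sg' h2 sg0 h1 st tg0.
have hz := strip_dir st ze; have hy := strip_dir st' ye.
have oLy : onlyL fs y.
  apply: (bad_onlyL Af (dir_VM hy) (dir_VM hz)); last exact: onlyH_seenH (oH (dir_VM hz) na) sz.
  by apply: bad_sym; apply: (badI st sg0 tg0 hz (F1 _ hy)); right; apply: F2.
have nbz : ~~ (b -- z).
  by apply/negP => /(b_inS SM XM (dir_VM hz)) k; apply: (inS_excl SM XM _ k); exists s, t.
have gt' : g' != t' by rewrite eq_sym.
exfalso; apply: (strip_prism ehf SM XM D ta' st' sg' gt' ye (onlyL_atL oLy sy) (E' y ye sy) E' (F5 _ hz) sz na nbz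
  e4 n41 n42 B4).
move=> p pQ; apply/negP => sp.
have nSp : ~ inS alpha p by move=> h; have [/(_ h)] := beam_inS XM ns' B4 pQ.
by have := F4 p (beam_dir B4 pQ); rewrite (H p (beam_VM B4 pQ) nSp sp).
Qed.

End Interior.

End HungStrip.

Section HungEnds.
Variables (J G : sgraph) (ehf : even_hole_free G) (M : strip_family J G).
Variables (alpha beta : {set J}) (a b : G).
Hypothesis SM : is_strip_system M.
Hypothesis XM : cross_edge M alpha beta a b.
Variable fs : seq G.
Hypothesis D : hung M a b fs.
Hypothesis maxM : forall M' : strip_family J G,
  is_strip_system M' -> has_cross_edge M' a b -> ~~ (VM M \proper VM M').
Implicit Types (p q r s t u v w g : J) (x y z f : G) (Q R : seq G) (c d : bool).

Notation Mvv u v := (Me M [set u; v]).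
Notation bad := (bad M).
Notation beam := (beam M alpha).

Let ab : a -- b. Proof. by case: XM. Qed.
Let P : pend a b fs. Proof. by case: D. Qed.
Let oH : forall x, x \in VM M -> ~~ (a -- x) -> onlyH fs x. Proof. by case: D. Qed.

(** Read off from [pendant_path]: x is the only seen vertex of the path made of the two beams and
    does not lie on the first, so it ends its own beam. *)
Lemma lone_end v g w c d x Q2 Q3 : v -- g -> v -- w -> g != w -> beam v g d (x :: Q2) -> beam v w c Q3 ->
  sees fs x -> ~~ (a -- x) -> {in Q2, forall z, ~~ sees fs z} -> {in Q3, forall z, ~~ sees fs z} ->
  x = last x (x :: Q2) /\ d || ~~ c.
Proof.
move=> vg vw ne B2 B3 sx na u2 u3; have nv := two_nonleaf vg vw ne.
rewrite eq_sym in ne.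
have T := beam_touch SM vw vg ne B3 B2.
have L3 := beam_leg XM nv B3; have L2 := beam_leg XM nv B2.
have x2 := mem_head x Q2.
have only z : z \in rev Q3 ++ x :: Q2 -> sees fs z -> z = x.
  rewrite mem_cat mem_rev => /orP[/u3/negP//|/predU1P[//|/u2/negP//]].
have V z : z \in rev Q3 ++ x :: Q2 -> z \in VM M.
  by rewrite mem_cat mem_rev => /orP[]; [exact: (beam_VM B3) | exact: (beam_VM B2)].
have H : {in rev Q3 ++ x :: Q2, forall z, onlyH fs z}.
  move=> z zP; case k: (sees fs z); last by apply: noF_onlyH; apply: (hung_noF D (V z zP)); rewrite k.
  by rewrite (only z zP k); apply: oH na; apply: (beam_VM B2).
have S : has (sees fs) (rev Q3 ++ x :: Q2) by apply/hasP; exists x; rewrite // mem_cat x2 orbT.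
case: (pendant_path ehf ab P L3 L2 T H S) => [[p [x0 [y0 [r [e k]]]]]|[_ k]|[k1 k2]|[_ _ [x0 [y0 [k1 k2 k3 k4 k5]]]]].
- have U := ipath_uniq (ipath_touch (let: And3 h _ _ := L3 in h) (let: And3 h _ _ := L2 in h) T).
  have i1 : x0 \in rev Q3 ++ x :: Q2 by rewrite e mem_cat mem_head orbT.
  have i2 : y0 \in rev Q3 ++ x :: Q2 by rewrite e mem_cat !inE eqxx !orbT.
  have e1 : x0 = x by apply: only => //; rewrite k // eqxx.
  have e2 : y0 = x by apply: only => //; rewrite k // eqxx orbT.
  by move: U; rewrite e cat_uniq e1 e2 /= mem_head !andbF.
- have n3 := beam_nonnil B3.
  have hQ : head x (rev Q3 ++ x :: Q2) \in rev Q3.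
    by case/lastP: (Q3) n3 => // Q y _; rewrite rev_rcons /= mem_head.
  have hP : head x (rev Q3 ++ x :: Q2) \in rev Q3 ++ x :: Q2 by rewrite mem_cat hQ.
  move: (k _ hP); rewrite [X in _ == X](head_def _ x) ?(mem_nonnil hP) // eqxx.
  by move=> sh; rewrite mem_rev in hQ; have := u3 _ hQ; rewrite sh.
- have xP : x \in rev Q3 ++ x :: Q2 by rewrite mem_cat x2 orbT.
  by move: (k2 x xP); rewrite sx last_cat /= => /esym/eqP.
- by case/eqP: k3; rewrite (only x0) // (only y0).
Qed.

(** They lie in different strips; if both were in M_s they would be adjacent and form a square with
    a and b. *)
Lemma beta_bad x z : x \in VM M -> z \in VM M -> b -- x -> a -- z -> bad x z.
Proof.
move=> xV zV bx az; have [s [u [ub su xe xu]]] := aE SM (cross_edge_sym XM) xV bx.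
have lu := beta_leaf XM ub; have hx := strip_dir su xe.
have nz : z \notin Mvv s u.
  by apply/negP => k; apply: (inS_excl SM XM (a_inS SM XM zV az)); exists s, u.
have [g [sg gu hz]] := dir_of SM (cross_edge_sym XM) ub su zV nz.
rewrite eq_sym in gu; exists s, u, g; split=> //; split=> //; apply/negP => /andP[xs zs].
by have := no_four_cycle ehf SM XM zV xV _ az bx; apply; rewrite edgeC; apply: (heads_adj SM su sg gu hx hz).
Qed.

End HungEnds.

Section HungStrips.
Variables (J G : sgraph) (ehf : even_hole_free G) (M : strip_family J G).
Variables (alpha beta : {set J}) (a b : G).
Hypothesis SM : is_strip_system M.
Hypothesis XM : cross_edge M alpha beta a b.
Variable fs : seq G.
Hypothesis D : hung M a b fs.
Hypothesis maxM : forall M' : strip_family J G,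
  is_strip_system M' -> has_cross_edge M' a b -> ~~ (VM M \proper VM M').
Implicit Types (p q r s t u v w g : J) (x y z f : G) (Q R : seq G) (c d : bool).

Notation Mv := (Mv M).
Notation Mvv u v := (Me M [set u; v]).
Notation dir := (dir M).
Notation bad := (bad M).
Notation inS := (inS M).
Notation beam := (beam M alpha).

Let ab : a -- b. Proof. by case: XM. Qed.
Let Af : attached M a b fs. Proof. by case: D. Qed.
Let P : pend a b fs. Proof. by case: D. Qed.
Let pf : ipath fs. Proof. by case: P. Qed.
Let f0 : fs != [::]. Proof. by case: P. Qed.
Let oH : forall x, x \in VM M -> ~~ (a -- x) -> onlyH fs x. Proof. by case: D. Qed.

Lemma beam_tail s w c x Q : beam s w c (x :: Q) ->
  (forall z, z \in Q -> sees fs z -> z \in Mv s) -> {in Q, forall z, ~~ sees fs z}.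
Proof.
move=> B H z zQ; apply/negP => sz; have zQ' : z \in x :: Q by rewrite inE zQ orbT.
have := H z zQ sz; rewrite (beam_head B zQ') /= => /eqP k.
by have := beam_uniq B; rewrite /= -k zQ.
Qed.

Lemma beta_beam_noS v w Q z : v \notin leaves J -> beam v w false Q -> z \in Q -> ~ inS alpha z.
Proof. by move=> nv B zQ h; have [/(_ h)] := beam_inS XM nv B zQ. Qed.

Lemma noS_noa x : x \in VM M -> ~ inS alpha x -> ~~ (a -- x).
Proof. by move=> xV nS; apply/negP => /(a_inS SM XM xV). Qed.

(** At s, a seen third beam would give a second exit besides x, and an unseen one completes the
    prism. *)
Lemma hung_ends_core s t z x : t \in alpha -> s -- t -> z \in Mvv s t -> a -- z -> atL fs z ->
  (forall z', z' \in Mvv s t -> sees fs z' -> a -- z') ->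
  x \in VM M -> ~ inS alpha x -> sees fs x -> ~~ (b -- x) -> x \in Mv s.
Proof.
move=> ta st ze az zL E xV nS sx nb; apply/negPn/negP => nx.
have ns := nbr_nonleaf SM (alpha_leaf XM ta) st.
have nxe : x \notin Mvv s t by apply/negP => k; apply: nS; exists s, t.
have [g [sg gt hx]] := dir_of SM XM ta st xV nxe.
have [w3 [e3 n31 n32 n3a]] := third_beta SM XM ns (introT orP (or_introl _ ta)) st sg.
have [Q3 B3] := dir_beam SM XM ns e3 n3a.
case u3: (has (sees fs) Q3).
  case/hasP: u3 => y y3 sy; rewrite eq_sym in n32.
  exact: (no_two_exits ehf SM XM D sg e3 n32 hx (beam_dir B3 y3) nx sx sy nS (beta_beam_noS ns B3 y3)).
apply: (strip_prism ehf SM XM D ta st sg gt ze zL az E hx sx (noS_noa xV nS) nb e3 n31 n32 B3).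
by move=> z' zQ; apply/negP => k; move/hasP: u3; case; exists z'.
Qed.

(** With p unseen, x would be the only seen vertex of two beams at s, hence the end of its beam and
    a neighbour of b. *)
Lemma head_seen s t g w x (p : G) : t \in alpha -> s -- t ->
  (forall x', x' \in VM M -> ~ inS alpha x' -> sees fs x' -> x' \in Mv s) ->
  s -- g -> g != t -> x \in dir s g -> x \in Mv s -> sees fs x -> ~~ (b -- x) ->
  s -- w -> w != t -> w != g -> p \in dir s w -> p \in Mv s -> sees fs p.
Proof.
move=> ta st H sg gt hx xs sx nb sw wt wg hp ps; apply/negPn/negP => up.
have ns := nbr_nonleaf SM (alpha_leaf XM ta) st.
have [nSx _ nax] := end_not_head SM XM ta st sg gt hx xs.
have [nSp _ nap] := end_not_head SM XM ta st sw wt hp ps.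
have [Q2 [B2 x2]] := beta_beam SM XM ns sg hx nSx.
have [Q2' ?] := beam_hd B2 x2 xs; subst Q2.
have [Q3 [B3 p3]] := beta_beam SM XM ns sw hp nSp.
have [Q3' ?] := beam_hd B3 p3 ps; subst Q3.
have tl w' (q : G) Q : beam s w' false (q :: Q) -> {in Q, forall z, ~~ sees fs z}.
  move=> B; apply: (beam_tail B) => z' zQ.
  have zQ' : z' \in q :: Q by rewrite inE zQ orbT.
  by apply: H; [apply: (beam_VM B zQ') | apply: (beta_beam_noS ns B zQ')].
have u3 : {in p :: Q3', forall z, ~~ sees fs z} by move=> z' /predU1P[->|] //; apply: tl B3 _.
rewrite eq_sym in wg.
have [k _] := lone_end ehf SM XM D sg sw wg B2 B3 sx nax (tl _ _ _ B2) u3.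
by move: nb; rewrite (beam_b XM ns B2 x2) -k eqxx.
Qed.

(** The last hypothesis confines the seen vertices outside the alpha strips to M_s, for each seen
    alpha strip st. Two seen strips contradict [two_heads]; a single one is enlarged by
    [hung_close]. *)
Lemma hung_local_heads z0 x0 : z0 \in VM M -> a -- z0 -> sees fs z0 ->
  x0 \in VM M -> ~ inS alpha x0 -> sees fs x0 ->
  (forall x, x \in VM M -> ~ inS alpha x -> sees fs x -> ~~ (b -- x)) ->
  (forall s t z x, t \in alpha -> s -- t -> z \in Mvv s t -> sees fs z ->
     x \in VM M -> ~ inS alpha x -> sees fs x -> x \in Mv s) -> False.
Proof.
move=> zV az sz xV nSx sx N H.
have [s [t [ta st ze zt]]] := aE SM XM zV az.
have ns := nbr_nonleaf SM (alpha_leaf XM ta) st.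
have Hs x := H s t z0 x ta st ze sz.
have xs := Hs x0 xV nSx sx.
have nxe : x0 \notin Mvv s t by apply/negP => k; apply: nSx; exists s, t.
have [g [sg gt hx]] := dir_of SM XM ta st xV nxe.
have H2 (p : G) : p \in Mv s -> p \notin Mvv s t -> sees fs p.
  move=> ps npe; have [w [sw wt hp]] := dir_of SM XM ta st (Mv_VM SM ps) npe.
  have key g' x' w' (p' : G) : s -- g' -> g' != t -> x' \in dir s g' -> x' \in Mv s -> sees fs x' ->
      s -- w' -> w' != t -> w' != g' -> p' \in dir s w' -> p' \in Mv s -> sees fs p'.
    move=> sg' gt' hx' xs' sx'.
    have [nSx' _ _] := end_not_head SM XM ta st sg' gt' hx' xs'.
    exact: (head_seen ta st Hs sg' gt' hx' xs' sx' (N x' (dir_VM hx') nSx' sx')).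
  case: (eqVneq w g) => [e|ne]; last exact: (key g x0 w p).
  subst w; have [w' [sw' wt' wg']] := third_dir SM XM t g ns.
  have [p' [pe' ps']] := head_exists SM sw'.
  have sp' := key g x0 w' p' sg gt hx xs sx sw' wt' wg' (strip_dir sw' pe') ps'.
  by rewrite eq_sym in wg'; apply: (key w' p' g p sw' wt' (strip_dir sw' pe') ps' sp' sg gt wg' hp ps).
apply: (hung_close SM XM D maxM ta st) => // y yV nye sy.
have [[s' [t' [ta' st' ye]]]|nSy] := inSP M alpha y; last exact: Hs.
have tt' : t != t'.
  apply: contraNneq nye => e; subst t'; have st1 : t -- s by rewrite edgeC.
  have st1' : t -- s' by rewrite edgeC.
  by rewrite (leaf_uniq (alpha_leaf XM ta) st1 st1').
have [g0 [g' [_ [ss' _ _ _ _]]]] := strips_facing SM XM ta ta' st st' tt'.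
rewrite eq_sym in ss'; case: (two_heads SM XM ta st ss' H2 _) => x' xV' nS' sx'.
exact: (H s' t' y x' ta' st' ye sy).
Qed.

Lemma strips_bad s t s' t' y z : t \in alpha -> t' \in alpha -> s -- t -> s' -- t' ->
  z \in Mvv s t -> y \in Mvv s' t' -> y \notin Mvv s t -> bad z y.
Proof.
move=> ta ta' st st' ze ye nye; have tt' : t != t'.
  apply: contraNneq nye => e; subst t'; have st1 : t -- s by rewrite edgeC.
  have st1' : t -- s' by rewrite edgeC.
  by rewrite (leaf_uniq (alpha_leaf XM ta) st1 st1').
have [g0 [g' [[sg _ _ _] [_ tg _ F1 F2]]]] := strips_facing SM XM ta ta' st st' tt'.
have hy := strip_dir st' ye.
by apply: (badI st sg tg (strip_dir st ze) (F1 _ hy)); right; apply: F2.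
Qed.

Lemma not_both x : 1 < size fs -> seenH fs x -> onlyL fs x -> False.
Proof.
move=> k /hasP[f ff /andP[/eqP fh fx]] [_ H]; have := H f ff fx.
have := ipath_uniq pf; case: (fs) k fh ff => // f1 [|f2 r] // _ -> _ /= /andP[n _] e.
by move: n; rewrite e mem_last.
Qed.

(** The aim is to enlarge the strip st by [fs]. The obstacle are neighbours of b, to which
    [hung_ends_core] does not apply. If all vertices seen outside the alpha strips are neighbours of
    b, then one of them contradicts [single_head]. Otherwise some seen x in M_s is not a neighbour
    of b, and it forces all others into M_s. *)
Lemma hung_far_end s t z x0 : 1 < size fs -> t \in alpha -> s -- t -> z \in Mvv s t -> a -- z ->
  sees fs z -> onlyL fs z -> (forall z', z' \in VM M -> inS alpha z' -> sees fs z' -> a -- z') ->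
  x0 \in VM M -> ~ inS alpha x0 -> sees fs x0 -> False.
Proof.
move=> k1 ta st ze az sz zL E xV0 nS0 sx0; have ns := nbr_nonleaf SM (alpha_leaf XM ta) st.
have hz := strip_dir st ze; have zV := dir_VM hz.
have E' z' : z' \in Mvv s t -> sees fs z' -> a -- z'.
  by move=> ze'; apply: E; [apply: dir_VM (strip_dir st ze') | exists s, t].
have core x := hung_ends_core ta st ze az (onlyL_atL zL sz) E' (x := x).
have xH x : x \in VM M -> ~ inS alpha x -> sees fs x -> seenH fs x.
  by move=> xV nS; apply: onlyH_seenH; apply: oH (noS_noa xV nS).
have one (w : G) : w \in VM M -> inS alpha w -> sees fs w -> onlyL fs w -> w \in Mvv s t.
  move=> wV [s' [t' [ta' st' we]]] sw wL; apply/negPn/negP => nwe.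
  case: (bad_seen Af zV wV (strips_bad ta ta' st st' ze we nwe) sz sw) => -[h1 h2].
    exact: (not_both k1 h1 zL).
  exact: (not_both k1 h2 wL).
have U x : x \in VM M -> sees fs x -> b -- x -> forall w : G, w \in VM M -> inS alpha w -> sees fs w -> w \in Mvv s t.
  move=> xV sx bx w wV Sw sw; apply: one => //.
  have nS : ~ inS alpha x by move=> h; apply: (inS_excl SM XM h (b_inS SM XM xV bx)).
  have := beta_bad ehf SM XM xV wV bx (E w wV Sw sw).
  by move/bad_sym => bd; apply: (bad_onlyL Af wV xV bd (xH x xV nS sx)).
case ne: [exists x in VM M, [&& sees fs x, ~~ (b -- x) & ~~ [exists s, exists t, [&& t \in alpha, s -- t & x \in Me M [set s; t]]]]]; last first.
  have allb x : x \in VM M -> ~ inS alpha x -> sees fs x -> b -- x.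
    move=> xV nS sx; apply: contraFT ne => nb; apply/exists_inP; exists x => //.
    by rewrite sx nb; apply/negP => /inSP.
  have bx := allb x0 xV0 nS0 sx0.
  have [s1 [u [ub su xe xu]]] := aE SM (cross_edge_sym XM) xV0 bx.
  have lu := beta_leaf XM ub; have n1 := nbr_nonleaf SM lu su.
  have hx := strip_dir su xe.
  have [g sg hz1] := VM_dir SM s1 zV.
  have [w [sw wu wg]] := third_dir SM XM u g n1.
  have nwb : w \notin beta by apply: contraNN wu => wb; rewrite (beta_uniq XM sw su wb ub).
  have [h [he hs]] := head_exists SM sw.
  have [Q2 B2] := alpha_head_beam SM XM n1 sw nwb he hs.
  have [c1 [Q1 [B1 x1]]] := any_beam SM XM n1 su hx.
  have cE : c1 = false.
    have := beam_strip n1 B1 x1 lu su xe; move/negP: (fun h => alpha_betaF XM h ub).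
    by case: (u \in alpha) => // _ <-.
  subst c1; rewrite eq_sym in wu.
  have T := beam_touch SM su sw wu B1 B2.
  (* Seen vertices lie in the strip st, which is in direction g, or are neighbours of b, which a
     beam ending at a avoids. *)
  have u2 : {in h :: Q2, forall z, noF fs z}.
    move=> y yQ; have yV := beam_VM B2 yQ; apply: (hung_noF D yV); apply/negP => sy.
    have [Sy|nSy] := inSP M alpha y.
      have ye := U x0 xV0 sx0 bx y yV Sy sy.
      have hyz : y \in dir s1 g.
        case: (VM_dir SM s1 yV) => g' sg' hy'.
        case: (dir_edge SM sg st ze hz1) => [[e1 e2]|[[e1 e2]|[k2 k3]]].
        - by subst; apply: strip_dir.
        - by subst; apply: strip_dir; rewrite // MvvC.
        - by apply/(dirP M); exists s, t; split.
      by rewrite (dir_inj SM sw sg (beam_dir B2 yQ) hyz) eqxx in wg.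
    have by' := allb y yV nSy sy.
    by have [_ /(_ (b_inS SM XM yV by'))] := beam_inS XM n1 B2 yQ.
  have xl : x0 = last x0 Q1 by apply/eqP; have := beam_b XM n1 B1 x1; rewrite bx andbT => <-.
  have [q1 e1] : exists q : seq G, Q1 = q ++ [:: x0].
    case: (lastP Q1) (x1) xl => // q z'; rewrite last_rcons => _ ->.
    by exists q; rewrite cats1.
  apply: (single_head ehf ab P (beam_leg XM n1 B1) (beam_leg XM n1 B2) T (x := x0) (s := rev q1 ++ h :: Q2)).
  - by rewrite e1 rev_cat.
  - exact: (hung_atH D xV0 (noS_noa xV0 nS0) sx0).
  move=> y; rewrite mem_cat mem_rev => /orP[yq|]; last exact: u2.
  have yQ : y \in Q1 by rewrite e1 mem_cat yq.
  have yV := beam_VM B1 yQ; apply: (hung_noF D yV); apply/negP => sy.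
  have := allb y yV (beta_beam_noS n1 B1 yQ) sy.
  rewrite (beam_b XM n1 B1 yQ) andbT e1 last_cat /= => /eqP k.
  by move: (beam_uniq B1); rewrite e1 cat_uniq /= orbF -k yq andbF.
case/exists_inP: ne => x xV /and3P[sx nbx /inSP nS]; have xs := core x xV nS sx nbx.
have nxe : x \notin Mvv s t by apply/negP => k; apply: nS; exists s, t.
have [g [sg gt hx]] := dir_of SM XM ta st xV nxe.
have H y : y \in VM M -> ~ inS alpha y -> sees fs y -> y \in Mv s.
  move=> yV nSy sy; apply/negPn/negP => ny.
  have nye : y \notin Mvv s t by apply/negP => k; apply: nSy; exists s, t.
  have [w [sw wt hy]] := dir_of SM XM ta st yV nye.
  case: (eqVneq w g) => [e|wg]; last first.
    exact: (no_two_exits ehf SM XM D sw sg wg hy hx ny sy sx nSy nS).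
  subst w.
  have [w3 [e3 n31 n32 n3a]] := third_beta SM XM ns (introT orP (or_introl _ ta)) st sg.
  have [Q3 B3] := dir_beam SM XM ns e3 n3a.
  case u3: (has (sees fs) Q3).
    case/hasP: u3 => y' y3 sy'; rewrite eq_sym in n32.
    exact: (no_two_exits ehf SM XM D sg e3 n32 hy (beam_dir B3 y3) ny sy sy' nSy (beta_beam_noS ns B3 y3)).
  apply: (strip_prism ehf SM XM D ta st sg gt ze (onlyL_atL zL sz) az E' hx sx (noS_noa xV nS) nbx e3 n31 n32 B3).
  by move=> z' zQ; apply/negP => k; move/hasP: u3; case; exists z'.
have H2 (p : G) : p \in Mv s -> p \notin Mvv s t -> sees fs p.
  move=> ps npe; have [w [sw wt hp]] := dir_of SM XM ta st (Mv_VM SM ps) npe.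
  case: (eqVneq w g) => [e|ne]; last exact: (head_seen ta st H sg gt hx xs sx nbx sw wt ne hp ps).
  subst w; have [w' [sw' wt' wg']] := third_dir SM XM t g ns.
  have [p' [pe' ps']] := head_exists SM sw'; have hp' := strip_dir sw' pe'.
  have sp' := head_seen ta st H sg gt hx xs sx nbx sw' wt' wg' hp' ps'.
  rewrite eq_sym in wg'.
  (* If p' is a neighbour of b it may end its beam; the beam of p is then steered to a, and the
     condition on the letters in [lone_end] fails. *)
  case: (boolP (b -- p')) => bp'; last exact: (head_seen ta st H sw' wt' hp' ps' sp' bp' sg gt wg' hp ps).
  apply/negPn/negP => up.
  have [s1 [u [ub su xe xu]]] := aE SM (cross_edge_sym XM) (dir_VM hp') bp'.
  have lu := beta_leaf XM ub.
  have [? ?] : s1 = s /\ u = w'.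
    case: (strip_eq SM su sw' xe pe') => -[? ?]; subst; first by [].
    by rewrite lu in ns.
  subst s1 u.
  have ngb : g \notin beta by apply: contraNN wg' => gb; rewrite (beta_uniq XM sg sw' gb ub).
  have [Q2 B2] := alpha_head_beam SM XM ns sg ngb (dir_head SM sg hp ps) ps.
  have [nSp' _ nap'] := end_not_head SM XM ta st sw' wt' hp' ps'.
  have [Q1 [B1 p1]] := beta_beam SM XM ns sw' hp' nSp'.
  have [Q1' ?] := beam_hd B1 p1 ps'; subst Q1.
  have u1 : {in Q1', forall z, ~~ sees fs z}.
    apply: (beam_tail B1) => z' zQ.
    have zQ' : z' \in p' :: Q1' by rewrite inE zQ orbT.
    by apply: H; [apply: (beam_VM B1 zQ') | apply: (beta_beam_noS ns B1 zQ')].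
  have u2 : {in p :: Q2, forall z, ~~ sees fs z}.
    move=> y yQ; have yV := beam_VM B2 yQ; apply/negP => sy.
    have [Sy|nSy] := inSP M alpha y.
      have ye := U p' (dir_VM hp') sp' bp' y yV Sy sy.
      by rewrite (dir_inj SM sg st (beam_dir B2 yQ) (strip_dir st ye)) eqxx in gt.
    have := H y yV nSy sy; rewrite (beam_head B2 yQ) /= => /eqP k.
    by rewrite k (negbTE up) in sy.
  rewrite eq_sym in wg'.
  by have [_] := lone_end ehf SM XM D sw' sg wg' B1 B2 sp' nap' u1 u2.
apply: (hung_close SM XM D maxM ta st) => // y yV nye sy.
have [Sy|nSy] := inSP M alpha y; last exact: H.
have [s' [t' [ta' st' ye]]] := Sy.
have tt' : t != t'.
  apply: contraNneq nye => e; subst t'; have st1 : t -- s by rewrite edgeC.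
  have st1' : t -- s' by rewrite edgeC.
  by rewrite (leaf_uniq (alpha_leaf XM ta) st1 st1').
have [g0 [g' [[sg0 _ _ _] [_ tg0 _ F1 F2]]]] := strips_facing SM XM ta ta' st st' tt'.
(* The vertex y forms a bad pair with a seen head p in a third direction, so it is seen by the last
   vertex only and must belong to st. *)
have [w [sw wt wg0]] := third_dir SM XM t g0 ns.
have [p [pe ps]] := head_exists SM sw; have hp := strip_dir sw pe.
have [nSp npe _] := end_not_head SM XM ta st sw wt hp ps.
have hy := strip_dir st' ye.
have bd : bad y p.
  by apply: bad_sym; apply: (badI sw sg0 wg0 hp (F1 _ hy)); right; apply: F2.
case/negP: nye; apply: one => //.
exact: (bad_onlyL Af yV (dir_VM hp) bd (xH p (dir_VM hp) nSp (H2 p ps npe))).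
Qed.

(** If [fs] has at least two vertices, then either some seen neighbour of a is seen by the last
    vertex only, or no seen vertex of an alpha strip forms a bad pair with a seen vertex outside. If
    [fs] is a single vertex, [end_even] excludes seen neighbours of b. *)
Lemma hung_strip_ends x0 z0 : (forall z, z \in VM M -> inS alpha z -> sees fs z -> a -- z) ->
  x0 \in VM M -> ~ inS alpha x0 -> sees fs x0 -> z0 \in VM M -> inS alpha z0 -> sees fs z0 -> False.
Proof.
move=> E xV nS sx zV Sz sz; have az := E z0 zV Sz sz.
have ev x : x \in VM M -> sees fs x -> b -- x -> ~~ odd (size fs).
  move=> xV' sx' bx; have na : ~~ (a -- x).
    by apply/negP => ax; rewrite (ab_excl SM XM xV' ax) in bx.
  apply: (end_even ehf ab P (x := x)); last exact: (hung_atH D xV' na sx').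
    by move=> y; rewrite inE => /eqP ->; have [k _] := bVM XM xV'; rewrite k bx eqxx.
  by move=> y; rewrite inE => /eqP ->; have [k _] := aVM XM xV'; rewrite k (negbTE na).
have xH x : x \in VM M -> ~ inS alpha x -> sees fs x -> seenH fs x.
  by move=> xV' nS'; apply: onlyH_seenH; apply: oH (noS_noa xV' nS').
case: (ltnP 1 (size fs)) => k.
  case L: [exists z in VM M, [&& sees fs z, a -- z & all (fun f => (f -- z) ==> (f == last f fs)) fs]].
    case/exists_inP: L => z zV' /and3P[sz' az' /allP L].
    have [s [t [ta st ze zt]]] := aE SM XM zV' az'.
    apply: (hung_far_end k ta st ze az' sz' _ E xV nS sx).
    by split=> [|f ff fz]; [apply: att_out Af zV' | apply/eqP; move/implyP: (L f ff); apply].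
  have nL z : z \in VM M -> inS alpha z -> sees fs z -> onlyL fs z -> False.
    move=> zV' Sz' sz' [_ zL]; move/negP: (negbT L); apply; apply/exists_inP; exists z => //.
    by rewrite sz' (E z zV' Sz' sz'); apply/allP => f ff; apply/implyP => fz; apply/eqP; apply: zL.
  have nbd x z : x \in VM M -> ~ inS alpha x -> sees fs x -> z \in VM M -> inS alpha z -> sees fs z -> bad z x -> False.
    move=> xV' nS' sx' zV' Sz' sz' bd; apply: (nL z) => //.
    exact: (bad_onlyL Af zV' xV' bd (xH x xV' nS' sx')).
  apply: (hung_local_heads zV az sz xV nS sx).
    move=> x xV' nS' sx'; apply/negP => bx.
    exact: (nbd x z0 xV' nS' sx' zV Sz sz (bad_sym (beta_bad ehf SM XM xV' zV bx az))).
  move=> s t z x ta st ze sz' xV' nS' sx'; have hz := strip_dir st ze.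
  have nxe : x \notin Mvv s t by apply/negP => h; apply: nS'; exists s, t.
  have [g [sg gt hx]] := dir_of SM XM ta st xV' nxe; rewrite eq_sym in gt.
  apply/negPn/negP => nx; apply: (nbd x z xV' nS' sx' (dir_VM hz) _ sz'); first by exists s, t.
  by apply: (badI st sg gt hz hx); right.
have k1 : size fs = 1 by apply/eqP; rewrite eqn_leq k lt0n size_eq0.
have N x : x \in VM M -> ~ inS alpha x -> sees fs x -> ~~ (b -- x).
  by move=> xV' _ sx'; apply/negP => bx; have := ev x xV' sx' bx; rewrite k1.
apply: (hung_local_heads zV az sz xV nS sx N) => s t z x ta st ze sz' xV' nS' sx'.
have zV' := dir_VM (strip_dir st ze).
have E' z' : z' \in Mvv s t -> sees fs z' -> a -- z'.
  by move=> ze'; apply: E; [apply: dir_VM (strip_dir st ze') | exists s, t].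
apply: (hung_ends_core ta st ze (E' z ze sz') _ E' xV' nS' sx' (N x xV' nS' sx')).
split; first exact: att_out Af zV'.
case/hasP: sz' => f; case: (fs) k1 => // f1 [] //= _; rewrite inE => /eqP -> fz f'.
by rewrite inE => /eqP ->; rewrite fz eqxx.
Qed.

Lemma hung_some_strip x z : x \in VM M -> ~ inS alpha x -> sees fs x ->
  z \in VM M -> inS alpha z -> sees fs z -> False.
Proof.
move=> xV nS sx zV Sz sz.
case E: [exists z in VM M, [&& sees fs z, ~~ (a -- z) & [exists s, exists t, [&& t \in alpha, s -- t & z \in Me M [set s; t]]]]].
  case/exists_inP: E => z' zV' /and3P[sz' na /inSP[s [t [ta st ze]]]].
  exact: (hung_strip_interior ehf SM XM D maxM ta st ze sz' na xV nS sx).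
apply: (hung_strip_ends _ xV nS sx zV Sz sz) => z' zV' Sz' sz'.
by apply: contraFT E => na; apply/exists_inP; exists z' => //; rewrite sz' na; apply/inSP.
Qed.

End HungStrips.

(** * All seen vertices in strips at alpha leaves *)

Section Ends.
Variables (J G : sgraph) (ehf : even_hole_free G) (M : strip_family J G).
Variables (alpha beta : {set J}) (a b : G).
Hypothesis SM : is_strip_system M.
Hypothesis XM : cross_edge M alpha beta a b.
Implicit Types (p q r s t u v w g : J) (x y z f : G) (Q R fs : seq G) (c d : bool).

Notation Mv := (Mv M).
Notation Mvv u v := (Me M [set u; v]).
Notation dir := (dir M).
Notation bad := (bad M).
Notation inS := (inS M).
Notation beam := (beam M alpha).

Let ab : a -- b. Proof. by case: XM. Qed.
Let treeJ : is_tree J. Proof. by case: SM => -[]. Qed.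

Lemma strip_in_dir v g s t x : v -- g -> s -- t -> x \in Mvv s t -> x \in dir v g ->
  {subset Mvv s t <= dir v g}.
Proof.
move=> vg st xe hx y ye; case: (dir_edge SM vg st xe hx) => [[e1 e2]|[[e1 e2]|[k1 k2]]].
- by subst; apply: strip_dir.
- by subst; apply: strip_dir; rewrite // MvvC.
- by apply/(dirP M); exists s, t; split.
Qed.

Lemma same_strip_not_bad s t x y : s -- t -> x \in Mvv s t -> y \in Mvv s t -> bad x y -> False.
Proof.
move=> st xe ye [v [w1 [w2 [[e1 e2 ne] [hx hy _]]]]].
by rewrite (dir_inj SM e1 e2 (strip_in_dir e1 st xe hx ye) hy) eqxx in ne.
Qed.

Lemma end_split fs v w c Q y : attached M a b fs -> v \notin leaves J -> beam v w c Q -> y \in Q -> a -- y ->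
  (forall z, z \in Q -> sees fs z -> a -- z) ->
  c = true /\ exists2 q : seq G, Q = q ++ [:: y] & {in q, forall z, noF fs z}.
Proof.
move=> Af nv B yQ ay E; have := beam_a XM nv B yQ; rewrite ay => /esym/andP[/eqP yl cE].
split=> //; have [q e] : exists q : seq G, Q = q ++ [:: y].
  case: (lastP Q) (yQ) yl => // q z'; rewrite last_rcons => _ ->.
  by exists q; rewrite cats1.
exists q => // z zq; have zQ : z \in Q by rewrite e mem_cat zq.
apply: noF_sees; first exact: att_out Af (beam_VM B zQ).
apply/negP => /(E z zQ); rewrite (beam_a XM nv B zQ) cE andbT e last_cat /= => /eqP k.
by move: (beam_uniq B); rewrite e cat_uniq /= orbF -k zq andbF.
Qed.

(** The two vertices end strips at different leaves of alpha that face each other, and every beam to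
    b is unseen, so [double_pendant] applies. *)
Lemma two_alpha_ends fs x y : attached M a b fs -> (forall f, f \in fs -> f -- b = false) ->
  x \in VM M -> y \in VM M -> bad x y -> sees fs x -> sees fs y ->
  (forall z, z \in VM M -> sees fs z -> a -- z) -> False.
Proof.
have key fs' x' y' : attached M a b fs' -> (forall f, f \in fs' -> f -- b = false) ->
    x' \in VM M -> y' \in VM M -> bad x' y' -> seenH fs' x' -> seenL fs' y' ->
    (forall z, z \in VM M -> sees fs' z -> a -- z) -> False.
  move=> {fs x y} {}Af fb xV yV bd sx sy E.
  have [pf f0 out _] := Af.
  have sx' := seenH_sees sx; have sy' := seenL_sees sy.
  have ax := E x' xV sx'; have ay := E y' yV sy'.
  have [s [t [ta st xe xt]]] := aE SM XM xV ax.
  have [s' [t' [ta' st' ye yt]]] := aE SM XM yV ay.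
  have tt' : t != t'.
    apply/eqP => e; subst t'; have st1 : t -- s by rewrite edgeC.
    have st1' : t -- s' by rewrite edgeC.
    have e := leaf_uniq (alpha_leaf XM ta) st1 st1'; subst s'.
    exact: (same_strip_not_bad st xe ye bd).
  have ns := nbr_nonleaf SM (alpha_leaf XM ta) st; have ns' := nbr_nonleaf SM (alpha_leaf XM ta') st'.
  have [g [g' [[sg h1 sg' h2] [ss' tg tg' F1 F2]]]] := strips_facing SM XM ta ta' st st' tt'.
  have [w3 [e3 n31 n32 n3a]] := third_beta SM XM ns (introT orP (or_introl _ ta)) st sg.
  have [w4 [e4 n41 n42 n4a]] := third_beta SM XM ns' (introT orP (or_introl _ ta')) st' sg'.
  have [Q3 B3] := dir_beam SM XM ns e3 n3a; have [Q4 B4] := dir_beam SM XM ns' e4 n4a.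
  have E' v w c Q : beam v w c Q -> forall z, z \in Q -> sees fs' z -> a -- z.
    by move=> B z zQ; apply: E; apply: (beam_VM B).
  have hy := strip_dir st' ye.
  have [c1 [Q1 [B1 x1]]] := any_beam SM XM ns st (strip_dir st xe).
  have [c2 [Q2 [B2 y2]]] := any_beam SM XM ns sg (F1 _ hy).
  have [c5 [Q5 [B5 y5]]] := any_beam SM XM ns' st' hy.
  have [? [q1 e1 u1]] := end_split Af ns B1 x1 ax (E' _ _ _ _ B1).
  have [? [q2 e2 u2]] := end_split Af ns B2 y2 ay (E' _ _ _ _ B2).
  have [? [q5 e5 u5]] := end_split Af ns' B5 y5 ay (E' _ _ _ _ B5).
  subst c1 c2 c5 Q1 Q2 Q5.
  have nF v w Q : v \notin leaves J -> beam v w false Q -> {in Q, forall z, noF fs' z}.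
    move=> nv B z zQ; apply: noF_sees; first exact: att_out Af (beam_VM B zQ).
    by apply/negP => /(E' _ _ _ _ B z zQ); rewrite (beam_a XM nv B zQ) andbF.
  have nb : noF fs' b.
    by split=> // ; apply/negP => /out[_ _]; rewrite eqxx.
  rewrite eq_sym in n31; rewrite eq_sym in n41.
  apply: (double_pendant ehf ab pf f0 nb (beam_leg XM ns B1) (beam_leg XM ns B2) (beam_leg XM ns B3)
    (beam_leg XM ns' B5) (beam_leg XM ns' B4) (beam_touch SM st sg tg B1 B2) (beam_touch SM st e3 n31 B1 B3)
    (beam_touch SM st' e4 n41 B5 B4) (beam_apart SM sg h1 sg' h2 st tg st' tg' B1 B5)
    (beam_apart SM sg h1 sg' h2 st tg e4 n42 B1 B4) (beam_apart SM sg h1 sg' h2 e3 n32 st' tg' B3 B5)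
    (beam_apart SM sg h1 sg' h2 e3 n32 e4 n42 B3 B4) _ _ u1 u2 u5 (nF _ _ _ ns B3) (nF _ _ _ ns' B4)).
  - exact: onlyH_atH (bad_onlyH Af xV yV bd sy) sx'.
  - exact: onlyL_atL (bad_onlyL Af yV xV (bad_sym bd) sx) sy'.
move=> Af fb xV yV bd sx sy E.
case: (bad_seen Af xV yV bd sx sy) => -[k1 k2]; first exact: (key fs x y).
apply: (key (rev fs) x y) => //; rewrite ?seenH_rev ?seenL_rev //; first exact: attached_rev.
  by move=> f; rewrite mem_rev; apply: fb.
by move=> z zV; rewrite sees_rev; apply: E.
Qed.

(** If only the strip st is seen, it is enlarged at its leaf end: the last vertex of [fs], the
    neighbour of a, joins M_t. A second seen strip gives a theta or a prism. *)
Lemma hung_all_strips fs x : hung M a b fs ->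
  (forall M' : strip_family J G, is_strip_system M' -> has_cross_edge M' a b -> ~~ (VM M \proper VM M')) ->
  (forall z, z \in VM M -> sees fs z -> inS alpha z) ->
  x \in VM M -> ~~ (a -- x) -> sees fs x -> False.
Proof.
move=> D maxM H xV na sx; have [Af P oH] := D; have [pf f0 out _] := Af.
have [s [t [ta st xe]]] := H x xV sx.
have lt := alpha_leaf XM ta; have ns := nbr_nonleaf SM lt st.
have hx := strip_dir st xe.
have nF v w Q : v \notin leaves J -> beam v w false Q -> {in Q, forall z, ~~ sees fs z}.
  move=> nv B z zQ; apply/negP => /(H z (beam_VM B zQ)) h.
  by have [/(_ h)] := beam_inS XM nv B zQ.
case W: [exists w in VM M, sees fs w && (w \notin Mvv s t)]; last first.
  have H1 z : z \in VM M -> sees fs z -> z \in Mvv s t.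
    by move=> zV sz; apply: contraFT W => n; apply/exists_inP; exists z; rewrite ?sz.
  have ts : t -- s by rewrite edgeC.
  have [_ _ Ca Cb] := P.
  have tb : t \in beta = false by apply/negP => tb; exact: (alpha_betaF XM ta tb).
  have f0r : rev fs != [::] by rewrite -size_eq0 size_rev size_eq0.
  have outr f : f \in rev fs -> [/\ f \notin VM M, f != a & f != b] by rewrite mem_rev; apply: out.
  have nt z : z \in Mvv t s -> z \notin Mv t -> ~~ (a -- z).
    move=> ze; apply: contraNN => az; rewrite MvvC in ze.
    have [s' [t' [ta' st' ze' zt']]] := aE SM XM (dir_VM (strip_dir st ze)) az.
    by have [_ ->] := leaf_strip_uniq SM lt (alpha_leaf XM ta') st st' ze ze'.
  apply: (enlarge_pendant SM XM maxM ts (ipath_rev pf) f0r outr (y := x)).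
  - move=> f z ff zV zn; rewrite mem_rev in ff.
    have -> : z \in Mv t = false.
      apply/negP => zt; have [s' ts' ze] := Mv_strip SM zt.
      by rewrite (leaf_uniq lt ts' ts) (negbTE zn) in ze.
    rewrite /=; apply/negP => fz; have sz : sees fs z by apply/hasP; exists f.
    by have := H1 z zV sz; rewrite MvvC (negbTE zn).
  - by move=> f; rewrite mem_rev head_rev ta /= => ff; have [_ ->] := Ca f ff.
  - by move=> f; rewrite mem_rev tb /= => ff; have [_ ->] := Cb f ff.
  - move=> z ze nz; apply: onlyH_rev; apply: oH; last exact: nt.
    by rewrite MvvC in ze; apply: dir_VM (strip_dir st ze).
  - by rewrite MvvC.
  - apply/negP => xt; move/negP: na; apply; have [_ ->] := aVM XM xV.
    by apply/existsP; exists t; rewrite ta.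
  - by rewrite sees_rev.
case/exists_inP: W => w wV /andP[sw nwe].
have [s' [t' [ta' st' we]]] := H w wV sw.
have tt' : t != t'.
  apply: contraNneq nwe => e; subst t'; have st1 : t -- s by rewrite edgeC.
  have st1' : t -- s' by rewrite edgeC.
  by rewrite (leaf_uniq lt st1 st1').
have ns' := nbr_nonleaf SM (alpha_leaf XM ta') st'.
have [g [g' [[sg h1 sg' h2] [ss' tg tg' F1 F2]]]] := strips_facing SM XM ta ta' st st' tt'.
have [w3 [e3 n31 n32 n3a]] := third_beta SM XM ns (introT orP (or_introl _ ta)) st sg.
have [w4 [e4 n41 n42 n4a]] := third_beta SM XM ns' (introT orP (or_introl _ ta')) st' sg'.
have [Q3 B3] := dir_beam SM XM ns e3 n3a; have [Q4 B4] := dir_beam SM XM ns' e4 n4a.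
case E: [exists w' in Mvv s' t', sees fs w' && ~~ (a -- w')].
  case/exists_inP: E => w' we' /andP[sw' naw'].
  apply: (strip_exits ehf SM XM D ta ta' st st' ss' _ _ e3 n31 B3 (nF _ _ _ ns B3) e4 n41 B4 (nF _ _ _ ns' B4)
    xe we' na naw' sx sw').
    by move=> g0 sg0 k; rewrite (side_disj treeJ sg0 sg k h1).
  by move=> g0 sg0 k; rewrite (side_disj treeJ sg0 sg' k h2).
have E' z' : z' \in Mvv s' t' -> sees fs z' -> a -- z'.
  by move=> ze' sz'; apply: contraFT E => na'; apply/exists_inP; exists z'; rewrite ?sz'.
have [F5 F6] := dir_far SM sg' h2 sg h1 st tg.
have hy := strip_dir st' we.
have oLw : onlyL fs w.
  apply: (bad_onlyL Af (dir_VM hy) xV); last exact: onlyH_seenH (oH _ xV na) sx.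
  by apply: bad_sym; apply: (badI st sg tg hx (F1 _ hy)); right; apply: F2.
have nbx : ~~ (b -- x).
  by apply/negP => /(b_inS SM XM xV) k; apply: (inS_excl SM XM _ k); exists s, t.
have gt' : g' != t' by rewrite eq_sym.
exact: (strip_prism ehf SM XM D ta' st' sg' gt' we (onlyL_atL oLw sw) (E' w we sw) E' (F5 _ hx) sx na nbx
  e4 n41 n42 B4 (nF _ _ _ ns' B4)).
Qed.

End Ends.

Lemma uniq_split (T : eqType) (A B A' B' : seq T) x :
  uniq (A ++ x :: B) -> A ++ x :: B = A' ++ x :: B' -> B = B'.
Proof.
elim: A A' => [|z A IH] [|z' A'] //=; first by move=> _ [].
- by move=> /andP[n _] [e1 e2]; rewrite e2 e1 mem_cat mem_head orbT in n.
- by move=> /andP[n _] [e1 e2]; rewrite e1 mem_cat mem_head orbT in n.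
- by move=> /andP[_ u] [_ e]; apply: IH e.
Qed.

Lemma cat3_pair (T : eqType) (s1 s2 s3 p r : seq T) x y : uniq (s1 ++ s2 ++ s3) ->
  s1 ++ s2 ++ s3 = p ++ [:: x, y & r] -> x \in s2 -> y \notin s3 ->
  exists R1 R2, s2 = R1 ++ [:: x, y & R2].
Proof.
move=> u e xs; case/splitPr: xs u e => R1 R2.
rewrite -(catA R1) catA cat_cons => u /(uniq_split u) e ny.
exists R1; case: R2 e {u} => [|y' R2] /= e; first by rewrite e mem_head in ny.
by case: e => -> _; exists R2.
Qed.

(** * No seen vertex in a strip at an alpha leaf *)

Section Free.
Variables (J G : sgraph) (ehf : even_hole_free G) (M : strip_family J G).
Variables (alpha beta : {set J}) (a b : G).
Hypothesis SM : is_strip_system M.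
Hypothesis XM : cross_edge M alpha beta a b.
Variable fs : seq G.
Hypothesis D : hung M a b fs.
Hypothesis N : forall z, z \in VM M -> sees fs z -> ~ inS M alpha z.
Implicit Types (p q r s t u v w g : J) (x y z f : G) (Q R : seq G) (c d : bool).

Notation Mv := (Mv M).
Notation Mvv u v := (Me M [set u; v]).
Notation dir := (dir M).
Notation beam := (beam M alpha).

Let ab : a -- b. Proof. by case: XM. Qed.
Let P : pend a b fs. Proof. by case: D. Qed.
Let oH : forall x, x \in VM M -> ~~ (a -- x) -> onlyH fs x. Proof. by case: D. Qed.

Let noa x : x \in VM M -> sees fs x -> ~~ (a -- x).
Proof. by move=> xV sx; apply: noS_noa SM XM _ xV (N xV sx). Qed.

(** A seen vertex off M_u would be an exit besides x or y. An unseen z in M_u would leave a seen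
    head as the only seen vertex of two beams, against [lone_end]; if that head is a neighbour of b,
    the beam of z is steered to a. *)
Lemma star_seen u w1 w2 x y : u -- w1 -> u -- w2 -> w1 != w2 -> x \in dir u w1 -> y \in dir u w2 ->
  x \in Mv u -> y \in Mv u -> sees fs x -> sees fs y -> forall z, z \in VM M -> sees fs z = (z \in Mv u).
Proof.
move=> e1 e2 ne hx hy xu yu sx sy z zV; have nu := two_nonleaf e1 e2 ne.
have H z' : z' \in VM M -> sees fs z' -> z' \in Mv u.
  move=> zV' sz'; have [w e hz] := VM_dir SM u zV'; apply/negPn/negP => nz.
  case: (eqVneq w w1) => [?|n].
    subst w; exact: (no_two_exits ehf SM XM D e1 e2 ne hz hy nz sz' sy (N zV' sz') (N (dir_VM hy) sy)).
  exact: (no_two_exits ehf SM XM D e e1 n hz hx nz sz' sx (N zV' sz') (N (dir_VM hx) sx)).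
apply/idP/idP => [/(H z zV)//|zu]; apply/negPn/negP => uz.
have [w e hz] := VM_dir SM u zV.
have key w' x' : u -- w' -> w' != w -> x' \in dir u w' -> x' \in Mv u -> sees fs x' -> False.
  move=> e' n' hx' xu' sx'.
  have [Q2 [B2 x2]] := beta_beam SM XM nu e' hx' (N (dir_VM hx') sx').
  have [Q2' ?] := beam_hd B2 x2 xu'; subst Q2.
  have tl w0 c x0 Q : beam u w0 c (x0 :: Q) -> {in Q, forall z, ~~ sees fs z}.
    move=> B; apply: (beam_tail B) => z' zQ; apply: H; apply: (beam_VM B).
    by rewrite inE zQ orbT.
  have nax := noa (dir_VM hx') sx'.
  have ze := dir_head SM e hz zu.
  case: (boolP (b -- x')) => bx.
    have [s1 [t [tb st xe xt]]] := aE SM (cross_edge_sym XM) (dir_VM hx') bx.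
    have [? ?] : s1 = u /\ t = w'.
      case: (strip_eq SM st e' xe (dir_head SM e' hx' xu')) => -[? ?]; subst; first by [].
      by rewrite (beta_leaf XM tb) in nu.
    subst s1 t.
    have nwb : w \notin beta.
      by apply: contraNN n' => wb; rewrite (beta_uniq XM e e' wb tb).
    have [Q3 B3] := alpha_head_beam SM XM nu e nwb ze zu.
    have u3 : {in z :: Q3, forall z, ~~ sees fs z} by move=> z' /predU1P[->|] //; apply: tl B3 _.
    by have [_] := lone_end ehf SM XM D e' e n' B2 B3 sx' nax (tl _ _ _ _ B2) u3.
  have [c [Q3 [B3 z3]]] := any_beam SM XM nu e hz.
  have [Q3' ?] := beam_hd B3 z3 zu; subst Q3.
  have u3 : {in z :: Q3', forall z, ~~ sees fs z} by move=> z' /predU1P[->|] //; apply: tl B3 _.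
  have [k _] := lone_end ehf SM XM D e' e n' B2 B3 sx' nax (tl _ _ _ _ B2) u3.
  by move: bx; rewrite (beam_b XM nu B2 x2) -k eqxx.
case: (eqVneq w1 w) => [e1w|n]; last exact: (key w1 x).
by apply: (key w2 y e2 _ hy yu sy); rewrite -e1w eq_sym.
Qed.

Lemma separate p q x y : p -- q -> x \in Mvv p q -> y \in VM M -> y \notin Mvv p q ->
  exists v w1 w2, [/\ v -- w1, v -- w2, w1 != w2, x \in dir v w1 & y \in dir v w2].
Proof.
move=> e xe yV ny; have [g pg hy] := VM_dir SM p yV.
case: (eqVneq q g) => [?|n]; last by exists p, q, g; split=> //; apply: strip_dir.
subst g; case: (dir_split SM e hy) => [k|[r [qr rp hyr]]]; first by rewrite k in ny.
exists q, p, r; split=> //; first by rewrite edgeC.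
  by rewrite eq_sym.
by apply: strip_dir; rewrite 1?edgeC // MvvC.
Qed.

(** If two strips are seen, some vertex v of J separates two seen vertices, and [no_two_exits] puts
    both into M_v. *)
Lemma star_or_strip x : x \in VM M -> sees fs x ->
  (exists2 u, u \notin leaves J & forall z, z \in VM M -> sees fs z = (z \in Mv u)) \/
  (exists p q, [/\ p -- q, x \in Mvv p q & forall z, z \in VM M -> sees fs z -> z \in Mvv p q]).
Proof.
move=> xV sx; have [p [q [pq xe]]] := VMP M _ xV.
case E: [exists y in VM M, sees fs y && (y \notin Mvv p q)]; last first.
  right; exists p, q; split=> // z zV sz; apply: contraFT E => nz; apply/exists_inP.
  by exists z; rewrite ?sz.
left; case/exists_inP: E => y yV /andP[sy ny].
have [v [w1 [w2 [e1 e2 ne hx hy]]]] := separate pq xe yV ny.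
exists v; first exact: two_nonleaf e1 e2 ne.
apply: (star_seen e1 e2 ne hx hy _ _ sx sy); apply/negPn/negP => k.
  exact: (no_two_exits ehf SM XM D e1 e2 ne hx hy k sx sy (N xV sx) (N yV sy)).
rewrite eq_sym in ne.
exact: (no_two_exits ehf SM XM D e2 e1 ne hy hx k sy sx (N yV sy) (N xV sx)).
Qed.

Lemma other_nbr v w (A : {set J}) : v \notin leaves J ->
  (forall w1 w2, v -- w1 -> v -- w2 -> w1 \in A -> w2 \in A -> w1 = w2) ->
  exists r, [/\ v -- r, r != w & r \notin A].
Proof.
move=> nv U; have [r [e n _]] := third_dir SM XM w w nv.
case: (boolP (r \in A)) => rA; last by exists r.
have [r' [e' n' n2]] := third_dir SM XM w r nv.
by exists r'; split=> //; apply: contraNN n2 => rA'; rewrite (U r' r).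
Qed.

(* Apply the leaf-to-leaf path lemma to an extension of R, of which only R is seen. *)
Lemma rung_pair p q R x : p -- q -> p \notin leaves J -> rung M p q R -> x \in R -> sees fs x ->
  (forall z, z \in VM M -> sees fs z -> z \in Mvv p q) ->
  exists R1 x0 y0 R2, R = R1 ++ [:: x0, y0 & R2] /\ {in R, forall z, sees fs z = (z == x0) || (z == y0)}.
Proof.
move=> pq np rR xR sx H.
have RV z : z \in R -> z \in VM M.
  by case: rR => _ _ sR _ _ /sR k; apply: dir_VM (strip_dir pq k).
have [t [Q [aQ eQ tb]]] : exists t Q, [/\ arm M p q t (R ++ Q), {in Q, forall z, ~~ sees fs z} & t \notin alpha].
  case: (boolP (q \in leaves J)) => lq.
    exists q, [::]; rewrite cats0; split=> //; first exact: arm_rung.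
    apply/negP => qa; apply: (N (RV x xR) sx); exists p, q; split=> //.
    by case: rR => _ _ sR _ _; apply: sR.
  have [r [qr rp ra]] := other_nbr p lq (fun w1 w2 e1 e2 h1 h2 => alpha_uniq XM e1 e2 h1 h2).
  have [Q [t aQ tE]] := dir_beam SM XM lq qr ra.
  exists t, Q; split; first exact: (arm_cat SM pq lq qr rp rR aQ).
    move=> z zQ; apply/negP => sz; case: aQ => _ _ sQ _ _.
    have hz := sQ z zQ.
    by have := strip_not_deep SM pq qr rp (H z (dir_VM hz) sz); rewrite hz.
  by rewrite -tE.
have B2 : beam p q false (R ++ Q) by exists t; rewrite // (negbTE tb).
have B2V z := beam_VM B2 (z := z).
have unseen w c Q1 : p -- w -> w != q -> beam p w c Q1 -> {in Q1, forall z, ~~ sees fs z}.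
  move=> pw wq B z zQ; apply/negP => sz.
  by rewrite (dir_inj SM pw pq (beam_dir B zQ) (strip_dir pq (H z (beam_VM B zQ) sz))) eqxx in wq.
(* The second beam is steered to a exactly when the rung contains a seen neighbour of b. This
   excludes the outcome in which only the end at b is seen, and in the last outcome it provides a
   neighbour of b for [end_even]. *)
have [w [c [Q1 [pw wq B1 cE]]]] : exists w c Q1, [/\ p -- w, w != q, beam p w c Q1 &
    c = has (fun z => sees fs z && (b -- z)) R].
  case: (has _ R).
    have [w [pw wq wb]] := other_nbr q np (fun w1 w2 e1 e2 h1 h2 => beta_uniq XM e1 e2 h1 h2).
    have [h [he hp]] := head_exists SM pw.
    by have [Q1 B1] := alpha_head_beam SM XM np pw wb he hp; exists w, true, (h :: Q1).
  have [w [pw wq wa]] := other_nbr q np (fun w1 w2 e1 e2 h1 h2 => alpha_uniq XM e1 e2 h1 h2).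
  by have [Q1 B1] := dir_beam SM XM np pw wa; exists w, false, Q1.
have u1 := unseen w c Q1 pw wq B1.
have T := beam_touch SM pw pq wq B1 B2.
have L1 := beam_leg XM np B1; have L2 := beam_leg XM np B2.
have V z : z \in rev Q1 ++ (R ++ Q) -> z \in VM M.
  by rewrite mem_cat mem_rev => /orP[]; [exact: (beam_VM B1) | exact: (beam_VM B2)].
have HH : {in rev Q1 ++ (R ++ Q), forall z, onlyH fs z}.
  move=> z zP; case k: (sees fs z); last by apply: noF_onlyH; apply: (hung_noF D (V z zP)); rewrite k.
  by apply: oH (V z zP) (noa (V z zP) k).
have inR z : z \in rev Q1 ++ (R ++ Q) -> sees fs z -> z \in R.
  by rewrite !mem_cat mem_rev => /or3P[/u1/negP//|//|/eQ/negP//].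
have S : has (sees fs) (rev Q1 ++ (R ++ Q)) by apply/hasP; exists x; rewrite // !mem_cat xR orbT.
have xP : x \in rev Q1 ++ (R ++ Q) by rewrite !mem_cat xR orbT.
have U := ipath_uniq (ipath_touch (let: And3 h _ _ := L1 in h) (let: And3 h _ _ := L2 in h) T).
case: (pendant_path ehf ab P L1 L2 T HH S) => [[p1 [x0 [y0 [r [e k]]]]]|[_ k]|[k1 k2]|[k1 k2 _]].
- have i1 : x0 \in rev Q1 ++ (R ++ Q) by rewrite e mem_cat mem_head orbT.
  have i2 : y0 \in rev Q1 ++ (R ++ Q) by rewrite e mem_cat !inE eqxx !orbT.
  have x0R : x0 \in R by apply: inR; rewrite // k // eqxx.
  have y0R : y0 \in R by apply: inR; rewrite // k // eqxx orbT.
  have y0Q : y0 \notin Q by apply/negP => /eQ; rewrite k // eqxx orbT.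
  have [R1 [R2 eR]] := cat3_pair U e x0R y0Q.
  exists R1, x0, y0, R2; split=> // z zR; apply: k.
  by rewrite !mem_cat zR orbT.
- have n1 := beam_nonnil B1.
  have hQ : head x (rev Q1 ++ (R ++ Q)) \in rev Q1.
    by case/lastP: (Q1) n1 => // Q' y _; rewrite rev_rcons /= mem_head.
  have hP : head x (rev Q1 ++ (R ++ Q)) \in rev Q1 ++ (R ++ Q) by rewrite mem_cat hQ.
  move: (k _ hP); rewrite [X in _ == X](head_def _ x) ?(mem_nonnil hP) // eqxx.
  by move=> sh; rewrite mem_rev in hQ; have := u1 _ hQ; rewrite sh.
- move: (k2 x xP); rewrite sx last_cat => /esym/eqP xl.
  have bx : b -- x.
    by rewrite (beam_b XM np B2) ?mem_cat ?xR // andbT (last_def _ (last x (rev Q1))) ?(mem_nonnil (s := R ++ Q) (x := x)) ?mem_cat ?xR // -xl.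
  have cT : c by rewrite cE; apply/hasP; exists x; rewrite // sx.
  by rewrite cT in k1.
- rewrite orbF in k1; rewrite k1 in cE; case/esym/hasP: cE => y yR /andP[sy by'].
  have yV := RV y yR; have na := noa yV sy.
  suff: ~~ odd (size fs) by rewrite k2.
  apply: (end_even ehf ab P (x := y)); last exact: (hung_atH D yV na sy).
    by move=> z; rewrite inE => /eqP ->; have [k _] := bVM XM yV; rewrite k by' eqxx.
  by move=> z; rewrite inE => /eqP ->; have [k _] := aVM XM yV; rewrite k (negbTE na).
Qed.

End Free.

(** * Trees from parent pointers *)

Section Rooted.
Variables (V : finType) (r : V) (up : V -> V) (mu : V -> nat).
Hypothesis mu_up : forall v, v != r -> mu (up v) < mu v.
Implicit Types (u v w y : V).

Definition up_rel : rel V := [rel u v | (u != r) && (up u == v) || (v != r) && (up v == u)].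

Lemma up_rel_sym : symmetric up_rel.
Proof. by move=> u v; rewrite /up_rel /= orbC. Qed.

Lemma up_rel_irr : irreflexive up_rel.
Proof.
move=> u; rewrite /up_rel /= orbb; apply/negP => /andP[ur /eqP e].
by have := mu_up ur; rewrite e ltnn.
Qed.

Definition rooted : sgraph := SGraph up_rel_sym up_rel_irr.

Lemma rooted_up u : u != r -> (u : rooted) -- up u.
Proof. by move=> ur; rewrite /sedge /= /up_rel /= ur eqxx. Qed.

Lemma rooted_nbr u v : (u : rooted) -- v -> mu v <= mu u -> u != r /\ up u = v.
Proof.
rewrite /sedge /= /up_rel /= => /orP[/andP[ur /eqP]|/andP[vr /eqP e]] //.
by have := mu_up vr; rewrite e ltnNge => /negbTE ->.
Qed.

Definition below v u := exists n, iter n up u = v.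

Lemma below_refl v : below v v. Proof. by exists 0. Qed.

Lemma below_up v u : below v (up u) -> below v u.
Proof. by case=> n e; exists n.+1; rewrite iterSr. Qed.

Lemma below_trans v u w : below v u -> below u w -> below v w.
Proof. by move=> [n <-] [m <-]; exists (n + m); rewrite iterD. Qed.

Lemma below_root u : below r u.
Proof.
move: {2}(mu u) (leqnn (mu u)) => n; elim: n u => [|n IH] u h.
  case: (eqVneq u r) => [->|ur]; first exact: below_refl.
  by have := leq_trans (mu_up ur) h.
case: (eqVneq u r) => [->|ur]; first exact: below_refl.
by apply/below_up/IH; rewrite -ltnS (leq_trans (mu_up ur)).
Qed.

Hypothesis up_root : up r = r.

Lemma iter_root n : iter n up r = r.
Proof. by elim: n => //= n ->. Qed.

Lemma below_mu v u : below v u -> mu v <= mu u.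
Proof.
case=> n <-; elim: n => //= n IH; case: (eqVneq (iter n up u) r) => [e|h].
  by rewrite e up_root -e.
by apply: ltnW; apply: leq_trans (mu_up h) IH.
Qed.

Lemma chain_connect (S : {set V}) v u : below v u ->
  (forall w, below v w -> below w u -> w \in S) -> connect (@restr_edge rooted S) u v.
Proof.
case=> n; elim: n u => [|n IH] u /= e H; first by rewrite -e connect0.
case: (eqVneq u r) => [ur|ur].
  by rewrite -e ur iter_root up_root.
have e' : iter n up (up u) = v by rewrite -iterSr.
apply: connect_trans (IH (up u) e' _); last by move=> w h1 h2; apply: H => //; apply: below_up.
apply: connect1; rewrite /restr_edge /=.
rewrite H; [|by exists n.+1|exact: below_refl].
rewrite H; [|by exists n|by apply/below_up/below_refl].
exact: (rooted_up ur).
Qed.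

Lemma belowP u : exists n, iter n up u == r.
Proof. by have [n e] := below_root u; exists n; rewrite e. Qed.

Definition depth u := ex_minn (belowP u).

Lemma depth_root : depth r = 0.
Proof.
by rewrite /depth; case: ex_minnP => n _ /(_ 0 (eqxx r)); rewrite leqn0 => /eqP.
Qed.

Lemma depth_up u : u != r -> depth u = (depth (up u)).+1.
Proof.
move=> ur; rewrite /depth; case: ex_minnP => -[|n]; first by rewrite /= (negbTE ur).
rewrite iterSr => hn Mn; case: ex_minnP => m hm Mm; congr _.+1.
apply/eqP; rewrite eqn_leq Mm // andbT -ltnS; apply: Mn.
by rewrite iterSr.
Qed.

(** On a cycle the two neighbours of a vertex of largest measure would both be its parent. *)
Lemma rooted_tree : is_tree rooted.
Proof.
split; first by apply/card_gt0P; exists r.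
- have sym : connect_sym (@restr_edge rooted [set: V]) by apply: sym_connect_sym; exact: restr_edge_sym.
  have toroot u : connect (@restr_edge rooted [set: V]) u r.
    by apply: chain_connect (below_root u) _ => w _ _; rewrite inE.
  by move=> x y _ _; apply: connect_trans (toroot x) _; rewrite sym.
move=> c sz /andP[cc uc].
have [v vc vmax] : exists2 v, v \in c & forall w, w \in c -> mu w <= mu v.
  case: c sz {cc uc} => // c0 c _.
  case: (@arg_maxnP V c0 (fun v => v \in c0 :: c) mu (mem_head _ _)) => v vc H.
  by exists v.
have [i c' e] := rot_to vc.
move: cc uc sz; rewrite -(rot_cycle i) -(rot_uniq i) -(size_rot i) e.
case: c' e => [|x c'] e //; case/lastP: c' e => [|c' y] e //.
rewrite /cycle rcons_cons /= => /andP[vx]; rewrite rcons_path last_rcons => /andP[_ yv].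
have mem w : w \in [:: v, x & rcons c' y] -> w \in c by rewrite -e mem_rot.
have yc : y \in [:: v, x & rcons c' y] by rewrite !inE mem_rcons mem_head !orbT.
have xc : x \in [:: v, x & rcons c' y] by rewrite !inE eqxx orbT.
have [_ e1] := rooted_nbr vx (vmax x (mem x xc)).
have vy : (v : rooted) -- y by rewrite edgeC.
have [_ e2] := rooted_nbr vy (vmax y (mem y yc)).
by rewrite -e1 e2 mem_rcons mem_head andbF.
Qed.

Lemma down_connect v y l : y != r -> up y = v -> below y l ->
  connect (@restr_edge rooted [set~ v]) y l.
Proof.
move=> yr e h; rewrite (sym_connect_sym (@restr_edge_sym rooted _)).
apply: chain_connect h _ => w yw _; rewrite !inE; apply/eqP => wv.
by have := below_mu yw; rewrite wv -e leqNgt mu_up.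
Qed.

Lemma up_connect v l : v != r -> ~ below v l -> connect (@restr_edge rooted [set~ v]) (up v) l.
Proof.
move=> vr nl.
apply: (@connect_trans _ _ r).
  apply: chain_connect (below_root _) _ => w _ wv; rewrite !inE; apply/eqP => e; subst w.
  by have := below_mu wv; rewrite leqNgt mu_up.
rewrite (sym_connect_sym (@restr_edge_sym rooted _)).
apply: chain_connect (below_root _) _ => w _ wv; rewrite !inE; apply/eqP => e; subst w.
exact: nl.
Qed.

(** A component of the tree minus v is determined by the neighbour of v that it contains. *)
Lemma few_from_directions (S : {set V}) :
  (forall v y1 y2 : rooted, v -- y1 -> v -- y2 -> y1 != y2 ->
     (exists2 l, l \in leaves rooted :&: S & connect (restr_edge [set~ v]) y1 l) \/
     (exists2 l, l \in leaves rooted :&: S & connect (restr_edge [set~ v]) y2 l)) ->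
  few_components_avoiding (S : {set rooted}).
Proof.
move=> H v; apply/card_le1_eqP => K1 K2; rewrite !inE.
have sym : connect_sym (@restr_edge rooted [set~ v]) by apply: sym_connect_sym; exact: restr_edge_sym.
move=> /andP[/imsetP[x1 x1v e1] d1] /andP[/imsetP[x2 x2v e2] d2]; rewrite !inE in x1v x2v.
have [y1 vy1] := side_cover rooted_tree x1v; have [y2 vy2] := side_cover rooted_tree x2v.
rewrite !inE => c2 c1.
have no x y K l : K = [set z in [set~ v] | connect (@restr_edge rooted [set~ v]) x z] ->
    [disjoint K & leaves rooted :&: S] -> connect (@restr_edge rooted [set~ v]) y x ->
    (v : rooted) -- y -> l \in leaves rooted :&: S -> connect (@restr_edge rooted [set~ v]) y l -> False.
  move=> -> d c vy lL cl; have := disjointFl d lL; rewrite inE (connect_trans _ cl); last by rewrite sym.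
  rewrite andbT !inE => /negbFE /eqP lv; subst l.
  by have := side_notin vy; rewrite inE cl.
case: (eqVneq y1 y2) => [e|ne].
  subst y2; rewrite e1 e2; apply/setP => z; rewrite !inE; congr (_ && _).
  have k : connect (@restr_edge rooted [set~ v]) x1 x2 by apply: connect_trans c2; rewrite sym.
  by rewrite (same_connect sym k).
by case: (H v y1 y2 vy1 vy2 ne) => -[l lL cl]; exfalso;
  [apply: (no _ _ _ _ e1 d1 c1 vy1 lL cl) | apply: (no _ _ _ _ e2 d2 c2 vy2 lL cl)].
Qed.

Definition children v : {set V} := [set c | (c != r) && (up c == v)].

Lemma degree_rooted v : v != r -> degree (v : rooted) = #|children v|.+1.
Proof.
move=> vr; rewrite /degree; have -> : [set y : rooted | (v : rooted) -- y] = up v |: children v.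
  apply/setP => y; rewrite !inE /sedge /= /up_rel /= vr /= eq_sym.
  by [].
rewrite cardsU1 inE; suff -> : (up v != r) && (up (up v) == v) = false by [].
apply/negP => /andP[h /eqP e]; have := mu_up h; rewrite e.
by rewrite ltnNge ltnW ?mu_up.
Qed.

Lemma degree_root : degree (r : rooted) = #|children r|.
Proof.
by rewrite /degree; apply: eq_card => y; rewrite !inE /sedge /= /up_rel /= eqxx.
Qed.

End Rooted.

(* A tree line-graph in G given edge by edge: nodes with parent pointers, the path nseg n being carried by
   the edge from n to its parent; the root is a leaf labelled b, nkid its only child, and nlab n tells whether
   the leaf n is labelled a. *)
Record node_system (G : sgraph) (a b : G) := NodeSystem {
  node :> finType;
  nroot : node;
  npar : node -> node;
  nrk : node -> nat;
  nkid : node;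
  nseg : node -> seq G;
  nlab : pred node
}.

(** * The tree of a node system *)

Section NodeSystem.
Variables (G : sgraph) (a b : G) (N : node_system a b).
Implicit Types (n m c : N) (x y z : G).
Notation r0 := (nroot N).
Notation par := (@npar G a b N).
Notation rk := (@nrk G a b N).
Notation n0 := (nkid N).
Notation R := (@nseg G a b N).
Notation lab := (@nlab G a b N).

Definition leafN n := [forall c, (c != r0) ==> (par c != n)].
Definition seg_head n := head a (R n).
Notation hd := seg_head.
Definition seg_last n := last a (R n).
Notation lst := seg_last.

Record node_system_ok : Prop := {
  ok_edge : a -- b;
  ok_rk : forall n, n != r0 -> rk (par n) < rk n;
  ok_kid : n0 != r0 /\ par n0 = r0;
  ok_kid_uniq : forall n, n != r0 -> par n = r0 -> n = n0;
  ok_kid_leaf : ~~ leafN n0;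
  ok_two : forall c, c != r0 -> par c != r0 -> exists c', [/\ c' != r0, par c' = par c & c' != c];
  ok_path : forall n, n != r0 -> ipath (R n) && (R n != [::]);
  ok_adj : forall n m x y, n != r0 -> m != r0 -> n != m -> x \in R n -> y \in R m -> x != y /\
     x -- y = [|| [&& par n == par m, x == hd n & y == hd m], [&& par m == n, x == lst n & y == hd m]
                | [&& par n == m, y == lst m & x == hd n]];
  ok_a : forall n x, n != r0 -> x \in R n -> x != a /\ a -- x = [&& x == lst n, leafN n & lab n];
  ok_b : forall n x, n != r0 -> x \in R n ->
     x != b /\ b -- x = (x == hd n) && (par n == r0) || [&& x == lst n, leafN n & ~~ lab n];
  ok_fewA : forall c c', c != r0 -> c' != r0 -> par c = par c' -> leafN c -> leafN c' ->
     ~~ lab c -> ~~ lab c' -> c = c';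
  ok_rootA : forall c, c != r0 -> par c = n0 -> leafN c -> lab c;
  ok_fewB : forall c c', c != r0 -> c' != r0 -> par c = par c' -> leafN c -> leafN c' ->
     lab c -> lab c' -> c = c'
}.

Hypothesis ok : node_system_ok.

Let rk_par := ok_rk ok.
Let Rp n : n != r0 -> ipath (R n). Proof. by case/(ok_path ok)/andP. Qed.
Let Rn n : n != r0 -> R n != [::]. Proof. by case/(ok_path ok)/andP. Qed.

Lemma par_neq n : n != r0 -> par n != n.
Proof. by move=> h; apply/eqP => e; have := rk_par h; rewrite e ltnn. Qed.

Lemma seg_disj n m x : n != r0 -> m != r0 -> x \in R n -> x \in R m -> n = m.
Proof.
move=> hn hm xn xm; apply/eqP/negPn/negP => ne.
by have [] := ok_adj ok hn hm ne xn xm; rewrite eqxx.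
Qed.

Lemma hd_in n : n != r0 -> hd n \in R n.
Proof. by move=> /Rn; exact: mem_head_def. Qed.

Lemma lst_in n : n != r0 -> lst n \in R n.
Proof. by move=> /Rn; exact: mem_last_def. Qed.

Definition seg_verts : {set G} := [set x | [exists n, (n != r0) && (x \in R n)]].
Notation S := seg_verts.

Lemma SP x : reflect (exists2 n, n != r0 & x \in R n) (x \in S).
Proof. by rewrite inE; apply: (iffP existsP) => [[n /andP[]]|[n h1 h2]]; exists n; rewrite ?h1. Qed.

Definition owner x := odflt n0 [pick n | (n != r0) && (x \in R n)].
Notation nd := owner.

Lemma ndE n x : n != r0 -> x \in R n -> nd x = n.
Proof.
move=> hn xn; rewrite /nd; case: pickP => [m /andP[hm xm]|/(_ n)]; last by rewrite hn xn.
exact: seg_disj hm hn xm xn.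
Qed.

(** The vertex before x on the way from the root: its predecessor in the segment, or the last vertex
    of the parent's segment. In the tree to be built x is an edge and this is the edge above it;
    None marks the edge at the root. *)
Definition prev_vertex x : option G :=
  if x == hd (nd x) then (if par (nd x) == r0 then None else Some (lst (par (nd x))))
  else Some (nth a (R (nd x)) (index x (R (nd x))).-1).
Notation pv := prev_vertex.

Lemma pv_hd n : n != r0 -> pv (hd n) = if par n == r0 then None else Some (lst (par n)).
Proof. by move=> hn; rewrite /pv (ndE hn (hd_in hn)) eqxx. Qed.

Lemma pv_in n x : n != r0 -> x \in R n -> x != hd n ->
  exists y, [/\ pv x = Some y, y \in R n, y != lst n & index x (R n) = (index y (R n)).+1].
Proof.
move=> hn xn nh; rewrite /pv (ndE hn xn) (negbTE nh).
have i0 : 0 < index x (R n).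
  rewrite lt0n; apply: contra nh => /eqP e; rewrite -(nth_index a xn) e nth0.
  by rewrite /hd; case: (R n) xn.
have ix : index x (R n) < size (R n) by rewrite index_mem.
have iy : (index x (R n)).-1 < size (R n) by apply: leq_ltn_trans ix; apply: leq_pred.
exists (nth a (R n) (index x (R n)).-1); split=> //; first exact: mem_nth.
  rewrite /lst -nth_last nth_uniq ?ipath_uniq ?Rp //; last by rewrite ltn_predL (leq_ltn_trans _ ix).
  by move: i0 ix; clear; move: (index _ _) => i; move: (size _) => k; lia.
by rewrite index_uniq ?ipath_uniq ?Rp // prednK.
Qed.

Lemma pv_next n x : n != r0 -> x \in R n -> x != lst n ->
  exists y, [/\ pv y = Some x, y \in R n & y != hd n].
Proof.
move=> hn xn nl; have ix : index x (R n) < size (R n) by rewrite index_mem.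
have iy : (index x (R n)).+1 < size (R n).
  rewrite ltn_neqAle ix andbT; apply: contra nl => /eqP e.
  by rewrite /lst -nth_last -e /= nth_index.
have uR := ipath_uniq (Rp hn).
have yR : nth a (R n) (index x (R n)).+1 \in R n by apply: mem_nth.
have yh : nth a (R n) (index x (R n)).+1 != hd n.
  by rewrite /hd -nth0 nth_uniq // (leq_ltn_trans _ iy).
exists (nth a (R n) (index x (R n)).+1); split=> //.
by rewrite /pv (ndE hn yR) (negbTE yh) index_uniq //= nth_index.
Qed.

Lemma seg_adj n x y : n != r0 -> x \in R n -> y \in R n ->
  x -- y = ((index x (R n)).+1 == index y (R n)) || ((index y (R n)).+1 == index x (R n)).
Proof.
move=> hn xn yn; rewrite -(ipath_nth a (Rp hn)) ?index_mem // !nth_index //.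
Qed.

Lemma pv_seg n x y : n != r0 -> x \in R n -> y \in R n ->
  (pv x == Some y) = ((index y (R n)).+1 == index x (R n)).
Proof.
move=> hn xn yn; have uR := ipath_uniq (Rp hn).
case: (eqVneq x (hd n)) => [e|nh].
  rewrite e pv_hd // /hd -nth0 index_uniq ?lt0n ?size_eq0 ?Rn //.
  apply/eqP; case: (eqVneq (par n) r0) => [//|pr] [k].
  have := par_neq hn; rewrite (seg_disj pr hn (lst_in pr) _) ?eqxx //.
  by rewrite k.
have [z [-> zn _ ->]] := pv_in hn xn nh; rewrite eqSS.
apply/eqP/eqP => [[->]//|e]; congr Some.
by rewrite -(nth_index a zn) -e nth_index.
Qed.

Lemma pv_cross n m x y : n != r0 -> m != r0 -> n != m -> x \in R n -> y \in R m ->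
  (pv x == Some y) = [&& par n == m, y == lst m & x == hd n].
Proof.
move=> hn hm nm xn ym; case: (eqVneq x (hd n)) => [e|nh]; last first.
  rewrite !andbF; have [z [-> zn _ _]] := pv_in hn xn nh; apply/eqP => -[k]; subst z.
  by rewrite (seg_disj hn hm zn ym) eqxx in nm.
rewrite e pv_hd // andbT; case: (eqVneq (par n) r0) => [->|pr].
  by rewrite [r0 == m]eq_sym (negbTE hm).
case: (eqVneq (par n) m) => [->|ne] /=; first by rewrite eq_sym; apply/eqP/eqP => [[]|->].
apply/eqP => -[k]; rewrite -k in ym.
by rewrite (seg_disj pr hm (lst_in pr) ym) eqxx in ne.
Qed.

Lemma pv_same n m x y : n != r0 -> m != r0 -> x \in R n -> y \in R m -> x != y -> pv x = pv y ->
  [/\ n != m, par n = par m, x = hd n & y = hd m].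
Proof.
have key n' m' x' y' : n' != r0 -> m' != r0 -> x' \in R n' -> y' \in R m' -> x' != y' ->
    pv x' = pv y' -> x' != hd n' -> False.
  move=> hn hm xn ym xy e nh; have [z [ez zn zl iz]] := pv_in hn xn nh.
  case: (eqVneq y' (hd m')) => [ey|nh'].
    move: e; rewrite ez ey pv_hd //; case: eqP => // /eqP pr [k]; subst z.
    by rewrite (seg_disj hn pr zn (lst_in pr)) eqxx in zl.
  have [z' [ez' zn' zl' iz']] := pv_in hm ym nh'.
  move: e; rewrite ez ez' => -[k]; subst z'.
  have ? := seg_disj hn hm zn zn'; subst m'.
  by case/eqP: xy; rewrite -(nth_index a xn) -(nth_index a ym) iz iz'.
move=> hn hm xn ym xy e.
case: (eqVneq x (hd n)) => [ex|nh]; last by case: (key n m x y).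
case: (eqVneq y (hd m)) => [ey|nh]; last by case: (key m n y x) => //; rewrite eq_sym.
have nm : n != m by apply: contraNneq xy => k; rewrite ex ey k.
split=> //; move: e; rewrite ex ey !pv_hd //.
case: eqP => [pn|/eqP pn]; case: eqP => [pm|/eqP pm] //; first by rewrite pn pm.
move=> -[k]; have := lst_in pn; rewrite k => h.
exact: seg_disj pn pm h (lst_in pm).
Qed.

(** Two edges of a rooted tree share an end iff one is right above the other or both hang from the
    same vertex, that is, have the same edge above them. *)
Lemma S_adj x y : x \in S -> y \in S -> x != y ->
  x -- y = [|| pv x == Some y, pv y == Some x | pv x == pv y].
Proof.
move=> /SP[n hn xn] /SP[m hm ym] xy.
case: (eqVneq n m) => [?|nm].
  subst m; rewrite (seg_adj hn xn ym) !(pv_seg hn) // orbC.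
  suff -> : (pv x == pv y) = false by rewrite orbF.
  by apply/eqP => e; have [] := pv_same hn hm xn ym xy e; rewrite eqxx.
have [_ ->] := ok_adj ok hn hm nm xn ym.
rewrite (pv_cross hn hm nm xn ym) (pv_cross hm hn _ ym xn); last by rewrite eq_sym.
case: (eqVneq (pv x) (pv y)) => [e|ne].
  have [_ -> -> ->] := pv_same hn hm xn ym xy e.
  by rewrite !eqxx !orbT.
suff -> : [&& par n == par m, x == hd n & y == hd m] = false by rewrite orFb orbF orbC.
apply/and3P => -[/eqP e1 /eqP e2 /eqP e3]; case/eqP: ne; rewrite e2 e3 !pv_hd //.
by rewrite e1.
Qed.

Definition leafS x := [exists n, [&& n != r0, x == lst n & leafN n]].

Lemma leafSE n x : n != r0 -> x \in R n -> leafS x = (x == lst n) && leafN n.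
Proof.
move=> hn xn; apply/existsP/andP => [[m /and3P[hm /eqP e lm]]|[h1 h2]]; last by exists n; rewrite hn h1.
subst x; by rewrite -(seg_disj hm hn (lst_in hm) xn) eqxx.
Qed.

Lemma no_child x y : x \in S -> leafS x -> y \in S -> pv y != Some x.
Proof.
move=> /SP[n hn xn] lx /SP[m hm ym]; rewrite (leafSE hn xn) in lx; case/andP: lx => /eqP e lf.
case: (eqVneq m n) => [?|ne].
  subst m; rewrite (pv_seg hn ym xn) e; have := ym; rewrite -index_mem.
  have -> : index (lst n) (R n) = (size (R n)).-1.
    by rewrite /lst -nth_last index_uniq ?ipath_uniq ?Rp // ltn_predL lt0n size_eq0 Rn.
  by move: (index _ _) => i; move: (size _) => k; lia.
rewrite (pv_cross hm hn ne ym xn); have := forallP lf m.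
by rewrite hm /= => /negbTE ->.
Qed.

Lemma has_child x : x \in S -> ~~ leafS x -> exists2 y, y \in S & pv y = Some x.
Proof.
move=> /SP[n hn xn]; rewrite (leafSE hn xn) negb_and; case: (eqVneq x (lst n)) => [e|nl] /=; last first.
  by move=> _; have [y [e yn _]] := pv_next hn xn nl; exists y => //; apply/SP; exists n.
move=> /forallPn[c]; rewrite negb_imply negbK => /andP[hc /eqP pc].
exists (hd c); first by apply/SP; exists c; rewrite // hd_in.
by rewrite pv_hd // pc (negbTE hn) e.
Qed.

End NodeSystem.

Section NodeTree.
Variables (G : sgraph) (ehf : even_hole_free G) (a b : G) (N : node_system a b).
Hypothesis ok : node_system_ok N.
Implicit Types (n m c : N) (x y z : G).
Notation r0 := (nroot N).
Notation par := (@npar G a b N).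
Notation rk := (@nrk G a b N).
Notation n0 := (nkid N).
Notation R := (@nseg G a b N).
Notation lab := (@nlab G a b N).
Notation S := (seg_verts N).
Notation pv := (@prev_vertex G a b N).
Notation nd := (@owner G a b N).
Notation hd := (@seg_head G a b N).
Notation lst := (@seg_last G a b N).
Notation leafN := (@leafN G a b N).
Notation leafS := (@leafS G a b N).

Let rk_par := ok_rk ok.
Let Rp n : n != r0 -> ipath (R n). Proof. by case/(ok_path ok)/andP. Qed.
Let n0r : n0 != r0. Proof. by case: (ok_kid ok). Qed.
Let pn0 : par n0 = r0. Proof. by case: (ok_kid ok). Qed.

(** The edge x is represented by its lower end; None is the root. *)
Definition tree_vertex : finType := option {x : G | x \in S}.
Notation vert := tree_vertex.
Definition vertex_of x : vert := insub x.
Notation vtx := vertex_of.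
Definition tree_up (v : vert) : vert := obind (fun o : {x : G | x \in S} => obind vtx (pv (val o))) v.
Notation up := tree_up.
(** Lexicographic in the rank of the node and the position in its segment; the factor exceeds every
    position. *)
Definition tree_rank (v : vert) := if v is Some o then (rk (nd (val o)) * #|G|.+1 + index (val o) (R (nd (val o)))).+1 else 0.
Notation mu := tree_rank.

Lemma inSeg n x : n != r0 -> x \in R n -> x \in S.
Proof. by move=> hn xn; apply/SP; exists n. Qed.

Lemma vtxE x (xS : x \in S) : vtx x = Some (exist _ x xS).
Proof. by rewrite /vtx insubT. Qed.

Lemma vtx_neq x : x \in S -> vtx x != None.
Proof. by move=> xS; rewrite vtxE. Qed.

Lemma vtxP (v : vert) : v != None -> exists2 x, x \in S & v = vtx x.
Proof. by case: v => // -[x xS] _; exists x; rewrite ?vtxE. Qed.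

Lemma vtx_inj x y : x \in S -> y \in S -> vtx x = vtx y -> x = y.
Proof. by move=> xS yS; rewrite !vtxE => -[]. Qed.

Lemma vtx_eq x y : x \in S -> y \in S -> (vtx x == vtx y) = (x == y).
Proof. by move=> xS yS; apply/eqP/eqP => [/vtx_inj ->|->]. Qed.

Lemma pvS x y : x \in S -> pv x = Some y -> y \in S.
Proof.
move=> /SP[n hn xn]; case: (eqVneq x (hd n)) => [->|nh].
  rewrite pv_hd //; case: eqP => // /eqP pr [<-].
  by apply: (inSeg pr); apply: lst_in.
by have [z [-> zn _ _]] := pv_in ok hn xn nh => -[<-]; apply: inSeg zn.
Qed.

Lemma up_vtx x : x \in S -> up (vtx x) = obind vtx (pv x).
Proof. by move=> xS; rewrite (vtxE xS). Qed.

Lemma up_eq x y : x \in S -> y \in S -> (up (vtx x) == vtx y) = (pv x == Some y).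
Proof.
move=> xS yS; rewrite up_vtx //; case e: (pv x) => [z|] /=; last by rewrite eq_sym (negbTE (vtx_neq yS)).
by rewrite vtx_eq //; apply: pvS e.
Qed.

Lemma up_none x : x \in S -> (up (vtx x) == None) = (pv x == None).
Proof.
move=> xS; rewrite up_vtx //; case e: (pv x) => [z|] //=.
by rewrite (negbTE (vtx_neq (pvS xS e))).
Qed.

Lemma mu_vtx n x : n != r0 -> x \in R n -> mu (vtx x) = (rk n * #|G|.+1 + index x (R n)).+1.
Proof. by move=> hn xn; rewrite (vtxE (inSeg hn xn)) /= (ndE ok hn xn). Qed.

Lemma index_small n x : n != r0 -> x \in R n -> index x (R n) < #|G|.
Proof.
move=> hn xn; apply: leq_trans (_ : size (R n) <= _); first by rewrite index_mem.
by rewrite -(card_uniqP (ipath_uniq (Rp hn))) max_card.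
Qed.

Lemma mu_up v : v != None -> mu (up v) < mu v.
Proof.
move=> /vtxP[x xS ->]; have /SP[n hn xn] := xS; rewrite up_vtx // (mu_vtx hn xn).
case: (eqVneq x (hd n)) => [e|nh].
  rewrite e pv_hd //; case: eqP => // /eqP pr; rewrite [obind _ _]/= (mu_vtx pr (lst_in ok pr)).
  have := index_small pr (lst_in ok pr); have := rk_par hn.
  move: (rk _) (rk _) #|_| (index _ _) (index _ _) => i j k p q; clear => h1 h2.
  have : j.+1 * k.+1 <= i * k.+1 by rewrite leq_mul2r ?h1 ?h2 ?orbT.
  by rewrite mulSn; move: (i * _) (j * _) h1 => u v; lia.
have [z [-> zn _ ->]] := pv_in ok hn xn nh.
by rewrite [obind _ _]/= (mu_vtx hn zn) addnS.
Qed.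

Definition node_tree : sgraph := rooted mu_up.
Notation T := node_tree.

Lemma up_root : up None = None. Proof. by []. Qed.

Lemma T_tree : is_tree T. Proof. exact: rooted_tree mu_up up_root. Qed.

Lemma T_up x : x \in S -> (vtx x : T) -- up (vtx x).
Proof. by move=> xS; apply: rooted_up; apply: vtx_neq. Qed.

(** The root is a leaf labelled b of depth zero, so the odd side has to be the side of a. *)
Definition odd_side : {set T} := [set v : T | odd (depth mu_up v)].
Notation A' := odd_side.
Definition even_side : {set T} := [set v : T | ~~ odd (depth mu_up v)].
Notation B' := even_side.

Lemma T_bipartition : is_bipartition A' B'.
Proof.
split.
- by apply/pred0P => v; rewrite /= !inE andbN.
- by apply/setP => v; rewrite !inE orbN.
move=> u v; rewrite !inE /sedge /= => /orP[/andP[h /eqP e]|/andP[h /eqP e]].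
  by rewrite (depth_up mu_up h) e.
by rewrite (depth_up mu_up h) e /= negbK.
Qed.

(** The edges on the way from x up to the root, as an induced path of G. The vertices after x have
    children, so none of them is a leaf edge other than the one at the root. *)
Lemma up_path x : x \in S -> exists L, [/\ ipath (x :: L), size (x :: L) = depth mu_up (vtx x),
  last x L = hd n0, {subset x :: L <= S} &
  {in x :: L, forall z, mu (vtx z) <= mu (vtx x)} /\ {in L, forall z, ~~ leafS z /\ z != x}].
Proof.
move: {2}(mu (vtx x)) (leqnn (mu (vtx x))) => k; elim: k x => [|k IH] x h xS.
  by have := mu_up (vtx_neq xS); rewrite ltnNge (leq_trans h).
have dE := depth_up mu_up (vtx_neq xS).
case e: (pv x) => [y|]; last first.
  exists [::]; rewrite dE up_vtx // e /= depth_root; split=> //.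
  - have /SP[n hn xn] := xS; case: (eqVneq x (hd n)) => [k1|nh].
      by move: e; rewrite /= k1 pv_hd //; case: eqP => // /(ok_kid_uniq ok hn) -> _.
    by have [z []] := pv_in ok hn xn nh; rewrite e.
  - by move=> z; rewrite inE => /eqP ->.
  - by split=> // z; rewrite inE => /eqP ->.
have yS := pvS xS e.
have ey : up (vtx x) = vtx y by rewrite up_vtx // e.
have lt : mu (vtx y) < mu (vtx x) by rewrite -ey; apply: mu_up; apply: vtx_neq.
have hy : mu (vtx y) <= k by rewrite -ltnS (leq_trans lt).
have [L [pL sL lL SL [mL nL]]] := IH y hy yS.
have lx z : z \in y :: L -> mu (vtx z) < mu (vtx x) by move=> zL; apply: leq_ltn_trans (mL z zL) lt.
have nx z : z \in y :: L -> z != x.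
  by move=> /lx k1; apply: contraTneq k1 => ->; rewrite ltnn.
exists (y :: L); split.
- apply: ipath_cons => // x' z; rewrite inE => /eqP -> zL; have zS := SL z zL.
  have xz : x != z by rewrite eq_sym nx.
  split=> //; rewrite (S_adj ok xS zS xz) e /= eqxx /=.
  have -> : (pv z == Some x) = false.
    apply/eqP => k1; have := mu_up (vtx_neq zS); rewrite up_vtx // k1 /= ltnNge ltnW //; exact: lx.
  have -> : (Some y == pv z) = false.
    apply/eqP => k1; have := mu_up (vtx_neq zS); rewrite up_vtx // -k1 /= ltnNge mL //.
  by rewrite ?orbF [RHS]eq_sym.
- by rewrite dE ey /= -sL.
- by [].
- by move=> z /predU1P[->|/SL].
split; first by move=> z /predU1P[->|/lx/ltnW].
move=> z zL; split; last exact: nx.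
case/predU1P: zL => [->|zL]; last by case: (nL z zL).
by apply/negP => ly; have := no_child ok yS ly xS; rewrite e eqxx.
Qed.

Lemma S_a x : x \in S -> (x != a) * (leafS x = false -> a -- x = false) *
  (forall n, n != r0 -> x \in R n -> a -- x = leafS x && lab n).
Proof.
move=> xS; have /SP[n hn xn] := xS; have [k1 k2] := ok_a ok hn xn; split; first split=> //.
  by rewrite (leafSE ok hn xn) k2; case: (_ == _) => //= ->.
by move=> m hm xm; have [_ ->] := ok_a ok hm xm; rewrite (leafSE ok hm xm) andbA.
Qed.

Lemma S_b x : x \in S -> (x != b) * (leafS x = false -> b -- x = (x == hd n0)) *
  (forall n, n != r0 -> x \in R n -> b -- x = (x == hd n0) || leafS x && ~~ lab n).
Proof.
move=> xS.
have key n : n != r0 -> x \in R n -> (x == hd n) && (par n == r0) = (x == hd n0).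
  move=> hn xn; apply/andP/eqP => [[/eqP -> /eqP /(ok_kid_uniq ok hn) ->] //|e].
  have := hd_in ok n0r; rewrite -e => h; have ? := seg_disj ok hn n0r xn h.
  by subst n; rewrite e pn0 !eqxx.
have /SP[n hn xn] := xS; have [k1 k2] := ok_b ok hn xn; split; first split=> //.
  by rewrite (leafSE ok hn xn) k2 key //; case: (x == lst n) => /= [->|]; rewrite ?andbF orbF.
by move=> m hm xm; have [_ ->] := ok_b ok hm xm; rewrite (leafSE ok hm xm) key // andbA.
Qed.

Lemma root_seg_leaf x : x \in R n0 -> leafS x = false.
Proof. by move=> xn; rewrite (leafSE ok n0r xn) (negbTE (ok_kid_leaf ok)) andbF. Qed.

(** The way up from the leaf is a path of [depth] vertices that ends at a neighbour of b. It is
    closed to a ring by b if the leaf is labelled b and by the edge ab if it is labelled a, so the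
    label forces the parity of the depth. *)
Lemma leaf_depth n : n != r0 -> leafN n -> odd (depth mu_up (vtx (lst n))) = lab n.
Proof.
move=> hn ln; have xn := lst_in ok hn; have xS := inSeg hn xn; have ab := ok_edge ok.
have [L [pL sL lL SL [_ nL]]] := up_path xS.
have lx : leafS (lst n) by rewrite (leafSE ok hn xn) eqxx.
set x := lst n in xn xS pL sL lL SL nL lx *.
have xh : x != hd n0.
  by apply: contraTneq lx => ->; rewrite (root_seg_leaf (hd_in ok n0r)).
have L0 : L != [::] by apply: contraNneq xh => e; rewrite -lL e.
have bE z : z \in x :: L -> b -- z = (z == last z (x :: L)) || (z == x) && ~~ lab n.
  move=> zL; have zS := SL z zL; have -> : last z (x :: L) = hd n0 by rewrite -lL.
  case/predU1P: zL => [->|zL]; first by rewrite eqxx ((S_b xS).2 n hn xn) lx.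
  by have [l nz] := nL z zL; rewrite (negbTE nz) orbF ((S_b zS).1.2 (negbTE l)).
have aE z : z \in x :: L -> a -- z = (z == x) && lab n.
  move=> zL; have zS := SL z zL.
  case/predU1P: zL => [->|zL]; first by rewrite eqxx ((S_a xS).2 n hn xn) lx.
  by have [l nz] := nL z zL; rewrite (negbTE nz) ((S_a zS).1.2 (negbTE l)).
have na z : z \in x :: L -> z != a by move=> zL; rewrite (S_a (SL z zL)).1.1.
have nb z : z \in x :: L -> z != b by move=> zL; rewrite (S_b (SL z zL)).1.1.
case ln': (lab n).
  suff h : odd (size (x :: L) + size [:: b; a]) by move: h; rewrite sL addn2 /= negbK.
  apply: (ring_odd ehf pL) => //; first by rewrite /= edgeC ab eqxx inE eq_sym (edge_neq ab).
    by rewrite addn2.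
  move=> z w zL; rewrite !inE => /orP[]/eqP ->; rewrite ?nb ?na // [z -- _]edgeC ?bE ?aE // ln' ?andbT ?andbF ?orbF.
    by rewrite /= eqxx ?[b == a]eq_sym ?(negbTE (edge_neq ab)) ?andbF ?orbF ?andbT.
  by rewrite /= eqxx ?(negbTE (edge_neq ab)) ?andbF ?andbT.
suff h : odd (size (x :: L) + size [:: b]) by move: h; rewrite sL addn1 /= => /negbTE.
apply: (ring_odd ehf pL) => //; first by case: (L) L0 => //= ? ? _; rewrite addn1.
by move=> z w zL; rewrite inE => /eqP ->; rewrite nb // [z -- b]edgeC bE // ln' /= eqxx !andbT.
Qed.

End NodeTree.

Section NodeTree.
Variables (G : sgraph) (ehf : even_hole_free G) (a b : G) (N : node_system a b).
Hypothesis ok : node_system_ok N.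
Implicit Types (n m c : N) (x y z : G).
Notation r0 := (nroot N).
Notation par := (@npar G a b N).
Notation rk := (@nrk G a b N).
Notation n0 := (nkid N).
Notation R := (@nseg G a b N).
Notation lab := (@nlab G a b N).
Notation S := (seg_verts N).
Notation pv := (@prev_vertex G a b N).
Notation hd := (@seg_head G a b N).
Notation lst := (@seg_last G a b N).
Notation leafN := (@leafN G a b N).
Notation leafS := (@leafS G a b N).
Notation vtx := (@vertex_of G a b N).
Notation up := (@tree_up G a b N).
Notation mu_up := (mu_up ok).
Notation T := (node_tree ok).
Notation A' := (odd_side ok).
Notation B' := (even_side ok).
Notation tbelow := (below up).

Let rk_par := ok_rk ok.
Let Rp n : n != r0 -> ipath (R n). Proof. by case/(ok_path ok)/andP. Qed.
Let n0r : n0 != r0. Proof. by case: (ok_kid ok). Qed.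
Let pn0 : par n0 = r0. Proof. by case: (ok_kid ok). Qed.

Definition parr n := if n == r0 then r0 else par n.
Notation nbelow := (below parr).

Lemma parrE n : n != r0 -> parr n = par n. Proof. by rewrite /parr => /negbTE ->. Qed.

Lemma rk_parr n : n != r0 -> rk (parr n) < rk n.
Proof. by move=> h; rewrite parrE // rk_par. Qed.

Lemma parr_root : parr r0 = r0. Proof. by rewrite /parr eqxx. Qed.

Lemma few_leaf c c' : c != r0 -> c' != r0 -> par c = par c' -> leafN c -> leafN c' -> lab c = lab c' -> c = c'.
Proof.
move=> h h' e l l' k; case ll: (lab c); last by apply: (ok_fewA ok) => //; rewrite -?k ll.
by apply: (ok_fewB ok) => //; rewrite -k.
Qed.

(** A node that is not a leaf has at least two children, and at most one of them is a leaf with the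
    unwanted label. *)
Lemma descend d n : n != r0 -> ~~ (leafN n && (lab n != d)) ->
  exists m, [/\ m != r0, leafN m, lab m = d & nbelow n m].
Proof.
set K := \max_m rk m.
have leK m : rk m <= K by apply: leq_bigmax.
move: {2}(K - rk n).+1 (ltnSn (K - rk n)) => k; elim: k n => // k IH n hk hn.
case ln: (leafN n) => /=.
  by rewrite negbK => /eqP e; exists n; split=> //; exact: below_refl.
move=> _; case/forallPn: (negbT ln) => c; rewrite negb_imply negbK => /andP[hc /eqP pc].
have pc0 : par c != r0 by rewrite pc.
have [c' [hc' pc' ne]] := ok_two ok hc pc0; rewrite pc in pc'.
have [c2 [h2 p2 b2]] : exists c2, [/\ c2 != r0, par c2 = n & ~~ (leafN c2 && (lab c2 != d))].
  case: (boolP (leafN c && (lab c != d))) => [/andP[l1 l2]|k1]; last by exists c.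
  exists c'; split=> //; apply/negP => /andP[l3 l4]; case/eqP: ne.
  apply: few_leaf => //; first by rewrite pc.
  by move: l2 l4; case: (lab c); case: (lab c'); case: (d).
have lt : rk n < rk c2 by rewrite -p2 rk_par.
have hk2 : K - rk c2 < k by have := leK c2; move: hk lt; clear; lia.
have [m [m1 m2 m3 m4]] := IH c2 hk2 h2 b2.
exists m; split=> //; apply: below_trans m4.
by exists 1; rewrite /= parrE.
Qed.

Lemma nbelow_sib n c m : n != r0 -> c != r0 -> par c = par n -> c != n -> nbelow c m -> ~ nbelow n m.
Proof.
have key i j n' c' m' : i <= j -> iter i parr m' = c' -> iter j parr m' = n' -> c' != r0 -> n' != r0 ->
    par c' = par n' -> c' = n'.
  move=> ij e1 e2 hc hn pc; case: (eqVneq i j) => [e|ne]; first by rewrite -e1 -e2 e.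
  have e : iter (j - i) parr c' = n' by rewrite -e1 -iterD subnK.
  have e3 : (j - i) = (j - i).-1.+1 by rewrite prednK // subn_gt0 ltn_neqAle ne.
  rewrite e3 iterSr parrE // pc in e.
  have /(below_mu rk_parr parr_root) : nbelow n' (par n') by exists (j - i).-1.
  by rewrite leqNgt rk_par.
move=> hn hc pc ne [i e1] [j e2]; case/eqP: ne.
by case: (leqP i j) => [h|/ltnW h]; [apply: (key i j n c m) | apply/esym/(key j i c n m)].
Qed.

(** A sibling of n leads down to a leaf labelled a unless it is itself a leaf labelled b; then the
    parent is tried. At a child of [n0] the exception is ruled out by [ok_rootA], the root being a
    leaf labelled b next to [n0]. *)
Lemma ascend n : n != r0 -> par n != r0 ->
  exists m, [/\ m != r0, leafN m, lab m & ~ nbelow n m].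
Proof.
move: {2}(rk n).+1 (ltnSn (rk n)) => k; elim: k n => // k IH n hk hn pn.
have [c [hc pc ne]] := ok_two ok hn pn.
case: (boolP (leafN c && ~~ lab c)) => [/andP[lc bc]|h]; last first.
  have h' : ~~ (leafN c && (lab c != true)) by move: h; case: (lab c).
  have [m [m1 m2 m3 m4]] := descend hc h'.
  by exists m; split=> //; apply: nbelow_sib m4.
case: (eqVneq (par (par n)) r0) => [e|ppn].
  have e' := ok_kid_uniq ok pn e.
  by have := ok_rootA ok hc (etrans pc e') lc; rewrite (negbTE bc).
have hk2 : rk (par n) < k by rewrite -ltnS (leq_trans _ hk) // ltnS rk_par.
have [m [m1 m2 m3 m4]] := IH (par n) hk2 pn ppn.
exists m; split=> // h; apply: m4; apply: below_trans h.
by exists 1; rewrite /= parrE.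
Qed.

Lemma below_seg n x y : n != r0 -> x \in R n -> y \in R n -> index x (R n) <= index y (R n) ->
  tbelow (vtx x) (vtx y).
Proof.
move=> hn xn; move: {2}(index y (R n)) (leqnn (index y (R n))) => k; elim: k y => [|k IH] y hk yn h.
  have e : index x (R n) = index y (R n) by move: hk h; clear; lia.
  by rewrite -(nth_index a xn) -(nth_index a yn) e; exact: below_refl.
case: (eqVneq (index x (R n)) (index y (R n))) => [e|ne].
  by rewrite -(nth_index a xn) -(nth_index a yn) e; exact: below_refl.
have nh : y != hd n.
  apply: contraNneq ne => e; rewrite e in h *; rewrite eqn_leq h.
  by rewrite /seg_head -nth0 index_uniq ?ipath_uniq ?Rp // lt0n size_eq0; case/andP: (ok_path ok hn).
have [z [e zn _ iz]] := pv_in ok hn yn nh.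
apply: below_up; rewrite (up_vtx (inSeg hn yn)) e /=.
by apply: IH => //; move: hk h ne; rewrite iz; clear; lia.
Qed.

Lemma index_lst n : n != r0 -> index (lst n) (R n) = (size (R n)).-1.
Proof.
move=> hn; have := ok_path ok hn => /andP[p0 s0].
by rewrite /seg_last -nth_last index_uniq ?ipath_uniq // ltn_predL lt0n size_eq0.
Qed.

Lemma below_lst n x : n != r0 -> x \in R n -> tbelow (vtx x) (vtx (lst n)).
Proof.
move=> hn xn; apply: (below_seg hn xn (lst_in ok hn)).
by rewrite index_lst //; move: xn; rewrite -index_mem; case: (size _).
Qed.

Lemma below_nodes n m x : n != r0 -> m != r0 -> nbelow n m -> x \in R n -> tbelow (vtx x) (vtx (lst m)).
Proof.
move=> hn hm [k e] xn; elim: k m hm e => [|k IH] m hm; first by move=> /= ->; exact: below_lst.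
rewrite iterSr parrE // => e; case: (eqVneq (par m) r0) => [pm|pm].
  by move: hn; rewrite -e pm (iter_root parr_root) eqxx.
apply: below_trans (IH _ pm e) _.
apply: (below_trans (u := vtx (hd m))); last by apply: below_lst => //; apply: hd_in.
exists 1; rewrite /= (up_vtx (inSeg hm (hd_in ok hm))) pv_hd // (negbTE pm).
by [].
Qed.

Lemma pv_node m y z : m != r0 -> y \in R m -> pv y = Some z -> z \in R m \/ par m != r0 /\ z = lst (par m).
Proof.
move=> hm ym; case: (eqVneq y (hd m)) => [->|nh].
  by rewrite pv_hd //; case: eqP => // /eqP pm [<-]; right.
by have [w [-> wm _ _]] := pv_in ok hm ym nh => -[<-]; left.
Qed.

Lemma below_nd n m x y : n != r0 -> m != r0 -> x \in R n -> y \in R m -> tbelow (vtx x) (vtx y) -> nbelow n m.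
Proof.
move=> hn hm xn ym [k e]; elim: k m y hm ym e => [|k IH] m y hm ym.
  move=> /= /(vtx_inj (inSeg hm ym) (inSeg hn xn)) e; subst y.
  by rewrite (seg_disj ok hn hm xn ym); exact: below_refl.
rewrite iterSr (up_vtx (inSeg hm ym)); case e: (pv y) => [z|] /=; last first.
  by rewrite (iter_root (up_root N)) => k'; have := vtx_neq (inSeg hn xn); rewrite -k'.
case: (pv_node hm ym e) => [zm|[pm ez]]; first exact: IH.
rewrite ez => h; have h' := IH _ _ pm (lst_in ok pm) h.
by apply: below_up; rewrite parrE.
Qed.

Lemma T_nbr (v y : T) : v -- y -> v != None /\ up v = y \/ y != None /\ up y = v.
Proof. by rewrite /sedge /= => /orP[/andP[h /eqP e]|/andP[h /eqP e]]; [left|right]. Qed.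

Lemma leaf_vtx x : x \in S -> (vtx x \in leaves T) = leafS x.
Proof.
move=> xS; rewrite inE (degree_rooted mu_up (vtx_neq xS)) eqSS cards_eq0.
case lx: (leafS x).
  apply/set0Pn => -[c]; rewrite inE => /andP[hc]; have [y yS ->] := vtxP hc.
  by rewrite up_eq // (negbTE (no_child ok xS lx yS)).
have [y yS e] := has_child ok xS (negbT lx).
by apply/negbTE/set0Pn; exists (vtx y); rewrite inE vtx_neq // up_eq // e eqxx.
Qed.

Lemma pv_none x : x \in S -> (pv x == None) = (x == hd n0).
Proof.
move=> /SP[n hn xn]; apply/eqP/eqP => [e|->]; last by rewrite pv_hd // pn0 eqxx.
case: (eqVneq x (hd n)) => [k1|nh]; last by have [z []] := pv_in ok hn xn nh; rewrite e.
by move: e; rewrite k1 pv_hd //; case: eqP => // /(ok_kid_uniq ok hn) ->.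
Qed.

Lemma leaf_none : (None : T) \in leaves T.
Proof.
rewrite inE degree_root; apply/cards1P; exists (vtx (hd n0)); apply/setP => c.
rewrite !inE; have hS := inSeg n0r (hd_in ok n0r).
case: (eqVneq c None) => [->|hc]; first by rewrite [RHS]eq_sym (negbTE (vtx_neq hS)).
have [y yS ->] := vtxP hc; by rewrite up_none // pv_none // vtx_eq.
Qed.

Lemma leaf_A m : m != r0 -> leafN m -> (vtx (lst m) \in leaves T :&: A') = lab m.
Proof.
move=> hm lm; have mS := inSeg hm (lst_in ok hm).
rewrite in_setI leaf_vtx // (leafSE ok hm (lst_in ok hm)) eqxx lm /= inE.
exact: (leaf_depth ehf ok hm lm).
Qed.

Lemma leaf_B m : m != r0 -> leafN m -> (vtx (lst m) \in leaves T :&: B') = ~~ lab m.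
Proof.
move=> hm lm; have mS := inSeg hm (lst_in ok hm).
rewrite in_setI leaf_vtx // (leafSE ok hm (lst_in ok hm)) eqxx lm /= inE.
by congr (~~ _); exact: (leaf_depth ehf ok hm lm).
Qed.

Lemma none_B : (None : T) \in leaves T :&: B'.
Proof. by rewrite in_setI leaf_none inE depth_root. Qed.

Lemma child_down (v : T) c y d : c != r0 -> y \in R c -> up (vtx y) = v -> ~~ (leafN c && (lab c != d)) ->
  exists m, [/\ m != r0, leafN m, lab m = d & connect (@restr_edge T [set~ v]) (vtx y) (vtx (lst m))].
Proof.
move=> hc yc e h; have [m [m1 m2 m3 m4]] := descend hc h; exists m; split=> //.
apply: (down_connect mu_up (up_root N)) => //; first exact: vtx_neq (inSeg hc yc).
exact: below_nodes m4 yc.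
Qed.

Lemma sibs (v : T) c c' y y' : c != r0 -> c' != r0 -> y \in R c -> y' \in R c' ->
  up (vtx y) = v -> up (vtx y') = v -> vtx y != vtx y' -> c != c' /\ par c = par c'.
Proof.
move=> hc hc' yc yc' <- e ne; have yS := inSeg hc yc; have yS' := inSeg hc' yc'.
have ne' : y != y' by apply: contraNneq ne => ->.
suff k : pv y = pv y' by have [] := pv_same ok hc hc' yc yc' ne' k.
move: e; rewrite !up_vtx //; case k1: (pv y) => [z|]; case k2: (pv y') => [z'|] //=.
- by move=> /(vtx_inj (pvS ok yS' k2) (pvS ok yS k1)) ->.
- by move/esym => k; have := vtx_neq (pvS ok yS k1); rewrite k.
- by move=> k; have := vtx_neq (pvS ok yS' k2); rewrite k.
Qed.

(** The only directions without a leaf labelled a lead down inside a leaf segment labelled b, or up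
    inside the segment at the root; no vertex has two of them. *)
Lemma T_fewA : few_components_avoiding A'.
Proof.
apply: (@few_from_directions _ _ _ _ mu_up (up_root N) A') => v y1 y2 vy1 vy2 ne.
have dir (y : T) : v -- y ->
    (exists2 l, l \in leaves T :&: A' & connect (restr_edge [set~ v]) y l) \/
    ((exists c x, [/\ c != r0, x \in R c, y = vtx x, up (vtx x) = v & leafN c && ~~ lab c]) \/
     [/\ v != None, up v = y & forall n x, n != r0 -> x \in R n -> v = vtx x -> par n = r0]).
  move=> vy; case: (T_nbr vy) => [[hv e]|[hy e]].
    have [x xS ex] := vtxP hv; have /SP[n hn xn] := xS.
    case: (eqVneq (par n) r0) => [pn|pn].
      right; right; split=> // n' x' hn' xn' ex'; rewrite ex in ex'.
      have e' := vtx_inj xS (inSeg hn' xn') ex'; subst x'.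
      by rewrite (seg_disj ok hn' hn xn' xn).
    have [m [m1 m2 m3 m4]] := ascend hn pn; left.
    exists (vtx (lst m)); first by rewrite leaf_A.
    rewrite -e; apply: (up_connect mu_up (up_root N)) => //; rewrite ex => k.
    exact: m4 (below_nd hn m1 xn (lst_in ok m1) k).
  have [x xS ex] := vtxP hy; have /SP[c hc xc] := xS; rewrite ex in e.
  case: (boolP (leafN c && ~~ lab c)) => h; first by right; left; exists c, x.
  have h' : ~~ (leafN c && (lab c != true)) by move: h; case: (lab c).
  left; have [m [m1 m2 m3 m4]] := child_down hc xc e h'.
  by exists (vtx (lst m)); [rewrite leaf_A | rewrite ex].
case: (dir y1 vy1) => [|d1]; first by left.
case: (dir y2 vy2) => [|d2]; first by right.
exfalso.
have mixed (y y' : T) : (exists c x, [/\ c != r0, x \in R c, y = vtx x, up (vtx x) = v & leafN c && ~~ lab c]) ->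
   [/\ v != None, up v = y' & forall n x, n != r0 -> x \in R n -> v = vtx x -> par n = r0] -> False.
  move=> [c [x [hc xc _ e /andP[lc bc]]]] [hv _ H].
  have [z zS ez] := vtxP hv; have /SP[n hn zn] := zS.
  have en := ok_kid_uniq ok hn (H n z hn zn ez); subst n.
  have k : pv x == Some z by rewrite -up_eq ?(inSeg hc xc) // e ez.
  case: (pv_node hc xc (eqP k)) => [zc|[pc e2]].
    by have := ok_kid_leaf ok; rewrite -(seg_disj ok hc n0r zc zn) lc.
  have e3 : par c = n0.
    by apply: (seg_disj ok pc n0r (x := z)) => //; rewrite e2 lst_in.
  by have := ok_rootA ok hc e3 lc; rewrite (negbTE bc).
case: d1 => d1; case: d2 => d2.
- case: d1 => c1 [x1 [h1 i1 e1 u1 /andP[l1 b1]]]; case: d2 => c2 [x2 [h2 i2 e2 u2 /andP[l2 b2]]].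
  rewrite e1 e2 in ne; have [k1 k2] := sibs h1 h2 i1 i2 u1 u2 ne.
  by case/eqP: k1; apply: (ok_fewA ok).
- exact: (mixed y1 y2).
- exact: (mixed y2 y1).
- by case: d1 => _ e1 _; case: d2 => _ e2 _; rewrite -e1 -e2 eqxx in ne.
Qed.

(** The root is a leaf of this side, so only directions into leaf segments labelled a can fail. *)
Lemma T_fewB : few_components_avoiding B'.
Proof.
apply: (@few_from_directions _ _ _ _ mu_up (up_root N) B') => v y1 y2 vy1 vy2 ne.
have dir (y : T) : v -- y ->
    (exists2 l, l \in leaves T :&: B' & connect (restr_edge [set~ v]) y l) \/
    (exists c x, [/\ c != r0, x \in R c, y = vtx x, up (vtx x) = v & leafN c && lab c]).
  move=> vy; case: (T_nbr vy) => [[hv e]|[hy e]].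
    left; exists None; first exact: none_B.
    rewrite -e; apply: (up_connect mu_up (up_root N)) => // -[k].
    by rewrite (iter_root (up_root N)) => k'; rewrite -k' in hv.
  have [x xS ex] := vtxP hy; have /SP[c hc xc] := xS; rewrite ex in e.
  case: (boolP (leafN c && lab c)) => h; first by right; exists c, x.
  have h' : ~~ (leafN c && (lab c != false)) by move: h; case: (lab c).
  left; have [m [m1 m2 m3 m4]] := child_down hc xc e h'.
  by exists (vtx (lst m)); [rewrite leaf_B // m3 | rewrite ex].
case: (dir y1 vy1) => [|[c1 [x1 [h1 i1 e1 u1 /andP[l1 b1]]]]]; first by left.
case: (dir y2 vy2) => [|[c2 [x2 [h2 i2 e2 u2 /andP[l2 b2]]]]]; first by right.
rewrite e1 e2 in ne; have [k1 k2] := sibs h1 h2 i1 i2 u1 u2 ne.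
by case/eqP: k1; apply: (ok_fewB ok).
Qed.

Lemma T_leaves : 2 < #|leaves T|.
Proof.
have h d : ~~ (leafN n0 && (lab n0 != d)) by rewrite (negbTE (ok_kid_leaf ok)).
have [m [m1 m2 m3 _]] := descend n0r (h true).
have [m' [m1' m2' m3' _]] := descend n0r (h false).
have i1 : vtx (lst m) \in leaves T by have := leaf_A m1 m2; rewrite m3 in_setI => /andP[].
have i2 : vtx (lst m') \in leaves T by have := leaf_B m1' m2'; rewrite m3' in_setI => /andP[].
have n1 := vtx_neq (inSeg m1 (lst_in ok m1)); have n2 := vtx_neq (inSeg m1' (lst_in ok m1')).
have ne : vtx (lst m) != vtx (lst m').
  apply/eqP => /(vtx_inj (inSeg m1 (lst_in ok m1)) (inSeg m1' (lst_in ok m1'))) e.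
  have := lst_in ok m1; rewrite e => h1.
  by have := seg_disj ok m1 m1' h1 (lst_in ok m1') => k; rewrite k m3' in m3.
apply/card_gt2P; exists None, (vtx (lst m)), (vtx (lst m')); split=> //; first by split=> //; exact: leaf_none.
by split; rewrite // eq_sym.
Qed.

Lemma T_extended : extended_tree A' B'.
Proof. split; [exact: T_tree | exact: T_leaves | exact: T_bipartition | exact: T_fewA | exact: T_fewB]. Qed.

End NodeTree.

(** * The shape as a graph *)

Section ShapeOf.
Variable T : sgraph.
Implicit Types (x y : T) (p : seq T).

Definition branchb x p y := [&& branch_vertex x, branch_vertex y, path (@sedge T) x (rcons p y),
  uniq (x :: rcons p y) & all (fun z => degree z == 2) p].

Lemma branchP x p y : reflect (is_branch x p y) (branchb x p y).
Proof.
apply: (iffP and5P) => -[h1 h2 h3 h4 h5]; split=> //.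
  by move=> z /(allP h5)/eqP.
by apply/allP => z /h5 ->.
Qed.

Lemma branchb_rev x p y : branchb x p y -> branchb y (rev p) x.
Proof.
case/and5P=> h1 h2 h3 h4 h5; rewrite /branchb h1 h2 all_rev h5 andbT /=.
have := rev_path (@sedge T) x (rcons p y).
rewrite last_rcons belast_rcons rev_cons => ->.
rewrite (eq_path (e' := @sedge T)); last by move=> u v; rewrite edgeC.
rewrite h3 /= !mem_rcons !inE !mem_rev !rcons_uniq mem_rev rev_uniq.
move: h4; rewrite /= mem_rcons inE rcons_uniq !negb_or [y == x]eq_sym.
by case: (x == y); case: (x \in p); case: (y \in p).
Qed.

Definition shape_vertex : finType := {v : T | branch_vertex v}.
(** Branches repeat no vertex, so bounding their length by the order of the tree makes the
    existential boolean. *)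
Definition shape_rel : rel shape_vertex :=
  [rel u v | [exists p : (#|T|).-bseq T, branchb (val u) p (val v)]].

Lemma shape_relP u v : reflect (exists p, is_branch (val u) p (val v)) (shape_rel u v).
Proof.
apply: (iffP existsP) => [[p /branchP b]|[p /branchP b]]; first by exists p.
have sz : size p <= #|T|.
  case/and5P: b => _ _ _; rewrite cons_uniq rcons_uniq => /and3P[_ _ up] _.
  by rewrite -(card_uniqP up) max_card.
by exists (Bseq sz).
Qed.

Lemma shape_rel_sym : symmetric shape_rel.
Proof.
move=> u v; apply/shape_relP/shape_relP => -[p /branchP/branchb_rev/branchP b]; by exists (rev p).
Qed.

Lemma shape_rel_irr : irreflexive shape_rel.
Proof.
move=> u; apply/shape_relP => -[p [_ _ _]]; by rewrite /= mem_rcons mem_head.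
Qed.

Definition shape_of : sgraph := SGraph shape_rel_sym shape_rel_irr.

Lemma shape_of_shape : is_shape T shape_of.
Proof.
exists val; split; first exact: val_inj.
- move=> v; split=> [bv|[u <-]]; last exact: (valP u).
  by exists (exist _ v bv).
- by move=> u v; split=> /shape_relP.
Qed.

End ShapeOf.

Section NodeTree.
Variables (G : sgraph) (ehf : even_hole_free G) (a b : G) (N : node_system a b).
Hypothesis ok : node_system_ok N.
Implicit Types (n m c : N) (x y z : G).
Notation r0 := (nroot N).
Notation par := (@npar G a b N).
Notation R := (@nseg G a b N).
Notation S := (seg_verts N).
Notation pv := (@prev_vertex G a b N).
Notation hd := (@seg_head G a b N).
Notation lst := (@seg_last G a b N).
Notation leafN := (@leafN G a b N).
Notation leafS := (@leafS G a b N).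
Notation vtx := (@vertex_of G a b N).
Notation up := (@tree_up G a b N).
Notation mu := (@tree_rank G a b N).
Notation mu_up := (mu_up ok).
Notation T := (node_tree ok).
Notation A' := (odd_side ok).
Notation B' := (even_side ok).

Let rk_par := ok_rk ok.

Lemma T_edge (e : {set T}) : e \in edges T -> exists2 x, x \in S & e = [set vtx x; up (vtx x)].
Proof.
rewrite inE => /existsP[u /existsP[v /andP[uv /eqP ->]]].
case: (T_nbr uv) => -[h <-]; have [x xS ->] := vtxP h; exists x => //.
by rewrite setUC.
Qed.

(** The vertex of G for which an edge of the tree stands, recovered from its lower end. *)
Definition edge_bot (e : line_graph T) : G :=
  odflt a [pick x | (x \in S) && (val e == [set vtx x; up (vtx x)])].

Lemma edge_botP e : edge_bot e \in S /\ val e = [set vtx (edge_bot e); up (vtx (edge_bot e))].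
Proof.
rewrite /edge_bot; case: pickP => [x /andP[h /eqP k] //|]; have [x xS k] := T_edge (valP e).
by move=> /(_ x); rewrite xS -k eqxx.
Qed.

Lemma set2_meet (U : finType) (x x' : U) (A : {set U}) :
  ([set x; x'] :&: A != set0) = (x \in A) || (x' \in A).
Proof.
apply/set0Pn/orP => [[z]|[h|h]]; first by rewrite !inE => /andP[/orP[]/eqP -> h]; [left|right].
  by exists x; rewrite !inE eqxx.
by exists x'; rewrite !inE eqxx orbT.
Qed.

Lemma up_up x y : x \in S -> y \in S -> (up (vtx x) == up (vtx y)) = (pv x == pv y).
Proof.
move=> xS yS; case e: (pv y) => [z|].
  by rewrite [up (vtx y)]up_vtx // e /= up_eq //; apply: pvS e.
by rewrite [up (vtx y)]up_vtx // e /= up_none.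
Qed.

Lemma up_leaf x (B : {set T}) : x \in S -> (up (vtx x) \in leaves T :&: B) = (pv x == None) && ((None : T) \in B).
Proof.
move=> xS; case e: (pv x) => [y|]; rewrite up_vtx // e /=; last by rewrite in_setI leaf_none.
have yS := pvS ok xS e; rewrite in_setI leaf_vtx //; case l: (leafS y) => //.
by have := no_child ok yS l xS; rewrite e eqxx.
Qed.

Lemma none_A : ((None : T) \in A') = false.
Proof. by rewrite inE depth_root. Qed.

Lemma none_B' : (None : T) \in B'.
Proof. by rewrite inE depth_root. Qed.

Lemma edge_bot_a e : a -- edge_bot e = leaf_edge_at A' e.
Proof.
have [xS k] := edge_botP e; rewrite /leaf_edge_at k set2_meet up_leaf // none_A andbF orbF.
have /SP[n hn xn] := xS; rewrite ((S_a ok xS).2 n hn xn).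
case l: (leafS (edge_bot e)); last by rewrite in_setI leaf_vtx // l.
have := l; rewrite (leafSE ok hn xn) => /andP[/eqP -> ln].
by rewrite leaf_A.
Qed.

Lemma edge_bot_b e : b -- edge_bot e = leaf_edge_at B' e.
Proof.
have [xS k] := edge_botP e; rewrite /leaf_edge_at k set2_meet up_leaf // none_B' andbT.
have /SP[n hn xn] := xS; rewrite ((S_b ok xS).2 n hn xn) (pv_none ok) // orbC; congr (_ || _).
case l: (leafS (edge_bot e)); last by rewrite in_setI leaf_vtx // l.
have := l; rewrite (leafSE ok hn xn) => /andP[/eqP -> ln].
by rewrite leaf_B.
Qed.

Lemma T_induced : ext_induced_in A' B' a b.
Proof.
have ab := ok_edge ok.
exists (fun s : ext_line_graph A' B' => match s with inl e => edge_bot e | inr c => if c then a else b end).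
split=> //; split.
- move=> [e|c] [f|d].
  + move=> k; congr inl; apply: val_inj; have [_ ->] := edge_botP e; have [_ ->] := edge_botP f.
    by rewrite k.
  + have [h _] := edge_botP e; case: d => k; exfalso.
      by have := (S_a ok h).1.1; rewrite k eqxx.
    by have := (S_b ok h).1.1; rewrite k eqxx.
  + have [h _] := edge_botP f; case: c => k; exfalso.
      by have := (S_a ok h).1.1; rewrite -k eqxx.
    by have := (S_b ok h).1.1; rewrite -k eqxx.
  + by case: c; case: d => // k; case/eqP: (edge_neq ab); rewrite k.
- move=> [e|c] [f|d]; rewrite [RHS]/sedge /=.
  + rewrite /line_rel /=; have [xS k1] := edge_botP e; have [yS k2] := edge_botP f.
    case: (eqVneq e f) => [->|ne] /=; first by rewrite edgexx.
    have xy : edge_bot e != edge_bot f.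
      by apply: contraNneq ne => k; apply/eqP/val_inj; rewrite k1 k2 k.
    rewrite k1 k2 set2_meet !inE (S_adj ok xS yS xy) vtx_eq // (negbTE xy) /=.
    rewrite [vtx (edge_bot e) == _]eq_sym !up_eq // up_up //.
    by rewrite orbCA.
  + by case: d; rewrite edgeC ?edge_bot_a ?edge_bot_b.
  + by case: c; rewrite ?edge_bot_a ?edge_bot_b.
  + by case: c; case: d => //=; rewrite ?edgexx // edgeC.
Qed.

Lemma degree_vtx x : x \in S -> degree (vtx x : T) = #|[set y in S | pv y == Some x]|.+1.
Proof.
move=> xS; rewrite (degree_rooted mu_up (vtx_neq xS)); congr _.+1.
rewrite -(card_in_imset (f := vtx)); last by move=> y y' /setIdP[h _] /setIdP[h' _]; apply: vtx_inj.
apply: eq_card => v; rewrite inE; apply/andP/imsetP => [[h /eqP k]|[y]].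
  by have [y yS e] := vtxP h; exists y => //; apply/setIdP; rewrite yS -up_eq // -e k eqxx.
by move=> /setIdP[yS k] ->; rewrite vtx_neq // up_eq.
Qed.

Lemma branch_lst n : n != r0 -> branch_vertex (vtx (lst n) : T).
Proof.
move=> hn; have xn := lst_in ok hn; have xS := inSeg hn xn.
rewrite /branch_vertex degree_vtx //; case ln: (leafN n).
  have lx : leafS (lst n) by rewrite (leafSE ok hn xn) eqxx.
  suff -> : [set y in S | pv y == Some (lst n)] = set0 by rewrite cards0.
  by apply/setP => y; rewrite [RHS]inE; apply/negP => /setIdP[yS k]; have := no_child ok xS lx yS; rewrite k.
case/forallPn: (negbT ln) => c; rewrite negb_imply negbK => /andP[hc /eqP pc].
have pc0 : par c != r0 by rewrite pc.
have [c' [hc' pc' ne]] := ok_two ok hc pc0.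
have i d : d != r0 -> par d = n -> hd d \in [set y in S | pv y == Some (lst n)].
  by move=> hd' pd; apply/setIdP; rewrite (inSeg hd' (hd_in ok hd')) pv_hd // pd (negbTE hn) eqxx.
have : [set hd c; hd c'] \subset [set y in S | pv y == Some (lst n)].
  by rewrite subUset !sub1set !i // pc'.
move/subset_leq_card; rewrite cards2.
have -> : hd c != hd c'.
  apply: contraNneq ne => e; have h := hd_in ok hc; rewrite e in h.
  by rewrite (seg_disj ok hc hc' h (hd_in ok hc')).
by case: #|_| => [|[|k]].
Qed.

Lemma degree_inner n x : n != r0 -> x \in R n -> x != lst n -> degree (vtx x : T) = 2.
Proof.
move=> hn xn nl; have xS := inSeg hn xn; rewrite degree_vtx //; congr _.+1.
have [y [k yn _]] := pv_next ok hn xn nl; have yS := inSeg hn yn.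
apply/eqP/cards1P; exists y; apply/setP => y'; rewrite [RHS]inE.
apply/setIdP/eqP => [[yS' /eqP k']|->]; last by rewrite k.
apply/eqP/negPn/negP => ne; have /SP[m hm ym] := yS'.
have [_ pp ey' ey] := pv_same ok hm hn ym yn ne (etrans k' (esym k)).
move: k; rewrite ey pv_hd //; case: eqP => // /eqP pn [e].
have h := lst_in ok pn; rewrite e in h.
by have := par_neq ok hn; rewrite (seg_disj ok pn hn h xn) eqxx.
Qed.

Definition node_vertex n : T := if n == r0 then None else vtx (lst n).

Lemma node_branch n : branch_vertex (node_vertex n).
Proof.
rewrite /node_vertex; case: eqP => [_|/eqP hn]; last exact: branch_lst.
by have := leaf_none ok; rewrite inE /branch_vertex => /eqP ->.
Qed.

Lemma node_inj : injective node_vertex.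
Proof.
move=> n m; rewrite /node_vertex; case: eqP => [->|/eqP hn]; case: eqP => [->|/eqP hm] //.
- by move=> k; have := vtx_neq (inSeg hm (lst_in ok hm)); rewrite -k.
- by move=> k; have := vtx_neq (inSeg hn (lst_in ok hn)); rewrite k.
move=> /(vtx_inj (inSeg hn (lst_in ok hn)) (inSeg hm (lst_in ok hm))) e.
by have h := lst_in ok hn; rewrite e in h; apply: (seg_disj ok hn hm h (lst_in ok hm)).
Qed.

Lemma seg_branch n x : n != r0 -> x \in R n -> exists p : seq T,
  [/\ path (@sedge T) (vtx x) (rcons p (node_vertex (par n))), uniq (rcons p (node_vertex (par n))),
    {in p, forall v : T, degree v = 2} & {in rcons p (node_vertex (par n)), forall v : T, mu v < mu (vtx x)}].
Proof.
move=> hn; move: {2}(index x (R n)) (erefl (index x (R n))) => k; elim: k x => [|k IH] x ik xn;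
  have xS := inSeg hn xn.
  have e : x = hd n by rewrite -(nth_index a xn) ik nth0 /seg_head.
  have eu : up (vtx x) = node_vertex (par n).
    by rewrite up_vtx // e pv_hd // /node_vertex; case: eqP.
  exists [::]; split=> //=; first by rewrite -eu andbT; apply: T_up.
  by move=> z; rewrite inE => /eqP ->; rewrite -eu mu_up // vtx_neq.
have nh : x != hd n.
  apply/eqP => e; move: ik; rewrite e /seg_head -nth0 index_uniq //.
    by rewrite lt0n size_eq0; case/andP: (ok_path ok hn).
  by apply: ipath_uniq; case/andP: (ok_path ok hn).
have [y [e yn nl iy]] := pv_in ok hn xn nh.
have eu : up (vtx x) = vtx y by rewrite up_vtx // e.
have lt : mu (vtx y) < mu (vtx x) by rewrite -eu mu_up // vtx_neq.
have iy' : index y (R n) = k by move: ik; rewrite iy => -[].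
have [p [p1 p2 p3 p4]] := IH y iy' yn.
exists (vtx y :: p); split.
- by rewrite /= p1 andbT -eu; apply: T_up.
- rewrite /= p2 andbT; apply/negP => /p4; by rewrite ltnn.
- by move=> z /predU1P[->|/p3 //]; apply: degree_inner nl.
- by move=> z /predU1P[->//|/p4 h]; apply: ltn_trans lt.
Qed.

(** The segment of each node is a branch of the tree between this node and its parent. *)
Lemma shape_edges : #|N| <= #|edges (shape_of T)|.+1.
Proof.
pose bn n : shape_of T := exist _ (node_vertex n) (node_branch n).
have bi : injective bn by move=> n m [] /node_inj.
have key : [set [set bn n; bn (par n)] | n in [set~ r0]] \subset edges (shape_of T).
  apply/subsetP => e /imsetP[n]; rewrite !inE => hn ->; apply/existsP; exists (bn n).
  apply/existsP; exists (bn (par n)); rewrite eqxx andbT; apply/shape_relP.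
  have [p [p1 p2 p3 p4]] := seg_branch hn (lst_in ok hn).
  have nE : node_vertex n = vtx (lst n) by rewrite /node_vertex (negbTE hn).
  exists p; rewrite /= nE; split=> //.
  - exact: branch_lst.
  - exact: node_branch.
  - rewrite /= p2 andbT; apply/negP => /p4; by rewrite ltnn.
have := subset_leq_card key; rewrite card_in_imset; last first.
  move=> n m; rewrite !inE => hn hm /set2_eq[[/bi //]|[/bi e1 /bi e2]].
  by have := rk_par hn; have := rk_par hm; rewrite -e1 e2; clear; lia.
rewrite cardsC1 => h; apply: leq_trans (_ : #|N|.-1.+1 <= _); last by rewrite ltnS.
exact: leqSpred.
Qed.

End NodeTree.

Lemma node_system_tree (G : sgraph) (a b : G) (N : node_system a b) :
  even_hole_free G -> node_system_ok N ->
  exists (T : sgraph) (A B : {set T}) (J : sgraph),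
    [/\ extended_tree A B, ext_induced_in A B a b, is_shape T J & #|N| <= #|edges J|.+1].
Proof.
move=> ehf ok; exists (node_tree ok), (odd_side ok), (even_side ok), (shape_of (node_tree ok)); split.
- exact: T_extended.
- exact: T_induced.
- exact: shape_of_shape.
- exact: shape_edges.
Qed.

(** * Growing the shape *)

Section RootedStrips.
Variables (J G : sgraph) (M : strip_family J G) (alpha beta : {set J}) (a b : G).
Hypothesis SM : is_strip_system M.
Hypothesis XM : cross_edge M alpha beta a b.
Implicit Types (p q r s t u v w c m : J) (x y z f : G).
Notation Mv := (Mv M).
Notation Mvv u v := (Me M [set u; v]).

Let treeJ : is_tree J. Proof. by case: SM => -[]. Qed.

(** From a vertex that is not a leaf there is a direction outside alpha, and a beam in it that ends
    in beta. *)
Lemma beta_leaf_exists : exists t, t \in beta.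
Proof.
have [v nv] : exists v : J, v \notin leaves J.
  have [v _] : exists v, v \in [set: J] by apply/set0Pn; rewrite -card_gt0 cardsT; case: treeJ.
  case: (boolP (v \in leaves J)) => lx; last by exists v.
  by have [s xs _] := leaf_nbr lx; exists s; apply: (nbr_nonleaf SM lx); rewrite edgeC.
have [r [vr _ ra]] := other_nbr SM XM v nv (fun w1 w2 e1 e2 h1 h2 => alpha_uniq XM e1 e2 h1 h2).
have [Q [t [_ _ _ _ [lt _ _ _]] tE]] := dir_beam SM XM nv vr ra.
by exists t; apply: (beta_not_alpha XM lt); rewrite -tE.
Qed.

Variable r0 : J.
Hypothesis rb : r0 \in beta.

Let lr : r0 \in leaves J. Proof. exact: (beta_leaf XM rb). Qed.

(* The parent of v in J rooted at r0. *)
Definition pj v : J := odflt r0 [pick p | (v -- p) && (r0 \in side v p)].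

Lemma pjP v : v != r0 -> v -- pj v /\ r0 \in side v (pj v).
Proof.
move=> h; rewrite /pj; case: pickP => [p /andP[]//|H].
have h' : r0 != v by rewrite eq_sym.
have [q vq hq] := side_cover treeJ h'.
by have := H q; rewrite vq hq.
Qed.

Lemma pj_eq v p : v -- p -> r0 \in side v p -> v != r0 /\ pj v = p.
Proof.
move=> vp h; have vr : v != r0 by rewrite eq_sym (side_neq vp h).
by have [h1 h2] := pjP vr; split=> //; apply: (side_disj treeJ h1 vp h2 h).
Qed.

Lemma edge_pj u v : u -- v -> v != r0 /\ pj v = u \/ u != r0 /\ pj u = v.
Proof.
move=> uv; have vu : v -- u by rewrite edgeC.
by case/orP: (side_split treeJ r0 vu) => h; [left|right]; apply: pj_eq.
Qed.

Lemma pj_child u c : u -- c -> u = r0 \/ c != pj u -> c != r0 /\ pj c = u.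
Proof.
move=> uc h; case: (edge_pj uc) => // -[h1 h2]; case: h => h; first by rewrite h eqxx in h1.
by rewrite h2 eqxx in h.
Qed.

Lemma pj_pj v : v != r0 -> pj v != r0 -> v != pj (pj v).
Proof.
move=> h h'; have [h1 h2] := pjP h; have [h3 h4] := pjP h'.
apply/eqP => e; rewrite -e in h3 h4.
by have := side_excl treeJ h1 h2; rewrite h4.
Qed.

(** Sides shrink away from the root, so this grows. *)
Definition rkj v := if v == r0 then 0 else #|J| - #|side (pj v) v|.

Lemma rkj_pj v : v != r0 -> rkj (pj v) < rkj v.
Proof.
move=> h; have [h1 h2] := pjP h; rewrite /rkj (negbTE h).
have pv : pj v -- v by rewrite edgeC.
have lt u w : u -- w -> #|side u w| < #|J|.
  move=> uw; rewrite -cardsT; apply: proper_card; rewrite properEneq subsetT andbT.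
  by apply/eqP => e; have := side_notin uw; rewrite e inE.
case: (eqVneq (pj v) r0) => [e|h']; first by rewrite subn_gt0 lt.
have [h3 h4] := pjP h'; have pp : pj (pj v) -- pj v by rewrite edgeC.
have := proper_card (side_proper treeJ pp pv (pj_pj h h')).
have := lt _ _ pv; have := lt _ _ pp.
by move: #|side _ _| #|side _ _| #|J| => i j k; clear; lia.
Qed.

Lemma child_exists u : u \notin leaves J -> exists2 c, c != r0 & pj c = u.
Proof.
move=> nu; have ur : u != r0 by apply: contraNneq nu => ->.
have [h1 _] := pjP ur; have [c [uc n1 _]] := third_dir SM XM (pj u) (pj u) nu.
by have [h2 h3] := pj_child uc (or_intror n1); exists c.
Qed.

Lemma child_other u c : u \notin leaves J -> exists c', [/\ c' != r0, pj c' = u & c' != c].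
Proof.
move=> nu; have ur : u != r0 by apply: contraNneq nu => ->.
have [c' [uc n1 n2]] := third_dir SM XM (pj u) c nu.
by have [h2 h3] := pj_child uc (or_intror n1); exists c'.
Qed.

Lemma child_nonleaf c : c != r0 -> pj c != r0 -> pj c \notin leaves J.
Proof.
move=> h h'; have [h1 _] := pjP h; have [h3 _] := pjP h'.
have uc : pj c -- c by rewrite edgeC.
exact: (two_nonleaf uc h3 (pj_pj h h')).
Qed.

Lemma leaf_no_child u c : u != r0 -> u \in leaves J -> c != r0 -> pj c != u.
Proof.
by move=> h lu hc; apply/eqP => e; have := child_nonleaf hc; rewrite e lu => /(_ h).
Qed.

Lemma kid_exists : exists n0, [/\ n0 != r0, pj n0 = r0, n0 \notin leaves J & forall n, n != r0 -> pj n = r0 -> n = n0].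
Proof.
have [s rs H] := leaf_nbr lr; have sr : s -- r0 by rewrite edgeC.
have [h1 h2] := pj_child rs (or_introl erefl).
exists s; split=> //; first exact: (nbr_nonleaf SM lr).
move=> n hn e; have [h _] := pjP hn; apply: H; by rewrite edgeC -e.
Qed.

Lemma few_edges : #|edges J| < #|J|.
Proof.
have key : edges J \subset [set [set v; pj v] | v in [set~ r0]].
  apply/subsetP => e /edgesP[u [v [uv ->]]]; apply/imsetP.
  by case: (edge_pj uv) => -[h1 h2]; [exists v | exists u]; rewrite ?inE ?h2 // setUC.
apply: leq_ltn_trans (subset_leq_card key) _; apply: leq_ltn_trans (leq_imset_card _ _) _.
rewrite cardsC1; have : 0 < #|J| by case: treeJ.
by case: #|_|.
Qed.

Variable R : J -> seq G.
Hypothesis Rr : forall v, v != r0 -> rung M (pj v) v (R v).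

Let hd v := head a (R v).
Let lst v := last a (R v).

Lemma R_hd v z : v != r0 -> z \in R v -> (z \in Mv (pj v)) = (z == hd v).
Proof.
move=> h zR; have [_ _ _ H _] := Rr h; rewrite H //.
by rewrite /hd (head_def z a) // (mem_nonnil zR).
Qed.

Lemma R_lst v z : v != r0 -> z \in R v -> (z \in Mv v) = (z == lst v).
Proof.
move=> h zR; have [_ _ _ _ H] := Rr h; rewrite H //.
by rewrite /lst (last_def z a) // (mem_nonnil zR).
Qed.

Lemma R_strip v z : v != r0 -> z \in R v -> z \in Mvv (pj v) v.
Proof. by move=> h; have [_ _ sR _ _] := Rr h; apply: sR. Qed.

Lemma R_VM v z : v != r0 -> z \in R v -> z \in VM M.
Proof.
move=> h /(R_strip h) zE; apply/VMP => //; exists (pj v), v; split=> //.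
by have [k _] := pjP h; rewrite edgeC.
Qed.

Lemma R_ends v z u : v != r0 -> z \in R v -> z \in Mv u -> u = pj v \/ u = v.
Proof.
move=> h zR; apply: (Mv_ends SM) (R_strip h zR).
by have [k _] := pjP h; rewrite edgeC.
Qed.

Lemma R_adj v w x y : v != r0 -> w != r0 -> v != w -> x \in R v -> y \in R w -> x != y /\
  x -- y = [|| [&& pj v == pj w, x == hd v & y == hd w], [&& pj w == v, x == lst v & y == hd w]
             | [&& pj v == w, y == lst w & x == hd v]].
Proof.
have par_neq u : u != r0 -> pj u != u.
  by move=> h; apply/eqP => e; have := rkj_pj h; rewrite e ltnn.
have key v' w' x' y' : v' != r0 -> w' != r0 -> v' != w' -> x' \in R v' -> y' \in R w' -> pj w' = v' ->
    x' -- y' = (x' == lst v') && (y' == hd w').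
  move=> h h' ne x1 y1 e; have [k1 _] := pjP h; have [k2 _] := pjP h'.
  have e1 : v' -- pj v' by []. have e2 : v' -- w' by rewrite -e edgeC.
  have ne' : pj v' != w'.
    by apply/eqP => e'; have := rkj_pj h; have := rkj_pj h'; rewrite e e'; clear; lia.
  have [_ _ _ _ [_ H]] := SM.
  have yv : (y' \in Mv v') = (y' == hd w') by rewrite -(R_hd h' y1) e.
  rewrite (H v' (pj v') w' e1 e2 ne' x' y') ?(R_lst h x1) ?yv //.
    by have := R_strip h x1; rewrite MvvC.
  by have := R_strip h' y1; rewrite e.
move=> h h' ne xR yR; have [k1 _] := pjP h; have [k2 _] := pjP h'.
split.
  apply/eqP => e; subst y; have k1' : pj v -- v by rewrite edgeC. have k2' : pj w -- w by rewrite edgeC.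
  case: (strip_eq SM k1' k2' (R_strip h xR) (R_strip h' yR)) => -[e1 e2]; first by rewrite e2 eqxx in ne.
  by have := rkj_pj h; have := rkj_pj h'; rewrite e1 -e2; clear; lia.
have [_ _ _ _ [H1 H2]] := SM.
case: (eqVneq (pj w) v) => [e|n1].
  have -> : (pj v == w) = false.
    by apply/eqP => e'; have := rkj_pj h; have := rkj_pj h'; rewrite e e'; clear; lia.
  by rewrite (key v w) // e (negbTE (par_neq v h)) /= orbF.
case: (eqVneq (pj v) w) => [e|n2].
  have ne' : w != v by rewrite eq_sym.
  by rewrite edgeC (key w v y x h' h ne' yR xR e) e [w == pj w]eq_sym (negbTE (par_neq w h')) /=.
case: (eqVneq (pj v) (pj w)) => [e|n3] /=.
  rewrite !orbF; have e1 : pj v -- v by rewrite edgeC. have e2 : pj v -- w by rewrite e edgeC.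
  rewrite (H2 (pj v) v w e1 e2 ne x y (R_strip h xR)); last by rewrite e; apply: R_strip.
  by rewrite (R_hd h xR) e (R_hd h' yR).
apply/negbTE; apply: (H1 (pj v) v (pj w) w) (R_strip h xR) (R_strip h' yR); rewrite 1?edgeC //.
rewrite /= !inE !negb_or n3 n2 par_neq // [v == pj w]eq_sym n1 ne !andbT /=.
by rewrite par_neq.
Qed.

Lemma R_a v x : v != r0 -> x \in R v -> x != a /\ a -- x = (x == lst v) && (v \in alpha).
Proof.
move=> h xR; have [-> ->] := aVM XM (R_VM h xR); split=> //.
apply/existsP/andP => [[t /andP[ta xt]]|[/eqP xl va]]; last by exists v; rewrite va R_lst // xl eqxx.
case: (R_ends h xR xt) => e; subst t; last by rewrite -R_lst.
exfalso; case: (eqVneq (pj v) r0) => [e|k]; first by rewrite e in ta; exact: (alpha_betaF XM ta rb).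
by have := child_nonleaf h k; rewrite (alpha_leaf XM ta).
Qed.

Lemma R_b v x : v != r0 -> x \in R v -> x != b /\ b -- x = (x == hd v) && (pj v == r0) || (x == lst v) && (v \in beta).
Proof.
move=> h xR; have [-> ->] := bVM XM (R_VM h xR); split=> //.
apply/existsP/orP => [[t /andP[tb xt]]|[/andP[/eqP xl /eqP e]|/andP[/eqP xl vb]]].
- case: (R_ends h xR xt) => e; subst t; last by right; rewrite tb andbT -R_lst.
  case: (eqVneq (pj v) r0) => [e|k]; first by left; rewrite andbT -R_hd.
  by have := child_nonleaf h k; rewrite (beta_leaf XM tb).
- by exists r0; rewrite rb -e R_hd // xl eqxx.
- by exists v; rewrite vb R_lst // xl eqxx.
Qed.

End RootedStrips.

(** * New leaves in the shape *)

Section Grow.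
Variables (J G : sgraph) (ehf : even_hole_free G) (M : strip_family J G) (alpha beta : {set J}) (a b : G).
Hypothesis SM : is_strip_system M.
Hypothesis XM : cross_edge M alpha beta a b.
Hypothesis maxJ : forall (T : sgraph) (A' B' : {set T}) (J' : sgraph),
  extended_tree A' B' -> ext_induced_in A' B' a b -> is_shape T J' -> #|edges J'| <= #|edges J|.
Variable fs : seq G.
Hypothesis D : hung M a b fs.
Implicit Types (p q r s t u v w c m : J) (x y z f : G).
Notation Mv := (Mv M).

Let ab : a -- b. Proof. by case: XM. Qed.
Let Af : attached M a b fs. Proof. by case: D. Qed.
Let P : pend a b fs. Proof. by case: D. Qed.
Let pf : ipath fs. Proof. by case: P. Qed.
Let f0 : fs != [::]. Proof. by case: P. Qed.

(** J has fewer edges than vertices, and the shape obtained has at least one edge for each node but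
    the root. *)
Lemma grow (N : node_system a b) : node_system_ok N -> #|J| < #|N| -> False.
Proof.
move=> ok lt; have [T [A [B [J' [h1 h2 h3 h4]]]]] := node_system_tree ehf ok.
have := maxJ h1 h2 h3; have [t tb] := beta_leaf_exists SM XM.
have := few_edges SM t; move: lt h4.
by move: #|J| #|N| #|edges J| #|edges J'|; clear; lia.
Qed.

Let oHf z f : z \in VM M -> ~~ (a -- z) -> f \in fs -> f -- z = (f == head a fs) && sees fs z.
Proof.
move=> zV na ff; case sz: (sees fs z); last first.
  by rewrite andbF; apply/negP => fz; move/hasP: sz; case; exists f.
rewrite andbT; have [_ ->] := hung_atH D zV na sz => //.
by rewrite (head_def f a).
Qed.

Let fsV f z : f \in fs -> z \in VM M -> f != z.
Proof. by move=> ff zV; apply: contraTneq ff => ->; apply: att_out Af zV. Qed.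

Let fs_a f : f \in fs -> f != a /\ a -- f = (f == last a fs).
Proof.
case: P => _ _ Ca _ ff; have [h ->] := Ca f ff; split=> //.
by rewrite (last_def f a).
Qed.

Let fs_b f : f \in fs -> f != b /\ b -- f = false.
Proof. by case: P => _ _ _ Cb ff; apply: Cb. Qed.

Lemma adj_flip (N : node_system a b) (n m : N) x y :
  y != x /\ y -- x = [|| [&& npar m == npar n, y == seg_head m & x == seg_head n], [&& npar n == m, y == seg_last m & x == seg_head n]
             | [&& npar m == n, x == seg_last n & y == seg_head m]] ->
  x != y /\ x -- y = [|| [&& npar n == npar m, x == seg_head n & y == seg_head m], [&& npar m == n, x == seg_last n & y == seg_head m]
             | [&& npar n == m, y == seg_last m & x == seg_head n]].
Proof.
case=> h1 h2; rewrite eq_sym h1 edgeC h2; split=> //.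
by rewrite [npar m == npar n]eq_sym [(y == seg_head m) && _]andbC; case: (_ && _); rewrite //= orbC.
Qed.

Lemma rungs_exist r0 : exists R : J -> seq G, forall v, v != r0 -> rung M (pj r0 v) v (R v).
Proof.
apply: (fin_all_exists (P := fun v (Q : seq G) => v != r0 -> rung M (pj r0 v) v Q)) => v; case: (eqVneq v r0) => [e|h]; first by exists [::]; move=> /=; rewrite ?e ?eqxx.
have [k _] := pjP SM h; have k' : pj r0 v -- v by rewrite edgeC.
by have [R rR] := rung_exists SM k'; exists R => _.
Qed.

(** The pendant path becomes the segment of a new leaf, labelled a, with parent m. It is the node
    [None], whose rank only has to exceed those of J. *)
Lemma no_star m : m \notin leaves J -> (forall z, z \in VM M -> sees fs z -> ~ inS M alpha z) ->
  (forall z, z \in VM M -> sees fs z = (z \in Mv m)) -> False.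
Proof.
move=> nm N H; have [r0 rb] := beta_leaf_exists SM XM.
have lr := beta_leaf XM rb.
have [R Rr] := rungs_exist r0; have [n0 [n0r pn0 nl0 U0]] := kid_exists SM XM rb.
have mr : m != r0 by apply: contraNneq nm => ->.
(* The new leaf is labelled a, so m must have no neighbour in alpha; such a neighbour would have a
   seen head in its strip. *)
have noalpha t : m -- t -> t \in alpha -> False.
  move=> mt ta; have [x [xe xm]] := head_exists SM mt; have xV := dir_VM (strip_dir mt xe).
  by apply: (N x xV); [rewrite H | exists m, t].
pose NS : node_system a b := @NodeSystem G a b (option J) (Some r0)
  (fun o => if o is Some v then Some (pj r0 v) else Some m)
  (fun o => if o is Some v then rkj r0 v else #|J|.+1) (Some n0)
  (fun o => if o is Some v then R v else fs) (fun o => if o is Some v then v \in alpha else true).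
have SE u v : (Some u == Some v :> option J) = (u == v) by [].
have lf v : v != r0 -> leafN (Some v : NS) = (v \in leaves J).
  move=> h; apply/forallP/idP => [k|lv [c|]] /=.
  - apply/negPn/negP => nv; have [c hc pc] := child_exists SM XM rb nv.
    by have := k (Some c); rewrite /= !SE hc pc eqxx.
  - by rewrite !SE; apply/implyP => hc; apply: (leaf_no_child SM).
  - by rewrite SE; apply: contraNneq nm => ->.
have lfN : leafN (None : NS).
  by apply/forallP => -[c|] /=; rewrite ?implybT.
have lfleaf v : Some v != nroot NS -> leafN (Some v : NS) -> v \in leaves J by rewrite SE => h; rewrite lf.
have a1 (f y : G) v : v != r0 -> f \in fs -> y \in R v -> f != y /\
    f -- y = [|| [&& npar (None : NS) == npar (Some v : NS), f == seg_head (None : NS) & y == seg_head (Some v : NS)],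
       [&& npar (Some v : NS) == None, f == seg_last (None : NS) & y == seg_head (Some v : NS)]
      | [&& npar (None : NS) == Some v, y == seg_last (Some v : NS) & f == seg_head (None : NS)]].
  move=> h ff yR; have yV := R_VM SM Rr h yR; split; first exact: fsV.
  case: (boolP (a -- y)) => ay.
    have Sy := a_inS SM XM yV ay.
    have sy : sees fs y = false by apply/negP => sy; exact: (N y yV sy Sy).
    have -> : f -- y = false by apply/negP => fy; move/hasP: sy; case; exists f.
    have ny : y \in Mv m = false by rewrite -H.
    rewrite /= /seg_head /seg_last /= !SE; symmetry; apply/negP => /orP[/and3P[/eqP e _ k]|/and3P[/eqP e k _]].
      by have := R_hd a Rr h yR; rewrite -e ny => k'; rewrite k in k'.
    by have := R_lst a Rr h yR; rewrite -e ny => k'; rewrite e k in k'.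
  rewrite (oHf yV ay ff) (H y yV) /= /seg_head /seg_last /= !SE.
  case: (eqVneq m (pj r0 v)) => [e|n1].
    rewrite e (R_hd a Rr h yR); case: (f == _); rewrite ?andbF ?orbF //=.
    have -> : (pj r0 v == v) = false.
      by apply/eqP => e'; have := rkj_pj SM h; rewrite e' ltnn.
    by rewrite orbF.
  case: (eqVneq m v) => [e|n2] /=; first by rewrite e (R_lst a Rr h yR) andbC.
  by apply/negbTE/negP => /andP[_ ym]; case: (R_ends SM Rr h yR ym) => k; [rewrite k eqxx in n1 | rewrite k eqxx in n2].
have parS v : npar (Some v : NS) = Some (pj r0 v) by [].
have ok : node_system_ok NS.
  split.
  - exact: ab.
  - move=> [v|] /=; rewrite ?SE => h; first exact: (rkj_pj SM h).
    by rewrite ltnS /rkj; case: (m == r0); rewrite // leq_subr.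
  - by rewrite /= !SE pn0.
  - move=> [v|] /=; first by rewrite SE => h [e]; rewrite (U0 v h e).
    by move=> _ [e]; rewrite e eqxx in mr.
  - by rewrite lf.
  - move=> [c|] /=; rewrite !SE => h hp.
      have nl := child_nonleaf SM h hp; have [c' [h1 h2 h3]] := child_other SM XM rb c nl.
      by exists (Some c'); rewrite /= !SE h1 h2 h3.
    have [c' h1 h2] := child_exists SM XM rb nm.
    by exists (Some c'); rewrite /= !SE h1 h2.
  - move=> [v|] /=; rewrite ?SE => h; first by have [-> -> _ _ _] := Rr v h.
    by rewrite pf f0.
  - move=> [v|] [w|] x y; rewrite /= ?SE => h h' ne xR yR //.
    + by have := R_adj a SM Rr h h' ne xR yR.
    + by apply: adj_flip; apply: a1.
    + exact: a1.
  - move=> [v|] x h xR.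
      have hv : v != r0 by []. have [h1 h2] := R_a SM XM rb Rr hv xR.
      split=> //; rewrite h2 lf //= /seg_last /=; congr (_ && _).
      case va: (v \in alpha); rewrite ?andbF // andbT.
      by rewrite (alpha_leaf XM va).
    by have [h1 ->] := fs_a xR; rewrite h1 lfN /= andbT.
  - move=> [v|] x h xR.
      have hv : v != r0 by []. have [h1 h2] := R_b SM XM rb Rr hv xR.
      split=> //; rewrite h2 lf //= /seg_last /seg_head /= SE; congr (_ || (_ && _)).
      apply/idP/andP => [vb|[lv va]]; last exact: (beta_not_alpha XM lv va).
      by rewrite (beta_leaf XM vb); split=> //; apply/negP => va; exact: (alpha_betaF XM va vb).
    by have [h1 ->] := fs_b xR; rewrite h1 lfN /= !andbF SE (negbTE mr) andbF.
  - move=> [c|] [c'|] h h' e l l' //= na na'; congr Some.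
    have hc : c != r0 by []. have hc' : c' != r0 by [].
    have bc := beta_not_alpha XM (lfleaf c h l) na; have bc' := beta_not_alpha XM (lfleaf c' h' l') na'.
    have [k1 _] := pjP SM hc; have [k2 _] := pjP SM hc'; move: e => /= [e].
    by apply: (beta_uniq XM (s := pj r0 c)) => //; rewrite 1?edgeC // e.
  - move=> [c|] h e l //=; apply/negPn/negP => na.
    have hc : c != r0 by []. have bc := beta_not_alpha XM (lfleaf c h l) na.
    have [k1 _] := pjP SM hc; have [k2 _] := pjP SM n0r; move: e => /= [e].
    rewrite e in k1; rewrite pn0 in k2; have k1' : n0 -- c by rewrite edgeC.
    by have ec := beta_uniq XM k1' k2 bc rb; rewrite ec eqxx in hc.
  - move=> [c|] [c'|] h h' e l l' //= va va'.
    + have hc : c != r0 by []. have hc' : c' != r0 by [].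
      have [k1 _] := pjP SM hc; have [k2 _] := pjP SM hc'; move: e => /= [e]; congr Some.
      by apply: (alpha_uniq XM (s := pj r0 c)) => //; rewrite 1?edgeC // e.
    + have hc : c != r0 by []. have [k1 _] := pjP SM hc; move: e => /= [e].
      by case: (noalpha c) => //; rewrite -e edgeC.
    + have hc : c' != r0 by []. have [k1 _] := pjP SM hc; move: e => /= [e].
      by case: (noalpha c') => //; rewrite e edgeC.
by apply: (grow ok); rewrite card_option.
Qed.

End Grow.

Section Grow.
Variables (J G : sgraph) (ehf : even_hole_free G) (M : strip_family J G) (alpha beta : {set J}) (a b : G).
Hypothesis SM : is_strip_system M.
Hypothesis XM : cross_edge M alpha beta a b.
Hypothesis maxJ : forall (T : sgraph) (A' B' : {set T}) (J' : sgraph),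
  extended_tree A' B' -> ext_induced_in A' B' a b -> is_shape T J' -> #|edges J'| <= #|edges J|.
Variable fs : seq G.
Hypothesis D : hung M a b fs.
Implicit Types (p q r s t u v w c m : J) (x y z f : G).
Notation Mvv u v := (Me M [set u; v]).

Let ab : a -- b. Proof. by case: XM. Qed.
Let Af : attached M a b fs. Proof. by case: D. Qed.
Let P : pend a b fs. Proof. by case: D. Qed.
Let pf : ipath fs. Proof. by case: P. Qed.
Let f0 : fs != [::]. Proof. by case: P. Qed.
Hypothesis N : forall z, z \in VM M -> sees fs z -> ~ inS M alpha z.

(** The rung at w is cut between x0 and y0. The cut is the new node [inr false], which carries the
    part towards the parent of w; below it are w with the other part and the new leaf [inr true]
    with segment [fs]. *)
Lemma no_split_rung r0 w R1 x0 y0 R2 : r0 \in beta -> w != r0 -> rung M (pj r0 w) w (R1 ++ [:: x0, y0 & R2]) ->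
  {in R1 ++ [:: x0, y0 & R2], forall z, sees fs z = (z == x0) || (z == y0)} ->
  (forall z, z \in VM M -> sees fs z -> z \in Mvv (pj r0 w) w) -> False.
Proof.
move=> rb wr rw H1 H2.
have [R' Rr'] := rungs_exist SM r0; have [n0 [n0r pn0 nl0 U0]] := kid_exists SM XM rb.
pose Rw : seq G := R1 ++ [:: x0, y0 & R2].
pose R v := if v == w then Rw else R' v.
have Rr v : v != r0 -> rung M (pj r0 v) v (R v).
  by move=> h; rewrite /R; case: eqP => [->|_]; [exact: rw | exact: Rr'].
have RwE : R w = Rw by rewrite /R eqxx.
have pR : ipath Rw by case: rw.
have uR := ipath_uniq pR.
have Rsplit : Rw = rcons R1 x0 ++ (y0 :: R2) by rewrite /Rw -cats1 -catA.
have [p1 p2 L12] : [/\ ipath (rcons R1 x0), ipath (y0 :: R2) & linked (rcons R1 x0) (y0 :: R2)].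
  by apply: ipath_catP; rewrite -Rsplit.
have in1 z : z \in rcons R1 x0 -> z \in R w by rewrite RwE Rsplit mem_cat => ->.
have in2 z : z \in y0 :: R2 -> z \in R w by rewrite RwE Rsplit mem_cat => ->; rewrite orbT.
have d12 z : z \in rcons R1 x0 -> z \in y0 :: R2 -> False.
  by move=> z1 z2; have [] := L12 z z z1 z2; rewrite eqxx.
have hdw : head a (R w) = head a (rcons R1 x0) by rewrite RwE Rsplit; case: (R1).
have lstw : last a (R w) = last a (y0 :: R2) by rewrite RwE Rsplit last_cat.
have lst1 : last a (rcons R1 x0) = x0 by rewrite last_rcons.
have hd1 : head a (rcons R1 x0) \in rcons R1 x0 by apply: mem_head_def; case: (R1).
have pw : pj r0 w -- w by have [k _] := pjP SM wr; rewrite edgeC.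
have x01 : x0 \in rcons R1 x0 by rewrite mem_rcons mem_head.
have pww : pj r0 w != w by apply/eqP => e; have := rkj_pj SM wr; rewrite e ltnn.
have Rv v : v != w -> R v = R' v by rewrite /R => /negbTE ->.
(* A leaf w labelled a would stand beside the new leaf, which is labelled a too. *)
have wna : w \notin alpha.
  apply/negP => wa; have zV : x0 \in VM M by apply: (R_VM SM Rr wr); apply: in1.
  apply: (N zV); first by rewrite H1 ?eqxx // -/Rw -RwE in1.
  by exists (pj r0 w), w; split=> //; apply: (R_strip Rr wr); apply: in1.
(* Ranks are doubled to make room for the new node between w and its parent. *)
pose NS : node_system a b := @NodeSystem G a b (J + bool)%type (inl r0)
  (fun o => match o with inl v => if v == w then inr false else inl (pj r0 v)
                       | inr true => inr false | inr false => inl (pj r0 w) end)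
  (fun o => match o with inl v => (rkj r0 v).*2 | inr true => (rkj r0 w).*2 | inr false => (rkj r0 w).*2.-1 end)
  (if n0 == w then inr false else inl n0)
  (fun o => match o with inl v => if v == w then y0 :: R2 else R v
                       | inr true => fs | inr false => rcons R1 x0 end)
  (fun o => match o with inl v => v \in alpha | inr b => b end).
have SE u v : (inl u == inl v :> J + bool)%type = (u == v) by [].
have SE' (c d : bool) : (inr c == inr d :> J + bool)%type = (c == d) by [].
have lf v : v != r0 -> leafN (inl v : NS) = (v \in leaves J).
  move=> h; apply/forallP/idP => [k|lv [c|[]]] /=.
  - apply/negPn/negP => nv; have [c hc pc] := child_exists SM XM rb nv.
    case: (eqVneq c w) => [e|ne]; first by have := k (inr false); rewrite /= ?SE -e pc eqxx.
    by have := k (inl c); rewrite /= (negbTE ne) ?SE hc pc eqxx.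
  - rewrite ?SE; apply/implyP => hc; case: (eqVneq c w) => // _; apply: (leaf_no_child SM h lv hc).
  - by [].
  - by have := leaf_no_child SM h lv wr.
have lfT : leafN (inr true : NS).
  by apply/forallP => -[c|[]] /=; rewrite ?implybT //; case: (eqVneq c w) => _; rewrite ?implybT.
have lfF : leafN (inr false : NS) = false.
  by apply/negbTE/forallPn; exists (inr true).
have rkw : 0 < rkj r0 w by apply: leq_ltn_trans (rkj_pj SM wr).
have oHf z f : z \in VM M -> ~~ (a -- z) -> f \in fs -> f -- z = (f == head a fs) && sees fs z.
  move=> zV na ff; case sz: (sees fs z); last first.
    by rewrite andbF; apply/negP => fz; move/hasP: sz; case; exists f.
  rewrite andbT; have [_ ->] := hung_atH D zV na sz => //.
  by rewrite (head_def f a).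
have fsV f z : f \in fs -> z \in VM M -> f != z.
  by move=> ff zV; apply: contraTneq ff => ->; apply: att_out Af zV.
have seesN z : z \in R w -> ~~ (a -- z).
  move=> zR; have zV := R_VM SM Rr wr zR; apply/negP => az.
  have [_] := R_a SM XM rb Rr wr zR; by rewrite az (negbTE wna) andbF.
pose adjok (n m : NS) := forall x y, x \in nseg n -> y \in nseg m -> x != y /\
  x -- y = [|| [&& npar n == npar m, x == seg_head n & y == seg_head m], [&& npar m == n, x == seg_last n & y == seg_head m]
             | [&& npar n == m, y == seg_last m & x == seg_head n]].
have flip (n m : NS) : adjok n m -> adjok m n.
  by move=> h x y xn ym; apply: adj_flip; apply: h.
have a1 : adjok (inr true) (inr false).
  move=> f y /= ff y1; have yR := in1 y y1; have yV := R_VM SM Rr wr yR.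
  split; first exact: fsV.
  rewrite (oHf y f yV (seesN y yR) ff) H1 -?/Rw -?RwE // /seg_head /seg_last /= ?SE' lst1 /=.
  have -> : (y == y0) = false by apply/eqP => e; apply: (d12 y) => //; rewrite e mem_head.
  by rewrite orbF andbC.
have a2 : adjok (inr true) (inl w).
  move=> f y /=; rewrite eqxx => ff y1; have yR := in2 y y1; have yV := R_VM SM Rr wr yR.
  split; first exact: fsV.
  rewrite (oHf y f yV (seesN y yR) ff) H1 -?/Rw -?RwE // /seg_head /seg_last /= !eqxx /= ?SE' ?orbF.
  have -> : (y == x0) = false by apply/eqP => e; apply: (d12 y) => //; rewrite e.
  by rewrite ?orbF.
have a3 v : v != r0 -> v != w -> adjok (inr true) (inl v).
  move=> h vw f y /=; rewrite (negbTE vw) => ff yR; have yV := R_VM SM Rr h yR.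
  split; first exact: fsV.
  have -> : f -- y = false; last by rewrite /seg_head /seg_last /= ?(negbTE vw).
  apply/negP => fy; have sy : sees fs y by apply/hasP; exists f.
  have pv : pj r0 v -- v by have [k _] := pjP SM h; rewrite edgeC.
  case: (strip_eq SM pw pv (H2 y yV sy) (R_strip Rr h yR)) => -[e1 e2]; first by rewrite e2 eqxx in vw.
  by have := rkj_pj SM h; have := rkj_pj SM wr; rewrite e1 -e2; clear; lia.
have a4 : adjok (inr false) (inl w).
  move=> x y /=; rewrite eqxx => x1 y2; have [k1 k2] := L12 x y x1 y2; split=> //.
  by rewrite k2 last_rcons /seg_head /seg_last /= !eqxx last_rcons ?SE (negbTE pww) /= orbF.
have a5 v : v != r0 -> v != w -> adjok (inr false) (inl v).
  move=> h vw x y /=; rewrite (negbTE vw) => x1 yR; have wv : w != v by rewrite eq_sym.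
  have [k1 k2] := R_adj a SM Rr wr h wv (in1 x x1) yR; split=> //.
  rewrite k2 /seg_head /seg_last /= ?(negbTE vw) ?SE hdw lstw /=.
  have -> : (x == last y0 R2) = false by apply/eqP => e; apply: (d12 x) => //; rewrite e mem_last.
  by rewrite andbF /=.
have a6 v : v != r0 -> v != w -> adjok (inl w) (inl v).
  move=> h vw x y /=; rewrite eqxx (negbTE vw) => x2 yR; have wv : w != v by rewrite eq_sym.
  have [k1 k2] := R_adj a SM Rr wr h wv (in2 x x2) yR; split=> //.
  rewrite k2 /seg_head /seg_last /= ?(negbTE vw) eqxx ?SE hdw lstw /=.
  have -> : (x == head a (rcons R1 x0)) = false by apply/eqP => e; apply: (d12 x) => //; rewrite e.
  by rewrite !andbF /= orbF.
have a7 v v' : v != r0 -> v' != r0 -> v != w -> v' != w -> v != v' -> adjok (inl v) (inl v').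
  move=> h h' vw vw' ne x y /=; rewrite (negbTE vw) (negbTE vw') => xR yR.
  have [k1 k2] := R_adj a SM Rr h h' ne xR yR; split=> //.
  by rewrite k2 /seg_head /seg_last /= ?(negbTE vw) (negbTE vw').
have pL v c : npar (inl v : NS) = inl c -> v != w /\ pj r0 v = c.
  by rewrite /=; case: eqP => // /eqP h [].
have ok : node_system_ok NS.
  split.
  - exact: ab.
  - move=> [v|[]] h /=; last 2 first.
    + by rewrite ltn_predL double_gt0.
    + by have := rkj_pj SM wr; move: (rkj _ _) (rkj _ _); clear; lia.
    rewrite ?SE in h; case: (eqVneq v w) => [->|vw].
      by rewrite ltn_predL double_gt0.
    by rewrite ltn_double; apply: (rkj_pj SM h).
  - rewrite /=; case: (eqVneq n0 w) => [e|ne]; last by rewrite ?SE (negbTE ne) pn0.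
    by rewrite -e pn0.
  - move=> [v|[]] h /=; rewrite ?SE in h.
    + case: eqP => // /eqP vw [e]; have ev := U0 v h e; subst v.
      by rewrite (negbTE vw).
    + by [].
    + by move=> [e]; rewrite -(U0 w wr e) eqxx.
  - by rewrite /=; case: (eqVneq n0 w) => [_|ne]; [rewrite lfF | rewrite lf].
  - move=> [c|[]] h hp.
    + rewrite ?SE in h; rewrite /= in hp *; move: hp; case: (eqVneq c w) => [e _|cw]; first by exists (inr true).
      rewrite ?SE => hp; have nl := child_nonleaf SM h hp.
      have [c' [h1 h2 h3]] := child_other SM XM rb c nl.
      case: (eqVneq c' w) => [e|cw']; first by exists (inr false); rewrite -e h2.
      by exists (inl c'); rewrite ?SE (negbTE cw') h1 h2 h3.
    + by exists (inl w); rewrite /= ?SE eqxx.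
    + rewrite /= ?SE in hp; have nl := child_nonleaf SM wr hp.
      have [c' [h1 h2 h3]] := child_other SM XM rb w nl.
      by exists (inl c'); rewrite /= (negbTE h3) h1 h2.
  - move=> [v|[]] h /=.
    + rewrite ?SE in h; case: eqP => [_|_]; first by rewrite p2.
      by have [-> -> _ _ _] := Rr v h.
    + by rewrite pf f0.
    + by rewrite p1; case: (R1).
  - have fin (n m : NS) : n != nroot NS -> m != nroot NS -> n != m -> adjok n m.
      move: n m => [v|[]] [v'|[]] //; rewrite ?SE => h h' ne.
      * case: (eqVneq v w) => [e|vw]; first by subst v; apply: a6 => //; rewrite eq_sym.
        case: (eqVneq v' w) => [e|vw']; first by subst v'; apply: flip; apply: a6.
        exact: a7.
      * by apply: flip; case: (eqVneq v w) => [->|vw] //; apply: a3.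
      * by apply: flip; case: (eqVneq v w) => [->|vw] //; apply: a5.
      * by case: (eqVneq v' w) => [->|vw] //; apply: a3.
      * by case: (eqVneq v' w) => [->|vw] //; apply: a5.
      * exact: flip.
    by move=> n m x y h h' ne xn ym; apply: fin.
  - move=> [v|[]] x h xn.
    + rewrite ?SE in h; have xR : x \in R v.
        by move: xn; rewrite /=; case: eqP => [->|] //; apply: in2.
      have [h1 h2] := R_a SM XM rb Rr h xR; split=> //; rewrite h2 lf // /seg_last /=.
      have -> : last a (R v) = last a (if v == w then y0 :: R2 else R v) by case: eqP => [->|].
      case va: (v \in alpha); rewrite ?andbF // !andbT.
      by rewrite (alpha_leaf XM va) andbT.
    + case: P => _ _ Ca _; have [h1 ->] := Ca x xn; split=> //; rewrite lfT /seg_last /= !andbT.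
      by rewrite (last_def x a).
    + have xR := in1 x xn; have [h1 _] := R_a SM XM rb Rr wr xR; split=> //.
      by rewrite (negbTE (seesN x xR)) /= lfF !andbF.
  - move=> [v|[]] x h xn.
    + rewrite ?SE in h; have xR : x \in R v.
        by move: xn; rewrite /=; case: eqP => [->|] //; apply: in2.
      have [h1 h2] := R_b SM XM rb Rr h xR; split=> //; rewrite h2 lf // /seg_last /seg_head /=.
      have -> : (v \in beta) = (v \in leaves J) && (v \notin alpha).
        apply/idP/andP => [vb|[lv va]]; last exact: (beta_not_alpha XM lv va).
        by rewrite (beta_leaf XM vb); split=> //; apply/negP => va; exact: (alpha_betaF XM va vb).
      case: (eqVneq v w) => [e|vw]; last by rewrite ?SE.
      subst v; rewrite /= eqxx in xn; rewrite hdw lstw /=.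
      have -> : (x == head a (rcons R1 x0)) = false by apply/eqP => e'; apply: (d12 x) => //; rewrite e'.
      by rewrite andbF.
    + case: P => _ _ _ Cb; have [h1 ->] := Cb x xn; split=> //.
      by rewrite /= !andbF.
    + have xR := in1 x xn; have [h1 ->] := R_b SM XM rb Rr wr xR; split=> //.
      rewrite /seg_head /seg_last /= ?SE hdw lfF lstw !andbF orbF.
      have -> : (x == last y0 R2) = false by apply/eqP => e'; apply: (d12 x) => //; rewrite e' mem_last.
      by rewrite orbF.
  - move=> [c|[]] [c'|[]] h h' e l l' //= na na'; rewrite ?lfF // in l l'; congr inl.
    rewrite ?SE in h; rewrite ?SE in h'.
    have bc : c \in beta by apply: (beta_not_alpha XM _ na); rewrite -lf.
    have bc' : c' \in beta by apply: (beta_not_alpha XM _ na'); rewrite -lf.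
    have [k1 _] := pjP SM h; have [k2 _] := pjP SM h'.
    move: e => /=; case: (eqVneq c w) => [->|cw]; case: (eqVneq c' w) => [->|cw'] // [e].
    by apply: (beta_uniq XM (s := pj r0 c)) => //; rewrite 1?edgeC // e.
  - move=> [c|[]] h e l //=; last by rewrite lfF in l.
    rewrite ?SE in h; apply/negPn/negP => na.
    have bc : c \in beta by apply: (beta_not_alpha XM _ na); rewrite -lf.
    have [k1 _] := pjP SM h; have [k2 _] := pjP SM n0r.
    move: e => /=; case: (eqVneq n0 w) => [e|ne]; case: (eqVneq c w) => [e'|cw] //.
      by move=> _; have := nl0; rewrite e -e' -lf // l.
    move=> [e2].
    rewrite e2 in k1; rewrite pn0 in k2; have k1' : n0 -- c by rewrite edgeC.
    by have ec := beta_uniq XM k1' k2 bc rb; rewrite ec eqxx in h.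
  - move=> [c|[]] [c'|[]] h h' e l l' //= va va'.
    + rewrite ?SE in h; rewrite ?SE in h'; have [k1 _] := pjP SM h; have [k2 _] := pjP SM h'; congr inl.
      move: e => /=; case: (eqVneq c w) => [->|cw]; case: (eqVneq c' w) => [->|cw'] // [e].
      by apply: (alpha_uniq XM (s := pj r0 c)) => //; rewrite 1?edgeC // e.
    + move: e => /=; case: eqP => // e; by rewrite -e va in wna.
    + move: e => /=; case: eqP => // e; by rewrite -e va' in wna.
apply: (grow ehf SM XM maxJ ok); rewrite /= card_sum card_bool addnC.
by [].
Qed.

End Grow.

Lemma extended_tree_swap (T : sgraph) (A B : {set T}) : extended_tree A B -> extended_tree B A.
Proof.
case=> h1 h2 [d c e] h4 h5; split=> //; split; rewrite 1?disjoint_sym 1?setUC //.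
by move=> x y xy; rewrite -(e y x) // edgeC.
Qed.

Lemma ext_induced_swap (T : sgraph) (A B : {set T}) (G : sgraph) (a b : G) :
  ext_induced_in A B a b -> ext_induced_in B A b a.
Proof.
case=> f [[fi fe] fa fb].
pose g (s : ext_line_graph B A) : ext_line_graph A B :=
  match s with inl e => inl e | inr c => inr (~~ c) end.
exists (f \o g); split=> //; split.
  by move=> [e|c] [e'|d] /= /fi //=; case: c; case: d.
move=> [e|c] [e'|d]; rewrite /= fe.
- by [].
- by case: d.
- by case: c.
- by case: c; case: d.
Qed.

(** Dropping the first or the last vertex of [fs] gives a shorter path, which must lose f or f'. *)
Lemma minimal_ends (G : sgraph) (fs : seq G) f f' : ipath fs -> f \in fs -> f' \in fs ->
  (forall s : seq G, ipath s -> {subset s <= fs} -> size s < size fs -> f \in s -> f' \in s -> False) ->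
  f = head f fs /\ f' = last f' fs \/ f = last f fs /\ f' = head f' fs.
Proof.
move=> pf ff ff' sub; have uf := ipath_uniq pf.
case: fs pf ff ff' sub uf => // g0 s pf ff ff' sub uf.
have h1 : (f == g0) || (f' == g0).
  apply/negPn/negP; rewrite negb_or => /andP[n1 n2].
  apply: (sub s); first by case/and3P: pf.
  - by move=> g gs; rewrite inE gs orbT.
  - exact: ltnSn.
  - by move: ff; rewrite inE (negbTE n1).
  - by move: ff'; rewrite inE (negbTE n2).
have h2 : (f == last g0 s) || (f' == last g0 s).
  apply/negPn/negP; rewrite negb_or => /andP[n1 n2].
  apply: (sub (belast g0 s)).
  - by move: pf; rewrite lastI -cats1 => /ipath_catP[].
  - exact: mem_belast.
  - by rewrite size_belast /=.
  - by move: ff; rewrite lastI mem_rcons inE (negbTE n1).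
  - by move: ff'; rewrite lastI mem_rcons inE (negbTE n2).
rewrite /=; case/orP: h1 => /eqP e1; case/orP: h2 => /eqP e2; [|by left|by right|].
- have s0 : s = [::].
    by case: s uf e2 {pf ff ff' sub} => //= g s; rewrite e1 => /andP[+ _] => /negP n e; case: n; rewrite e mem_last.
  by subst s; left; split=> //; move: ff'; rewrite !inE => /eqP.
- have s0 : s = [::].
    by case: s uf e2 {pf ff ff' sub} => //= g s; rewrite e1 => /andP[+ _] => /negP n e; case: n; rewrite e mem_last.
  by subst s; left; split=> //; move: ff; rewrite !inE => /eqP.
Qed.

(** * Pairs that cannot both be seen when b is unseen *)

Section MainLemma.
Variables (J G : sgraph) (ehf : even_hole_free G) (M : strip_family J G) (alpha beta : {set J}) (a b : G).
Hypothesis SM : is_strip_system M.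
Hypothesis XM : cross_edge M alpha beta a b.
Hypothesis maxM : forall M' : strip_family J G,
  is_strip_system M' -> has_cross_edge M' a b -> ~~ (VM M \proper VM M').
Hypothesis maxJ : forall (T : sgraph) (A' B' : {set T}) (J' : sgraph),
  extended_tree A' B' -> ext_induced_in A' B' a b -> is_shape T J' -> #|edges J'| <= #|edges J|.
Implicit Types (p q r s t u v w c m : J) (x y z f : G) (fs : seq G).
Notation bad := (bad M).

Lemma no_hung fs x : hung M a b fs -> x \in VM M -> ~~ (a -- x) -> sees fs x -> False.
Proof.
move=> D xV na sx.
case E: [exists z in VM M, sees fs z && ~~ [exists s, exists t, [&& t \in alpha, s -- t & z \in Me M [set s; t]]]];
  last first.
  apply: (hung_all_strips ehf SM XM D maxM _ xV na sx) => z zV sz; apply/inSP.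
  by apply: contraFT E => h; apply/exists_inP; exists z; rewrite ?sz.
case/exists_inP: E => x' xV' /andP[sx' /inSP nS]; clear x xV na sx; move: x' xV' sx' nS => x xV sx nS.
case E: [exists z in VM M, sees fs z && [exists s, exists t, [&& t \in alpha, s -- t & z \in Me M [set s; t]]]].
  case/exists_inP: E => z zV /andP[sz /inSP Sz].
  exact: (hung_some_strip ehf SM XM D maxM xV nS sx zV Sz sz).
have N z : z \in VM M -> sees fs z -> ~ inS M alpha z.
  by move=> zV sz /inSP h; move/negP: (negbT E); apply; apply/exists_inP; exists z; rewrite ?sz.
case: (star_or_strip ehf SM XM D N xV sx) => [[u nu H]|[p [q [pq xe H]]]].
  exact: (no_star ehf SM XM maxJ D nu N H).
have [r0 rb] := beta_leaf_exists SM XM.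
(* The second beam in [rung_pair] starts at p, which therefore must not be a leaf; p and q are not
   both leaves. *)
wlog np : p q pq xe H / p \notin leaves J.
  move=> W; case: (boolP (p \in leaves J)) => lp; last exact: (W p q).
  have qp : q -- p by rewrite edgeC.
  have xe' : x \in Me M [set q; p] by rewrite MvvC.
  apply: (W q p qp xe') => [z zV sz|]; first by rewrite MvvC; apply: H.
  by apply/negP => lq; exact: (leaf_leafF SM lp lq pq).
have [R rR xR] := rung_through SM pq xe.
have [R1 [x0 [y0 [R2 [eR HR]]]]] := rung_pair ehf SM XM D N pq np rR xR sx H.
subst R; case: (edge_pj SM r0 pq) => -[h e].
  by apply: (no_split_rung ehf SM XM maxJ D N rb h _ HR); rewrite e.
have rR' := rung_rev rR; rewrite rev_cat !rev_cons -!cats1 -!catA /= in rR'.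
apply: (no_split_rung ehf SM XM maxJ D N rb h (R1 := rev R2) (x0 := y0) (y0 := x0) (R2 := rev R1)); rewrite ?e.
- exact: rR'.
- move=> z zR; rewrite orbC; apply: HR; move: zR; rewrite !mem_cat !inE !mem_rev.
  by case: (z \in R1); case: (z \in R2); case: (z == x0); case: (z == y0).
- by move=> z zV sz; rewrite MvvC; apply: H.
Qed.

(* A pair whose members may not both have neighbours in a connected set unseen by b. *)
Definition conflict x y := bad x y /\ y \in VM M \/ y = a /\ ~~ (a -- x).

(** Induction on the length makes the path an attachment. If a is unseen it is detached. If only
    neighbours of a are seen, [two_alpha_ends] applies. Otherwise some seen vertex is in conflict
    with a itself, and minimality for this conflict shows that the path hangs from a by one of its
    ends. *)
Lemma no_conflict fs x y : ipath fs ->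
  (forall f, f \in fs -> [/\ f \notin VM M, f != a & f != b]) -> (forall f, f \in fs -> f -- b = false) ->
  x \in VM M -> conflict x y -> sees fs x -> sees fs y -> False.
Proof.
move: {2}(size fs) (leqnn (size fs)) => k; elim: k fs x y => [|k IH] fs x y hk pf out fb xV C sx sy.
  by move: sx hk; case: (fs).
have f0 : fs != [::] by case/hasP: sx => f /mem_nonnil.
have mn x' y' f f' : x' \in VM M -> conflict x' y' -> f \in fs -> f' \in fs -> f -- x' -> f' -- y' ->
    f = head f fs /\ f' = last f' fs \/ f = last f fs /\ f' = head f' fs.
  move=> xV' C' ff ff' fx fy.
  have sub (s : seq G) : ipath s -> {subset s <= fs} -> size s < size fs -> f \in s -> f' \in s -> False.
    move=> ps ss sz fs1 fs2; apply: (IH s x' y') => //.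
    - by rewrite -ltnS (leq_trans sz).
    - by move=> g /ss; apply: out.
    - by move=> g /ss; apply: fb.
    - by apply/hasP; exists f.
    - by apply/hasP; exists f'.
  exact: (minimal_ends pf ff ff' sub).
have Af : attached M a b fs.
  split=> // p q f f' pV qV bd ff ff' fp fq; apply: (mn p q f f' pV _ ff ff' fp fq).
  by left.
case sa: (sees fs a); last first.
  have fa f : f \in fs -> f -- a = false.
    by move=> ff; apply/negP => h; move/hasP: sa; case; exists f.
  case: C => [[bd yV]|[ya _]]; last by rewrite ya sa in sy.
  by apply: (no_detached ehf SM XM maxM (fs := fs) _ xV yV bd sx sy); split.
case E: [exists z in VM M, sees fs z && ~~ (a -- z)]; last first.
  have E' z : z \in VM M -> sees fs z -> a -- z.
    by move=> zV sz; apply: contraFT E => h; apply/exists_inP; exists z; rewrite ?sz.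
  case: C => [[bd yV]|[_ na]]; last by rewrite (E' x xV sx) in na.
  exact: (two_alpha_ends ehf SM XM Af fb xV yV bd sx sy E').
case/exists_inP: E => {C x y xV sx sy} z zV /andP[sz naz].
have Cz x : ~~ (a -- x) -> conflict x a by move=> h; right.
have bfs : b \notin fs by apply/negP => /out[_ _]; rewrite eqxx.
have afs : a \notin fs by apply/negP => /out[_]; rewrite eqxx.
case/hasP: (sa) => g gf ga; case/hasP: (sz) => f ff fz.
have mk fs' : ipath fs' -> fs' != [::] -> fs' =i fs -> attached M a b fs' ->
    (forall h, h \in fs -> h -- a -> h = last h fs') ->
    (forall x h, x \in VM M -> ~~ (a -- x) -> h \in fs -> h -- x -> h = head h fs') -> hung M a b fs'.
  move=> pf' f0' m A H1 H2; split=> //.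
    split=> //.
      move=> h; rewrite m => hf; have [_ na' nb'] := out h hf; split=> //.
      apply/idP/eqP => [ah|e]; first by apply: H1; rewrite // edgeC.
      have eg := H1 g gf ga.
      have -> : h = g by rewrite [LHS]e [LHS](last_def h g f0') -eg.
      by rewrite edgeC.
    move=> h; rewrite m => hf; have [_ na' nb'] := out h hf; split=> //.
    by rewrite edgeC fb.
  move=> x xV nx; split; first exact: att_out Af xV || (rewrite m; exact: att_out Af xV).
  by move=> h; rewrite m => hf hx; apply: (H2 x).
have two h : h \in fs -> h = head h fs -> h = last h fs -> forall h', h' \in fs -> h' = h.
  move=> hf e1 e2; have uf := ipath_uniq pf.
  case: (fs) hf e1 e2 uf => // g0 s hf /= e1 e2 /andP[n _] h'.
  by case: s e2 n {hf} => [|g1 s] /= e2; [rewrite inE e1 => _ /eqP | rewrite e1 in e2; rewrite e2 mem_last].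
case: (mn z a f g zV (Cz z naz) ff gf fz ga) => -[e1 e2].
  apply: (no_hung (fs := fs) _ zV naz sz); apply: mk => //.
    move=> h hf ha; case: (mn z a f h zV (Cz z naz) ff hf fz ha) => -[k1 k2] //.
    by rewrite (two f ff e1 k1 h hf) -k1.
  move=> x h xV nx hf hx; case: (mn x a h g xV (Cz x nx) hf gf hx ga) => -[k1 k2] //.
  by rewrite (two g gf k2 e2 h hf) -k2.
apply: (no_hung (fs := rev fs) _ zV naz); last by rewrite sees_rev.
apply: mk; [exact: ipath_rev | by rewrite -size_eq0 size_rev size_eq0 | by move=> h; rewrite mem_rev | exact: attached_rev | | ].
  move=> h hf ha; rewrite last_rev; case: (mn z a f h zV (Cz z naz) ff hf fz ha) => -[k1 k2] //.
  by rewrite (two f ff k1 e1 h hf) -k1.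
move=> x h xV nx hf hx; rewrite head_rev; case: (mn x a h g xV (Cz x nx) hf gf hx ga) => -[k1 k2] //.
by rewrite (two g gf e2 k2 h hf) -k2.
Qed.

End MainLemma.

(** * Attachments seen by both a and b *)

Lemma last_index_of (p : pred nat) n : (exists2 k, k < n & p k) ->
  exists k, [/\ k < n, p k & forall j, k < j -> j < n -> ~~ p j].
Proof.
elim: n => [[k]|n IH] // [k kn pk]; case pn: (p n).
  by exists n; split=> // j h1 h2; move: h1; rewrite ltnNge -ltnS h2.
have kn' : k < n.
  by rewrite ltn_neqAle -ltnS kn andbT; apply: contraFneq pn => <-.
have [|m [h1 h2 h3]] := IH; first by exists k.
exists m; split=> //; first exact: ltnW.
move=> j mj; rewrite ltnS leq_eqVlt => /orP[/eqP ->|jn]; first by rewrite pn.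
exact: h3.
Qed.

(* pa i, pb i: the i-th vertex of an induced path is adjacent to a, to b; the gaps are parities of holes
   through a, b or ab, and first_b is the hole leaving the path at its first neighbour of b. *)
Section Labels.
Variables (r : nat) (pa pb : pred nat).
Hypothesis dis : forall i, i < r -> pa i -> pb i -> False.
Hypothesis gap_a : forall i j, i < j -> j < r -> pa i -> pa j -> (forall k, i < k -> k < j -> ~~ pa k) -> odd (j - i).
Hypothesis gap_b : forall i j, i < j -> j < r -> pb i -> pb j -> (forall k, i < k -> k < j -> ~~ pb k) -> odd (j - i).
Hypothesis gap_ab : forall i j, i < j -> j < r -> pa i && pb j || pb i && pa j ->
  (forall k, i < k -> k < j -> ~~ pa k && ~~ pb k) -> ~~ odd (j - i).
Hypothesis first_b : forall j, j < r -> pb j -> (forall k, k < j -> ~~ pb k) ->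
  ~~ odd j /\ exists2 k, k < j & pa k.

Lemma odd_gap i j : i < j -> odd (j - i) = odd j (+) odd i.
Proof. by move=> /ltnW h; rewrite oddB. Qed.

Lemma some_a_before j : j < r -> pb j -> exists2 k, k < j & pa k.
Proof.
elim/ltn_ind: j => j IH jr pj; case h: (has pb (iota 0 j)).
  case/hasP: h => k; rewrite mem_iota /= add0n => kj pk.
  have [m mk pm] := IH k kj (ltn_trans kj jr) pk; exists m => //; exact: ltn_trans kj.
have [|_ //] := first_b jr pj.
by move=> k kj; apply: contraFN h => pk; apply/hasP; exists k; rewrite // mem_iota add0n.
Qed.

(** The minimum is the last occurrence of the letter other than the most recent one: an even place
    for a, an odd place for b. A repeated letter leaves it alone; when the letter changes, the gap
    between equal letters and the gap between the two different letters give the parity of the new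
    minimum from that of the old one. *)
Lemma label_parity i la lb : i <= r -> la < i -> lb < i -> pa la -> pb lb ->
  (forall k, la < k -> k < i -> ~~ pa k) -> (forall k, lb < k -> k < i -> ~~ pb k) ->
  odd (minn la lb) = (lb < la).
Proof.
elim: i la lb => // i IH la lb ir; rewrite !ltnS => hla hlb ala blb na nb.
have na' k : la < k -> k < i -> ~~ pa k by move=> h1 h2; apply: na => //; apply: ltnW.
have nb' k : lb < k -> k < i -> ~~ pb k by move=> h1 h2; apply: nb => //; apply: ltnW.
case: (eqVneq lb i) => [e|nlb].
  subst lb; have lai : la < i.
    rewrite ltn_neqAle hla andbT; apply/eqP => e; subst la; exact: (dis ir ala blb).
  rewrite (minn_idPl (ltnW lai)) ltnNge (ltnW lai) /=.
  have ge : (forall k, la < k -> k < i -> ~~ pb k) -> odd la = odd i.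
    move=> h; have h2 : ~~ odd (i - la).
      by apply: gap_ab; rewrite ?ala ?blb // => k k1 k2; rewrite na' // h.
    by rewrite odd_gap // in h2; move: h2; case: (odd i); case: (odd la).
  (* At the first b there is no earlier minimum, and [first_b] supplies the parity. *)
  case hb: (has pb (iota 0 i)); last first.
    have nob k : k < i -> ~~ pb k.
      by move=> ki; apply: contraFN hb => pk; apply/hasP; exists k; rewrite // mem_iota add0n.
    have [/negbTE k1 _] := first_b ir blb nob.
    by rewrite ge // => k _; apply: nob.
  have [m [mi pm nm]] : exists k, [/\ k < i, pb k & forall j, k < j -> j < i -> ~~ pb j].
    by apply: last_index_of; case/hasP: hb => k; rewrite mem_iota add0n => ki pk; exists k.
  have := IH la m (ltnW ir) lai mi ala pm na' nm.
  case: (ltngtP la m) => [h|h|e]; last by subst m; case: (dis (ltn_trans lai ir) ala pm).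
    by move=> ->.
  move=> om; rewrite ge //.
    by have := gap_b mi ir pm blb nm; rewrite odd_gap // om; case: (odd i).
  by move=> k k1 k2; apply: nm => //; apply: ltn_trans h k1.
have lbi : lb < i by rewrite ltn_neqAle nlb.
case: (eqVneq la i) => [e|nla]; last first.
  by apply: (IH la lb (ltnW ir)) => //; rewrite ltn_neqAle nla.
subst la; rewrite (minn_idPr (ltnW lbi)) lbi.
have lbr : lb < r by apply: ltn_trans ir.
have [k0 k0l pk0] := some_a_before lbr blb.
have [m [mi pm nm]] : exists k, [/\ k < i, pa k & forall j, k < j -> j < i -> ~~ pa j].
  by apply: last_index_of; exists k0 => //; apply: ltn_trans lbi.
have := IH m lb (ltnW ir) mi lbi pm blb nm nb'.
case: (ltngtP lb m) => [//|h|e]; last by subst m; case: (dis lbr pm blb).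
move=> om; have oi := gap_a mi ir pm ala nm; rewrite odd_gap // om addbF in oi.
have h2 : ~~ odd (i - lb).
  apply: gap_ab; rewrite ?ala ?blb ?orbT // => k k2 k3.
  by rewrite nb' // nm //; apply: ltn_trans k2.
by rewrite odd_gap // in h2; move: oi h2; case: (odd i); case: (odd m); case: (odd lb).
Qed.

Lemma label_clash (d : bool) (pc := if d then pb else pa) (pd := if d then pa else pb) :
  odd r = d -> (exists2 k, k < r & pc k) ->
  (forall j, j < r -> pc j -> (forall k, j < k -> k < r -> ~~ pc k) ->
     ~~ odd (r.-1 - j) /\ exists2 k, j < k & (k < r) && pd k) -> False.
Proof.
move=> rd ec H; have [j [jr pj nj]] := last_index_of ec.
have [h1 [k jk /andP[kr pk]]] := H j jr pj nj.
have [m [mr pm nm]] : exists k, [/\ k < r, pd k & forall j, k < j -> j < r -> ~~ pd j].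
  by apply: last_index_of; exists k.
have jm : j < m.
  rewrite ltnNge; apply/negP => mj; have := nm k (leq_ltn_trans mj jk) kr; by rewrite pk.
have r1 : odd r.-1 = ~~ d by rewrite -rd; case: (r) jr => // n _ /=; rewrite negbK.
rewrite oddB in h1; last by rewrite -ltnS (ltn_predK jr).
rewrite r1 in h1.
case: d @pc @pd rd ec H pj nj pk pm nm r1 h1 => pc pd rd ec H pj nj pk pm nm r1 h1.
  have := label_parity (leqnn r) mr jr pm pj nm nj.
  by rewrite (minn_idPr (ltnW jm)) jm => k1; rewrite k1 in h1.
have := label_parity (leqnn r) jr mr pj pm nj nm.
by rewrite (minn_idPl (ltnW jm)) ltnNge (ltnW jm) /= => k1; rewrite k1 in h1.
Qed.

End Labels.

Section Paths.
Variable G : sgraph.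
Implicit Types (x y z f : G) (s fs : seq G).

(** At each step x is joined to the last of its neighbours on the induced path already found. *)
Lemma connect_ipath (S : {set G}) x y : x \in S -> connect (restr_edge S) x y ->
  exists s, [/\ ipath (x :: s), {subset x :: s <= S} & last x s = y].
Proof.
move=> xS /connectP[c]; elim: c x xS => [|z c IH] x xS /=.
  by move=> _ ->; exists [::]; split=> // z; rewrite inE => /eqP ->.
case/andP => /and3P[_ zS xz] pc ey.
have [s [ps ss ls]] := IH z zS pc ey; have {}ls : last x (z :: s) = y by [].
case xs: (x \in z :: s).
  case/splitPr: xs ps ss ls => s1 s2 ps ss ls; exists s2; split.
  - by case/ipath_catP: ps.
  - by move=> w ws; apply: ss; rewrite mem_cat ws orbT.
  - by move: ls; rewrite last_cat.
have h : has (fun w => x -- w) (z :: s) by rewrite /= xz.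
have [s1 [w [s2 [e xw n]]]] := last_split h; rewrite e in ps ss ls xs.
exists (w :: s2); split.
- apply: ipath_cons; first by case/ipath_catP: ps.
  move=> x' w'; rewrite inE => /eqP -> ws; split.
    by apply: contraFneq xs => ->; rewrite mem_cat ws orbT.
  rewrite /= eqxx /=; move: ws; rewrite inE => /orP[/eqP ->|ws]; first by rewrite xw eqxx.
  rewrite (negbTE (n _ ws)); symmetry; apply/negbTE; apply: contraNneq (n _ ws) => ->.
  by rewrite xw.
- move=> w'; rewrite inE => /orP[/eqP -> //|ws]; apply: ss; rewrite mem_cat ws orbT //.
- by move: ls; rewrite last_cat.
Qed.

End Paths.

Lemma nbrsP (G : sgraph) (F : {set G}) x : reflect (exists2 f, f \in F & x -- f) (x \in nbrs F).
Proof. by rewrite inE; apply: exists_inP. Qed.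

Section Helly.
Variables (J G : sgraph) (M : strip_family J G).
Hypothesis SM : is_strip_system M.
Implicit Types (p q r s t u v w : J) (x y z f : G).

(* A Helly property of the tree J. *)
Lemma local_pairwise (X : {set G}) : X \subset VM M ->
  (forall x y, x \in X -> y \in X -> ~ bad M x y) ->
  (exists2 e, e \in edges J & X \subset Me M e) \/ exists u, X \subset Mv M u.
Proof.
move=> /subsetP XV nb; case: (set_0Vmem X) => [->|[x xX]].
  by right; have [[_ J3] _ _ _ _] := SM; case/card_gt0P: (ltn_trans (ltn0Sn 1) J3) => u _; exists u; apply: sub0set.
have /VMP[p [q [pq xe]]] := XV x xX.
case: (boolP (X \subset Me M [set p; q])) => [h|/subsetPn[y yX ny]].
  left; exists [set p; q] => //; rewrite inE; apply/existsP; exists p; apply/existsP; exists q.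
  by rewrite pq eqxx.
have [v [w1 [w2 [e1 e2 ne hx hy]]]] := separate SM pq xe (XV y yX) ny.
right; exists v; apply/subsetP => z zX; have [w e hz] := VM_dir SM v (XV z zX).
apply/negPn/negP => nz; case: (eqVneq w w1) => [?|n].
  by subst w; apply: (nb z y zX yX); apply: (badI e1 e2 ne hz hy); left.
by apply: (nb z x zX xX); apply: (badI e e1 n hz hx); left.
Qed.

End Helly.

Section MainSets.
Variables (J G : sgraph) (ehf : even_hole_free G) (M : strip_family J G) (alpha beta : {set J}) (a b : G).
Hypothesis SM : is_strip_system M.
Hypothesis XM : cross_edge M alpha beta a b.
Hypothesis maxM : forall M' : strip_family J G,
  is_strip_system M' -> has_cross_edge M' a b -> ~~ (VM M \proper VM M').
Hypothesis maxJ : forall (T : sgraph) (A' B' : {set T}) (J' : sgraph),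
  extended_tree A' B' -> ext_induced_in A' B' a b -> is_shape T J' -> #|edges J'| <= #|edges J|.
Variable F : {set G}.
Hypothesis cF : connected_set F.
Hypothesis oF : forall f, f \in F -> [/\ f \notin VM M, f != a & f != b].
Implicit Types (p q r s t u v w : J) (x y z f : G) (fs : seq G).

Lemma path_between x y : x \in nbrs F -> y \in nbrs F ->
  exists fs, [/\ ipath fs, {subset fs <= F}, sees fs x & sees fs y].
Proof.
case/nbrsP => f fF xf /nbrsP[g gF yg].
have [s [ps ss ls]] := connect_ipath fF (cF fF gF).
exists (f :: s); split=> //; apply/hasP; first by exists f; rewrite ?mem_head // edgeC.
by exists g; rewrite -?ls ?mem_last // edgeC ls.
Qed.

Lemma unseen_not_bad x y : b \notin nbrs F -> x \in VM M :&: nbrs F -> y \in VM M :&: nbrs F -> ~ bad M x y.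
Proof.
move=> nb /setIP[xV xF] /setIP[yV yF] bd; have [fs [pf sF sx sy]] := path_between xF yF.
apply: (no_conflict ehf SM XM maxM maxJ pf _ _ xV _ sx sy).
- by move=> f /sF; apply: oF.
- move=> f /sF fF; apply/negP => h; case/negP: nb; apply/nbrsP; exists f; by rewrite // edgeC.
- by left.
Qed.

End MainSets.

Section Swap.
Variables (J G : sgraph) (M : strip_family J G) (a b : G).

Lemma max_strips_swap : (forall M' : strip_family J G,
    is_strip_system M' -> has_cross_edge M' a b -> ~~ (VM M \proper VM M')) ->
  forall M' : strip_family J G,
    is_strip_system M' -> has_cross_edge M' b a -> ~~ (VM M \proper VM M').
Proof.
move=> H M' SM' [alpha [beta /cross_edge_sym X]]; apply: H => //; by exists beta, alpha.
Qed.

Lemma max_shape_swap : (forall (T : sgraph) (A' B' : {set T}) (J' : sgraph),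
    extended_tree A' B' -> ext_induced_in A' B' a b -> is_shape T J' -> #|edges J'| <= #|edges J|) ->
  forall (T : sgraph) (A' B' : {set T}) (J' : sgraph),
    extended_tree A' B' -> ext_induced_in A' B' b a -> is_shape T J' -> #|edges J'| <= #|edges J|.
Proof. by move=> H T A' B' J' /extended_tree_swap h1 /ext_induced_swap h2; apply: H h1 h2. Qed.

End Swap.

Lemma segment (G : sgraph) (x0 : G) (fs : seq G) i j : i <= j -> j < size fs -> ipath fs ->
  exists s, [/\ ipath s, size s = (j - i).+1, forall x, head x s = nth x0 fs i,
    forall x, last x s = nth x0 fs j &
    forall z, z \in s -> exists k, [/\ i <= k, k <= j & z = nth x0 fs k]].
Proof.
move=> ij jn pf; have sz : size (take (j - i).+1 (drop i fs)) = (j - i).+1.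
  by rewrite size_takel // size_drop ltn_sub2r // (leq_ltn_trans ij).
exists (take (j - i).+1 (drop i fs)); split=> //.
- move: pf; rewrite -{1}(cat_take_drop i fs) => /ipath_catP[_ + _].
  by rewrite -{1}(cat_take_drop (j - i).+1 (drop i fs)) => /ipath_catP[].
- move=> x; rewrite -nth0 (set_nth_default x0) ?sz // nth_take // nth_drop addn0 //.
- move=> x; rewrite -nth_last (set_nth_default x0) ?sz //= nth_take // nth_drop subnKC //.
- move=> z /(nthP x0)[k]; rewrite sz ltnS => kj <-; exists (i + k).
  rewrite leq_addr nth_take // nth_drop; split=> //; first by rewrite -(subnKC ij) leq_add2l.
Qed.

(** * The holes behind the parities of labels *)

Section LabelParity.
Variables (G : sgraph) (ehf : even_hole_free G) (a b : G).
Variables (x0 : G) (fs : seq G).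
Hypothesis pf : ipath fs.
Notation g := (nth x0 fs).

Lemma gap_same c i j : c \notin fs -> i < j -> j < size fs -> g i -- c -> g j -- c ->
  (forall k, i < k -> k < j -> ~~ (g k -- c)) -> odd (j - i).
Proof.
move=> cf ij jn hi hj H; have [s [ps sz hd ls ms]] := segment x0 (ltnW ij) jn pf.
have s0 : s != [::] by rewrite -size_eq0 sz.
have : odd (size s + size [:: c]).
  apply: (ring_odd ehf) => //; first by rewrite sz /=; lia.
  move=> z y zs; rewrite inE => /eqP ->; have [k [ik kj ->]] := ms z zs; split.
    by apply: contraNneq cf => <-; rewrite mem_nth // (leq_ltn_trans kj).
  rewrite (hd (g k)) (ls (g k)) /= eqxx !andbT.
  rewrite !nth_uniq ?(ipath_uniq pf) // ?(leq_ltn_trans kj) // ?(ltn_trans ij jn) //.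
  case: (eqVneq k j) => [->|nj]; first by rewrite hj.
  case: (eqVneq k i) => [->|ni]; first by rewrite hi.
  by apply/negbTE/H; rewrite ltn_neqAle // ?ik ?kj ?andbT // eq_sym.
by rewrite sz /= addn1 /= negbK.
Qed.

Lemma gap_diff c d i j : c \notin fs -> d \notin fs -> c -- d -> (forall f, f \in fs -> ~~ ((f -- c) && (f -- d))) ->
  i < j -> j < size fs -> g i -- c -> g j -- d ->
  (forall k, i < k -> k < j -> ~~ (g k -- c) && ~~ (g k -- d)) -> ~~ odd (j - i).
Proof.
move=> cf df cd nb ij jn hi hj H; have [s [ps sz hd ls ms]] := segment x0 (ltnW ij) jn pf.
have s0 : s != [::] by rewrite -size_eq0 sz.
have i0 : i < size fs by apply: ltn_trans jn.
have nid : g i -- d = false by have := nb _ (mem_nth x0 i0); rewrite hi => /negbTE.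
have njc : g j -- c = false by have := nb _ (mem_nth x0 jn); rewrite hj andbT => /negbTE.
have : odd (size s + size [:: d; c]).
  apply: (ring_odd ehf) => //.
  - by rewrite /= !andbT inE eq_sym (edge_neq cd) /= edgeC cd eqxx.
  - by rewrite sz /=; lia.
  move=> z y zs; have [k [ik kj ->]] := ms z zs; have k0 := leq_ltn_trans kj jn.
  rewrite (hd (g k)) (ls (g k)) /= !nth_uniq ?(ipath_uniq pf) // => yt; split.
    by move: yt; rewrite !inE => /orP[] /eqP ->; [move: df|move: cf]; apply: contraNneq => <-; rewrite mem_nth.
  move: yt; rewrite !inE => /orP[] /eqP ->; rewrite eqxx ?andbT.
    rewrite [d == c]eq_sym (negbTE (edge_neq cd)) andbF orbF.
    case: (eqVneq k j) => [->|nj]; first by rewrite hj.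
    case: (eqVneq k i) => [->|ni]; first by rewrite nid.
    have /H/(_ _)/andP[] : i < k by rewrite ltn_neqAle ik andbT eq_sym.
      by rewrite ltn_neqAle kj andbT.
    by move=> _ /negbTE.
  rewrite (negbTE (edge_neq cd)) andbF /=.
  case: (eqVneq k i) => [->|ni]; first by rewrite hi.
  case: (eqVneq k j) => [->|nj]; first by rewrite njc.
  have /H/(_ _)/andP[] : i < k by rewrite ltn_neqAle ik andbT eq_sym.
    by rewrite ltn_neqAle kj andbT.
  by move/negbTE.
by rewrite sz /= addnC /= negbK.
Qed.

(* The hole through c, an initial segment of fs, and a path E avoiding fs. *)
Lemma cap_ring c s x (E : seq G) : ipath s -> s != [::] -> capped c s -> ipath (x :: E) -> capped c (x :: E) ->
  atH s x -> {in E, forall z, noF s z} -> odd (size s + size E).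
Proof.
move=> ps s0 cs pE cE hx nE.
have := fring ehf (y := c) (R := rev E) (x := x) ps s0.
rewrite size_rev; apply => //.
- rewrite -rev_cons; apply: ipath_cons; first exact: ipath_rev.
  move=> c' z; rewrite inE => /eqP -> zE; rewrite mem_rev in zE; have [n ->] := cE z zE.
  by rewrite eq_sym n /= eqxx head_rev.
- split; first by apply/negP => /cs[]; rewrite eqxx.
  by move=> f /cs[_]; rewrite edgeC.
- by move=> z; rewrite mem_rev; apply: nE.
Qed.

Hypothesis ab : a -- b.

(** The ring through E and b puts the first neighbour of b at an even place. If no neighbour of a
    came before it, the ring through x, a and b would put it at an odd place. *)
Lemma first_cap x (E : seq G) : atH fs x -> ipath (x :: E) -> capped b (x :: E) -> a -- x -> b -- x = false -> b \notin fs -> a \notin fs ->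
  {in E, forall z, noF fs z} -> ~~ odd (size E) -> (forall f, f \in fs -> ~~ ((f -- a) && (f -- b))) ->
  forall j, j < size fs -> g j -- b -> (forall k, k < j -> ~~ (g k -- b)) ->
  ~~ odd j /\ exists2 k, k < j & g k -- a.
Proof.
move=> hx pE cE ax bx bf af nE oE nb j jn bj nk.
have [s [ps sz hd ls ms]] := segment x0 (leq0n j) jn pf; rewrite subn0 in sz.
have s0 : s != [::] by rewrite -size_eq0 sz.
have ss : {subset s <= fs}.
  by move=> z /ms[k [_ kj ->]]; rewrite mem_nth // (leq_ltn_trans kj).
have cs : capped b s.
  move=> z zs; have zf := ss z zs; split; first by apply: contraNneq bf => <-.
  have [k [_ kj e]] := ms z zs; rewrite (ls z) e edgeC nth_uniq ?(ipath_uniq pf) ?(leq_ltn_trans kj) //.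
  by case: (eqVneq k j) => [-> //|n]; apply/negbTE/nk; rewrite ltn_neqAle n.
have hs : atH s x.
  case: hx => xf hx; split; first by apply: contra xf; apply: ss.
  by move=> f /ss ff; rewrite hx // hd nth0 (head_def f x0) // (mem_nonnil ff).
have oj : ~~ odd j.
  have := cap_ring ps s0 cs pE cE hs; rewrite sz oddD (negbTE oE) addbF /= => k; apply: k.
  by move=> z /nE[zf Hz]; split; [apply: contra zf; apply: ss | move=> f /ss; apply: Hz].
split=> //; case h: (has (fun k => g k -- a) (iota 0 j)).
  by case/hasP: h => k; rewrite mem_iota add0n => kj ka; exists k.
have jna : g j -- a = false by have := nb _ (mem_nth x0 jn); rewrite bj andbT => /negbTE.
suff: odd (size s + size [:: a]) by rewrite sz /= addn1 /= negbK (negbTE oj).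
have xa : x != a by rewrite eq_sym (edge_neq ax).
apply: (cap_ring (c := b) (x := x)) => //.
- by rewrite /= inE xa /= edgeC ax eqxx.
- move=> z; rewrite !inE => /orP[] /eqP -> /=.
    by rewrite (negbTE xa) bx; split=> //; case: (cE x (mem_head _ _)).
  by rewrite eqxx edgeC ab; split=> //; apply: edge_neq.
- move=> z; rewrite inE => /eqP ->; split; first by apply: contra af; apply: ss.
  move=> f /ms[k [_ kj ->]]; move: kj; rewrite leq_eqVlt => /orP[/eqP -> //|kj].
  by apply: contraFF h => ka; apply/hasP; exists k; rewrite // mem_iota add0n.
Qed.

End LabelParity.

Section Ends.
Variables (J G : sgraph) (ehf : even_hole_free G) (M : strip_family J G) (alpha beta : {set J}) (a b : G).
Hypothesis SM : is_strip_system M.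
Hypothesis XM : cross_edge M alpha beta a b.
Implicit Types (p q r s u v w : J).

Let ab : a -- b. Proof. by case: XM. Qed.

Lemma end_strip s t x : s -- t -> t \in leaves J -> x \in Mv M t -> x \in Me M [set s; t].
Proof.
move=> st lt xt; have [q tq hx] := VM_dir SM t (Mv_VM SM xt).
have ts : t -- s by rewrite edgeC.
by rewrite (leaf_uniq lt ts tq) MvvC; apply: dir_head.
Qed.

Lemma arm_end p q t (Q : seq G) t2 z : arm M p q t Q -> z \in Q -> t2 \in leaves J -> t2 != p ->
  z \in Mv M t2 -> z = last z Q /\ t2 = t.
Proof. by case=> _ _ _ _ [_ _ H _] zQ lt n; rewrite H // => /andP[/eqP e /eqP]. Qed.

Lemma end_arm s w t x : s \notin leaves J -> s -- w -> x \in dir M s w -> t \in leaves J -> x \in Mv M t ->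
  exists Q : seq G, arm M s w t (rcons Q x).
Proof.
move=> ns sw hx lt xt; have [t1 [Q [A xQ _]]] := arm_through SM XM sw hx.
have ts : t != s by apply: contraNneq ns => <-.
have [e ?] := arm_end A xQ lt ts xt; subst t1.
by case/lastP: Q A xQ e => [//|Q y] A _; rewrite last_rcons => ->; exists Q.
Qed.

Section Pair.
Variables (t t' : J) (x y : G).
Hypotheses (ta : t \in alpha) (lt' : t' \in leaves J) (tt' : t' != t).
Hypotheses (xt : x \in Mv M t) (yt : y \in Mv M t').

Let lt := alpha_leaf XM ta.

Lemma end_dirs : exists s g, [/\ s -- t, s \notin leaves J, s -- g, g != t &
  x \in dir M s t /\ y \in dir M s g].
Proof.
have [s ts _] := leaf_nbr lt; have st : s -- t by rewrite edgeC.
have xe := end_strip st lt xt.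
have ns : y \notin Me M [set s; t].
  apply/negP => h; have [s' ts' _] := leaf_nbr lt'; have st' : s' -- t' by rewrite edgeC.
  have [_ e] := leaf_strip_uniq SM lt' lt st' st (end_strip st' lt' yt) h.
  by move: tt'; rewrite e eqxx.
have [g [sg gt hy]] := dir_of SM XM ta st (Mv_VM SM yt) ns.
exists s, g; split=> //; first exact: (nbr_nonleaf SM lt st).
by split=> //; apply: strip_dir.
Qed.

Lemma arm_misses s w t1 (Q : seq G) z : s \notin leaves J -> arm M s w t1 Q -> z \in Q ->
  t1 != t -> t1 != t' -> z \notin Mv M t /\ z \notin Mv M t'.
Proof.
move=> ns A zQ n n'; split; apply/negP.
  move=> h; have ts : t != s by apply: contraNneq ns => <-.
  by have [_ e] := arm_end A zQ lt ts h; rewrite e eqxx in n.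
move=> h; have ts : t' != s by apply: contraNneq ns => <-.
by have [_ e] := arm_end A zQ lt' ts h; rewrite e eqxx in n'.
Qed.

Lemma arm_misses_belast s w t1 (Q : seq G) x1 z : s \notin leaves J -> arm M s w t1 (rcons Q x1) ->
  z \in Q -> z \notin Mv M t /\ z \notin Mv M t'.
Proof.
move=> ns A zQ; have zQ' : z \in rcons Q x1 by rewrite mem_rcons inE zQ orbT.
have zx : z != x1.
  have : uniq (rcons Q x1) by case: A => /ipath_uniq.
  by rewrite rcons_uniq => /andP[n _]; apply: contraNneq n => <-.
split; apply/negP.
  move=> h; have ts : t != s by apply: contraNneq ns => <-.
  by have [e _] := arm_end A zQ' lt ts h; rewrite e last_rcons eqxx in zx.
move=> h; have ts : t' != s by apply: contraNneq ns => <-.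
by have [e _] := arm_end A zQ' lt' ts h; rewrite e last_rcons eqxx in zx.
Qed.

(** The beams from the neighbour s of t, one to x and one to y; with a path between x and y they
    close to a ring that avoids a and b. *)
Lemma end_beams : exists Q1 Q2 : seq G, [/\ ipath (rcons Q1 x), ipath (rcons Q2 y),
  touch (rcons Q1 x) (rcons Q2 y), odd (size Q1 + size Q2) = (t' \notin alpha) &
  forall z, z \in Q1 ++ Q2 -> [/\ z \in VM M, z \notin Mv M t & z \notin Mv M t']].
Proof.
have [s [g [st ns sg gt [hx hy]]]] := end_dirs.
have [Q1 A1] := end_arm ns st hx lt xt; have [Q2 A2] := end_arm ns sg hy lt' yt.
have B1 : beam M alpha s t (t \in alpha) (rcons Q1 x) by exists t.
have B2 : beam M alpha s g (t' \in alpha) (rcons Q2 y) by exists t'.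
have T : touch (rcons Q1 x) (rcons Q2 y).
  by apply: (beam_touch SM st sg _ B1 B2); rewrite eq_sym.
have L1 := beam_leg XM ns B1; have L2 := beam_leg XM ns B2.
exists Q1, Q2; split=> //; first by case: L1.
- by case: L2.
- have := closed_legs ehf ab L1 L2 T; rewrite !size_rcons addSn addnS /= negbK ta => ->.
  by case: (t' \in alpha).
move=> z; rewrite mem_cat => /orP[] zQ.
  have [n1 n2] := arm_misses_belast ns A1 zQ; split=> //.
  by apply: (beam_VM B1); rewrite mem_rcons inE zQ orbT.
have [n1 n2] := arm_misses_belast ns A2 zQ; split=> //.
by apply: (beam_VM B2); rewrite mem_rcons inE zQ orbT.
Qed.

(** From x back to s and out to b along a third beam. This beam does not end in t, a leaf of alpha,
    nor in t', which lies in another direction at s. *)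
Lemma exit_path : exists E : seq G, [/\ ipath (x :: E), capped b (x :: E), ~~ odd (size E) &
  forall z, z \in E -> [/\ z \in VM M, z \notin Mv M t & z \notin Mv M t']].
Proof.
have [s [g [st ns sg gt [hx hy]]]] := end_dirs.
have [Q1 A1] := end_arm ns st hx lt xt; have [Q2 A2] := end_arm ns sg hy lt' yt.
have B1 : beam M alpha s t true (rcons Q1 x) by exists t.
have [w [sw wt wg wa]] := third_beta SM XM (w1 := t) (w2 := g) ns (introT orP (or_introl ta)) st sg.
have [Q3 B3] := dir_beam SM XM ns sw wa.
have T : touch (rcons Q1 x) Q3 by apply: (beam_touch SM st sw _ B1 B3); rewrite eq_sym.
have L1 := beam_leg XM ns B1; have L3 := beam_leg XM ns B3.
exists (rev Q1 ++ Q3); rewrite -cat_cons -rev_rcons; split.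
- by apply: ipath_touch => //; [case: L1 | case: L3].
- exact: (capped_rev_legs L1 L3).
- by have := closed_legs ehf ab L1 L3 T; rewrite size_rcons size_cat size_rev.
move=> z; rewrite mem_cat mem_rev => /orP[] zQ.
  have [n1 n2] := arm_misses_belast ns A1 zQ; split=> //.
  by apply: (beam_VM B1); rewrite mem_rcons inE zQ orbT.
case: (B3) => t3 A3 c3.
have [n1 n2] : z \notin Mv M t /\ z \notin Mv M t'.
  apply: (arm_misses ns A3 zQ); first by apply: contraTneq ta => <-; rewrite -c3.
  have s3 : t3 \in side s w by case: A3 => _ _ _ _ [].
  have s2 : t' \in side s g by case: A2 => _ _ _ _ [].
  by apply: contraNneq wg => e; rewrite -e in s2; have [[tJ _] _ _ _ _] := SM; rewrite (side_disj tJ sw sg s3 s2).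
by split=> //; apply: (beam_VM B3).
Qed.

End Pair.
End Ends.

(** Transfers the conclusion of [first_cap] for the reversed path to the other end of the path. *)
Lemma last_of_first_rev (T : Type) (x0 : T) (fs : seq T) (pc pe : pred T) :
  (forall j, j < size fs -> pc (nth x0 (rev fs) j) -> (forall k, k < j -> ~~ pc (nth x0 (rev fs) k)) ->
     ~~ odd j /\ exists2 k, k < j & pe (nth x0 (rev fs) k)) ->
  forall j, j < size fs -> pc (nth x0 fs j) -> (forall k, j < k -> k < size fs -> ~~ pc (nth x0 fs k)) ->
     ~~ odd ((size fs).-1 - j) /\ exists2 k, j < k & (k < size fs) && pe (nth x0 fs k).
Proof.
move=> H j jn pj nj; have -> : (size fs).-1 - j = size fs - j.+1 by lia.
have rn k : k < size fs -> nth x0 (rev fs) (size fs - k.+1) = nth x0 fs k.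
  by move=> kn; rewrite nth_rev; [congr nth; lia | lia].
have jn' : size fs - j.+1 < size fs by lia.
have pj' : pc (nth x0 (rev fs) (size fs - j.+1)) by rewrite rn.
have nk k : k < size fs - j.+1 -> ~~ pc (nth x0 (rev fs) k).
  by move=> kj; rewrite nth_rev; [apply: nj; lia | lia].
have [oj [k kj pk]] := H _ jn' pj' nk; split=> //; exists (size fs - k.+1); first by lia.
by rewrite nth_rev in pk; [rewrite pk andbT; lia | lia].
Qed.

Section LeafClash.
Variables (J G : sgraph) (ehf : even_hole_free G) (M : strip_family J G) (alpha beta : {set J}) (a b : G).
Hypothesis SM : is_strip_system M.
Hypothesis XM : cross_edge M alpha beta a b.
Implicit Types (p q r s u v w : J).

Let ab : a -- b. Proof. by case: XM. Qed.
Let ba : b -- a. Proof. by rewrite edgeC. Qed.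

(** The ring of [fs] with the beams to x and y fixes the parity of [fs]; [first_cap] at x, and at y
    for the reversed path, locates the first and last labels. At y it is applied to the letter not
    adjacent to y, whence the choice of [lastc] according to the side of t'. *)
Lemma leaf_clash (fs : seq G) t t' x y : t \in alpha -> t' \in leaves J -> t' != t ->
  x \in Mv M t -> y \in Mv M t' -> ipath fs ->
  (forall f, f \in fs -> [/\ f \notin VM M, f != a, f != b & ~~ ((f -- a) && (f -- b))]) ->
  atH fs x -> atL fs y ->
  (forall z, z \in VM M -> sees fs z -> z \in Mv M t \/ z \in Mv M t') ->
  sees fs a -> sees fs b -> False.
Proof.
move=> ta lt' tt' xt yt pf out hx hy H sa sb.
have xV := Mv_VM SM xt; have yV := Mv_VM SM yt.
have f0 : fs != [::] by case/hasP: sa => f /mem_nonnil.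
have af : a \notin fs by apply/negP => /out[_]; rewrite eqxx.
have bf : b \notin fs by apply/negP => /out[_ _]; rewrite eqxx.
have nb f : f \in fs -> ~~ ((f -- a) && (f -- b)) by case/out.
have nb' f : f \in fs -> ~~ ((f -- b) && (f -- a)) by rewrite andbC; apply: nb.
have nF z : [/\ z \in VM M, z \notin Mv M t & z \notin Mv M t'] -> noF fs z.
  case=> zV n n'; apply: noF_sees; first by apply/negP => /out[]; rewrite zV.
  by apply/negP => /(H z zV)[] h; [rewrite h in n | rewrite h in n'].
have ax : a -- x by have [_ ->] := aVM XM xV; apply/exists_inP; exists t.
have bx := ab_excl SM XM xV ax.
have parity : odd (size fs) = (t' \in alpha).
  have [Q1 [Q2 [p1 p2 T o nQ]]] := end_beams ehf SM XM ta lt' tt' xt yt.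
  have := direct ehf ab pf f0 p1 p2 T hx hy.
  have n1 : {in Q1, forall z, noF fs z} by move=> z zQ; apply/nF/nQ; rewrite mem_cat zQ.
  have n2 : {in Q2, forall z, noF fs z} by move=> z zQ; apply/nF/nQ; rewrite mem_cat zQ orbT.
  by move=> /(_ n1 n2); rewrite -addnA oddD o; case: (odd _); case: (t' \in alpha).
pose g := nth a fs.
have ex c : sees fs c -> exists2 k, k < size fs & g k -- c.
  by case/(has_nthP a) => k; exists k.
have firstb : forall j, j < size fs -> g j -- b -> (forall k, k < j -> ~~ (g k -- b)) ->
  ~~ odd j /\ exists2 k, k < j & g k -- a.
  have [E [pE cE oE nE]] := exit_path ehf SM XM ta lt' tt' xt yt.
  have nE' : {in E, forall z, noF fs z} by move=> z zE; apply/nF/nE.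
  have := first_cap ehf (x0 := a) pf ab hx pE cE ax bx bf af nE' oE nb.
  exact.
have lastc : let c := if t' \in alpha then b else a in let e := if t' \in alpha then a else b in
  forall j, j < size fs -> g j -- c -> (forall k, j < k -> k < size fs -> ~~ (g k -- c)) ->
     ~~ odd ((size fs).-1 - j) /\ exists2 k, j < k & (k < size fs) && (g k -- e).
  have Er z : noF fs z -> noF (rev fs) z := @noF_rev _ fs z.
  have nbr f : f \in rev fs -> ~~ ((f -- a) && (f -- b)) by rewrite mem_rev; apply: nb.
  have nbr' f : f \in rev fs -> ~~ ((f -- b) && (f -- a)) by rewrite mem_rev; apply: nb'.
  have afr : a \notin rev fs by rewrite mem_rev.
  have bfr : b \notin rev fs by rewrite mem_rev.
  have tt : t != t' by rewrite eq_sym.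
  have lt := alpha_leaf XM ta.
  move=> c e; apply: (last_of_first_rev (pc := fun f => f -- c) (pe := fun f => f -- e)).
  rewrite /c /e -(size_rev fs); case: (boolP (t' \in alpha)) => ta'.
    have ay : a -- y by have [_ ->] := aVM XM yV; apply/exists_inP; exists t'.
    have [E [pE cE oE nE]] := exit_path ehf SM XM ta' lt tt yt xt.
    have nE' : {in E, forall z, noF (rev fs) z} by move=> z /nE[h1 h2 h3]; apply/Er/nF.
    have := first_cap ehf (x0 := a) (ipath_rev pf) ab (atL_rev hy) pE cE ay (ab_excl SM XM yV ay) bfr afr nE' oE nbr.
    exact.
  have tb' := beta_not_alpha XM lt' ta'.
  have XM' := cross_edge_sym XM.
  have b_y : b -- y by have [_ ->] := bVM XM yV; apply/exists_inP; exists t'.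
  have [E [pE cE oE nE]] := exit_path ehf SM XM' tb' lt tt yt xt.
  have nE' : {in E, forall z, noF (rev fs) z} by move=> z /nE[h1 h2 h3]; apply/Er/nF.
  have := first_cap ehf (x0 := a) (ipath_rev pf) ba (atL_rev hy) pE cE b_y (ab_excl SM XM' yV b_y) afr bfr nE' oE nbr'.
  exact.
apply: (@label_clash (size fs) (fun k => g k -- a) (fun k => g k -- b) _ _ _ _ firstb (t' \in alpha) parity).
- by move=> i ir h1 h2; have := nb _ (mem_nth a ir); rewrite -/(g i) h1 h2.
- by move=> i j ij jr h1 h2 h3; exact: (gap_same ehf (x0 := a) pf af ij jr h1 h2 h3).
- by move=> i j ij jr h1 h2 h3; exact: (gap_same ehf (x0 := a) pf bf ij jr h1 h2 h3).
- move=> i j ij jr h1 h2; case/orP: h1 => /andP[k1 k2].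
    exact: (gap_diff ehf (x0 := a) pf af bf ab nb ij jr k1 k2 h2).
  have h2' k : i < k -> k < j -> ~~ (g k -- b) && ~~ (g k -- a) by move=> l1 l2; rewrite andbC h2.
  exact: (gap_diff ehf (x0 := a) pf bf af ba nb' ij jr k1 k2 h2').
- by case: (t' \in alpha); [apply: ex sb | apply: ex sa].
- by move: lastc; case: (t' \in alpha).
Qed.

End LeafClash.

(** If y were in M_s, its strip would join s to t', a second neighbour of s in alpha. *)
Lemma alpha_ends_bad (J G : sgraph) (M : strip_family J G) (alpha beta : {set J}) (a b : G) :
  is_strip_system M -> cross_edge M alpha beta a b ->
  forall t t' x y, t \in alpha -> t' \in alpha -> t' != t -> x \in Mv M t -> y \in Mv M t' -> bad M x y.
Proof.
move=> SM XM t t' x y ta ta' tt' xt yt; have lt' := alpha_leaf XM ta'.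
have [s [g [st ns sg gt [hx hy]]]] := end_dirs SM XM ta lt' tt' xt yt.
apply: (badI st sg _ hx hy); first by rewrite eq_sym.
right; apply/negP => ys; have [s' ts' _] := leaf_nbr lt'; have st' : s' -- t' by rewrite edgeC.
case: (strip_eq SM st' sg (end_strip SM st' lt' yt) (dir_head SM sg hy ys)) => -[e1 e2]; subst.
  by rewrite (alpha_uniq XM sg st ta' ta) eqxx in tt'.
by rewrite lt' in ns.
Qed.

Section Sides.
Variables (J G : sgraph) (ehf : even_hole_free G) (M : strip_family J G) (alpha beta : {set J}) (a b : G).
Hypothesis SM : is_strip_system M.
Hypothesis XM : cross_edge M alpha beta a b.
Hypothesis maxM : forall M' : strip_family J G,
  is_strip_system M' -> has_cross_edge M' a b -> ~~ (VM M \proper VM M').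
Hypothesis maxJ : forall (T : sgraph) (A' B' : {set T}) (J' : sgraph),
  extended_tree A' B' -> ext_induced_in A' B' a b -> is_shape T J' -> #|edges J'| <= #|edges J|.
Implicit Types (t : J) (x y z f : G) (fs : seq G).

Let XM' := cross_edge_sym XM.
Let maxM' := max_strips_swap maxM.
Let maxJ' := max_shape_swap maxJ.

Lemma ends_bad t t' x y : t \in leaves J -> t' \in leaves J -> t' != t ->
  x \in Mv M t -> y \in Mv M t' -> bad M x y.
Proof.
move=> lt lt' tt' xt yt; have xV := Mv_VM SM xt; have yV := Mv_VM SM yt.
rewrite !(leafE XM) in lt lt'.
have aA t1 z : t1 \in alpha -> z \in Mv M t1 -> a -- z.
  by move=> h zt; have [_ ->] := aVM XM (Mv_VM SM zt); apply/exists_inP; exists t1.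
have bB t1 z : t1 \in beta -> z \in Mv M t1 -> b -- z.
  by move=> h zt; have [_ ->] := bVM XM (Mv_VM SM zt); apply/exists_inP; exists t1.
case/orP: lt => h; case/orP: lt' => h'.
- exact: (alpha_ends_bad SM XM h h' tt').
- by apply/bad_sym/(beta_bad ehf SM XM yV xV (bB _ _ h' yt) (aA _ _ h xt)).
- exact: (beta_bad ehf SM XM xV yV (bB _ _ h xt) (aA _ _ h' yt)).
- exact: (alpha_ends_bad SM XM' h h' tt').
Qed.

(** In a shortest counterexample both letters are seen, by [no_conflict] for ab and for ba.
    Minimality for all pairs of leaves makes the two ends see x and y and excludes seen vertices of
    a third leaf, which is the situation of [leaf_clash]. *)
Lemma ends_clash fs t t' x y : ipath fs ->
  (forall f, f \in fs -> [/\ f \notin VM M, f != a, f != b & ~~ ((f -- a) && (f -- b))]) ->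
  (forall z, z \in VM M -> sees fs z -> exists2 t1, t1 \in leaves J & z \in Mv M t1) ->
  t \in leaves J -> t' \in leaves J -> t' != t -> x \in Mv M t -> y \in Mv M t' ->
  sees fs x -> sees fs y -> False.
Proof.
move: {2}(size fs) (leqnn (size fs)) => k; elim: k fs t t' x y => [|k IH] fs t t' x y hk pf out E lt lt' tt' xt yt sx sy.
  by move: sx hk; case: (fs).
have mn t1 t2 x1 y1 f f' : t1 \in leaves J -> t2 \in leaves J -> t2 != t1 -> x1 \in Mv M t1 -> y1 \in Mv M t2 ->
    f \in fs -> f' \in fs -> f -- x1 -> f' -- y1 -> f = head f fs /\ f' = last f' fs \/ f = last f fs /\ f' = head f' fs.
  move=> l1 l2 n12 h1 h2 ff ff' e1 e2; apply: (minimal_ends pf ff ff') => s ps ss sz fs1 fs2.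
  apply: (IH s t1 t2 x1 y1 _ ps _ _ l1 l2 n12 h1 h2).
  - by rewrite -ltnS (leq_trans sz).
  - by move=> h /ss; apply: out.
  - move=> z zV /hasP[h hs hz]; apply: E => //; apply/hasP; exists h => //; exact: ss.
  - by apply/hasP; exists f.
  - by apply/hasP; exists f'.
have bd := ends_bad lt lt' tt' xt yt; have xV := Mv_VM SM xt.
have out' f : f \in fs -> [/\ f \notin VM M, f != a & f != b] by case/out.
have out2 f : f \in fs -> [/\ f \notin VM M, f != b & f != a] by case/out.
have cf c : conflict M c x y by left; split=> //; apply: Mv_VM yt.
have sb : sees fs b.
  apply/negPn/negP => n; apply: (no_conflict ehf SM XM maxM maxJ pf out' _ xV (cf a) sx sy).
  by move=> f ff; apply: contraNF n => h; apply/hasP; exists f.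
have sa : sees fs a.
  apply/negPn/negP => n; apply: (no_conflict ehf SM XM' maxM' maxJ' pf out2 _ xV (cf b) sx sy).
  by move=> f ff; apply: contraNF n => h; apply/hasP; exists f.
(* A path of one vertex would be adjacent to both a and b, and such vertices are excluded. *)
have sz : forall f, f \in fs -> f = head f fs -> f = last f fs -> False.
  move=> f ff e1 e2; have e : fs = [:: f].
    have uf := ipath_uniq pf; case: (fs) ff e1 e2 uf => // g0 [|g1 s] _ /= ->; first by [].
    by move=> e /andP[+ _]; rewrite {1}e mem_last.
  have [_ _ _] := out f ff; move: sa sb; rewrite e /= !orbF.
  by move=> -> ->.
wlog [f [f' [ff ff' fx fy [e1 e2]]]] : fs hk pf out E sx sy mn out' out2 sa sb sz /
    exists f f', [/\ f \in fs, f' \in fs, f -- x, f' -- y & f = head f fs /\ f' = last f' fs].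
  move=> W; case/hasP: (sx) => f ff fx; case/hasP: (sy) => f' ff' fy.
  case: (mn t t' x y f f' lt lt' tt' xt yt ff ff' fx fy) => -[e1 e2].
    by apply: (W fs) => //; exists f, f'.
  apply: (W (rev fs)); rewrite ?size_rev ?sees_rev //.
  - exact: ipath_rev.
  - by move=> h; rewrite mem_rev; apply: out.
  - by move=> z zV; rewrite sees_rev; apply: E.
  - move=> t1 t2 x1 y1 h h' l1 l2 n12 k1 k2; rewrite !mem_rev => hf hf' k3 k4.
    rewrite !head_rev !last_rev; case: (mn t1 t2 x1 y1 h h' l1 l2 n12 k1 k2 hf hf' k3 k4); [by right|by left].
  - by move=> h; rewrite mem_rev; apply: out'.
  - by move=> h; rewrite mem_rev; apply: out2.
  - by move=> h; rewrite mem_rev head_rev last_rev => hf k1 k2; apply: (sz h).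
  - by exists f, f'; rewrite !mem_rev head_rev last_rev.
have fl : f = last f fs -> False by apply: sz.
have fl' : f' = head f' fs -> False by move=> h; apply: (sz f').
have hx : atH fs x.
  have xf : x \notin fs by apply/negP => /out'[]; rewrite xV.
  apply: onlyH_atH => //; split=> // h hf hx.
  by case: (mn t t' x y h f' lt lt' tt' xt yt hf ff' hx fy) => -[].
have hy : atL fs y.
  have yf : y \notin fs by apply/negP => /out'[]; rewrite (Mv_VM SM yt).
  apply: onlyL_atL => //; split=> // h hf hy.
  by case: (mn t t' x y f h lt lt' tt' xt yt ff hf fx hy) => -[].
have HH z : z \in VM M -> sees fs z -> z \in Mv M t \/ z \in Mv M t'.
  move=> zV sz'; have [t1 l1 zt] := E z zV sz'.
  case: (eqVneq t1 t) => [<-|n]; first by left.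
  case: (eqVneq t1 t') => [<-|n']; first by right.
  have nr : t != t1 by rewrite eq_sym.
  have nr' : t' != t1 by rewrite eq_sym.
  case/hasP: sz' => h hf hz; exfalso.
  case: (mn t1 t z x h f l1 lt nr zt xt hf ff hz fx) => -[k1 k2]; first by apply: fl.
  case: (mn t1 t' z y h f' l1 lt' nr' zt yt hf ff' hz fy) => -[k3 k4]; last by apply: fl'.
  exact: (sz h).
have := lt; rewrite (leafE XM) => /orP[] ta.
  exact: (leaf_clash ehf SM XM ta lt' tt' xt yt pf out hx hy HH sa sb).
have out3 g : g \in fs -> [/\ g \notin VM M, g != b, g != a & ~~ ((g -- b) && (g -- a))].
  by case/out => *; split=> //; rewrite andbC.
exact: (leaf_clash ehf SM XM' ta lt' tt' xt yt pf out3 hx hy HH sb sa).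
Qed.

(** By [no_conflict] both letters are seen. In a shortest counterexample x is seen by one end and
    each letter by the opposite end, so one vertex would be adjacent to both a and b. *)
Lemma nonend_unseen fs x : ipath fs ->
  (forall f, f \in fs -> [/\ f \notin VM M, f != a, f != b & ~~ ((f -- a) && (f -- b))]) ->
  x \in VM M -> ~~ (a -- x) -> ~~ (b -- x) -> sees fs x -> sees fs a || sees fs b -> False.
Proof.
move: {2}(size fs) (leqnn (size fs)) => k; elim: k fs => [|k IH] fs hk pf out xV na nb sx sab.
  by move: sx hk; case: (fs).
have mn c f g : (c == a) || (c == b) -> f \in fs -> g \in fs -> f -- x -> g -- c ->
    f = head f fs /\ g = last g fs \/ f = last f fs /\ g = head g fs.
  move=> hc ff gf fx gc; apply: (minimal_ends pf ff gf) => s ps ss sz fs1 fs2.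
  apply: (IH s _ ps _ xV na nb).
  - by rewrite -ltnS (leq_trans sz).
  - by move=> h /ss; apply: out.
  - by apply/hasP; exists f.
  - by case/orP: hc => /eqP e; apply/orP; [left|right]; apply/hasP; exists g; rewrite -?e.
have out' f : f \in fs -> [/\ f \notin VM M, f != a & f != b] by case/out.
have out2 f : f \in fs -> [/\ f \notin VM M, f != b & f != a] by case/out.
case sb: (sees fs b); last first.
  rewrite sb orbF in sab; apply: (no_conflict ehf SM XM maxM maxJ pf out' _ xV _ sx sab); last by right.
  by move=> f ff; apply: contraFF sb => h; apply/hasP; exists f.
case sa: (sees fs a); last first.
  apply: (no_conflict ehf SM XM' maxM' maxJ' pf out2 _ xV _ sx sb); last by right.
  by move=> f ff; apply: contraFF sa => h; apply/hasP; exists f.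
case/hasP: sx => f ff fx; case/hasP: sa => g gf ga; case/hasP: sb => h hf hb.
have gh : g = h -> False by move=> e; case: (out g gf) => _ _ _; rewrite ga e hb.
have f0 := mem_nonnil ff.
have ea : (a == a) || (a == b) by rewrite eqxx.
have eb : (b == a) || (b == b) by rewrite eqxx orbT.
apply: gh.
case: (mn a f g ea ff gf fx ga) => -[e1 e2]; case: (mn b f h eb ff hf fx hb) => -[e3 e4].
- by rewrite e2 e4; apply: last_def.
- by rewrite e2 e4 (last_def g f) // (head_def h f) // -e1 -e3.
- by rewrite e2 e4 (last_def h f) // (head_def g f) // -e1 -e3.
- by rewrite e2 e4; apply: head_def.
Qed.

Section Connected.
Variable F : {set G}.
Hypothesis cF : connected_set F.
Hypothesis oF : forall f, f \in F -> [/\ f \notin VM M, f != a, f != b & ~~ ((f -- a) && (f -- b))].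

Lemma seen_end x : a \in nbrs F -> x \in VM M :&: nbrs F -> exists2 t, t \in leaves J & x \in Mv M t.
Proof.
move=> aF /setIP[xV xF]; have [fs [pf sF sx sa]] := path_between cF xF aF.
case h: ((a -- x) || (b -- x)).
  case/orP: h => h.
    have [_ e] := aVM XM xV; rewrite e in h; case/exists_inP: h => t ta xt.
    by exists t => //; apply: (alpha_leaf XM).
  have [_ e] := bVM XM xV; rewrite e in h; case/exists_inP: h => t ta xt.
  by exists t => //; apply: (beta_leaf XM).
exfalso; move/negbT: h; rewrite negb_or => /andP[nax nbx].
apply: (nonend_unseen pf _ xV nax nbx sx); last by rewrite sa.
by move=> f /sF; apply: oF.
Qed.

Lemma seen_one_leaf : a \in nbrs F ->
  exists2 t : J, t \in leaves J & VM M :&: nbrs F \subset Mv M t.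
Proof.
move=> aF; case: (set_0Vmem (VM M :&: nbrs F)) => [->|[x xX]].
  have [t tb] := beta_leaf_exists SM XM; exists t; [exact: (beta_leaf XM) | exact: sub0set].
have [t lt xt] := seen_end aF xX; exists t => //; apply/subsetP => y yX.
have [t' lt' yt] := seen_end aF yX; case: (eqVneq t' t) => [<- //|tt']; exfalso.
have xF : x \in nbrs F by case/setIP: xX.
have yF : y \in nbrs F by case/setIP: yX.
have [fs [pf sF sx sy]] := path_between cF xF yF.
apply: (ends_clash pf _ _ lt lt' tt' xt yt sx sy).
  by move=> f /sF; apply: oF.
move=> z zV /hasP[f /sF fF fz]; apply: seen_end => //; rewrite inE zV /=.
by apply/nbrsP; exists f; rewrite // edgeC.
Qed.

End Connected.
End Sides.

Theorem mainTheorem3 (G : sgraph) (a b : G) (J : sgraph)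
    (M : strip_family J G) (alpha beta : {set J}) :
  even_hole_free G -> a -- b -> is_optimal M a b ->
  cross_edge M alpha beta a b ->
  let Z := [set x | (x -- a) && (x -- b)] in
  forall F : {set G},
    connected_set F -> [disjoint F & Z :|: VM M :|: [set a; b]] ->
    (~ (a \in nbrs F /\ b \in nbrs F) ->
       is_local M alpha beta a b (VM M :&: nbrs F)) /\
    (a \in nbrs F /\ b \in nbrs F ->
       exists2 t : J, t \in leaves J & VM M :&: nbrs F \subset Mv M t).
Proof.
move=> ehf ab [_ maxJ SM _ maxM] XM Z F cF dF.
have oF f : f \in F -> [/\ f \notin VM M, f != a, f != b & ~~ ((f -- a) && (f -- b))].
  by move=> /(disjointFr dF); rewrite !inE => /norP[/norP[-> ->] /norP[-> ->]].
split; last by case=> aF _; apply: (seen_one_leaf ehf SM XM maxM maxJ cF oF aF).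
move=> nab; split; first by apply: subsetU; rewrite subsetIl.
have XM' := cross_edge_sym XM.
have nb x y : x \in VM M :&: nbrs F -> y \in VM M :&: nbrs F -> ~ bad M x y.
  (* If b sees F then a does not, and the two letters are exchanged. *)
  case: (boolP (b \in nbrs F)) => bF.
    have aF : a \notin nbrs F by apply/negP => aF; apply: nab.
    apply: (unseen_not_bad ehf SM XM' (max_strips_swap maxM) (max_shape_swap maxJ) cF _ aF).
    by move=> f /oF[].
  apply: (unseen_not_bad ehf SM XM maxM maxJ cF _ bF).
  by move=> f /oF[].
case: (local_pairwise SM (subsetIl _ _) nb) => h; [exact: Or41|exact: Or42].
Qed.
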